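(* Let $d\ge3$ and let $(Y_t)_{t\ge0}$ be the continuous time simple random walk on $\mathbb{Z}^d$ with jump rate $1$ started at the origin. For $a\in[0,1]$ let $\mathcal{M}_N(a)=\{x\in V_N:\ell_x^{\tau_N}>2ga\log N\}$. Then there exist random variables $M_a$, $a\in[0,1]$, such that for all $a\in[0,1]$ $$\frac{|\mathcal{M}_N(a)|}{N^{2(1-a)}}\xrightarrow[N\to\infty]{(d)}M_a.$$ Moreover, for all $a\in[0,1)$ the distribution of $M_a$ does not depend on $a$ and $M_a\overset{(d)}{=}\tau/g$. The variable $M_1$ is a Poisson variable with (random) parameter $\tau/g$: for all integers $k\ge0$, $$\mathbb{P}(M_1=k)=\frac1{k!}\,\mathbb{E}\left[e^{-\tau/g}\left(\frac{\tau}{g}\right)^k\right].$$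
   Context: $V_N=\{-N,\dots,N\}^d$, $\tau_N=\inf\{t\ge0:Y_t\notin V_N\}$, $\ell_x^t=\int_0^t\mathbf{1}_{\{Y_s=x\}}ds$, and $g=\mathbb{E}_0[\ell_0^\infty]$. $\tau$ denotes the first exit time of $[-1,1]^d$ of Brownian motion (in $\mathbb{R}^d$) starting at the origin. $|\cdot|$ of a finite set is its cardinality and $(d)$ denotes convergence/equality in distribution.
   Formalization: Here τ is the exit time of the Brownian motion with covariance (t/d)Id, the scaling limit of the rate-1 walk; with standard Brownian motion the claim fails by a factor d, since τ_N/N² then converges to dτ (e.g. at a=0 the limit would be dτ/g). *)

(* Defs.v *)
From HB Require Import structures.
From mathcomp Require Import all_boot all_order all_algebra finmap.
From mathcomp Require Import all_classical all_reals all_analysis measurable_realfun.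
Import Order.TTheory GRing.Theory Num.Theory.
Import numFieldNormedType.Exports.

Set Implicit Arguments.
Unset Strict Implicit.
Unset Printing Implicit Defensive.

Local Open Scope classical_set_scope.
Local Open Scope ring_scope.

(* Mutual independence of the classes of events [F i]; the [F i] below are
   always sigma-algebras. *)
Definition mutually_independent {disp} {T : measurableType disp} {R : realType}
    (P : probability T R) (I : choiceType) (F : I -> set (set T)) : Prop :=
  forall (J : {fset I}) (A : I -> set T),
    (forall j, j \in J -> F j (A j)) ->
    P (\bigcap_(j in [set` J]) A j) = (\prod_(j <- J) P (A j))%E.

Definition eq_in_distribution {disp1 disp2 disp} {T1 : measurableType disp1}
    {T2 : measurableType disp2} {S : measurableType disp} {R : realType}
    (P : probability T1 R) (X : T1 -> S) (Q : probability T2 R) (Y : T2 -> S)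
    : Prop :=
  [/\ measurable_fun setT X, measurable_fun setT Y &
      forall A : set S, measurable A -> P (X @^-1` A) = Q (Y @^-1` A)].

Definition cvg_in_distribution {disp1 disp2} {T1 : measurableType disp1}
    {T2 : measurableType disp2} {R : realType}
    (P : probability T1 R) (X : nat -> T1 -> R)
    (Q : probability T2 R) (Y : T2 -> R) : Prop :=
  [/\ forall n, measurable_fun setT (X n), measurable_fun setT Y &
      forall f : R -> R, continuous f -> (exists C : R, forall x : R, `|f x| <= C) ->
        ('E_P[f \o X n] @[n --> \oo] --> 'E_Q[f \o Y])%E].

(* Law of one step of the simple random walk: uniform on the 2d vectors of
   Z^d with l^1-norm 1. *)
Definition srw_step_pmf (R : realType) (d : nat) (v : 'rV[int]_d) : R :=
  if \sum_i `|v 0 i| == 1 then (2 * d)%:R^-1 else 0.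

Definition steps_and_clocks_events {disp} {T : measurableType disp}
    {R : realType} (d : nat) (X : nat -> T -> 'rV[int]_d) (E : nat -> T -> R)
    (j : nat + nat) : set (set T) :=
  match j with
  | inl n => [set X n @^-1` A | A in setT]
  | inr n => [set E n @^-1` A | A in measurable]
  end.

(* [X n] is the n-th step, [E n] the n-th holding time.  The last three
   clauses hold for every outcome, i.e. all the paths of [Y] are
   right-continuous step functions with finitely many jumps in every bounded
   time interval.  [Y t] is unspecified for [t < 0]. *)
Definition is_ctsrw {disp} {T : measurableType disp} {R : realType} (d : nat)
    (P : probability T R) (Y : R -> T -> 'rV[int]_d) : Prop :=
  exists (X : nat -> T -> 'rV[int]_d) (E : nat -> T -> R),
  [/\ [/\ forall n v, measurable (X n @^-1` [set v]),
          forall n, measurable_fun setT (E n),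
          forall n v, P (X n @^-1` [set v]) = (srw_step_pmf R v)%:E,
          forall n (A : set R), measurable A ->
            P (E n @^-1` A) = exponential_prob 1 A &
          mutually_independent P (steps_and_clocks_events X E)],
      forall n w, 0 < E n w,
      forall w, \sum_(i < n) E i w @[n --> \oo] --> +oo &
      forall n w (t : R), \sum_(i < n) E i w <= t < \sum_(i < n.+1) E i w ->
        Y t w = \sum_(i < n) X i w].

(* Brownian motion in R^d started at 0 with covariance matrix [sigma2 * t] times
   the identity at time [t]; [B t] is unspecified for [t < 0].  A coordinate of the
   rate-1 walk has variance t / d at time [t], so that the scaling limit of
   N^-1 Y_(N^2 t) is the Brownian motion with [sigma2 = d%:R^-1]. *)
Definition is_brownian_motion {disp} {T : measurableType disp} {R : realType}
    (d : nat) (sigma2 : R) (P : probability T R) (B : R -> T -> 'rV[R]_d)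
    : Prop :=
  [/\ forall (t : R) i, 0 <= t -> measurable_fun setT (fun w => B t w 0 i),
      forall w, B 0 w = 0,
      forall w i, {within `[0, +oo[, continuous (fun t : R => B t w 0 i)},
      forall (s t : R) i (A : set R), 0 <= s < t -> measurable A ->
        P [set w | A (B t w 0 i - B s w 0 i)] =
        normal_prob 0 (Num.sqrt (sigma2 * (t - s))) A &
      (* independence of the increments and of the coordinates *)
      forall t : nat -> R, 0 <= t 0%N -> (forall k, t k < t k.+1) ->
        mutually_independent P (fun ki : nat * 'I_d =>
          [set [set w | A (B (t ki.1.+1) w 0 ki.2 - B (t ki.1) w 0 ki.2)]
             | A in measurable])].

Definition exit_time {R : realType} {V : Type} (D : set V) (Z : R -> V)
    : \bar R :=
  ereal_inf [set t%:E | t in [set t : R | 0 <= t /\ ~ D (Z t)]].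

Definition local_time {R : realType} {V : Type} (Z : R -> V) (x : V)
    (t : \bar R) : \bar R :=
  (\int[lebesgue_measure]_(s in [set s : R | (0 <= s)%R /\ s%:E <= t])
     (\1_[set s | Z s = x] s)%:E)%E.

(* For d >= 3 the expectation is finite, so that [fine] is harmless. *)
Definition green0 {disp} {T : measurableType disp} {R : realType} (d : nat)
    (P : probability T R) (Y : R -> T -> 'rV[int]_d) : R :=
  fine (\int[P]_w local_time (Y^~ w) 0%R +oo)%E.

Definition box (d N : nat) : set 'rV[int]_d :=
  [set x | forall i, `|x 0 i| <= N%:Z].
Arguments box : clear implicits.

Definition unit_cube (R : realType) (d : nat) : set 'rV[R]_d :=
  [set x | forall i, `|x 0 i| <= 1].
Arguments unit_cube : clear implicits.

Definition thick_points {R : realType} (d : nat) (g a : R) (N : nat)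
    (Z : R -> 'rV[int]_d) : set 'rV[int]_d :=
  [set x | box d N x /\
    ((2 * g * a * ln N%:R)%:E < local_time Z x (exit_time (box d N) Z))%E].

Definition card_thick_points {R : realType} (d : nat) (g a : R) (N : nat)
    (Z : R -> 'rV[int]_d) : nat :=
  #|` fset_set (thick_points g a N Z)|%fset.

(* Main.v *)
(* Call a jump of the walk a crossing if the time spent at the current position
   passes the level u = 2 g a log N during the following holding time.  The thick points are in
   bijection with the crossings before the exit from the box.  Seen from a
   given jump, the reversed walk visits the current position a geometric number
   of times, so that a jump is a crossing with probability close to
   exp(-u/g)/g = N^(-2a)/g.

   Cut the jumps into blocks of length (log N)^16: the crossings of a block can be
   computed, up to a negligible error, from the jumps and clocks of that block alone,
   so that the counts of different blocks are independent.  Hence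
   E exp(-l |M_N(a)| / N^(2(1-a))) is asymptotically the probability that the walk
   leaves the box before being killed at rate c N^(-2), with c = l/g if a < 1; if a = 1
   then c = (1 - e^(-l))/g, because a block with a crossing contains just one (a moment
   bound for the number of visits to two points, with an exponent above 2).

   The killed walk is compared with Brownian motion through the functions
   prod_i cos(th_i x_i), for which both have the same asymptotic one-block
   decay; odd trigonometric polynomials approximating the sign function (Newton's
   iteration) turn this into the convergence of the discounted time spent in the cube, and
   Brownian scaling in c and r handles its boundary.  The Laplace transform thus tends to
   E exp(-c tau), and Bernstein polynomials in e^(-x) turn the convergence of Laplace
   transforms into convergence in distribution. *)

Require Import Defs.
From HB Require Import structures.
From mathcomp Require Import all_boot all_order all_algebra finmap.
From mathcomp Require Import all_classical all_reals all_analysis measurable_realfun.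
From mathcomp Require Import ring lra zify.
Import Order.TTheory GRing.Theory Num.Theory.
Import numFieldNormedType.Exports.

Set Implicit Arguments.
Unset Strict Implicit.
Unset Printing Implicit Defensive.

Local Open Scope classical_set_scope.
Local Open Scope ring_scope.

(** * Bounded random variables and independence *)

(** The exit from the box and the crossings are driven by the same steps, so they cannot be treated
    separately. Killing turns the Laplace transform into a product over blocks, and the correlation
    inside one block is harmless: the walk moves by o(N) there, so ignoring its displacement where
    killing occurs costs o(N^(-2)) per jump. No functional limit theorem is used. A product of
    cosines at odd multiples of pi / (2r) vanishes on the faces of the cube of half-width r, so
    stopping at the exit costs only the overshoot, and the killed expectations sum to a geometric
    series with limit 1 / (kap + c), whatever the array. Combinations of such products only
    approximate the indicator of the cube, so the discounted time in the cube is squeezed between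
    two half-widths. Its limit is never computed: Brownian motion sampled on a grid is itself such
    an array, and the continuity in c of its Laplace transform closes the gap. The exponent 16: the
    errors of a block add up to (log N)^15 times the crossing probability, so a block must be longer
    than that, and still o(N). *)

Section bounded_measurable.
Context d (T : measurableType d) (R : realType).
Implicit Types X Y : T -> R.

Definition bmeas X := measurable_fun setT X /\ exists C, forall w, `|X w| <= C.

Lemma bmeasM X Y : bmeas X -> bmeas Y -> bmeas (fun w => X w * Y w).
Proof.
move=> [mX [C XC]] [mY [D YD]]; split; first exact: measurable_funM.
exists (C * D) => w; rewrite normrM; apply: ler_pM => //.
Qed.

Lemma bmeasD X Y : bmeas X -> bmeas Y -> bmeas (fun w => X w + Y w).
Proof.
move=> [mX [C XC]] [mY [D YD]]; split; first exact: measurable_funD.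
by exists (C + D) => w; rewrite (le_trans (ler_normD _ _))// lerD.
Qed.

Lemma bmeas_cst r : bmeas (fun=> r).
Proof. by split; [exact: measurable_cst|exists `|r|]. Qed.

Lemma bmeasZ r X : bmeas X -> bmeas (fun w => r * X w).
Proof. by move=> bX; apply: bmeasM => //; exact: bmeas_cst. Qed.

Lemma bmeasN X : bmeas X -> bmeas (fun w => - X w).
Proof. by move=> /(bmeasZ (-1)); under eq_fun do rewrite mulN1r. Qed.

Lemma bmeasB X Y : bmeas X -> bmeas Y -> bmeas (fun w => X w - Y w).
Proof. by move=> bX bY; apply: bmeasD => //; exact: bmeasN. Qed.

Lemma bmeas_sum (I : Type) (s : seq I) (p : pred I) (X : I -> T -> R) :
  (forall i, p i -> bmeas (X i)) -> bmeas (fun w => \sum_(i <- s | p i) X i w).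
Proof.
move=> bX; elim: s => [|i s ih].
  by under eq_fun do rewrite big_nil; exact: bmeas_cst.
case pi : (p i); under eq_fun do rewrite big_cons pi //; last exact: ih.
by apply: bmeasD => //; exact: bX.
Qed.

Lemma bmeas_prod (I : Type) (s : seq I) (p : pred I) (X : I -> T -> R) :
  (forall i, p i -> bmeas (X i)) -> bmeas (fun w => \prod_(i <- s | p i) X i w).
Proof.
move=> bX; elim: s => [|i s ih].
  by under eq_fun do rewrite big_nil; exact: bmeas_cst.
case pi : (p i); under eq_fun do rewrite big_cons pi //; last exact: ih.
by apply: bmeasM => //; exact: bX.
Qed.

Lemma bmeas_indic (A : set T) : measurable A -> bmeas (\1_A).
Proof.
move=> mA; split; first exact: measurable_indic.
by exists 1 => w; rewrite indicE; case: (_ \in _); rewrite ?normr1 ?normr0.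
Qed.

End bounded_measurable.

Section expectation.
Context d (T : measurableType d) (R : realType) (P : probability T R).
Implicit Types X Y : T -> R.

(** A real-valued expectation, meant for bounded variables, where [fine] loses nothing. Clocks and
    exit times enter it through bounded functions of them. *)
Definition Ex X : R := (\int[P]_w X w)%R.

Lemma bmeas_integrable X : bmeas X -> P.-integrable setT (EFin \o X).
Proof.
move=> [mX [C XC]]; apply: measurable_bounded_integrable => //.
  by rewrite (le_lt_trans (probability_le1 _ _))// ltry.
exists C; split; first exact: num_real.
by move=> x Cx w _ /=; apply: le_trans (XC w) _; exact: ltW.
Qed.

Lemma Ex_EFin X : bmeas X -> (\int[P]_w (X w)%:E)%E = (Ex X)%:E.
Proof.
move=> bX; rewrite /Ex /Rintegral fineK//.
exact: integrable_fin_num (bmeas_integrable bX).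
Qed.

Lemma ExD X Y : bmeas X -> bmeas Y -> Ex (fun w => X w + Y w) = Ex X + Ex Y.
Proof. by move=> bX bY; rewrite /Ex RintegralD//; exact: bmeas_integrable. Qed.

Lemma ExB X Y : bmeas X -> bmeas Y -> Ex (fun w => X w - Y w) = Ex X - Ex Y.
Proof. by move=> bX bY; rewrite /Ex RintegralB//; exact: bmeas_integrable. Qed.

Lemma ExZ r X : bmeas X -> Ex (fun w => r * X w) = r * Ex X.
Proof. by move=> bX; rewrite /Ex RintegralZl//; exact: bmeas_integrable. Qed.

Lemma Ex_cst r : Ex (fun=> r) = r.
Proof.
rewrite /Ex Rintegral_cst; last exact: measurableT.
by rewrite -[RHS]mulr1; congr (_ * _); rewrite -[RHS]/(fine 1%E); congr fine; exact: probability_setT.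
Qed.

Lemma Ex_sum (I : Type) (s : seq I) (p : pred I) (X : I -> T -> R) :
  (forall i, p i -> bmeas (X i)) ->
  Ex (fun w => \sum_(i <- s | p i) X i w) = \sum_(i <- s | p i) Ex (X i).
Proof.
move=> bX; elim: s => [|i s ih].
  by under [in LHS]eq_fun do rewrite big_nil; rewrite Ex_cst big_nil.
rewrite big_cons; case pi : (p i); last first.
  by under [in LHS]eq_fun do rewrite big_cons pi //.
under [in LHS]eq_fun do rewrite big_cons pi //.
by rewrite ExD ?ih//; [exact: bX|exact: bmeas_sum].
Qed.

Lemma Ex_le X Y : bmeas X -> bmeas Y -> (forall w, X w <= Y w) -> Ex X <= Ex Y.
Proof.
by move=> bX bY XY; apply: le_Rintegral => //; exact: bmeas_integrable.
Qed.

Lemma Ex_ge0 X : (forall w, 0 <= X w) -> 0 <= Ex X.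
Proof. by move=> X0; apply: Rintegral_ge0. Qed.

Lemma Ex_norm_le X : bmeas X -> `|Ex X| <= Ex (fun w => `|X w|).
Proof. by move=> bX; apply: le_normr_Rintegral => //; exact: bmeas_integrable. Qed.

Lemma bmeas_norm X : bmeas X -> bmeas (fun w => `|X w|).
Proof.
move=> [mX [C XC]]; split; first exact: measurableT_comp.
by exists C => w; rewrite normr_id.
Qed.

Lemma Ex_indic A : measurable A -> (Ex \1_A)%:E = P A.
Proof. by move=> mA; rewrite -Ex_EFin ?integral_indic ?setIT//; exact: bmeas_indic. Qed.

End expectation.

Section independence.
Context d (T : measurableType d) (R : realType) (P : probability T R).
Variables G1 G2 : set (set T).
Hypothesis G1m : G1 `<=` measurable.
Hypothesis G2m : G2 `<=` measurable.
Hypothesis G1I : setI_closed G1.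
Hypothesis G2I : setI_closed G2.
Hypothesis G1T : G1 setT.
Hypothesis G2T : G2 setT.
Hypothesis G12 : forall A B, G1 A -> G2 B -> P (A `&` B) = (P A * P B)%E.

Lemma g_sigma_sub (G : set (set T)) : G `<=` measurable -> <<s G >> `<=` measurable.
Proof. by move=> Gm; apply: smallest_sub => //; exact: sigma_algebra_measurable. Qed.

(** For fixed [B] the finite measures P(. & B) and P(B) P agree on the pi-system [G], hence on the
    sigma-algebra it generates. Applied to each of the two factors in turn. *)
Let step (G : set (set T)) B : G `<=` measurable -> setI_closed G -> G setT ->
  measurable B ->
  (forall A, G A -> P (A `&` B) = (P A * P B)%E) ->
  forall A, <<s G >> A -> P (A `&` B) = (P A * P B)%E.
Proof.
move=> Gm GI GT mB GB A sA.
have PB : (0 <= fine (P B))%R by rewrite fine_ge0.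
have := @g_sigma_algebra_measure_unique _ R T G Gm (fun=> setT) (fun=> GT) _
  (mrestr P mB) (mscale (NngNum PB) P) GI _ _ A sA.
have sE C : mscale (NngNum PB) P C = (P C * P B)%E.
  rewrite /mscale muleC; congr (_ * _)%E.
  by rewrite -[RHS]fineK ?fin_num_measure.
move=> H; rewrite -sE; apply: H.
- by rewrite bigcup_const.
- by move=> C GC; rewrite [RHS]sE; exact: GB.
- move=> k; rewrite /mrestr; apply: le_lt_trans (ltry 1).
  by apply: probability_le1; exact: measurableI.
Qed.

Lemma indep_sigma A B : <<s G1 >> A -> <<s G2 >> B -> P (A `&` B) = (P A * P B)%E.
Proof.
move=> sA sB; apply: (step G1m) => //; first exact: (g_sigma_sub G2m).
move=> {sA}A GA; rewrite setIC muleC.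
apply: (step G2m) => //; first exact: G1m.
by move=> C GC; rewrite setIC muleC G12.
Qed.

Let T1 := g_sigma_algebraType G1.
Let T2 := g_sigma_algebraType G2.

Lemma measurable_id_sub (G : set (set T)) : G `<=` measurable ->
  measurable_fun setT (id : T -> g_sigma_algebraType G).
Proof. by move=> Gm _ A mA; rewrite setTI; exact: (g_sigma_sub Gm). Qed.

Lemma bmeas_sub (G : set (set T)) (U : g_sigma_algebraType G -> R) :
  G `<=` measurable -> bmeas U -> bmeas (U : T -> R).
Proof.
move=> Gm [mU bU]; split => //.
exact: (measurableT_comp mU (measurable_id_sub Gm)).
Qed.

(** Independence says that the diagonal map sends [P] to the product of its restrictions to the two
    sigma-algebras; Fubini then integrates one argument with the other frozen. This plays the part
    of conditioning on the past. *)
Lemma indep_freeze (G : T1 * T2 -> R) : bmeas G ->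
  bmeas (fun w : T1 => Ex P (fun w' => G (w, w'))) /\
  Ex P (fun w => G (w, w)) = Ex P (fun w => Ex P (fun w' => G (w, w'))).
Proof.
move=> bG; have [mG [C GC]] := bG.
pose m1 : {mfun T >-> T1} := mfun_Sub (mem_set (measurable_id_sub G1m)).
pose m2 : {mfun T >-> T2} := mfun_Sub (mem_set (measurable_id_sub G2m)).
have md : measurable_fun setT (fun w : T => (w, w) : T1 * T2).
  by apply/measurable_fun_pairP; split; exact: measurable_id_sub.
pose m12 : {mfun T >-> (T1 * T2)%type} := mfun_Sub (mem_set md).
pose Q1 : probability T1 R := distribution P m1.
pose Q2 : probability T2 R := distribution P m2.
have Q12 : forall X : set (T1 * T2), measurable X ->
    (Q1 \x Q2)%E X = distribution P m12 X.
  apply: product_measure_unique => A B mA mB.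
  by rewrite /= /distribution /pushforward/=; exact: indep_sigma.
have bGw w : bmeas (fun w' : T2 => G (w, w')).
  by split; [apply: measurableT_comp => //; exact: measurable_pair1|exists C => w'].
have inE w : (\int[Q2]_y (G (w, y))%:E)%E = (Ex P (fun w' => G (w, w')))%:E.
  rewrite integral_distribution//; first exact: Ex_EFin (bmeas_sub G2m (bGw w)).
  - by apply/measurable_EFinP; exact: (bGw w).1.
  - exact: bmeas_integrable (bmeas_sub G2m (bGw w)).
have iG : (Q1 \x Q2)%E.-integrable setT (EFin \o G).
  by apply: (@bmeas_integrable _ _ _ (Q1 \x Q2)%E).
have mF : measurable_fun setT (fun w : T1 => Ex P (fun w' => G (w, w'))).
  apply/measurable_EFinP; have := measurable_fubini_F iG.
  by apply: eq_measurable_fun => w _; rewrite /fubini_F/= inE.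
have bF : bmeas (fun w : T1 => Ex P (fun w' => G (w, w'))).
  split => //; exists C => w; have bw := bmeas_sub G2m (bGw w).
  rewrite (le_trans (Ex_norm_le _ bw))// -[leRHS](Ex_cst P).
  by apply: Ex_le => //; [exact: bmeas_norm|exact: bmeas_cst].
split => //; apply: EFin_inj.
have bGd : bmeas (fun w : T => G (w, w)).
  by split; [exact: (measurableT_comp mG md)|exists C => w].
rewrite -Ex_EFin//.
transitivity (\int[distribution P m12]_z (G z)%:E)%E.
  rewrite integral_distribution//; first by apply/measurable_EFinP.
  exact: bmeas_integrable.
transitivity (\int[(Q1 \x Q2)%E]_z (G z)%:E)%E.
  by apply: eq_measure_integral => /= A mA _; rewrite Q12.
rewrite -[LHS](integral12_prod_meas1 iG) /fubini_F/=.
under eq_integral do rewrite inE.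
rewrite integral_distribution//; first exact: Ex_EFin (bmeas_sub G1m bF).
- by apply/measurable_EFinP.
- exact: bmeas_integrable (bmeas_sub G1m bF).
Qed.

Lemma indep_Ex (U : T1 -> R) (V : T2 -> R) : bmeas U -> bmeas V ->
  Ex P (fun w => U w * V w) = Ex P U * Ex P V.
Proof.
move=> bU bV; have [_] := @indep_freeze (fun z => U z.1 * V z.2) (bmeasM
  (conj (measurableT_comp bU.1 measurable_fst) (let: conj _ (ex_intro C h) := bU in
    ex_intro _ C (fun z => h z.1)))
  (conj (measurableT_comp bV.1 measurable_snd) (let: conj _ (ex_intro C h) := bV in
    ex_intro _ C (fun z => h z.2)))).
move=> /= ->; have -> : (fun w => Ex P (fun w' => U w * V w')) = (fun w => Ex P V * U w).
  by apply/funext => w; rewrite (ExZ _ _ (bmeas_sub G2m bV)) mulrC.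
by rewrite (ExZ _ _ (bmeas_sub G1m bU)) mulrC.
Qed.

End independence.
Section finite_intersections.
Context d (T : measurableType d) (R : realType) (P : probability T R).
Context (I : choiceType) (F : I -> set (set T)).
Hypothesis Fm : forall i, F i `<=` measurable.
Hypothesis FI : forall i, setI_closed (F i).
Hypothesis FT : forall i, F i setT.
Hypothesis indF : mutually_independent P F.

(** Mutual independence speaks of finite intersections only; they form the pi-system on which the
    independence of two disjoint sets of indices is read off directly. *)
Definition fin_inter (D : set I) : set (set T) :=
  [set C | exists (J : {fset I}) (A : I -> set T),
     [/\ forall j, j \in J -> D j, forall j, F j (A j) &
      C = \bigcap_(j in [set` J]) A j]].

Lemma fin_interT D : fin_inter D setT.
Proof. by exists fset0, (fun=> setT); split=> //; rewrite set_fset0 bigcap_set0. Qed.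

Lemma fin_inter1 (D : set I) i A : D i -> F i A -> fin_inter D A.
Proof.
move=> Di FA; exists [fset i]%fset, (fun j => if j == i then A else setT); split.
- by move=> j; rewrite inE => /eqP ->.
- by move=> j; case: eqP => [->|//].
- rewrite set_fset1 bigcap_set1; by rewrite eqxx.
Qed.

Lemma fin_interI D : setI_closed (fin_inter D).
Proof.
move=> _ _ [J [A [JD FA ->]]] [J' [A' [J'D FA' ->]]].
pose ext (K : {fset I}) (B : I -> set T) j := if j \in K then B j else setT.
exists (J `|` J')%fset, (fun j => ext J A j `&` ext J' A' j); split.
- by move=> j; rewrite in_fsetU => /orP[/JD|/J'D].
- by move=> j; apply: FI; rewrite /ext; case: ifP.
- apply/seteqP; split => [w [wA wA'] j /= _|w wB].
    by rewrite /ext; split; case: ifPn => // jJ; [exact: wA|exact: wA'].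
  split=> j jJ; have := wB j; rewrite /= in_fsetU (jJ : is_true _) ?orbT => /(_ isT)[];
    by rewrite /ext (jJ : is_true _).
Qed.

Lemma fin_inter_measurable D : fin_inter D `<=` measurable.
Proof.
move=> _ [J [A [_ FA ->]]]; rewrite bigcap_fset.
by apply: bigsetI_measurable => j _; exact: Fm.
Qed.

Lemma fin_inter_indep D1 D2 A B : D1 `&` D2 = set0 ->
  fin_inter D1 A -> fin_inter D2 B -> P (A `&` B) = (P A * P B)%E.
Proof.
move=> D12 [J [A' [JD FA ->]]] [K [B' [KD FB ->]]].
have JK : [disjoint J & K]%fset.
  apply/fdisjointP => j jJ; apply/negP => jK.
  by rewrite -[False]/((set0 : set I) j) -D12; split; [exact: JD|exact: KD].
(* The index sets are disjoint, so the two families glue into one, to which mutual independence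
   applies. *)
pose C j := if j \in J then A' j else B' j.
have FC j : F j (C j) by rewrite /C; case: ifP.
have CJ : \bigcap_(j in [set` J]) A' j = \bigcap_(j in [set` J]) C j.
  by apply: eq_bigcapr => j /= jJ; rewrite /C jJ.
have CK : \bigcap_(j in [set` K]) B' j = \bigcap_(j in [set` K]) C j.
  apply: eq_bigcapr => j /= jK; rewrite /C ifN//.
  by apply/negP => jJ; move/fdisjointP: JK => /(_ _ jJ); rewrite jK.
rewrite CJ CK -bigcap_setU.
have -> : [set` J] `|` [set` K] = [set` (J `|` K)%fset].
  by rewrite set_fsetU.
rewrite !indF// -big_cat/=; apply: perm_big; apply: uniq_perm.
- exact: fset_uniq.
- rewrite cat_uniq !fset_uniq/= andbT; apply/hasPn => j jK.
  by apply/negP => jJ; move/fdisjointP: JK => /(_ _ jJ); rewrite jK.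
- by move=> j; rewrite mem_cat in_fsetU.
Qed.

(** The sample space seen through the indices in [D] only. With the sigma-algebra in the type,
    depending on a part of the randomness becomes measurability of a function on [past_type D]. *)
Definition past_type (D : set I) := g_sigma_algebraType (fin_inter D).

Lemma mutual_indep_Ex (D1 D2 : set I) (U : past_type D1 -> R) (V : past_type D2 -> R) :
  D1 `&` D2 = set0 -> bmeas U -> bmeas V ->
  Ex P (fun w => U w * V w) = Ex P U * Ex P V.
Proof.
move=> D12; apply: indep_Ex; first [exact: fin_inter_measurable|
  exact: fin_interI|exact: fin_interT|idtac].
by move=> A B; exact: fin_inter_indep.
Qed.

Lemma mutual_freeze (D1 D2 : set I) (G : past_type D1 * past_type D2 -> R) :
  D1 `&` D2 = set0 -> bmeas G ->
  bmeas (fun w : past_type D1 => Ex P (fun w' => G (w, w'))) /\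
  Ex P (fun w => G (w, w)) = Ex P (fun w => Ex P (fun w' => G (w, w'))).
Proof.
move=> D12; apply: indep_freeze; first [exact: fin_inter_measurable|
  exact: fin_interI|exact: fin_interT|idtac].
by move=> A B; exact: fin_inter_indep.
Qed.

Lemma measurable_past (D : set I) i A : D i -> F i A ->
  measurable (A : set (past_type D)).
Proof. by move=> Di FA; apply: sub_sigma_algebra; exact: fin_inter1 Di FA. Qed.

Lemma bmeas_past (D : set I) (U : past_type D -> R) :
  bmeas U -> bmeas (U : T -> R).
Proof. by apply: bmeas_sub; exact: fin_inter_measurable. Qed.

Lemma past_measurable (D : set I) (A : set (past_type D)) :
  measurable A -> measurable (A : set T).
Proof. by move=> mA; apply: g_sigma_sub mA; exact: fin_inter_measurable. Qed.

End finite_intersections.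

(** * Visits of the simple random walk *)

Section walk_average.
Variables (R : realType) (d : nat).
Local Notation V := 'rV[int]_d.
Implicit Types (x : V) (f : V -> R) (F : seq V -> R).

Definition stepv (e : 'I_d * bool) : V := (-1) ^+ e.2 *: delta_mx 0 e.1.

Definition avg f : R := (2 * d)%:R^-1 * \sum_(e : 'I_d * bool) f (stepv e).

(** Expectation over n independent uniform unit steps, as an iterated finite mean. The discrete walk
    is estimated in this form, without measure theory, and [steps_law] transfers the estimates to
    the random steps. *)
Fixpoint avgs n F : R :=
  if n is m.+1 then avg (fun e => avgs m (fun s => F (e :: s))) else F [::].

Fixpoint visits x (s : seq V) : nat :=
  if s is e :: s' then ((x + e == 0)%R + visits (x + e)%R s')%N else 0.

Lemma eq_avg f g : f =1 g -> avg f = avg g.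
Proof. by move=> fg; rewrite /avg; congr (_ * _); apply: eq_bigr. Qed.

Lemma avgD f g : avg (fun e => f e + g e) = avg f + avg g.
Proof. by rewrite /avg big_split mulrDr. Qed.

Lemma avgZ r f : avg (fun e => r * f e) = r * avg f.
Proof. by rewrite /avg -mulr_sumr mulrCA. Qed.

Lemma avgZr r f : avg (fun e => f e * r) = avg f * r.
Proof. by rewrite /avg -mulr_suml mulrA. Qed.

Lemma avg_le f g : (forall e, f e <= g e) -> avg f <= avg g.
Proof.
move=> fg; rewrite /avg ler_wpM2l ?invr_ge0//.
by apply: ler_sum => e _; exact: fg.
Qed.

Lemma avg_sum (I : Type) (s : seq I) (G : I -> V -> R) :
  avg (fun e => \sum_(i <- s) G i e) = \sum_(i <- s) avg (G i).
Proof. by rewrite /avg exchange_big/= mulr_sumr. Qed.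

Lemma avg_ge0 f : (forall e, 0 <= f e) -> 0 <= avg f.
Proof. by move=> f0; rewrite /avg mulr_ge0 ?invr_ge0// sumr_ge0. Qed.

Lemma eq_avgs n F G : F =1 G -> avgs n F = avgs n G.
Proof.
elim: n F G => [|n ih] F G FG //=; apply: eq_avg => e.
by apply: ih => s.
Qed.

Lemma avgs_le n F G : (forall s, F s <= G s) -> avgs n F <= avgs n G.
Proof.
by elim: n F G => [|n ih] F G FG //=; apply: avg_le => e; exact: ih.
Qed.

Lemma avgsD n F G : avgs n (fun s => F s + G s) = avgs n F + avgs n G.
Proof.
by elim: n F G => [//|n ih] F G /=; rewrite -avgD; apply: eq_avg => e; rewrite ih.
Qed.

Lemma avgsZ n r F : avgs n (fun s => r * F s) = r * avgs n F.
Proof.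
by elim: n F => [//|n ih] F /=; rewrite -avgZ; apply: eq_avg => e; rewrite ih.
Qed.

Lemma avgs_ge0 n F : (forall s, 0 <= F s) -> 0 <= avgs n F.
Proof. by elim: n F => [|n ih] F F0 //=; apply: avg_ge0 => e; exact: ih. Qed.

Lemma avgs_sum (I : Type) (r : seq I) n (F : I -> seq V -> R) :
  avgs n (fun s => \sum_(i <- r) F i s) = \sum_(i <- r) avgs n (F i).
Proof.
elim: n F => [//|n ih] F /=; rewrite -avg_sum; apply: eq_avg => e.
by rewrite ih.
Qed.

Hypothesis d_gt0 : (0 < d)%N.

Lemma avg_cst r : avg (fun=> r) = r.
Proof.
rewrite /avg sumr_const card_prod card_ord card_bool -[r *+ _]mulr_natl mulnC.
by rewrite mulKf// pnatr_eq0 muln_eq0 orbF -lt0n.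
Qed.

Lemma avgs_cst n r : avgs n (fun=> r) = r.
Proof. by elim: n => [//|n ih] /=; under eq_avg do rewrite ih; exact: avg_cst. Qed.

Lemma avgs_cat m n F :
  avgs (m + n) F = avgs m (fun s => avgs n (fun s' => F (s ++ s'))).
Proof. by elim: m F => [//|m ih] F /=; apply: eq_avg => e; rewrite ih. Qed.

Fixpoint Pn n x : R := if n is m.+1 then avg (fun e => Pn m (x + e)) else (x == 0)%:R.

(* [fv n x]: the first visit to 0 after time 0 by the walk started at x takes place at
   time n.+1. *)
Fixpoint fv n x : R :=
  avg (fun e => if x + e == 0 then (n == 0)%:R else if n is m.+1 then fv m (x + e) else 0).

Definition returns k n x : R := avgs n (fun s => (k <= visits x s)%:R).

Lemma Pn_avgs n x : Pn n x = avgs n (fun s => (x + \sum_(e <- s) e == 0)%:R).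
Proof.
elim: n x => [|n ih] x /=; first by rewrite big_nil addr0.
by apply: eq_avg => e; rewrite ih; apply: eq_avgs => s; rewrite big_cons addrA.
Qed.

Lemma Pn_ge0 n x : 0 <= Pn n x.
Proof. by elim: n x => [|n ih] x //=; apply: avg_ge0. Qed.

Lemma fv_ge0 n x : 0 <= fv n x.
Proof.
elim: n x => [|n ih] x /=; apply: avg_ge0 => e; case: ifP => //.
Qed.

(** Decomposition at the first visit to 0: a family whose one-step recursion is reset to [c] on
    hitting 0 is a convolution of [c] with the law of the hitting time. [Pn] and [returns] are the
    two instances. *)
Lemma renewal (W : nat -> V -> R) (c : nat -> R) :
  (forall x, W 0 x = 0) ->
  (forall n x, W n.+1 x = avg (fun e => if x + e == 0 then c n else W n (x + e))) ->
  forall n x, W n x = \sum_(j < n) fv j x * c (n - j.+1)%N.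
Proof.
move=> W0 WS; elim=> [|n ih] x; first by rewrite big_ord0.
rewrite WS big_ord_recl/= subSS subn0 -avgZr.
under [X in _ = _ + X]eq_bigr => j _.
  rewrite /= /bump/= add1n subSS -avgZr; over.
rewrite -avg_sum -avgD; apply: eq_avg => e.
case: ifPn => xe; first by rewrite mul1r big1 ?addr0// => j _; rewrite mul0r.
by rewrite mul0r add0r ih.
Qed.

Lemma Pn_renewal n x : Pn n.+1 x = \sum_(j < n.+1) fv j x * Pn (n - j)%N 0.
Proof.
(* The value at time 0 is replaced by 0, as [renewal] requires; positive times are unchanged. *)
pose W n x := if n is m.+1 then Pn m.+1 x else 0.
rewrite -[LHS]/(W n.+1 x) (@renewal W (fun n => Pn n 0))//.
case=> [|m] y; rewrite /W/=; apply: eq_avg => e; case: eqVneq => //.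
  by move=> _; rewrite eqxx.
by move=> ->.
Qed.

Lemma returns_renewal k n x :
  returns k.+1 n x = \sum_(j < n) fv j x * returns k (n - j.+1)%N 0.
Proof.
rewrite (@renewal (returns k.+1) (fun n => returns k n 0))//.
move=> m y; rewrite {1}/returns/=; apply: eq_avg => e; case: ifPn => [/eqP ->|_].
  by apply: eq_avgs => s; rewrite add1n ltnS.
by apply: eq_avgs => s; rewrite add0n.
Qed.

Lemma returns0 n x : returns 0 n x = 1.
Proof. by rewrite /returns -[RHS](avgs_cst n); apply: eq_avgs. Qed.

Lemma fv_le_Pn n x : fv n x <= Pn n.+1 x.
Proof.
rewrite Pn_renewal big_ord_recr/= subnn/= eqxx mulr1 lerDr.
by apply: sumr_ge0 => j _; rewrite mulr_ge0 ?fv_ge0 ?Pn_ge0.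
Qed.

End walk_average.

(** * Fourier analysis of the walk *)

Section heat_kernel.
Variables (R : realType) (d : nat).
Local Notation V := 'rV[int]_d.

(** Real substitutes for characters: the steps are symmetric in each coordinate, so the sine terms
    cancel and products of cosines are already eigenfunctions of the one-step average. *)
Definition Phi (th : 'I_d -> R) (x : V) : R := \prod_i cos (th i * (x 0 i)%:~R).

Lemma avg_Phi th x :
  avg (fun e => Phi th (x + e)) = (d%:R^-1 * \sum_i cos (th i)) * Phi th x.
Proof.
have step i (b : bool) : Phi th (x + stepv (i, b)) =
    cos (th i * ((x 0 i)%:~R + (-1) ^+ b)) *
    \prod_(j | j != i) cos (th j * (x 0 j)%:~R).
  rewrite /Phi (bigD1 i)//=; congr (_ * _).
    by rewrite /stepv/= !mxE !eqxx mulr1 rmorphD/= rmorphXn/= rmorphN rmorph1.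
  apply: eq_bigr => j ji.
  by rewrite /stepv/= !mxE eqxx (negbTE ji) mulr0 addr0.
rewrite /avg -(pair_bigA _ (fun i b => Phi th (x + stepv (i, b))))/=.
transitivity ((2 * d)%:R^-1 * \sum_i (2 * cos (th i) * Phi th x)).
  congr (_ * _); apply: eq_bigr => i _; rewrite big_bool/= !step expr1 expr0 -mulrDl.
  rewrite [Phi th x](bigD1 i)//= mulrA; congr (_ * _).
  rewrite !mulrDr mulrN1 mulr1 cosB cosD; ring.
rewrite -mulr_suml mulrA; congr (_ * _); rewrite -mulr_sumr mulrA; congr (_ * _).
by rewrite natrM invfM mulrAC mulVf ?mul1r.
Qed.

Lemma cos_char_sum (M : nat) (z : int) : (`|z| < M)%N ->
  \sum_(j < M) cos (2 * pi * j%:R / M%:R * z%:~R : R) = if z == 0 then M%:R else 0.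
Proof.
move=> zM; case: ifPn => [/eqP ->|z0].
  under eq_bigr do rewrite mulr0 cos0.
  by rewrite sumr_const card_ord.
have M0 : M%:R != 0 :> R by rewrite pnatr_eq0 -lt0n (leq_ltn_trans _ zM).
(* Multiplied by [sin h], the j-th term is half the difference of the sines of (2j+1)h and (2j-1)h,
   so the sum telescopes over a whole period; |z| < M makes [sin h] nonzero. *)
pose h : R := pi / M%:R * z%:~R.
have sh : sin h != 0.
  have -> : h = Num.sg z%:~R * (pi * (`|z|%N%:R / M%:R)).
    have zE : z%:~R = Num.sg z%:~R * `|z|%N%:R :> R by rewrite natr_absz intr_norm -numEsg.
    by rewrite /h [in LHS]zE; ring.
  rewrite sin_sg mulf_neq0 ?sgr_eq0 ?intr_eq0//.
  apply: lt0r_neq0; apply: sin_gt0_pi.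
  rewrite mulr_gt0 ?pi_gt0//=; last first.
    by rewrite divr_gt0// ltr0n ?absz_gt0// (leq_ltn_trans _ zM).
  rewrite gtr_pMr ?pi_gt0// ltr_pdivrMr ?mul1r ?ltr_nat//.
  by rewrite ltr0n (leq_ltn_trans _ zM).
apply: (mulfI sh); rewrite mulr0 mulr_sumr.
transitivity (\sum_(j < M) (sin ((2 * j.+1%:R - 1) * h) - sin ((2 * j%:R - 1) * h)) / 2).
  apply: eq_bigr => j _.
  have -> : 2 * pi * j%:R / M%:R * z%:~R = 2 * j%:R * h by rewrite /h; field.
  have -> : (2 * j.+1%:R - 1) * h = 2 * j%:R * h + h by rewrite -natr1; ring.
  have -> : (2 * j%:R - 1) * h = 2 * j%:R * h - h by ring.
  by rewrite sinB sinD; field.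
rewrite -mulr_suml -(big_mkord predT (fun j => sin ((2 * j.+1%:R - 1) * h) - sin ((2 * j%:R - 1) * h))) telescope_sumr//.
  rewrite mulr0 sub0r mulN1r sinN opprK.
  have -> : (2 * M%:R - 1) * h = - h + pi *+ 2 * z%:~R by rewrite /h; field.
  have -> : sin (- h + pi *+ 2 * z%:~R) = sin (- h).
    have per n y : sin (y + pi *+ 2 * n%:R) = sin y :> R.
      by rewrite -[RHS](periodicn (@sinD2pi R) n) mulr_natr.
    move: (- h) => y {sh h z0 zM}; case: z => n; first by rewrite per.
    by rewrite NegzE rmorphN/= mulrN -[LHS](per n.+1) -pmulrn subrK.
  by rewrite sinN addNr mul0r.
Qed.

End heat_kernel.

Section heat_kernel_bound.
Variables (R : realType) (d : nat).
Hypothesis d_gt0 : (0 < d)%N.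
Local Notation V := 'rV[int]_d.

Let th (M : nat) (f : {ffun 'I_d -> 'I_M}) (i : 'I_d) : R := 2 * pi * (f i)%:R / M%:R.

Lemma step_dist (x : V) e i : (`|((x + stepv e) 0 i)%R| <= `|(x 0 i)%R|.+1)%N.
Proof.
rewrite /stepv !mxE eqxx/=; case: e => j [] /=; case: (i == j) => /=;
  rewrite ?expr1 ?expr0 ?mulr0 ?mulr1; lia.
Qed.

(** Since M exceeds |x| + n, the walk cannot wrap around the torus of side M within n steps, and
    Fourier inversion on the torus is exact on the lattice. *)
Lemma Pn_fourier (M n : nat) (x : V) : (forall i, `|(x 0 i)%R| + n < M)%N ->
  Pn R n x = (M%:R ^+ d)^-1 *
    \sum_(f : {ffun 'I_d -> 'I_M}) (d%:R^-1 * \sum_i cos (th f i)) ^+ n * Phi (th f) x.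
Proof.
elim: n x => [|n ih] x xM /=.
  under eq_bigr do rewrite expr0 mul1r.
  rewrite /Phi /th -(bigA_distr_bigA (fun i (j : 'I_M) =>
     cos (2 * pi * j%:R / M%:R * (x 0 i)%:~R)))/=.
  have M0 : (0 < M)%N by rewrite (leq_ltn_trans _ (xM (Ordinal d_gt0))).
  have xM' i : (`|(x 0 i)%R| < M)%N by rewrite (leq_ltn_trans _ (xM i))// leq_addr.
  under [in RHS]eq_bigr do rewrite cos_char_sum//.
  case: eqVneq => [->|x0].
    under eq_bigr do rewrite mxE eqxx.
    by rewrite prodr_const card_ord mulVf// expf_neq0// pnatr_eq0 -lt0n.
  have [i xi] : exists i, x 0 i != 0.
    apply/existsP; apply: contraNT x0; rewrite negb_exists => /forallP x0.
    by apply/eqP/rowP => i; rewrite mxE; apply/eqP; rewrite -[_ == _]negbK x0.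
  by rewrite (bigD1 i)//= (negbTE xi) mul0r mulr0.
transitivity (avg (fun e => (M%:R ^+ d)^-1 *
    \sum_(f : {ffun 'I_d -> 'I_M}) (d%:R^-1 * \sum_i cos (th f i)) ^+ n * Phi (th f) (x + e))).
  rewrite /avg; congr (_ * _); apply: eq_bigr => -[j b] _; apply: ih => i.
  rewrite (leq_ltn_trans _ (xM i))// addnS -addSn leq_add2r.
  exact: step_dist.
rewrite avgZ; congr (_ * _); rewrite avg_sum; apply: eq_bigr => f _.
rewrite avgZ avg_Phi exprSr; ring.
Qed.

(** At even times every eigenvalue has a nonnegative power, and |Phi| is at most 1, its value at the
    origin. *)
Lemma Pn_sym0 n (x : V) : Pn R (2 * n)%N x <= Pn R (2 * n)%N (0 : V).
Proof.
pose M := (\sum_i `|(x 0 i)%R| + 2 * n).+1%N.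
have xM i : (`|(x 0 i)%R| + 2 * n < M)%N.
  by rewrite ltnS leq_add2r (bigD1 i)//= leq_addr.
have M0 (i : 'I_d) : (`|((0 : V) 0 i)%R| + 2 * n < M)%N.
  by rewrite mxE absz0 add0n ltnS leq_addl.
rewrite !(@Pn_fourier M)// ler_wpM2l ?invr_ge0 ?exprn_ge0//.
apply: ler_sum => f _; rewrite ler_wpM2l//.
  by rewrite exprM exprn_ge0// sqr_ge0.
rewrite [leRHS]big1; last by move=> i _; rewrite mxE mulr0 cos0.
apply: (le_trans (ler_norm _)); rewrite normr_prod.
by apply: prodr_ile1 => i _; rewrite normr_ge0 cos_max.
Qed.

(** One coordinate's share of the Fourier bound: the mean of the |cos| is at most exp of minus the
    mean of the 1 - |cos|, whose n-th power factorises over the coordinates. Absolute values take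
    care of the negative eigenvalues. *)
Definition heat1 (M n : nat) : R :=
  M%:R^-1 * \sum_(j < M) expR (- (n%:R / d%:R) * (1 - `|cos (2 * pi * j%:R / M%:R)|)).

Lemma Pn0_le_heat1 (M n : nat) : (n < M)%N -> Pn R n (0 : V) <= heat1 M n ^+ d.
Proof.
move=> nM; rewrite (@Pn_fourier M); last by move=> i; rewrite mxE absz0.
rewrite /heat1 exprMn exprVn ler_wpM2l ?invr_ge0 ?exprn_ge0//.
rewrite -[X in _ <= _ ^+ X](card_ord d) -prodr_const bigA_distr_bigA/=.
apply: ler_sum => f _; rewrite [X in _ * X]big1 ?mulr1; last first.
  by move=> i _; rewrite mxE mulr0 cos0.
rewrite -expR_sum -mulr_sumr sumrB sumr_const card_ord.
apply: (le_trans (ler_norm _)); rewrite normrX.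
have -> : - (n%:R / d%:R) * (1 *+ d - \sum_i `|cos (th f i)|) =
    n%:R * (- (1 - d%:R^-1 * \sum_i `|cos (th f i)|)) :> R.
  by field; rewrite pnatr_eq0 -lt0n.
rewrite [n%:R * _]mulrC expRM_natr lerXn2r ?nnegrE ?expR_ge0//.
rewrite (@le_trans _ _ (d%:R^-1 * \sum_i `|cos (th f i)|))//.
  by rewrite normrM ger0_norm ?invr_ge0// ler_wpM2l ?invr_ge0// ler_norm_sum.
by rewrite (le_trans _ (expR_ge1Dx _))// opprB addrC subrK.
Qed.

End heat_kernel_bound.

(** * Decay of the return probabilities *)

Section polynomial_decay.
Variables (R : realType).

Lemma sin_linear_lb : exists2 c : R, 0 < c <= 1 & forall y : R, 0 <= y <= pi / 2 -> c * y <= sin y.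
Proof.
have c1 := @cos1_gt0 R.
have s1 : 0 < sin (1 : R) by apply: sin2_gt0; lra.
exists (Num.min (cos 1) (sin 1 / 2)).
  by rewrite lt_min c1 divr_gt0//= ge_min cos_le1.
move=> y /andP[y0 yp]; have [y1|y1] := leP y 1.
  have [z] := @MVT_segment R sin cos 0 y y0 (fun z _ => is_derive_sin z)
    (continuous_subspaceT (@continuous_sin R)).
  rewrite in_itv/= => /andP[z0 zy]; rewrite sin0 !subr0 => ->; rewrite ler_wpM2r//.
  rewrite ge_min; apply/orP; left.
  have z1 : z <= 1 by exact: le_trans y1.
  have pi2 := @pihalf_ge1 R.
  have ppi : (1 : R) <= pi by lra.
  move: z1; rewrite le_eqVlt => /orP[/eqP->//|z1].
  by rewrite ltW// ltr_cos// in_itv/= ?z0 ?ler01 ?ppi//=; lra.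
have pi2 := @pihalf_lt2 R.
apply: (@le_trans _ _ (sin 1)).
  rewrite -[leRHS]mulr1 (@le_trans _ _ (sin 1 / 2 * y))//.
    by rewrite ler_wpM2r ?ge_min ?lexx ?orbT.
  by rewrite -mulrA ler_pM2l// mulrC ler_pdivrMr// mul1r; lra.
have pi0 := @pi_gt0 R.
by rewrite ltW// ltr_sin ?in_itv/= ?yp ?(le_trans _ y0)//; lra.
Qed.

(** With s the square root of A, 2 (A + r^2) is at least (s + r)^2, and the sum of the inverse
    squares of s + r telescopes. *)
Lemma sum_inv_quadratic (A : R) (n : nat) : 1 <= A ->
  \sum_(r < n) (1 + r%:R ^+ 2 / A)^-1 <= 4 * Num.sqrt A.
Proof.
move=> A1; have A0 : 0 < A by lra.
set s : R := Num.sqrt A; have s2 : s ^+ 2 = A by rewrite sqr_sqrtr// ltW.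
have s1 : 1 <= s by rewrite -[leLHS]sqrtr1 ler_wsqrtr.
have bnd m : \sum_(r < m.+1) ((s + r%:R) ^+ 2)^-1 <= 2 / s - (s + m%:R)^-1.
  elim: m => [|m ih].
    rewrite big_ord_recl big_ord0 /= !addr0.
    have -> : 2 / s - s^-1 = s^-1 by field; lra.
    by rewrite lef_pV2 ?posrE ?exprn_gt0//; [rewrite expr2 ler_peMl//; lra|lra|lra].
  rewrite big_ord_recr/=; apply: (le_trans (lerD ih (lexx _))).
  rewrite -addrA lerD2l lerNr opprD opprK lerBrDr.
  set t := s + m%:R; have t1 : 1 <= t by rewrite /t (le_trans s1)// lerDl.
  have -> : s + m.+1%:R = t + 1 by rewrite /t -[m.+1%:R]natr1 addrA.
  have -> : t^-1 = (t + 1)^-1 + (t * (t + 1))^-1 by field; lra.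
  rewrite lerD2l lef_pV2 ?posrE ?mulr_gt0 ?exprn_gt0//; try lra.
case: n => [|n]; first by rewrite big_ord0 mulr_ge0// sqrtr_ge0.
apply: (@le_trans _ _ (\sum_(r < n.+1) 2 * A * ((s + r%:R) ^+ 2)^-1)).
  apply: ler_sum => r _; set x : R := r%:R.
  have x0 : 0 <= x by rewrite /x.
  have -> : (1 + x ^+ 2 / A)^-1 = A / (A + x ^+ 2) by field; rewrite !gt_eqF ?ltr_pwDl ?sqr_ge0.
  have sx : 0 < (s + x) ^+ 2 by rewrite exprn_gt0//; lra.
  rewrite ler_pdivrMr; last by rewrite ltr_pwDl// sqr_ge0.
  rewrite [leRHS](_ : _ = A * ((2 * (A + x ^+ 2)) / (s + x) ^+ 2)); last by ring.
  rewrite ler_peMr ?(ltW A0)// ler_pdivlMr// mul1r -s2.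
  by rewrite -subr_ge0 [leRHS](_ : _ = (s - x) ^+ 2) ?sqr_ge0//; ring.
rewrite -mulr_sumr (@le_trans _ _ (2 * A * (2 / s)))//.
  rewrite ler_wpM2l//; first by lra.
  apply: (le_trans (bnd n)); rewrite gerBl invr_ge0 addr_ge0//; lra.
by rewrite -s2 le_eqVlt; apply/orP; left; apply/eqP; field; lra.
Qed.

Variable d : nat.
Hypothesis d_ge3 : (3 <= d)%N.
Let d_gt0 : (0 < d)%N. Proof. exact: ltn_trans d_ge3. Qed.

Lemma heat1_le1 M n : (0 < M)%N -> 0 <= heat1 R d M n <= 1.
Proof.
move=> M0; rewrite /heat1 mulr_ge0 ?invr_ge0//=; last first.
  by apply: sumr_ge0 => j _; exact: expR_ge0.
rewrite ler_pdivrMl ?ltr0n// mulr1.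
rewrite [leRHS](_ : _ = \sum_(j < M) (1 : R)); last by rewrite sumr_const card_ord.
apply: ler_sum => j _.
by rewrite -[leRHS]expR0 ler_expR mulNr oppr_le0 mulr_ge0 ?divr_ge0 ?subr_ge0 ?cos_max.
Qed.

(** The modulus 4n exceeds n, as [Pn_fourier] requires, and cuts the angles into four quarter turns
    of n points. In each, 1 - |cos| grows quadratically from the end where |cos| = 1, and
    [sum_inv_quadratic] applies with A of order n. *)
Lemma heat1_decay : exists2 C : R, 0 < C &
  forall n, (0 < n)%N -> heat1 R d (4 * n) n <= C / Num.sqrt n%:R.
Proof.
have [c /andP[c0 c1] sin_lb] := sin_linear_lb.
pose b : R := c ^+ 2 / (2 * d%:R).
have d0 : 0 < d%:R :> R by rewrite ltr0n.
have d1 : 1 <= d%:R :> R by rewrite ler1n.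
have b0 : 0 < b by rewrite /b divr_gt0// ?exprn_gt0//; lra.
have b1 : b <= 1 by rewrite /b ler_pdivrMr; [nra|lra].
exists (4 / Num.sqrt b); first by rewrite divr_gt0// sqrtr_gt0.
move=> n n0; have N0 : 0 < n%:R :> R by rewrite ltr0n.
pose A := n%:R / b.
have A1 : 1 <= A by rewrite ler_pdivlMr// mul1r (le_trans b1)// ler1n.
pose a (r : nat) : R := (1 + r%:R ^+ 2 / A)^-1.
pose E (j : nat) := expR (- (n%:R / d%:R) * (1 - `|cos (2 * pi * j%:R / (4 * n)%:R)|)) : R.
have pi0 := @pi_gt0 R; have pi2 := @pihalf_ge1 R.
have aux (w : R) (r : nat) : `|w| <= 1 -> (c * (r%:R / n%:R)) ^+ 2 <= 1 - w ^+ 2 ->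
    expR (- (n%:R / d%:R) * (1 - `|w|)) <= a r.
  move=> w1 wr; have w0 := normr_ge0 w.
  have hw : (c * (r%:R / n%:R)) ^+ 2 / 2 <= 1 - `|w|.
    by move: wr; rewrite -(real_normK (num_real w)); nra.
  rewrite mulNr expRN lef_pV2 ?posrE ?expR_gt0//; last first.
    by rewrite ltr_pwDl// divr_ge0 ?sqr_ge0//; lra.
  apply: (le_trans _ (expR_ge1Dx _)); rewrite lerD2l.
  apply: (@le_trans _ _ (n%:R / d%:R * ((c * (r%:R / n%:R)) ^+ 2 / 2))).
    by rewrite /A /b le_eqVlt; apply/orP; left; apply/eqP; field; rewrite !gt_eqF.
  by rewrite ler_wpM2l// divr_ge0.
have q1 (y : R) r : 0 <= y <= pi / 2 -> r%:R / n%:R <= y -> (c * (r%:R / n%:R)) ^+ 2 <= sin y ^+ 2 :> R.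
  move=> yp ry; have cr0 : 0 <= c * (r%:R / n%:R) by rewrite mulr_ge0 ?divr_ge0// ltW.
  have sy : c * (r%:R / n%:R) <= sin y.
    by rewrite (le_trans _ (sin_lb _ yp))// ler_wpM2l// ltW.
  by rewrite lerXn2r ?nnegrE// (le_trans cr0).
have angle q r : 2 * pi * (q * n + r)%:R / (4 * n)%:R =
    pi * r%:R / (2 * n%:R) + pi / 2 * q%:R :> R.
  by rewrite natrD !natrM; field; rewrite gt_eqF.
have yb r : (r <= n)%N -> 0 <= (pi : R) * r%:R / (2 * n%:R) <= pi / 2.
  move=> rn; apply/andP; split; first by rewrite divr_ge0// mulr_ge0// ltW.
  rewrite ler_pdivrMr ?mulr_gt0//; have : r%:R <= n%:R :> R by rewrite ler_nat.
  by move=> h; rewrite mulrA divfK// ler_pM2l.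
have rb (r : nat) : r%:R / n%:R <= pi * r%:R / (2 * n%:R) :> R.
  rewrite [leRHS](_ : _ = pi / 2 * (r%:R / n%:R)); last by field; rewrite gt_eqF.
  by rewrite ler_peMl// divr_ge0.
have evn q r : (r < n)%N -> (q = 0%N) \/ (q = 2%N) -> E (q * n + r)%N <= a r.
  move=> rn qq; rewrite /E angle; apply: aux; first exact: cos_max.
  set y := pi * r%:R / (2 * n%:R); have -> : cos (y + pi / 2 * q%:R) ^+ 2 = cos y ^+ 2.
    case: qq => ->; first by rewrite mulr0 addr0.
    by rewrite divfK// cosDpi sqrrN.
  by rewrite -sin2cos2; apply: q1; [apply: yb; exact: ltnW|exact: rb].
have odn q r : (r < n)%N -> (q = 1%N) \/ (q = 3%N) -> E (q * n + r)%N <= a (n - r)%N.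
  move=> rn qq; rewrite /E angle; apply: aux; first exact: cos_max.
  set y := pi * r%:R / (2 * n%:R); have -> : cos (y + pi / 2 * q%:R) ^+ 2 = sin y ^+ 2.
    case: qq => ->; first by rewrite mulr1 cosDpihalf sqrrN.
    have -> : y + pi / 2 * 3 = (y + pi / 2) + pi by field.
    by rewrite cosDpi cosDpihalf opprK.
  rewrite -cos2sin2.
  have -> : cos y = sin (pi * (n - r)%:R / (2 * n%:R)).
    transitivity (sin (pi / 2 - y)).
      by rewrite sinB sin_pihalf cos_pihalf mul1r mul0r subr0.
    by congr sin; rewrite natrB ?(ltnW rn)// /y; field; rewrite gt_eqF.
  by apply: q1; [apply: yb; rewrite leq_subr|exact: rb].
have S4 : \sum_(j < 4 * n) E j <= 4 * \sum_(r < n) a r.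
  have -> : (4 * n = n + (n + (n + n)))%N by clear; lia.
  rewrite !big_split_ord/=.
  have So : \sum_(r < n) a (n - r)%N <= \sum_(r < n) a r.
    rewrite [leRHS](reindex_inj rev_ord_inj)/=; apply: ler_sum => r _.
    have A0 : 0 < A by lra.
    rewrite /a lef_pV2 ?posrE ?lerD2l; last 2 first.
    - by rewrite ltr_pwDl// divr_ge0 ?sqr_ge0// ltW.
    - by rewrite ltr_pwDl// divr_ge0 ?sqr_ge0// ltW.
    by rewrite ler_pM2r ?invr_gt0// lerXn2r ?nnegrE// ler_nat leq_sub2l.
  have -> : 4 * \sum_(r < n) a r = \sum_(r < n) a r + (\sum_(r < n) a r +
    (\sum_(r < n) a r + \sum_(r < n) a r)) by ring.
  apply: lerD; last apply: lerD; last apply: lerD.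
  - by apply: ler_sum => r _; have := @evn 0 r; apply=> //; left.
  - apply: le_trans So; apply: ler_sum => r _.
    by have := @odn 1 r; rewrite mul1n; apply=> //; left.
  - apply: ler_sum => r _.
    by have := @evn 2 r; rewrite addnA mul2n addnn; apply=> //; right.
  - apply: le_trans So; apply: ler_sum => r _.
    have := @odn 3 r; rewrite (_ : 3 * n + r = n + (n + (n + r)))%N; last by clear; lia.
    by apply=> //; right.
rewrite /heat1 -/(E _); apply: (@le_trans _ _ ((4 * n)%:R^-1 * (4 * (4 * Num.sqrt A)))).
  rewrite ler_wpM2l ?invr_ge0//; apply: (le_trans S4).
  by rewrite ler_pM2l//; exact: sum_inv_quadratic.
have sn : Num.sqrt n%:R != 0 :> R by rewrite gt_eqF// sqrtr_gt0.
have sb : Num.sqrt b != 0 by rewrite gt_eqF// sqrtr_gt0.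
have -> : (4 * n)%:R = 4 * Num.sqrt n%:R ^+ 2 :> R by rewrite sqr_sqrtr ?natrM// ltW.
rewrite /A sqrtrM ?(ltW N0)// sqrtrV ?(ltW b0)//.
by rewrite le_eqVlt; apply/orP; left; apply/eqP; field; rewrite sn sb.
Qed.

(** Three of the d factors give the exponent 3/2; the others are at most 1. *)
Lemma Pn_decay : exists2 C : R, 0 < C &
  forall n, (0 < n)%N -> Pn R n (0 : 'rV[int]_d) <= C / Num.sqrt n%:R ^+ 3.
Proof.
have [C C0 hC] := heat1_decay; exists (C ^+ 3); first exact: exprn_gt0.
move=> n n0; have nM : (n < 4 * n)%N by lia.
apply: (le_trans (Pn0_le_heat1 R d_gt0 nM)).
have /andP[h0 h1] : 0 <= heat1 R d (4 * n) n <= 1 by apply: heat1_le1; lia.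
apply: (@le_trans _ _ (heat1 R d (4 * n) n ^+ 3)); first exact: ler_wiXn2l.
have h := hC _ n0.
by rewrite -expr_div_n lerXn2r ?nnegrE// (le_trans h0).
Qed.

End polynomial_decay.

(** * Green function and return times *)

Section green_function.
Variables (R : realType) (d : nat).
Hypothesis d_ge3 : (3 <= d)%N.
Let d_gt0 : (0 < d)%N. Proof. exact: ltn_trans d_ge3. Qed.
Local Notation V := 'rV[int]_d.
Local Notation P n := (Pn R n (0 : V)).

(** A power below 1/2, so that [wt n * Pn n], of order n^(-5/4), is summable. Being concave it is
    subadditive, which lets it pass through convolutions. *)
Definition wt (n : nat) : R := Num.sqrt (Num.sqrt n%:R).

Lemma sqrt_subadd (x y : R) : 0 <= x -> 0 <= y ->
  Num.sqrt (x + y) <= Num.sqrt x + Num.sqrt y.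
Proof.
move=> x0 y0; have sx := sqrtr_ge0 x; have sy := sqrtr_ge0 y.
rewrite -[leRHS]ger0_norm ?addr_ge0// -sqrtr_sqr ler_wsqrtr// sqrrD !sqr_sqrtr//.
by rewrite -addrA lerD2l lerDr mulrn_wge0// mulr_ge0.
Qed.

Lemma wtD m n : wt (m + n) <= wt m + wt n.
Proof.
rewrite /wt natrD (le_trans (ler_wsqrtr (sqrt_subadd _ _)))//.
exact: sqrt_subadd (sqrtr_ge0 _) (sqrtr_ge0 _).
Qed.

Lemma wt_ge0 n : 0 <= wt n. Proof. exact: sqrtr_ge0. Qed.

Lemma wt_le m n : (m <= n)%N -> wt m <= wt n.
Proof. by move=> mn; rewrite /wt !ler_wsqrtr// ler_nat. Qed.

Lemma wt4 n : wt n ^+ 4 = n%:R.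
Proof. by rewrite (exprM _ 2 2) !sqr_sqrtr// sqrtr_ge0. Qed.

Lemma wt_ge1 n : (0 < n)%N -> 1 <= wt n.
Proof.
by move=> n0; rewrite -[leLHS]sqrtr1 ler_wsqrtr// -[leLHS]sqrtr1 ler_wsqrtr// ler1n.
Qed.

Lemma sum_wt_inv5 N : \sum_(n < N) (wt n.+1 ^+ 5)^-1 <= 5.
Proof.
(* The terms n^(-5/4) are compared with the increments of -4 n^(-1/4). *)
suff: \sum_(n < N) (wt n.+1 ^+ 5)^-1 <= 5 - 4 * (wt N)^-1 * (0 < N)%N%:R.
  by move=> h; rewrite (le_trans h)// gerBl !mulr_ge0// invr_ge0 wt_ge0.
elim: N => [|[|n] ih]; first by rewrite big_ord0 mulr0 subr0.
  by rewrite big_ord_recl big_ord0 /wt !sqrtr1 expr1n invr1 !mulr1 addr0; lra.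
rewrite big_ord_recr/=; move: ih; rewrite !mulr1 => ih.
apply: (le_trans (lerD ih (lexx _))); rewrite -addrA lerD2l -mulN1r.
have a1 : 1 <= wt n.+1 by exact: wt_ge1.
have ab : wt n.+1 <= wt n.+2 by exact: wt_le.
have := wt4 n.+2; rewrite -natr1 -(wt4 n.+1).
move: a1 ab; move: (wt n.+1) (wt n.+2) => a b a1 ab b4.
have a0 : 0 < a by lra.
have b0 : 0 < b by lra.
have b1 : 1 <= b by lra.
suff: (b ^+ 5)^-1 <= 4 * (a^-1 - b^-1) by lra.
have -> : a^-1 - b^-1 = (b - a) / (a * b) by field; rewrite !gt_eqF.
have E : (b - a) * ((b + a) * (b ^+ 2 + a ^+ 2)) = 1.
  by rewrite (_ : 1 = b ^+ 4 - a ^+ 4); [ring|rewrite b4; ring].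
have ba : 0 <= b - a by lra.
have B3 : (b + a) * (b ^+ 2 + a ^+ 2) <= 4 * b ^+ 3.
  have a2 : a ^+ 2 <= b ^+ 2 by rewrite lerXn2r// nnegrE ltW.
  have -> : 4 * b ^+ 3 = (2 * b) * (2 * b ^+ 2) by ring.
  by apply: ler_pM; [lra|rewrite addr_ge0 ?sqr_ge0|lra|lra].
have ba4 : 1 <= (b - a) * (4 * b ^+ 3) by rewrite -[leLHS]E ler_wpM2l.
rewrite mulrA ler_pdivlMr ?mulr_gt0// mulrC ler_pdivrMr ?exprn_gt0//.
apply: (@le_trans _ _ (b ^+ 2)); first by rewrite expr2 ler_wpM2r// ltW.
have -> : 4 * (b - a) * b ^+ 5 = ((b - a) * (4 * b ^+ 3)) * b ^+ 2 by ring.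
by rewrite ler_peMl// sqr_ge0.
Qed.

Lemma wt_Pn_summable : exists2 C : R, 0 < C & forall N, \sum_(n < N) wt n * P n <= C.
Proof.
have [C C0 hC] := Pn_decay R d_ge3; exists (C * 5); first by rewrite mulr_gt0.
case=> [|N]; first by rewrite big_ord0 mulr_ge0// ltW.
rewrite big_ord_recl /wt !sqrtr0 mul0r add0r -/wt.
apply: (@le_trans _ _ (\sum_(n < N) C * (wt n.+1 ^+ 5)^-1)); last first.
  by rewrite -mulr_sumr ler_wpM2l ?sum_wt_inv5// ltW.
apply: ler_sum => n _; rewrite -[leLHS]/(wt n.+1 * P n.+1).
apply: (le_trans (ler_wpM2l (wt_ge0 _) (hC _ _)))=> //.
have w1 := @wt_ge1 n.+1 isT.
have -> : Num.sqrt n.+1%:R = wt n.+1 ^+ 2 :> R by rewrite sqr_sqrtr// sqrtr_ge0.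
rewrite le_eqVlt; apply/orP; left; apply/eqP; field.
by rewrite gt_eqF// (lt_le_trans _ w1).
Qed.

Definition Gn (n : nat) (x : V) : R := \sum_(m < n) Pn R m x.

(** The mean number of visits at integer times. [green0E] identifies it with the mean occupation
    time in continuous time. *)
Definition green : R := limn (Gn ^~ 0).

Lemma Gn_nd x : nondecreasing_seq (Gn ^~ x).
Proof.
apply/nondecreasing_seqP => n; rewrite /Gn big_ord_recr/= lerDl; exact: Pn_ge0.
Qed.

Lemma Gn_cvg : Gn ^~ 0 @ \oo --> green.
Proof.
have [C C0 hC] := wt_Pn_summable.
apply: nondecreasing_is_cvgn; first exact: Gn_nd.
exists (1 + C) => _ [n _ <-]; case: n => [|n]; first by rewrite /Gn big_ord0 addr_ge0// ltW.
rewrite /Gn big_ord_recl/= eqxx lerD2l (le_trans _ (hC n.+1))// big_ord_recl/=.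
rewrite /wt !sqrtr0 mul0r add0r; apply: ler_sum => m _.
by rewrite -[leLHS]/(P m.+1) -[leRHS]/(wt m.+1 * P m.+1) ler_peMl ?Pn_ge0 ?wt_ge1.
Qed.

Lemma Gn_le_green n : Gn n 0 <= green.
Proof.
apply: (nondecreasing_cvgn_le (Gn_nd 0)); apply/cvg_ex; exists green; exact: Gn_cvg.
Qed.

Lemma green_ge1 : 1 <= green.
Proof. by rewrite (le_trans _ (Gn_le_green 1))// /Gn big_ord_recl big_ord0/= eqxx addr0. Qed.

Let F (n : nat) : R := \sum_(j < n) fv R j (0 : V).

(** The return probability, as [F_cvg] confirms: the number of visits to 0 is geometric with mean
    [green]. *)
Definition retp : R := 1 - green^-1.

Let Gn_renewal n : Gn n.+1 0 = 1 + \sum_(j < n) fv R j (0 : V) * Gn (n - j) 0.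
Proof.
rewrite /Gn big_ord_recl/= eqxx; congr (_ + _).
rewrite (eq_bigr (fun m : 'I_n => Pn R m.+1 (0 : V)))//.
elim: n => [|n ih]; first by rewrite !big_ord0.
rewrite big_ord_recr ih Pn_renewal !big_ord_recr/= subnn subSnn big_ord_recl big_ord0.
rewrite addr0 addrA -big_split/=; congr (_ + _).
apply: eq_bigr => j _; rewrite -mulrDr subSn; last exact: ltnW.
by rewrite big_ord_recr.
Qed.

Lemma retp_ge0 : 0 <= retp.
Proof. by rewrite subr_ge0 invf_le1 ?green_ge1// (lt_le_trans ltr01 green_ge1). Qed.

Lemma retp_lt1 : retp < 1.
Proof. by rewrite gtrBl invr_gt0 (lt_le_trans ltr01 green_ge1). Qed.

(** Keeping the first n terms of the renewal equation at a horizon beyond n + m gives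
    [1 + F n * Gn m 0 <= green]; then m tends to infinity. *)
Let F_le n : F n <= retp.
Proof.
have g0 : 0 < green := lt_le_trans ltr01 green_ge1.
rewrite /retp lerBrDr -lerBrDl -(ler_pM2r g0) mulVf ?gt_eqF// mulrBl mul1r.
rewrite lerBrDr.
suff: forall m, 1 + F n * Gn m 0 <= green.
  move=> h; have -> : 1 + F n * green = limn (fun m => 1 + F n * Gn m 0).
    apply/esym/cvg_lim => //; apply: cvgD; first exact: cvg_cst.
    by apply: cvgM; [exact: cvg_cst|exact: Gn_cvg].
  apply: limr_le; last by near=> m.
  apply/cvg_ex; exists (1 + F n * green); apply: cvgD; first exact: cvg_cst.
  by apply: cvgM; [exact: cvg_cst|exact: Gn_cvg].
move=> m; apply: (le_trans _ (Gn_le_green (n + m).+1)); rewrite Gn_renewal lerD2l.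
rewrite big_split_ord/= /F mulr_suml.
rewrite -[leLHS]addr0 lerD//; last first.
  by apply: sumr_ge0 => j _; rewrite mulr_ge0 ?fv_ge0// sumr_ge0// => i _; exact: Pn_ge0.
apply: ler_sum => j _; rewrite ler_wpM2l ?fv_ge0//; apply: Gn_nd.
by rewrite -addnBAC ?leq_addl// ltnW.
Unshelve. all: by end_near. Qed.

Let F_nd : nondecreasing_seq F.
Proof. by apply/nondecreasing_seqP => n; rewrite /F big_ord_recr/= lerDl fv_ge0. Qed.

Lemma F_cvg : F @ \oo --> retp.
Proof.
have g0 : 0 < green := lt_le_trans ltr01 green_ge1.
have cF : cvgn F by apply: nondecreasing_is_cvgn => //; exists retp => _ [n _ <-].
have lF : limn F <= retp by apply: limr_le => //; near=> n.
suff: retp <= limn F by move=> h; rewrite (@le_anti _ _ retp (limn F)) ?h.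
rewrite /retp lerBlDr -lerBlDl -(ler_pM2r g0) mulVf ?gt_eqF// mulrBl mul1r.
rewrite lerBlDr; have -> : 1 + limn F * green = limn (fun n => 1 + F n * green).
  apply/esym/cvg_lim => //; apply: cvgD; first exact: cvg_cst.
  by apply: cvgM; [exact: cF|exact: cvg_cst].
have -> : green = limn (fun n => Gn n.+1 0).
  by apply/esym/cvg_lim => //; rewrite (cvg_shiftS (Gn ^~ 0)); exact: Gn_cvg.
apply: ler_lim.
- by apply/cvg_ex; exists green; rewrite (cvg_shiftS (Gn ^~ 0)); exact: Gn_cvg.
- apply/cvg_ex; exists (1 + limn F * limn (fun n => Gn n.+1 0)); apply: cvgD; first exact: cvg_cst.
  by apply: cvgM; [exact: cF|exact: cvg_cst].
near=> n; rewrite Gn_renewal lerD2l /F mulr_suml; apply: ler_sum => j _.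
have -> : limn (fun n => Gn n.+1 0) = green.
  by apply/cvg_lim => //; rewrite (cvg_shiftS (Gn ^~ 0)); exact: Gn_cvg.
by rewrite ler_wpM2l ?fv_ge0// Gn_le_green.
Unshelve. all: by end_near. Qed.

(** As [fv j] is at most [Pn j.+1], the return time has a moment of order 1/4 on the event of
    returning. The weighted tail and the truncated moment share one bound because the induction of
    [returns_tail] consumes exactly their sum. *)
Lemma first_return_moment : exists2 mu : R, 0 < mu &
  forall n, wt n * (retp - F n) + \sum_(j < n) wt j.+1 * fv R j (0 : V) <= mu.
Proof.
have [C C0 hC] := wt_Pn_summable; exists C => // n.
suff: forall m, wt n * (F (n + m) - F n) + \sum_(j < n) wt j.+1 * fv R j (0 : V) <= C.
  move=> h.
  have cv : (fun m => wt n * (F (n + m)%N - F n) + \sum_(j < n) wt j.+1 * fv R j (0 : V)) @ \oo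
      --> wt n * (retp - F n) + \sum_(j < n) wt j.+1 * fv R j (0 : V).
    apply: cvgD; last exact: cvg_cst.
    apply: cvgM; first exact: cvg_cst.
    apply: cvgB; last exact: cvg_cst.
    under eq_fun do rewrite addnC.
    by have := F_cvg; rewrite -(cvg_shiftn n).
  rewrite -(cvg_lim _ cv)//; apply: limr_le; last by near=> m; exact: h.
  by apply/cvg_ex; eexists; exact: cv.
move=> m; rewrite /F big_split_ord/= addrAC subrr add0r mulr_sumr.
apply: (@le_trans _ _ (\sum_(j < n + m) wt j.+1 * fv R j (0 : V))).
  rewrite [leRHS]big_split_ord/= [leLHS]addrC lerD2l; apply: ler_sum => j _.
  by rewrite ler_wpM2r ?fv_ge0// wt_le// -addnS leq_addr.
apply: (le_trans _ (hC (n + m).+1)); rewrite big_ord_recl/= -[leLHS]add0r lerD//.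
  by rewrite mulr_ge0 ?wt_ge0.
by apply: ler_sum => j _; rewrite ler_wpM2l ?wt_ge0 ?fv_le_Pn.
Unshelve. all: by end_near. Qed.

Lemma returns_ge0 k n x : 0 <= returns R k n (x : V).
Proof. by apply: avgs_ge0. Qed.

Lemma returns_le k n : returns R k n (0 : V) <= retp ^+ k.
Proof.
elim: k n => [|k ih] n; first by rewrite returns0// expr0.
rewrite returns_renewal// exprS (@le_trans _ _ (F n * retp ^+ k))//.
  by rewrite /F mulr_suml; apply: ler_sum => j _; rewrite ler_wpM2l ?fv_ge0.
by rewrite ler_wpM2r ?exprn_ge0 ?retp_ge0.
Qed.

(** Subadditivity splits the weight between the first return and the remaining ones; each of the k +
    1 returns then contributes at most [retp ^+ k * mu]. *)
Lemma returns_tail : exists2 mu : R, 0 < mu & forall k n,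
  wt n * (retp ^+ k.+1 - returns R k.+1 n (0 : V)) <= k.+1%:R * retp ^+ k * mu.
Proof.
have [mu mu0 hmu] := first_return_moment; exists mu => //.
have p0 := retp_ge0.
have gen k n : wt n * (retp ^+ k.+1 - returns R k.+1 n (0 : V)) <=
    \sum_(j < n) fv R j (0 : V) * (wt (n - j.+1) * (retp ^+ k - returns R k (n - j.+1) (0 : V)))
    + retp ^+ k * mu.
  rewrite returns_renewal//.
  have -> : retp ^+ k.+1 - \sum_(j < n) fv R j (0 : V) * returns R k (n - j.+1) (0 : V) =
    \sum_(j < n) fv R j (0 : V) * (retp ^+ k - returns R k (n - j.+1) (0 : V)) + retp ^+ k * (retp - F n).
    under [in RHS]eq_bigr do rewrite mulrBr.
    by rewrite sumrB -mulr_suml -/(F n) exprS; ring.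
  rewrite mulrDr mulr_sumr.
  apply: (@le_trans _ _ (\sum_(j < n) (fv R j (0 : V) * (wt (n - j.+1) *
      (retp ^+ k - returns R k (n - j.+1) (0 : V))) + retp ^+ k * (wt j.+1 * fv R j (0 : V))) +
      retp ^+ k * (wt n * (retp - F n)))).
    rewrite lerD//; last by rewrite mulrCA.
    apply: ler_sum => j _.
    have f0 := fv_ge0 R j (0 : V).
    have D0 : 0 <= retp ^+ k - returns R k (n - j.+1) (0 : V) by rewrite subr_ge0 returns_le.
    have Dp : retp ^+ k - returns R k (n - j.+1) (0 : V) <= retp ^+ k by rewrite gerBl returns_ge0.
    have wn : wt n <= wt (n - j.+1) + wt j.+1 by rewrite -{1}(subnK (ltn_ord j)) wtD.
    move: (wt (n - j.+1)) (wt j.+1) (wt n) (wt_ge0 (n - j.+1)) (wt_ge0 j.+1) wn f0 D0 Dp.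
    move: (fv _ _ _) (retp ^+ k) (returns _ _ _ _) => f q a w1 w2 w w10 w20 wn f0 D0 Dp.
    rewrite (@le_trans _ _ ((w1 + w2) * (f * (q - a))))//.
      by rewrite ler_wpM2r// mulr_ge0.
    rewrite mulrDl lerD//; first by rewrite mulrCA.
    by rewrite mulrA [q * _]mulrC ler_wpM2l// mulr_ge0.
  rewrite big_split/= -addrA lerD2l -mulr_sumr -mulrDr ler_wpM2l ?exprn_ge0//.
  by rewrite addrC; exact: hmu.
elim=> [|k ih] n.
  apply: (le_trans (gen 0 n)); rewrite expr0 !mul1r big1 ?add0r// => j _.
  by rewrite returns0// subrr !mulr0.
apply: (le_trans (gen k.+1 n)).
rewrite -[k.+2%:R]natr1 mulrDl mul1r mulrDl lerD2r.
apply: (@le_trans _ _ (F n * (k.+1%:R * retp ^+ k * mu))).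
  by rewrite /F mulr_suml; apply: ler_sum => j _; rewrite ler_wpM2l ?fv_ge0.
rewrite (@le_trans _ _ (retp * (k.+1%:R * retp ^+ k * mu)))//.
  by rewrite ler_wpM2r// !mulr_ge0 ?exprn_ge0// ltW.
by rewrite exprS le_eqVlt; apply/orP; left; apply/eqP; ring.
Qed.

End green_function.

(** * Visits to two points *)

Section two_points.
Variables (R : realType) (d : nat).
Hypothesis d_ge3 : (3 <= d)%N.
Let d_gt0 : (0 < d)%N. Proof. exact: ltn_trans d_ge3. Qed.
Local Notation V := 'rV[int]_d.
Local Notation g := (green R d).
Local Notation Gn := (Gn R).

(** The sign (-1)^(sum of the coordinates), written as the eigenfunction of eigenvalue -1. *)
Definition par (x : V) : R := Phi (fun=> pi) x.

Lemma par_step (x : V) e : par (x + stepv e) = - par x.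
Proof.
case: e => i b; rewrite /par /Phi (bigD1 i)//= [in RHS](bigD1 i)//= -mulNr; congr (_ * _).
  rewrite /stepv/= !mxE !eqxx mulr1 rmorphD/= rmorphXn/= rmorphN rmorph1 mulrDr.
  case: b; rewrite ?expr1 ?expr0 ?mulrN ?mulr1 ?cosDpi//.
  by rewrite -[in RHS](subrK pi (pi * _)) cosDpi opprK.
apply: eq_bigr => j ji.
by rewrite /stepv/= !mxE eqxx (negbTE ji) mulr0 addr0.
Qed.

Lemma Pn_par n (x : V) : Pn R n x * (par x - (-1) ^+ n) = 0.
Proof.
elim: n x => [|n ih] x.
  rewrite /= expr0; case: eqVneq => [->|_]; last by rewrite mul0r.
  by rewrite /par /Phi big1 ?subrr ?mulr0// => i _; rewrite mxE mulr0 cos0.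
rewrite /= -avgZr /avg big1 ?mulr0// => e _.
have -> : par x = - par (x + stepv e) by rewrite par_step opprK.
have := ih (x + stepv e); move: (par _) (Pn _ _ _) => u v h.
by transitivity (- (v * (u - (-1) ^+ n))); [rewrite exprS; ring|rewrite h oppr0].
Qed.

Lemma Pn_parity n (x : V) : Pn R (2 * n)%N x = 0 \/ Pn R (2 * n).+1 x = 0.
Proof.
have /eqP := Pn_par (2 * n)%N x; rewrite mulf_eq0 => /orP[/eqP|]; first by left.
rewrite subr_eq0 exprM sqrrN expr1n expr1n => /eqP px; right.
have /eqP := Pn_par (2 * n).+1 x; rewrite mulf_eq0 px => /orP[/eqP//|].
by rewrite exprS exprM sqrrN !expr1n mulr1 opprK => /eqP h; exfalso; lra.
Qed.

Lemma stepv_inj : injective (@stepv d).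
Proof.
move=> [i b] [j c] /= /rowP h; have := h i; rewrite /stepv !mxE !eqxx/=.
have [<-|ij] := eqVneq i j; first by case: b c {h} => [] [].
by rewrite mulr0 mulr1; case: b {h}.
Qed.

Lemma Pn1_le (x : V) : Pn R 1 x <= 2^-1.
Proof.
rewrite /= /avg.
apply: (@le_trans _ _ ((2 * d)%:R^-1 * 1)).
  rewrite ler_wpM2l ?invr_ge0//.
  have [[e0 /eqP e0x]|h] := pselect (exists e, x + stepv e == 0); last first.
    by rewrite big1// => e _; case: eqP => // he; exfalso; apply: h; exists e; apply/eqP.
  rewrite (bigD1 e0)//= e0x eqxx big1 ?addr0// => e ee0.
  case: eqP => // ex; exfalso; move/eqP: ee0; apply; apply: stepv_inj.
  by apply: (addrI x); rewrite ex e0x.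
rewrite mulr1 lef_pV2 ?posrE ?ltr0n ?muln_gt0// ler_nat.
by rewrite leq_pmulr.
Qed.

(** Parity leaves one of the two terms, and the odd one is an average of even-time probabilities. *)
Lemma Pn_pair n (x : V) : Pn R (2 * n)%N x + Pn R (2 * n).+1 x <= Pn R (2 * n)%N (0 : V).
Proof.
have [->|->] := Pn_parity n x; last by rewrite addr0; exact: Pn_sym0.
rewrite add0r -[leRHS](avg_cst d_gt0) /=; apply: avg_le => e; exact: Pn_sym0.
Qed.

(** Times are grouped as 2k and 2k + 1. Away from the origin the first pair contributes at most 1/2
    instead of 1, and the later ones no more than the return probabilities: a gap of 1/2 below the
    Green function, uniform in x. *)
Lemma Gn_off0 n (x : V) : x != 0 -> Gn n x <= g - 2^-1.
Proof.
move=> x0.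
apply: (@le_trans _ _ (Gn (2 * n.+1) x)); first by apply: Gn_nd; lia.
have pair m (y : V) : Gn (2 * m) y = \sum_(k < m) (Pn R (2 * k)%N y + Pn R (2 * k).+1 y) :> R.
  elim: m => [|m ih]; first by rewrite /Gn muln0 !big_ord0.
  by rewrite big_ord_recr/= -ih mulnS /Gn !big_ord_recr/= addrA.
rewrite pair big_ord_recl.
rewrite [X in X + _ + _](_ : _ = 0); last by rewrite /= (negbTE x0).
rewrite add0r.
apply: (@le_trans _ _ (2^-1 + \sum_(k < n) Pn R (2 * k.+1)%N (0 : V))).
  apply: lerD; first exact: Pn1_le.
  by apply: ler_sum => k _; exact: (Pn_pair k.+1 x).
have : 1 + \sum_(k < n) Pn R (2 * k.+1)%N (0 : V) <= g.
  apply: le_trans (Gn_le_green R d_ge3 (2 * n.+1)).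
  rewrite pair big_ord_recl; apply: lerD.
    by rewrite [X in X + _](_ : _ = 1) ?lerDl ?Pn_ge0//= eqxx.
  apply: ler_sum => k _; rewrite -[leLHS]addr0.
  exact: lerD (lexx _) (Pn_ge0 R (2 * k.+1).+1 0).
lra.
Qed.

(** With W = 1 + 4 (H(x) + H(x - y)), a visit to one of the two points lowers the average of W by 4,
    while W is at most 1 + 4 ((g - 1) + (g - 1/2)) = 4 (2g - 5/4) there. The quotient is the gain
    per visit. Any weight above 2 instead of 4 would serve in [two_base_exponent]. *)
Definition two_base : R := 1 + (2 * g - 5 / 4)^-1.

Lemma two_base_gt1 : 1 < two_base.
Proof. by have := green_ge1 R d_ge3; rewrite ltrDl invr_gt0; lra. Qed.

(** At a = 1 the level is 2 g log N, and a pair of crossings has probability at most N^(-4g(1 -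
    1/two_base)) up to powers of log N, which must be o(N^(-2)). *)
Lemma two_base_exponent : 2 < 4 * g * (1 - two_base^-1).
Proof.
have := green_ge1 R d_ge3; rewrite /two_base => g1.
have -> : 4 * g * (1 - (1 + (2 * g - 5 / 4)^-1)^-1) = 4 * g / (2 * g - 1 / 4).
  by field; lra.
by rewrite ltr_pdivlMr; lra.
Qed.

(* The function W below is superharmonic off {0, y}, and multiplying it by two_base at
   the two points of {0, y} is compensated by the jump of its average there. *)
Lemma two_points_moment : exists2 C : R, 0 < C & forall n (y : V), y != 0 ->
  avgs n (fun s => two_base ^+ (visits 0 s + visits (- y) s)) <= C.
Proof.
have g1 := green_ge1 R d_ge3.
set b := two_base; pose q : R := (2 * g - 5 / 4)^-1.
have bq : b = 1 + q by [].
have q0 : 0 < q by rewrite invr_gt0; lra.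
exists (1 + 4 * (2 * g)); first by lra.
move=> n y y0; pose H n (x : V) : R := Gn n.+1 x - (x == 0)%:R.
have HS m (x : V) : H m.+1 x = avg (fun e => (x + e == 0)%:R + H m (x + e)).
  rewrite /H /Gn big_ord_recl/= addrAC subrr add0r -avg_sum.
  apply: eq_avg => e; rewrite [RHS]addrC subrK.
  by apply: eq_bigr => k _.
have Hle m (x : V) : H m x <= Gn m.+1 x by rewrite /H gerBl.
have H0 m : H m 0 <= g - 1 by rewrite /H eqxx lerD2r Gn_le_green.
have Hy m (x : V) : x != 0 -> H m x <= g - 2^-1.
  by move=> x0; rewrite (le_trans (Hle _ _))// Gn_off0.
pose W m (x : V) := 1 + 4 * (H m x + H m (x - y)).
suff main : forall m (x : V), avgs m (fun s => b ^+ (visits x s + visits (x - y) s)) <= W m x.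
  have := main n 0; rewrite sub0r => h; apply: (le_trans h); rewrite /W.
  have := H0 n; have := Hy n (0 - y); rewrite sub0r oppr_eq0 => /(_ y0); lra.
have Wb m (z : V) : b ^+ ((z == 0%R) + (z - y == 0)%R) * W m z <=
    1 + 4 * (((z == 0)%:R + H m z) + ((z - y == 0)%:R + H m (z - y))).
  rewrite /W; have [z0|z0] := eqVneq z 0.
    have -> : (z - y == 0) = false by rewrite z0 sub0r oppr_eq0 (negbTE y0).
    rewrite addn0 expr1; have := Hy m (z - y); rewrite z0 sub0r oppr_eq0 => /(_ y0).
    have := H0 m; move: (H m 0) (H m (- y)) => u v u1 v1.
    suff : q * (1 + 4 * (u + v)) <= 4 by rewrite bq /=; lra.
    rewrite (@le_trans _ _ (q * (1 + 4 * (2 * g - 3 / 2))))//; last first.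
      by rewrite le_eqVlt; apply/orP; left; apply/eqP; rewrite /q; field; lra.
    by rewrite ler_wpM2l ?(ltW q0)//; lra.
  have [zy|zy] := eqVneq (z - y) 0; last by rewrite add0n expr0 mul1r /= !add0r.
  rewrite add0n expr1; have := Hy m z z0; rewrite zy; have := H0 m.
  move: (H m 0) (H m z) => u v u1 v1.
  suff : q * (1 + 4 * (u + v)) <= 4 by rewrite bq /=; lra.
  rewrite (@le_trans _ _ (q * (1 + 4 * (2 * g - 3 / 2))))//; last first.
    by rewrite le_eqVlt; apply/orP; left; apply/eqP; rewrite /q; field; lra.
  by rewrite ler_wpM2l ?(ltW q0)//; lra.
have b0 : 0 <= b by rewrite bq addr_ge0// ltW.
elim=> [|m ih] x.
  have H00 z : H 0 z = 0 by rewrite /H /Gn big_ord_recl big_ord0 addr0 subrr.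
  by rewrite /= /W !H00 !addr0 mulr0 addr0 expr0.
have -> : W m.+1 x = avg (fun e => 1 + 4 * (((x + e == 0)%:R + H m (x + e)) +
    ((x + e - y == 0)%:R + H m (x + e - y)))).
  rewrite avgD avg_cst// avgZ avgD /W !HS; congr (_ + _ * (_ + _)).
  by apply: eq_avg => e; rewrite [x - y + e]addrAC.
apply: avg_le => e; apply: le_trans (Wb _ _).
apply: (@le_trans _ _ (b ^+ ((x + e == 0%R) + (x + e - y == 0)%R) *
   avgs m (fun s => b ^+ (visits (x + e) s + visits (x + e - y) s)))).
  rewrite -avgsZ le_eqVlt; apply/orP; left; apply/eqP; apply: eq_avgs => s.
  by rewrite -exprD /= [x - y + e]addrAC addnACA.
by rewrite ler_wpM2l ?exprn_ge0.
Qed.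

End two_points.

(** * Poisson weights and crossing probabilities *)

Section poisson_weights.
Variable R : realType.

(** Also the probability that k unit exponential clocks add up to at most u and one more passes u,
    which is how it enters (see [crossing_law]). *)
Definition pois (u : R) (k : nat) : R := expR (- u) * (u ^+ k / k`!%:R).

Lemma exp_partial_le (x : R) N : 0 <= x -> \sum_(k < N) x ^+ k / k`!%:R <= expR x.
Proof.
move=> x0; rewrite -(big_mkord predT (fun k => x ^+ k / k`!%:R)).
apply: (@nondecreasing_cvgn_le _ (series (exp_coeff x))).
  apply/nondecreasing_seqP => n; rewrite !seriesEord/= big_ord_recr/= lerDl.
  by rewrite /exp_coeff/= divr_ge0// exprn_ge0.
exact: is_cvg_series_exp_coeff.
Qed.

Lemma pois_ge0 u k : 0 <= u -> 0 <= pois u k.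
Proof. by move=> u0; rewrite /pois mulr_ge0 ?expR_ge0// divr_ge0// exprn_ge0. Qed.

Lemma pois_pgf_le (u p : R) N : 0 <= u -> 0 <= p ->
  \sum_(k < N) pois u k * p ^+ k <= expR (- (u * (1 - p))).
Proof.
move=> u0 p0; rewrite (_ : - _ = - u + u * p); last by ring.
rewrite expRD; apply: le_trans (ler_wpM2l (expR_ge0 _) (exp_partial_le N (mulr_ge0 u0 p0))).
rewrite mulr_sumr le_eqVlt; apply/orP; left; apply/eqP; apply: eq_bigr => k _.
by rewrite /pois exprMn; ring.
Qed.

Lemma poisS u k : k.+1%:R * pois u k.+1 = u * pois u k.
Proof.
rewrite /pois factS natrM exprS; field.
by rewrite nat1r !pnatr_eq0 -lt0n fact_gt0.
Qed.

(** Chernoff's bound on the lower tail, through the generating function at 1/b. *)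
Lemma pois_cdf_le (v b : R) K : 0 <= v -> 1 <= b ->
  \sum_(i < K) pois v i <= b ^+ K * expR (- (v * (1 - b^-1))).
Proof.
move=> v0 b1; have b0 : 0 < b := lt_le_trans ltr01 b1.
apply: (@le_trans _ _ (b ^+ K * \sum_(i < K) pois v i * b^-1 ^+ i)); last first.
  by rewrite ler_wpM2l ?exprn_ge0 ?(ltW b0)// pois_pgf_le// invr_ge0 ltW.
rewrite mulr_sumr; apply: ler_sum => i _.
rewrite mulrCA ler_peMr ?pois_ge0// exprVn ler_pdivlMr ?exprn_gt0// mul1r.
by rewrite ler_weXn2l// ltnW.
Qed.

End poisson_weights.

Section crossing_estimates.
Variables (R : realType) (d : nat).
Hypothesis d_ge3 : (3 <= d)%N.
Let d_gt0 : (0 < d)%N. Proof. exact: ltn_trans d_ge3. Qed.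
Local Notation V := 'rV[int]_d.
Local Notation p := (retp R d).
Local Notation ret := (fun k n => returns R k n (0 : V)).

Let D k n := p ^+ k - ret k n.

Let D_ge0 k n : 0 <= D k n. Proof. by rewrite subr_ge0 returns_le. Qed.

(** Averaging [returns_tail] over Poisson weights: the factor k costs a factor u by [poisS], while
    the powers of p keep the whole decay exp(-u(1 - p)). The error is thus small relative to the
    crossing probability itself. *)
Lemma returns_deficit : exists2 mu : R, 0 < mu & forall (u : R) n N, 0 <= u -> (0 < n)%N ->
  \sum_(k < N) pois u k * (D k n + D k.+1 n) <=
    mu * (1 + u) * expR (- (u * (1 - p))) / wt R n.
Proof.
have [mu mu0 tail] := returns_tail R d_ge3.
have p0 := retp_ge0 R d_ge3; have p1 := ltW (retp_lt1 R d_ge3).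
exists (2 * mu); first by rewrite mulr_gt0.
move=> u n N u0 n0; have w0 : 0 < wt R n := lt_le_trans ltr01 (wt_ge1 R n0).
have tail' k : D k.+1 n <= k.+1%:R * p ^+ k * mu / wt R n.
  by rewrite ler_pdivlMr// mulrC; exact: tail.
have S0 M : \sum_(k < M) pois u k * p ^+ k <= expR (- (u * (1 - p))) by exact: pois_pgf_le.
set e := expR _ in S0 *.
have S1 M : \sum_(k < M) pois u k * (k%:R * p ^+ k.-1) <= u * e.
  case: M => [|M]; first by rewrite big_ord0 mulr_ge0// expR_ge0.
  rewrite big_ord_recl/= mul0r mulr0 add0r.
  apply: (le_trans _ (ler_wpM2l u0 (S0 M))); rewrite mulr_sumr.
  rewrite le_eqVlt; apply/orP; left; apply/eqP; apply: eq_bigr => k _.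
  rewrite -[LHS]/(pois u k.+1 * (k.+1%:R * p ^+ k)).
  by rewrite mulrA [X in X * _]mulrC poisS -mulrA.
under eq_bigr do rewrite mulrDr.
rewrite big_split/=.
have h1 : \sum_(k < N) pois u k * D k n <= mu * (u * e) / wt R n.
  apply: (@le_trans _ _ (mu / wt R n * \sum_(k < N) pois u k * (k%:R * p ^+ k.-1))).
    rewrite mulr_sumr; apply: ler_sum => -[[|k] kN] _ /=.
      by rewrite /D returns0// expr0 subrr !mulr0 mul0r !mulr0.
    rewrite mulrCA ler_wpM2l ?pois_ge0// (le_trans (tail' k))//.
    by rewrite le_eqVlt; apply/orP; left; apply/eqP; field; rewrite gt_eqF.
  rewrite mulrAC ler_pM2r ?invr_gt0// ler_pM2l//; exact: S1.
have h2 : \sum_(k < N) pois u k * D k.+1 n <= mu * ((1 + u) * e) / wt R n.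
  apply: (@le_trans _ _ (mu / wt R n * \sum_(k < N) (pois u k * p ^+ k +
     p * (pois u k * (k%:R * p ^+ k.-1))))).
    rewrite mulr_sumr; apply: ler_sum => k _.
    apply: (le_trans (ler_wpM2l (pois_ge0 k u0) (tail' k))).
    have -> : pois u k * p ^+ k + p * (pois u k * (k%:R * p ^+ k.-1)) =
        pois u k * (k.+1%:R * p ^+ k).
      case: (nat_of_ord k) => [|m] /=; first by rewrite mul0r !mulr0 addr0 mul1r.
      by rewrite exprS -[m.+2%:R]natr1; ring.
    by rewrite le_eqVlt; apply/orP; left; apply/eqP; field; rewrite gt_eqF.
  rewrite mulrAC ler_pM2r ?invr_gt0// ler_pM2l// big_split/= mulrDl mul1r.
  apply: lerD; first exact: S0.
  rewrite -mulr_sumr (le_trans _ (S1 N))// ler_piMl//.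
  by apply: sumr_ge0 => k _; rewrite mulr_ge0 ?pois_ge0// mulr_ge0// exprn_ge0.
apply: (le_trans (lerD h1 h2)).
rewrite -mulrDl ler_pM2r ?invr_gt0//.
have e0 : 0 <= e := expR_ge0 _.
have : 0 <= mu * e by rewrite mulr_ge0// ltW.
by move=> h; rewrite -subr_ge0 [leRHS](_ : _ = mu * e)//; ring.
Qed.

Lemma visits_size x (s : seq V) : (visits x s <= size s)%N.
Proof.
by elim: s x => [//|e s ih] x /=; apply: (@leq_add _ _ 1); [case: (_ == _)|exact: ih].
Qed.

Lemma avgs_size n (F G : seq V -> R) : (forall s, size s = n -> F s = G s) ->
  avgs n F = avgs n G.
Proof.
elim: n F G => [|n ih] F G FG /=; first exact: FG.
by apply: eq_avg => e; apply: ih => s sn; apply: FG; rewrite /= sn.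
Qed.

Lemma avgs_size_le n (F G : seq V -> R) : (forall s, size s = n -> F s <= G s) ->
  avgs n F <= avgs n G.
Proof.
elim: n F G => [|n ih] F G FG /=; first exact: FG.
by apply: avg_le => e; apply: ih => s sn; apply: FG; rewrite /= sn.
Qed.

Lemma layer_cake (f : nat -> R) k N : (k < N)%N ->
  f k = \sum_(j < N) f j * ((j <= k)%N%:R - (j < k)%N%:R).
Proof.
move=> kN; rewrite (bigD1 (Ordinal kN))//= leqnn ltnn subr0 mulr1 big1 ?addr0//.
by move=> j; rewrite -val_eqE/= leq_eqVlt => /negbTE ->; rewrite subrr mulr0.
Qed.

(** The number of visits to 0 in n steps is nearly geometric, and a geometric mixture of the Poisson
    weights is (1 - p) exp(-u(1 - p)). Sums are cut at N > n, beyond which no number of visits lies,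
    and N then tends to infinity. *)
Lemma crossing_asymp : exists2 C : R, 0 < C & forall (u : R) n, 0 <= u -> (0 < n)%N ->
  `|avgs n (fun s => pois u (visits (0 : V) s)) - (1 - p) * expR (- (u * (1 - p)))| <=
    C * (1 + u) * expR (- (u * (1 - p))) / wt R n.
Proof.
have [mu mu0 def] := returns_deficit; exists mu => // u n u0 n0.
have p0 := retp_ge0 R d_ge3.
set B := mu * _ * _ / _.
have fin N : (n < N)%N -> `|avgs n (fun s => pois u (visits (0 : V) s)) -
    (1 - p) * (\sum_(k < N) pois u k * p ^+ k)| <= B.
  move=> nN.
  have -> : avgs n (fun s => pois u (visits (0 : V) s)) =
      \sum_(k < N) pois u k * (ret k n - ret k.+1 n).
    transitivity (avgs n (fun s => \sum_(k < N) pois u k * ((k <= visits (0 : V) s)%N%:R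
        - (k < visits (0 : V) s)%N%:R))).
      apply: avgs_size => s sn; rewrite -layer_cake//.
      by rewrite (leq_ltn_trans (visits_size _ _))// sn.
    rewrite avgs_sum; apply: eq_bigr => k _; rewrite avgsZ; congr (_ * _).
    rewrite /returns -[X in _ = _ + X]mulN1r -avgsZ -avgsD; apply: eq_avgs => s.
    by rewrite mulN1r.
  rewrite mulr_sumr -sumrB (le_trans (ler_norm_sum _ _ _))//.
  apply: le_trans (def u n N u0 n0); apply: ler_sum => k _.
  have -> : pois u k * (ret k n - ret k.+1 n) - (1 - p) * (pois u k * p ^+ k) =
      pois u k * (D k.+1 n - D k n).
    by rewrite /D exprS; ring.
  rewrite normrM ger0_norm ?pois_ge0// ler_wpM2l ?pois_ge0//.
  by have := D_ge0 k n; have := D_ge0 k.+1 n; rewrite ler_norml; lra.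
have cv : (fun N => `|avgs n (fun s => pois u (visits (0 : V) s)) -
    (1 - p) * (\sum_(k < N) pois u k * p ^+ k)|) @ \oo -->
    `|avgs n (fun s => pois u (visits (0 : V) s)) - (1 - p) * expR (- (u * (1 - p)))|.
  apply: cvg_norm; apply: cvgB; first exact: cvg_cst.
  apply: cvgM; first exact: cvg_cst.
  rewrite (_ : - _ = - u + u * p); last by ring.
  rewrite expRD.
  under eq_fun => N.
    have -> : \sum_(k < N) pois u k * p ^+ k = expR (- u) * series (exp_coeff (u * p)) N.
      rewrite seriesEord mulr_sumr; apply: eq_bigr => k _.
      by rewrite /pois /exp_coeff/= exprMn; ring.
    over.
  apply: cvgM; first exact: cvg_cst.
  exact: is_cvg_series_exp_coeff.
rewrite -(cvg_lim _ cv)//; apply: limr_le; first by apply/cvg_ex; eexists; exact: cv.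
by near=> N; apply: fin; near: N; exact: nbhs_infty_gt.
Unshelve. all: by end_near. Qed.

(* [s] lists the increments of a path read backwards from its last point; cutting it at
   [n] forgets the early part of the path. *)
Lemma crossing_discrepancy : exists2 C : R, 0 < C & forall (u : R) n m, 0 <= u -> (0 < n)%N ->
  avgs (n + m) (fun s : seq V => (visits 0 (take n s) != visits 0 s)%:R *
      (pois u (visits 0 (take n s)) + pois u (visits 0 s)))
  <= C * (1 + u) * expR (- (u * (1 - p))) / wt R n.
Proof.
have [mu mu0 def] := returns_deficit; exists mu => // u n m u0 n0.
pose N := (n + m).+1.
apply: le_trans (def u n N u0 n0).
have vtake (s : seq V) x j : (visits x (take j s) <= visits x s)%N.
  elim: s x j => [|e s ih] x [|j] //=; by rewrite leq_add2l ih.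
have rt k : avgs (n + m) (fun s : seq V => (k <= visits 0 (take n s))%N%:R) = ret k n :> R.
  rewrite avgs_cat /returns; apply: avgs_size => s sn.
  rewrite -[RHS](avgs_cst d_gt0 m); apply: eq_avgs => s'.
  by rewrite take_size_cat.
have rn k : avgs (n + m) (fun s : seq V => (k <= visits 0 s)%N%:R) <= p ^+ k.
  exact: returns_le.
apply: (@le_trans _ _ (avgs (n + m) (fun s : seq V => \sum_(k < N) pois u k * (
   ((k <= visits 0 s)%N%:R - (k <= visits 0 (take n s))%N%:R) +
   ((k.+1 <= visits 0 s)%N%:R - (k.+1 <= visits 0 (take n s))%N%:R))))).
  apply: avgs_size_le => s sn.
  have v12 := vtake s 0 n; have vN : (visits 0 s < N)%N.
    by rewrite ltnS -sn visits_size.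
  have t0 (k a b : nat) : (a <= b)%N -> 0 <= (k <= b)%N%:R - (k <= a)%N%:R :> R.
    by move=> ab; rewrite subr_ge0 ler_nat; have [ka|] := leqP k a; rewrite ?(leq_trans ka ab).
  have T0 (k : 'I_N) : 0 <= pois u k * (
     ((k <= visits 0 s)%N%:R - (k <= visits 0 (take n s))%N%:R) +
     ((k.+1 <= visits 0 s)%N%:R - (k.+1 <= visits 0 (take n s))%N%:R)).
    by rewrite mulr_ge0 ?pois_ge0// addr_ge0// t0.
  move: v12; rewrite leq_eqVlt => /orP[/eqP ->|v12].
    rewrite eqxx mul0r; apply: sumr_ge0 => k _; rewrite mulr_ge0 ?pois_ge0//.
    by rewrite addr_ge0// t0.
  rewrite (ltn_eqF v12)/= mul1r.
  have v1N := ltn_trans v12 vN.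
  (* When the counts differ, the term at the full count yields its weight through the first
     difference, and the term at the truncated count through the second. *)
  rewrite (bigD1 (Ordinal vN))//= (bigD1 (Ordinal v1N))/=; last first.
    by rewrite -val_eqE/= (ltn_eqF v12).
  rewrite addrCA lerD//.
    by rewrite leqnn (ltnW v12) ltnn v12 subrr add0r subr0 mulr1.
  rewrite leqnn leqNgt v12 ltnn subr0 [(_ < visits 0 (take n s))%N]ltnNge (ltnW v12)/=.
  rewrite subrr addr0 mulr1 -[leLHS]addr0; apply: lerD => //.
  by apply: sumr_ge0 => k _; exact: T0.
rewrite avgs_sum; apply: ler_sum => k _; rewrite avgsZ ler_wpM2l ?pois_ge0//.
rewrite avgsD; apply: lerD.
  rewrite /D -rt (le_trans _ (lerB (rn k) (lexx _)))//.
  rewrite -[X in _ <= _ - X]mul1r -mulNr -avgsZ -avgsD; apply: avgs_le => s.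
  by rewrite mulN1r.
rewrite /D -rt (le_trans _ (lerB (rn k.+1) (lexx _)))//.
rewrite -[X in _ <= _ - X]mul1r -mulNr -avgsZ -avgsD; apply: avgs_le => s.
by rewrite mulN1r.
Qed.

End crossing_estimates.

(** * Newton's iteration in odd cosine sums *)

Section odd_cosine_sums.
Variable R : realType.

(* Newton's iteration for the sign function, an odd polynomial of its argument. *)
Definition newton (c : R) (n : nat) : R := iter n (fun q => q * (3 - q ^+ 2) / 2) c.

Definition odd_cos_sum (f : R -> R) := exists (K : nat) (a : nat -> R),
  forall y, f y = \sum_(k < K) a k * cos ((2 * k + 1)%:R * y).

Lemma odd_cos_sum_ext f g : f =1 g -> odd_cos_sum f -> odd_cos_sum g.
Proof. by move=> fg [K [a h]]; exists K, a => y; rewrite -fg. Qed.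

Lemma odd_cos_sum0 : odd_cos_sum (fun=> 0).
Proof. by exists 0, (fun=> 0) => y; rewrite big_ord0. Qed.

Lemma odd_cos_sumZ r f : odd_cos_sum f -> odd_cos_sum (fun y => r * f y).
Proof.
move=> [K [a h]]; exists K, (fun k => r * a k) => y; rewrite h mulr_sumr.
by apply: eq_bigr => k _; rewrite mulrA.
Qed.

Lemma odd_cos_sumD f g : odd_cos_sum f -> odd_cos_sum g ->
  odd_cos_sum (fun y => f y + g y).
Proof.
move=> [K [a ha]] [M [b hb]].
exists (K + M)%N, (fun k => (k < K)%N%:R * a k + (k < M)%N%:R * b k) => y.
rewrite ha hb.
have pad (L Q : nat) (c : nat -> R) : (L <= Q)%N ->
    \sum_(k < L) c k * cos ((2 * k + 1)%:R * y) =
    \sum_(k < Q) (k < L)%N%:R * c k * cos ((2 * k + 1)%:R * y).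
  move=> LQ; rewrite (big_ord_widen Q (fun k => c k * cos ((2 * k + 1)%:R * y)))//.
  rewrite big_mkcond; apply: eq_bigr => k _.
  by case: ltnP; rewrite ?mul1r ?mul0r.
rewrite (pad K (K + M)%N) ?leq_addr// (pad M (K + M)%N) ?leq_addl//.
by rewrite -big_split/=; apply: eq_bigr => k _; rewrite -mulrDl.
Qed.

Lemma odd_cos_sum_sum (I : Type) (s : seq I) (F : I -> R -> R) :
  (forall i, odd_cos_sum (F i)) -> odd_cos_sum (fun y => \sum_(i <- s) F i y).
Proof.
move=> hF; elim: s => [|i s ih].
  by apply: odd_cos_sum_ext odd_cos_sum0 => y; rewrite big_nil.
apply: odd_cos_sum_ext (odd_cos_sumD (hF i) ih) => y; by rewrite big_cons.
Qed.

Lemma odd_cos_sum_cos (m : nat) : odd m -> odd_cos_sum (fun y => cos (m%:R * y)).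
Proof.
move=> om; exists (m./2.+1), (fun k => (k == m./2)%:R) => y.
rewrite (bigD1 ord_max)//= eqxx mul1r big1 ?addr0; last first.
  by move=> k; rewrite -val_eqE/= => /negbTE ->; rewrite mul0r.
by rewrite mul2n -[in LHS](odd_double_half m) om addnC.
Qed.

Lemma oddB_dist (m n : nat) : odd (m - n + (n - m)) = odd m (+) odd n.
Proof.
have [mn|/ltnW nm] := leqP m n.
  by rewrite (eqP mn) add0n oddB// addbC.
by rewrite (eqP nm) addn0 oddB.
Qed.

Lemma cosM (m n : nat) (y : R) : cos (m%:R * y) * cos (n%:R * y) =
  2^-1 * (cos ((m + n)%:R * y) + cos ((m - n + (n - m))%:R * y)).
Proof.
have -> : cos ((m - n + (n - m))%:R * y) = cos (m%:R * y - n%:R * y).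
  have [mn|/ltnW nm] := leqP m n.
    by rewrite (eqP mn) add0n natrB// mulrBl -cosN opprB.
  by rewrite (eqP nm) addn0 natrB// mulrBl.
by rewrite natrD mulrDl cosD cosB; field.
Qed.

(** Two odd frequencies combine to even ones and a third restores oddness, so the class is closed
    under odd polynomials, Newton's step among them. *)
Lemma odd_cos_sumM3 f g q : odd_cos_sum f -> odd_cos_sum g -> odd_cos_sum q ->
  odd_cos_sum (fun y => f y * g y * q y).
Proof.
move=> [K [a ha]] [L [b hb]] [M [c hc]].
apply: (@odd_cos_sum_ext (fun y => \sum_(i < K) \sum_(j < L) \sum_(k < M)
   (a i * b j * c k) * (cos ((2 * i + 1)%:R * y) * cos ((2 * j + 1)%:R * y) *
      cos ((2 * k + 1)%:R * y)))).
  move=> y; rewrite ha hb hc [X in _ = X * _]mulr_suml [RHS]mulr_suml; apply: eq_bigr => i _.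
  rewrite [X in _ = X * _]mulr_sumr [RHS]mulr_suml; apply: eq_bigr => j _.
  by rewrite [RHS]mulr_sumr; apply: eq_bigr => k _; ring.
apply: odd_cos_sum_sum => i; apply: odd_cos_sum_sum => j; apply: odd_cos_sum_sum => k.
apply: odd_cos_sumZ.
have od r : odd (2 * r + 1) by rewrite oddD oddM.
move: (2 * i + 1)%N (2 * j + 1)%N (2 * k + 1)%N (od i) (od j) (od k) => m n l om on ol.
apply: (@odd_cos_sum_ext (fun y => 2^-1 * (
    2^-1 * (cos ((m + n + l)%:R * y) + cos (((m + n - l) + (l - (m + n)))%:R * y)) +
    2^-1 * (cos ((m - n + (n - m) + l)%:R * y) +
      cos (((m - n + (n - m) - l) + (l - (m - n + (n - m))))%:R * y))))).
  by move=> y; rewrite -(cosM (m + n) l) -(cosM (m - n + (n - m)) l) -mulrDl mulrA -cosM.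
have e0 : odd (m + n) = false by rewrite oddD om on.
have e1 : odd (m - n + (n - m)) = false by rewrite oddB_dist om on.
apply: odd_cos_sumZ; apply: odd_cos_sumD; apply: odd_cos_sumZ; apply: odd_cos_sumD.
- by apply: odd_cos_sum_cos; rewrite oddD e0 ol.
- by apply: odd_cos_sum_cos; rewrite oddB_dist e0 ol.
- by apply: odd_cos_sum_cos; rewrite oddD e1 ol.
- by apply: odd_cos_sum_cos; rewrite oddB_dist e1 ol.
Qed.

Lemma odd_cos_sum_newton n : odd_cos_sum (fun y => newton (cos y) n).
Proof.
elim: n => [|n ih].
  apply: odd_cos_sum_ext (odd_cos_sum_cos (m := 1) isT) => y; by rewrite mul1r.
apply: (@odd_cos_sum_ext (fun y => 3 / 2 * newton (cos y) n +
    (- 2^-1) * (newton (cos y) n * newton (cos y) n * newton (cos y) n))).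
  by move=> y; rewrite /newton iterS; set q := iter _ _ _; field.
by apply: odd_cos_sumD; apply: odd_cos_sumZ => //; exact: odd_cos_sumM3.
Qed.

Lemma newton_range (c : R) n : 0 <= c <= 1 -> c <= newton c n <= 1.
Proof.
move=> /andP[c0 c1]; elim: n => [|n /andP[ih0 ih1]]; first by rewrite lexx c1.
rewrite /newton iterS -/(newton c n); move: (newton c n) ih0 ih1 => q ih0 ih1.
have q0 : 0 <= q := le_trans c0 ih0.
have h1 : q * (3 - q ^+ 2) / 2 = q + q * (1 - q ^+ 2) / 2 by field.
have h2 : q * (3 - q ^+ 2) / 2 = 1 - (1 - q) ^+ 2 * (2 + q) / 2 by field.
have q2 : q ^+ 2 <= 1 by rewrite expr_le1.
apply/andP; split.
  by rewrite h1 (le_trans ih0)// lerDl divr_ge0// mulr_ge0// subr_ge0.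
by rewrite h2 gerBl divr_ge0// mulr_ge0 ?sqr_ge0// addr_ge0.
Qed.

Lemma newton_cvg_rate (c : R) n : 0 <= c <= 1 -> 1 - newton c n <= (1 - c / 2) ^+ n.
Proof.
move=> c01; have /andP[c0 c1] := c01.
elim: n => [|n ih]; first by rewrite expr0 gerBl.
have /andP[] := newton_range n c01.
rewrite /newton iterS -/(newton c n); move: (newton c n) ih => q ih q0 q1.
have -> : 1 - q * (3 - q ^+ 2) / 2 = (1 - (q + q ^+ 2) / 2) * (1 - q) by field.
have q2 : q ^+ 2 <= 1 by rewrite expr_le1// (le_trans c0).
have q3 : 0 <= q ^+ 2 by exact: sqr_ge0.
by rewrite [leRHS]exprS; apply: ler_pM => //; lra.
Qed.

End odd_cosine_sums.

(** * Arrays of killed paths *)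

Section double_limits.
Variable R : realType.

(* lim_N lim_n u N n = v, the inner limits being needed only up to an error that
   vanishes with N. *)
Definition lim2 (u : nat -> nat -> R) (v : R) := forall e : R, 0 < e ->
  \forall N \near \oo, \forall n \near \oo, `|u N n - v| <= e.

Lemma lim2_cst v : lim2 (fun _ _ => v) v.
Proof. by move=> e e0; near=> N; near=> n; rewrite subrr normr0 ltW. Unshelve. all: by end_near. Qed.

Lemma lim2D u v a b : lim2 u a -> lim2 v b -> lim2 (fun N n => u N n + v N n) (a + b).
Proof.
move=> ua vb e e0; have e2 : 0 < e / 2 by rewrite divr_gt0.
near=> N.
have hu : \forall n \near \oo, `|u N n - a| <= e / 2 by near: N; exact: ua.
have hv : \forall n \near \oo, `|v N n - b| <= e / 2 by near: N; exact: vb.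
near=> n.
have h1 : `|u N n - a| <= e / 2 by near: n; exact: hu.
have h2 : `|v N n - b| <= e / 2 by near: n; exact: hv.
rewrite opprD addrACA (le_trans (ler_normD _ _))//; lra.
Unshelve. all: by end_near. Qed.

Lemma lim2Z r u a : lim2 u a -> lim2 (fun N n => r * u N n) (r * a).
Proof.
move=> ua e e0.
have e2 : 0 < e / (`|r| + 1) by rewrite divr_gt0// ltr_wpDl.
near=> N.
have hu : \forall n \near \oo, `|u N n - a| <= e / (`|r| + 1) by near: N; exact: ua.
near=> n.
have h1 : `|u N n - a| <= e / (`|r| + 1) by near: n; exact: hu.
rewrite -mulrBr normrM (@le_trans _ _ (`|r| * (e / (`|r| + 1))))//.
  by rewrite ler_wpM2l.
by rewrite mulrCA ler_piMr ?(ltW e0)// ler_pdivrMr ?mul1r ?lerDl// ltr_wpDl.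
Unshelve. all: by end_near. Qed.

Lemma lim2_sum (I : Type) (s : seq I) (u : I -> nat -> nat -> R) (a : I -> R) :
  (forall i, lim2 (u i) (a i)) ->
  lim2 (fun N n => \sum_(i <- s) u i N n) (\sum_(i <- s) a i).
Proof.
move=> h; elim: s => [|i s ih].
  rewrite big_nil; have -> : (fun N n => \sum_(i <- [::]) u i N n) = (fun _ _ => 0).
    by apply/funext => N; apply/funext => n; rewrite big_nil.
  exact: lim2_cst.
rewrite big_cons; have -> : (fun N n => \sum_(i <- i :: s) u i N n) =
    (fun N n => u i N n + \sum_(i <- s) u i N n).
  by apply/funext => N; apply/funext => n; rewrite big_cons.
exact: lim2D.
Qed.

Lemma lim2_le u v a b : lim2 u a -> lim2 v b ->
  (\forall N \near \oo, forall n, u N n <= v N n) -> a <= b.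
Proof.
move=> ua vb uv; rewrite leNgt; apply/negP => ba.
have e0 : 0 < (a - b) / 4 by rewrite divr_gt0// subr_gt0.
have [N [h [h' h'']]] : exists N, (\forall n \near \oo, `|u N n - a| <= (a - b) / 4) /\
    (\forall n \near \oo, `|v N n - b| <= (a - b) / 4) /\ forall n, u N n <= v N n.
  apply: (@filter_ex _ \oo); near=> N; split; first by near: N; exact: ua.
  by split; near: N; [exact: vb|exact: uv].
have [n [h1 h2]] : exists n, `|u N n - a| <= (a - b) / 4 /\ `|v N n - b| <= (a - b) / 4.
  apply: (@filter_ex _ \oo); near=> n; split; first by near: n; exact: h.
  by near: n; exact: h'.
have := h'' n; move: h1 h2; rewrite !ler_norml => /andP[h1 _] /andP[_ h2] h3; lra.
Unshelve. all: by end_near. Qed.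

End double_limits.

Section heat_array.
Variable R : realType.

Definition cube {d : nat} (r : R) (x : 'I_d -> R) : bool := [forall i, `|x i| <= r].

Definition PhiR {d : nat} (th x : 'I_d -> R) : R := \prod_i cos (th i * x i).

(* rate of exponential decay of E[PhiR th (B_t)] for a Brownian motion B with covariance
   matrix (t / d) Id *)
Definition kap {d : nat} (th : 'I_d -> R) : R := (2 * d%:R)^-1 * \sum_i th i ^+ 2.

Definition stay {d0} {T : measurableType d0} {d : nat} (s : nat -> T -> 'I_d -> R)
  (r : R) (j : nat) (w : T) : R := \prod_(l < j.+1) (cube r (s l w))%:R.

(* [s N] is a random path which is killed at rate [c] per unit of time ([Z N j] being the
   survival probability up to step [j]), in which a step takes time [h N], and which
   behaves like a Brownian motion with covariance matrix (t / d) Id as N tends to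
   infinity. *)
Record heat_array {d0} {T : measurableType d0} (P : probability T R) {d : nat}
    (s : nat -> nat -> T -> 'I_d -> R) (Z : nat -> nat -> T -> R) (h : nat -> R) (c : R) : Prop := {
  ha_ms : forall N j i, measurable_fun setT (fun w => s N j w i);
  ha_s0 : forall N w i, s N 0 w i = 0;
  ha_mZ : forall N j, measurable_fun setT (Z N j);
  ha_Z01 : forall N j w, 0 <= Z N j w <= 1;
  ha_Z0 : forall N w, Z N 0 w = 1;
  ha_Zni : forall N j w, Z N j.+1 w <= Z N j w;
  ha_h : \forall N \near \oo, 0 < h N;
  ha_step : forall (th : 'I_d -> R) (r e : R), 0 < r -> 0 < e -> \forall N \near \oo, forall j,
    `|Ex P (fun w => PhiR th (s N j.+1 w) * (Z N j.+1 w * stay (s N) r j w)) -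
      (1 - (kap th + c) * h N) * Ex P (fun w => PhiR th (s N j w) * (Z N j w * stay (s N) r j w))|
    <= e * h N * Ex P (fun w => Z N j w * stay (s N) r j w);
  ha_jump : forall q r e : R, 0 < q -> 0 < r -> 0 < e -> \forall N \near \oo, forall j,
    Ex P (fun w => (~~ cube q (fun i => s N j.+1 w i - s N j w i))%:R *
      (Z N j w * stay (s N) r j w))
    <= e * h N * Ex P (fun w => Z N j w * stay (s N) r j w)
}.

Lemma natr_forall (d : nat) (b : 'I_d -> bool) :
  [forall i, b i]%:R = \prod_i (b i)%:R :> R.
Proof.
have [/forallP h|] := boolP [forall i, b i].
  by rewrite big1// => i _; rewrite h.
rewrite negb_forall => /existsP[i bi].
by rewrite (bigD1 i)//= (negbTE bi) mul0r.
Qed.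

Lemma bmeas_norm_le d0 (T : measurableType d0) (X : T -> R) (r : R) : measurable_fun setT X ->
  @bmeas _ T R (fun w => (`|X w| <= r)%R%:R).
Proof.
move=> mX; pose A := X @^-1` [set x | `|x| <= r].
have mA : measurable A.
  rewrite /A -[X @^-1` _]setTI; apply: mX => //.
  have -> : [set x : R | `|x| <= r] = `[- r, r]%classic.
    by apply/seteqP; split => x /=; rewrite in_itv/= ler_norml.
  exact: measurable_itv.
rewrite (_ : (fun _ => _) = \1_A); first exact: bmeas_indic.
by apply/funext => w; rewrite indicE mem_setE.
Qed.

Lemma bmeas_cube d0 (T : measurableType d0) (d : nat) (X : T -> 'I_d -> R) r :
  (forall i, measurable_fun setT (fun w => X w i)) -> @bmeas _ T R (fun w => (cube r (X w))%:R).
Proof.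
move=> mX; rewrite /cube; under eq_fun do rewrite natr_forall.
by apply: bmeas_prod => i _; exact: bmeas_norm_le.
Qed.

Lemma bmeas_cos d0 (T : measurableType d0) (X : T -> R) a : measurable_fun setT X ->
  bmeas (fun w => cos (a * X w)).
Proof.
move=> mX; split; last by exists 1 => w; exact: cos_max.
apply: (@measurable_comp _ _ _ _ _ _ setT) => //.
  by apply: continuous_measurable_fun; exact: continuous_cos.
exact: measurable_funM.
Qed.

Lemma bmeas_PhiR d0 (T : measurableType d0) (d : nat) (X : T -> 'I_d -> R) th :
  (forall i, measurable_fun setT (fun w => X w i)) -> bmeas (fun w => PhiR th (X w)).
Proof. by move=> mX; apply: bmeas_prod => i _; exact: bmeas_cos. Qed.

Lemma PhiR_norm (d : nat) (th x : 'I_d -> R) : `|PhiR th x| <= 1.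
Proof.
rewrite /PhiR normr_prod; apply: prodr_ile1 => i _.
by rewrite normr_ge0 cos_max.
Qed.

Lemma kap_ge0 (d : nat) (th : 'I_d -> R) : 0 <= kap th.
Proof. by rewrite /kap mulr_ge0 ?invr_ge0 ?mulr_ge0// sumr_ge0// => i _; exact: sqr_ge0. Qed.

Lemma cos_lipschitz (x y : R) : `|cos x - cos y| <= `|x - y|.
Proof.
wlog xy : x y / y <= x => [hw|].
  have [/hw//|/ltW yx] := leP y x; rewrite distrC (distrC x); exact: hw.
have [z _ ->] := @MVT_segment R cos (fun z => - sin z) y x xy
  (fun z _ => is_derive_cos z) (continuous_subspaceT (@continuous_cos R)).
by rewrite normrM normrN ler_piMl// sin_max.
Qed.

Section one_array.
Context d0 (T : measurableType d0) (P : probability T R) (d : nat).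
Hypothesis d_gt0 : (0 < d)%N.
Variables (s : nat -> nat -> T -> 'I_d -> R) (Z : nat -> nat -> T -> R) (h : nat -> R) (c : R).
Hypothesis c_ge0 : 0 <= c.
Hypothesis ha : heat_array P s Z h c.
Let E := Ex P.
Let chi r N j w := stay (s N) r j w.
Let beta r N j := E (fun w => Z N j w * chi r N j w).
Let alpha th r N j := E (fun w => PhiR th (s N j w) * (Z N j w * chi r N j w)).

Lemma bchi r N j : bmeas (chi r N j).
Proof. by apply: bmeas_prod => l _; apply: bmeas_cube => i; exact: (ha_ms ha). Qed.

Lemma bZ N j : bmeas (Z N j).
Proof.
split; first exact: (ha_mZ ha); exists 1 => w.
by have /andP[z0 z1] := ha_Z01 ha N j w; rewrite ger0_norm.
Qed.

Lemma stay01 r N j w : 0 <= chi r N j w <= 1.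
Proof.
apply/andP; split; first by apply: prodr_ge0 => l _.
by apply: prodr_ile1 => l _; rewrite ler0n lern1; case: (cube _ _).
Qed.

Lemma stayS r N j w : chi r N j.+1 w = chi r N j w * (cube r (s N j.+1 w))%:R.
Proof. by rewrite /chi /stay big_ord_recr. Qed.

Lemma stay_cube r N j w : chi r N j w = chi r N j w * (cube r (s N j w))%:R.
Proof.
rewrite /chi /stay big_ord_recr/= -mulrA -natrM.
by case: (cube _ _); rewrite ?muln1 ?muln0 ?mulr1 ?mulr0.
Qed.

Lemma stay_niS r N j w : chi r N j.+1 w <= chi r N j w.
Proof.
rewrite stayS ler_piMr//; first by have /andP[] := stay01 r N j w.
by case: (cube _ _).
Qed.

Lemma stay0 r N w : 0 < r -> chi r N 0 w = 1.
Proof.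
move=> r0; rewrite /chi /stay big_ord_recl big_ord0 mulr1.
rewrite (_ : cube _ _)//; apply/forallP => i.
by rewrite (ha_s0 ha) normr0 ltW.
Qed.

Let bPhi th N j : bmeas (fun w => PhiR th (s N j w)).
Proof. by apply: bmeas_PhiR => i; exact: (ha_ms ha). Qed.

Let bZchi r N j : bmeas (fun w => Z N j w * chi r N j w).
Proof. by apply: bmeasM; [exact: bZ|exact: bchi]. Qed.

Let bA th r N j k : bmeas (fun w => PhiR th (s N j w) * (Z N j w * chi r N k w)).
Proof. by apply: bmeasM => //; apply: bmeasM; [exact: bZ|exact: bchi]. Qed.

Let Zchi01 r N j k w : 0 <= Z N j w * chi r N k w <= 1.
Proof.
have /andP[? ?] := stay01 r N k w; have /andP[? ?] := ha_Z01 ha N j w.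
by rewrite mulr_ge0//= mulr_ile1.
Qed.

Let beta_ge0 r N j : 0 <= beta r N j.
Proof. by apply: Ex_ge0 => w; have /andP[] := Zchi01 r N j j w. Qed.

(** At frequency 1/r the function [PhiR] is at least cos(1)^d on the cube, and its killed
    expectation decreases by a multiple of [h N] times the surviving mass at each step. It serves as
    a Lyapunov function, and no killing is required: c may be 0. *)
Lemma heat_array_bounded (r : R) : 0 < r -> exists2 C : R, 0 < C &
  \forall N \near \oo, forall n, h N * \sum_(j < n) beta r N j <= C.
Proof.
move=> r0; pose th : 'I_d -> R := fun=> r^-1.
have k0 : 0 < kap th.
  rewrite /kap /th sumr_const card_ord mulr_gt0 ?invr_gt0 ?mulr_gt0 ?ltr0n//.
  by rewrite pmulrn_lgt0// exprn_gt0// invr_gt0.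
pose c0 : R := cos 1 ^+ d; have c00 : 0 < c0 by rewrite exprn_gt0// cos1_gt0.
have lb x : cube r x -> c0 <= PhiR th x.
  move=> /forallP cx; rewrite /PhiR /c0 -[X in _ ^+ X](card_ord d) -prodr_const.
  apply: ler_prod => i _; rewrite (ltW (cos1_gt0 _))/= -[leRHS]cos_norm normrM gtr0_norm ?invr_gt0//.
  have : r^-1 * `|x i| <= 1 by rewrite ler_pdivrMl// mulr1.
  rewrite le_eqVlt => /orP[/eqP->//|x1].
  have ppi : (1 : R) <= pi by have := @pihalf_ge1 R; lra.
  have z0 : 0 <= r^-1 * `|x i| by rewrite mulr_ge0 ?invr_ge0 ?(ltW r0).
  by rewrite ltW// ltr_cos// in_itv/= ?ler01 ?ppi// z0/= (le_trans (ltW x1) ppi).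
pose e := kap th * c0 / 2; have e0 : 0 < e by rewrite /e divr_gt0// mulr_gt0.
exists (2 / e); first by rewrite divr_gt0.
near=> N; have hN : 0 < h N by near: N; exact: (ha_h ha).
have step : forall j, `|E (fun w => PhiR th (s N j.+1 w) * (Z N j.+1 w * chi r N j w)) -
      (1 - (kap th + c) * h N) * alpha th r N j| <= e * h N * beta r N j.
  by near: N; exact: (ha_step ha).
have ab j : c0 * beta r N j <= alpha th r N j.
  rewrite /beta /E -ExZ//; apply: Ex_le => //; first exact: bmeasZ.
  move=> w; rewrite stay_cube; case: (boolP (cube r _)) => [cu|_]; last by rewrite !mulr0.
  by rewrite mulr1 ler_wpM2r ?lb//; have /andP[] := Zchi01 r N j j w.
(* Leaving the cube may discard negative values of [PhiR]; the added mass [E (chi r N j)] loses at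
   least as much, which makes the sum of the two decrease. *)
have tele j : e * h N * beta r N j <= (alpha th r N j + E (chi r N j)) -
    (alpha th r N j.+1 + E (chi r N j.+1)).
  have hA : alpha th r N j.+1 - E (fun w => PhiR th (s N j.+1 w) * (Z N j.+1 w * chi r N j w))
      <= E (chi r N j) - E (chi r N j.+1).
    rewrite /E -ExB//; try exact: bchi; rewrite -ExB//.
    apply: Ex_le; [exact: bmeasB|by apply: bmeasB; exact: bchi|move=> w].
    have := stay_niS r N j w; rewrite -subr_ge0 => d1.
    have : `|PhiR th (s N j.+1 w) * Z N j.+1 w| <= 1.
      rewrite normrM mulr_ile1 ?PhiR_norm//.
      by have /andP[z0 z1] := ha_Z01 ha N j.+1 w; rewrite ger0_norm.
    rewrite ler_norml => /andP[m1 _].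
    rewrite [leLHS](_ : _ = - (PhiR th (s N j.+1 w) * Z N j.+1 w) * (chi r N j w - chi r N j.+1 w)).
      by rewrite ler_piMl// lerNl.
    by ring.
  have := step j; rewrite ler_norml => /andP[_ st].
  have h1 : kap th * h N * (c0 * beta r N j) <= (kap th + c) * h N * alpha th r N j.
    apply: ler_pM (ab j); first exact: mulr_ge0 (ltW k0) (ltW hN).
      by rewrite mulr_ge0// ltW.
    by rewrite ler_pM2r// lerDl.
  have e2 : kap th * h N * (c0 * beta r N j) = 2 * (e * h N * beta r N j) by rewrite /e; field.
  by move: hA st h1; rewrite e2; move: (E _) => u; lra.
move=> n.
have : e * (h N * \sum_(j < n) beta r N j) <= 2.
  rewrite mulrA mulr_sumr.
  apply: (@le_trans _ _ (\sum_(j < n) ((alpha th r N j + E (chi r N j)) -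
    (alpha th r N j.+1 + E (chi r N j.+1))))); first by apply: ler_sum => j _; exact: tele.
  rewrite -(big_mkord predT (fun j => (alpha th r N j + E (chi r N j)) -
    (alpha th r N j.+1 + E (chi r N j.+1)))).
  under eq_bigr do rewrite -opprB.
  rewrite sumrN (telescope_sumr (fun j => alpha th r N j + E (chi r N j)))// opprB.
  have a0 : alpha th r N 0 <= 1.
    rewrite -[leRHS](Ex_cst P); apply: Ex_le => //; first exact: bmeas_cst.
    move=> w; apply: ler_normlW; rewrite normrM mulr_ile1 ?PhiR_norm//.
    by have /andP[z0 z1] := Zchi01 r N 0 0 w; rewrite ger0_norm.
  have q0 : E (chi r N 0) <= 1.
    rewrite -[leRHS](Ex_cst P); apply: Ex_le; [exact: bchi|exact: bmeas_cst|move=> w].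
    by have /andP[] := stay01 r N 0 w.
  have an : 0 <= alpha th r N n by rewrite (le_trans _ (ab n))// mulr_ge0// ltW.
  have qn : 0 <= E (chi r N n) by apply: Ex_ge0 => w; have /andP[] := stay01 r N n w.
  by lra.
by rewrite ler_pdivlMr// mulrC.
Unshelve. all: by end_near. Qed.

End one_array.
End heat_array.

Section one_array2.
Context (R : realType) d0 (T : measurableType d0) (P : probability T R) (d : nat).
Hypothesis d_gt0 : (0 < d)%N.
Variables (s : nat -> nat -> T -> 'I_d -> R) (Z : nat -> nat -> T -> R) (h : nat -> R) (c : R).
Hypothesis c_ge0 : 0 <= c.
Hypothesis ha : heat_array P s Z h c.
Let E := Ex P.
Let chi r N j w := stay (s N) r j w.
Let beta r N j := E (fun w => Z N j w * chi r N j w).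
Let alpha th r N j := E (fun w => PhiR th (s N j w) * (Z N j w * chi r N j w)).

Let bPhi th N j : bmeas (fun w => PhiR th (s N j w)).
Proof. by apply: bmeas_PhiR => i; exact: (ha_ms ha). Qed.

Let bZchi r N j k : bmeas (fun w => Z N j w * chi r N k w).
Proof. by apply: bmeasM; [exact: bZ ha _ _|exact: bchi ha _ _ _]. Qed.

Let bA th r N j k : bmeas (fun w => PhiR th (s N j w) * (Z N j w * chi r N k w)).
Proof. by apply: bmeasM. Qed.

Let Zchi01 r N j k w : 0 <= Z N j w * chi r N k w <= 1.
Proof.
have /andP[? ?] := stay01 s r N k w; have /andP[? ?] := ha_Z01 ha N j w.
by rewrite mulr_ge0//= mulr_ile1.
Qed.

Let beta_ge0 r N j : 0 <= beta r N j.
Proof. by apply: Ex_ge0 => w; have /andP[] := Zchi01 r N j j w. Qed.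

Let beta_cvg0 (r : R) : 0 < r -> \forall N \near \oo, forall e : R, 0 < e ->
  \forall n \near \oo, beta r N n <= e.
Proof.
move=> r0; have [C C0 hC] := heat_array_bounded d_gt0 c_ge0 ha r0.
near=> N; have hN : 0 < h N by near: N; exact: (ha_h ha).
have bd : forall n, h N * \sum_(j < n) beta r N j <= C by near: N; exact: hC.
move=> e e0.
have cs : cvgn (series (beta r N)).
  apply: nondecreasing_is_cvgn.
    by apply/nondecreasing_seqP => n; rewrite !seriesEord/= big_ord_recr/= lerDl.
  exists (C / h N) => _ [n _ <-]; rewrite seriesEord/= ler_pdivlMr// mulrC.
  exact: bd.
have := cvg_series_cvg_0 cs.
move=> /cvgrPdist_le /(_ _ e0); apply: filterS => n.
by rewrite sub0r normrN ger0_norm.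
Unshelve. all: by end_near. Qed.

(** The limit is the resolvent at c of the Laplacian with Dirichlet conditions, on one
    eigenfunction. As [PhiR] vanishes on the faces, cutting off at the exit hardly changes its
    expectation, which then decays geometrically at rate (kap + c) h. *)
Lemma heat_array_eigen (r : R) (k : 'I_d -> nat) : 0 < r ->
  let th i := (2 * k i + 1)%:R * (pi / (2 * r)) in
  lim2 (fun N n => h N * \sum_(j < n) alpha th r N j) (kap th + c)^-1.
Proof.
move=> r0 th e e0; have pi0 := @pi_gt0 R.
have th0 i : 0 < th i by rewrite /th mulr_gt0 ?ltr0n ?addn1// divr_gt0// mulr_gt0.
have th_r i : cos (th i * r) = 0.
  have -> : th i * r = pi / 2 + pi *+ k i.
    by rewrite /th natrD natrM -mulr_natr; field; rewrite gt_eqF.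
  by rewrite (alternatingn (@cosDpi R)) cos_pihalf mulr0.
pose L : R := \sum_i th i.
have L0 : 0 <= L by apply: sumr_ge0 => i _; exact: ltW.
(* After a jump of size at most q out of the cube, some coordinate is within q of a face, where its
   cosine vanishes; the cosine is Lipschitz. *)
have bdry x y (q : R) : 0 <= q -> cube r x -> ~~ cube r y -> cube q (fun i => y i - x i) ->
    `|PhiR th y| <= L * q.
  move=> q0 /forallP cx; rewrite negb_forall => /existsP[i]; rewrite -ltNge => yi /forallP cq.
  rewrite /PhiR (bigD1 i)//= normrM.
  apply: (@le_trans _ _ (`|cos (th i * y i)| * 1)).
    rewrite ler_wpM2l// normr_prod; apply: prodr_ile1 => j _.
    by rewrite normr_ge0 cos_max.
  rewrite mulr1 -cos_norm normrM gtr0_norm//.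
  rewrite -[cos _]subr0 -(th_r i) (le_trans (cos_lipschitz _ _))//.
  rewrite -mulrBr normrM gtr0_norm//; apply: ler_pM; [exact: ltW|exact: normr_ge0| |].
    by rewrite /L (bigD1 i)//= lerDl sumr_ge0// => j _; exact: ltW.
  rewrite ger0_norm ?subr_ge0 ?(ltW yi)// lerBlDr.
  have := cq i; have := cx i; have := ler_normD (y i - x i) (x i); rewrite subrK; lra.
have kc0 : 0 < kap th + c.
  rewrite ltr_wpDr// /kap mulr_gt0 ?invr_gt0 ?mulr_gt0 ?ltr0n//.
  rewrite (bigD1 (Ordinal d_gt0))//= ltr_wpDr ?exprn_gt0//.
  by apply: sumr_ge0 => i _; exact: sqr_ge0.
have [C C0 hC] := heat_array_bounded d_gt0 c_ge0 ha r0.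
(* Four errors of size e': the overshoot, controlled by [q]; the steps and the large jumps,
   controlled by [e1]; and the remainder [alpha] at time n. *)
pose e' := (kap th + c) * e / 4.
have e'0 : 0 < e' by rewrite /e' divr_gt0// mulr_gt0.
pose q := e' / (L + 1); have q0 : 0 < q by rewrite divr_gt0// ltr_wpDl.
pose e1 := e' / C; have e10 : 0 < e1 by rewrite divr_gt0.
near=> N; have hN : 0 < h N by near: N; exact: (ha_h ha).
have bd : forall n, h N * \sum_(j < n) beta r N j <= C by near: N; exact: hC.
have step : forall j, `|E (fun w => PhiR th (s N j.+1 w) * (Z N j.+1 w * chi r N j w)) -
      (1 - (kap th + c) * h N) * alpha th r N j| <= e1 * h N * beta r N j.
  by near: N; exact: (ha_step ha).
have jump : forall j, E (fun w => (~~ cube q (fun i => s N j.+1 w i - s N j w i))%:R *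
      (Z N j w * chi r N j w)) <= e1 * h N * beta r N j.
  by near: N; exact: (ha_jump ha).
have b0 : forall e, 0 < e -> \forall n \near \oo, beta r N n <= e.
  by near: N; exact: beta_cvg0.
have gam j : `|E (fun w => PhiR th (s N j.+1 w) * (Z N j.+1 w * chi r N j w)) -
    alpha th r N j.+1| <= L * q * (E (chi r N j) - E (chi r N j.+1)) + e1 * h N * beta r N j.
  have bc k0 := bchi ha r N k0.
  have bj : bmeas (fun w => (~~ cube q (fun i => s N j.+1 w i - s N j w i))%:R *
      (Z N j w * chi r N j w)).
    apply: bmeasM => //.
    have -> : (fun w => (~~ cube q (fun i => s N j.+1 w i - s N j w i))%:R) =
        (fun w => 1 - (cube q (fun i => s N j.+1 w i - s N j w i))%:R : R).
      by apply/funext => w; case: (cube _ _); rewrite ?subrr ?subr0.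
    apply: bmeasB; first exact: bmeas_cst.
    by apply: bmeas_cube => i; apply: measurable_funB; exact: (ha_ms ha).
  have bd2 : bmeas (fun w => chi r N j w - chi r N j.+1 w) by apply: bmeasB; exact: bc.
  have -> : E (chi r N j) - E (chi r N j.+1) = E (fun w => chi r N j w - chi r N j.+1 w).
    by rewrite /E ExB//; exact: bc.
  rewrite /alpha /E -ExB// -ExZ//.
  apply: (@le_trans _ _ (Ex P (fun w => L * q * (chi r N j w - chi r N j.+1 w) +
     (~~ cube q (fun i => s N j.+1 w i - s N j w i))%:R * (Z N j w * chi r N j w)))); last first.
    rewrite ExD//; last exact: bmeasZ.
    by rewrite lerD2l; exact: jump.
  rewrite (le_trans (Ex_norm_le P _))//; first exact: bmeasB.
  apply: Ex_le.
  - by apply: bmeas_norm; exact: bmeasB.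
  - by apply: bmeasD => //; exact: bmeasZ.
  move=> w; rewrite -mulrBr -mulrBr.
  have /andP[z0 z1] := ha_Z01 ha N j.+1 w; have zz := ha_Zni ha N j w.
  have /andP[x0 x1] := stay01 s r N j w; have Phi1 := PhiR_norm th (s N j.+1 w).
  have Lq0 : 0 <= L * q by rewrite mulr_ge0// ltW.
  rewrite /chi -/(stay _ _ _ _) [stay _ _ j.+1 _]stayS.
  have [cy|cy] := boolP (cube r (s N j.+1 w)).
    rewrite mulr1 subrr !mulr0 normr0 add0r.
    by rewrite mulr_ge0// mulr_ge0// (le_trans z0).
  rewrite mulr0 !subr0.
  have [cq|cq] := boolP (cube q _); rewrite /= ?mul0r ?mul1r ?addr0.
    rewrite [stay _ _ _ _]stay_cube; have [cx|cx] := boolP (cube r (s N j w)); last first.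
      by rewrite !mulr0 normr0.
    rewrite mulr1 !normrM mulrA (ger0_norm z0) (ger0_norm x0).
    rewrite ler_wpM2r//; apply: le_trans (bdry _ _ _ (ltW q0) cx cy cq).
    by rewrite ler_piMr.
  rewrite -[leLHS]add0r; apply: lerD; first exact: mulr_ge0.
  rewrite !normrM (ger0_norm z0) (ger0_norm x0).
  apply: (@le_trans _ _ (1 * (Z N j.+1 w * stay (s N) r j w))).
    by rewrite ler_wpM2r// mulr_ge0.
  by rewrite mul1r ler_wpM2r.
have main n : `|(kap th + c) * (h N * \sum_(j < n) alpha th r N j) -
    (alpha th r N 0 - alpha th r N n)| <= e' + e' + e'.
  have -> : (kap th + c) * (h N * \sum_(j < n) alpha th r N j) -
    (alpha th r N 0 - alpha th r N n) = \sum_(j < n)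
      ((kap th + c) * h N * alpha th r N j - (alpha th r N j - alpha th r N j.+1)).
    rewrite sumrB -mulr_sumr mulrA; congr (_ - _).
    rewrite -(big_mkord predT (fun j => alpha th r N j - alpha th r N j.+1)).
    under eq_bigr do rewrite -opprB.
    by rewrite sumrN telescope_sumr// opprB.
  rewrite (le_trans (ler_norm_sum _ _ _))//.
  apply: (@le_trans _ _ (\sum_(j < n) (L * q * (E (chi r N j) - E (chi r N j.+1)) +
     (e1 * h N * beta r N j + e1 * h N * beta r N j)))).
    apply: ler_sum => j _; rewrite addrA.
    apply: le_trans (lerD (gam j) (step j)).
    rewrite -[X in _ <= X + _]normrN; apply: le_trans (ler_normD _ _).
    by rewrite le_eqVlt; apply/orP; left; apply/eqP; congr (`|_|); ring.
  rewrite big_split/= -mulr_sumr -addrA; apply: lerD.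
    rewrite -(big_mkord predT (fun j => E (chi r N j) - E (chi r N j.+1))).
    under eq_bigr do rewrite -opprB.
    rewrite sumrN telescope_sumr// opprB.
    have q1 : E (chi r N 0) - E (chi r N n) <= 1.
      rewrite -[leRHS]subr0 lerB//.
        rewrite -[leRHS](Ex_cst P); apply: Ex_le; [exact: bchi ha _ _ _|exact: bmeas_cst|move=> w].
        by have /andP[] := stay01 s r N 0 w.
      by apply: Ex_ge0 => w; have /andP[] := stay01 s r N n w.
    apply: (@le_trans _ _ (L * q)); first by rewrite ler_piMr// mulr_ge0// ltW.
    by rewrite /q mulrCA ler_piMr ?(ltW e'0)// ler_pdivrMr ?mul1r ?lerDl// ltr_wpDl.
  have S : \sum_(j < n) e1 * h N * beta r N j <= e'.
    rewrite -mulr_sumr -mulrA (le_trans (ler_wpM2l (ltW e10) (bd n)))//.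
    by rewrite /e1 divfK// gt_eqF.
  by rewrite big_split/= lerD.
have hn := b0 _ e'0.
near=> n; have bn : beta r N n <= e' by near: n; exact: hn.
have a0 : alpha th r N 0 = 1.
  rewrite /alpha -[RHS](Ex_cst P); congr (Ex _ _); apply/funext => w.
  rewrite (ha_Z0 ha) mul1r /chi (stay0 ha)// mulr1 /PhiR big1// => i _.
  by rewrite (ha_s0 ha) mulr0 cos0.
have an : `|alpha th r N n| <= e'.
  apply: le_trans bn; rewrite (le_trans (Ex_norm_le P _))//; apply: Ex_le => //.
    exact: bmeas_norm.
  move=> w; have /andP[y0 y1] := Zchi01 r N n n w.
  by rewrite normrM (ger0_norm y0) ler_piMl// PhiR_norm.
rewrite -(ler_pM2l kc0) -[X in X * `|_|]gtr0_norm// -normrM mulrBr mulfV ?gt_eqF//.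
have := main n; rewrite a0 opprB addrA => mn.
set y := (kap th + c) * _ in mn *.
have -> : y - 1 = (y + alpha th r N n - 1) - alpha th r N n by ring.
rewrite (le_trans (ler_normB _ _))// (le_trans (lerD mn an))//.
by rewrite /e'; lra.
Unshelve. all: by end_near. Qed.

End one_array2.

(** * Comparison of two arrays *)

Section heat_array_comparison.
Variables (R : realType) (d : nat).
Hypothesis d_gt0 : (0 < d)%N.

Definition soft_cube (n : nat) (r : R) (x : 'I_d -> R) : R :=
  \prod_i newton (cos (pi / (2 * r) * x i)) n.

(** A lower bound on the cube of half-width r for the soft cube of half-width q r: the cosines are
    at least cos(pi / (2q)) there, and [newton_cvg_rate] applies to each coordinate. *)
Definition soft_inf (n : nat) (q : R) : R := (1 - (1 - cos (pi / (2 * q)) / 2) ^+ n) ^+ d.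

Lemma cos_cube (r : R) (x : 'I_d -> R) i : 0 < r -> cube r x -> 0 <= cos (pi / (2 * r) * x i) <= 1.
Proof.
move=> r0 /forallP /(_ i) xi; rewrite cos_le1 andbT -cos_norm normrM.
have pi0 := @pi_gt0 R.
rewrite gtr0_norm ?divr_gt0 ?mulr_gt0//; apply: cos_ge0_pihalf.
have h0 : 0 <= pi / (2 * r) * `|x i| by rewrite mulr_ge0// divr_ge0 ?mulr_ge0// ltW.
have -> : pi / 2 = pi / (2 * r) * r by field; rewrite gt_eqF.
rewrite (le_trans _ h0) ?ler_wpM2l ?divr_ge0 ?mulr_ge0 ?(ltW pi0) ?(ltW r0)//.
by rewrite oppr_le0 mulr_ge0 ?(ltW r0)// divr_ge0 ?mulr_ge0 ?(ltW pi0) ?(ltW r0).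
Qed.

Lemma soft_cube01 n (r : R) x : 0 < r -> cube r x -> 0 <= soft_cube n r x <= 1.
Proof.
move=> r0 cx; have h i : 0 <= newton (cos (pi / (2 * r) * x i)) n <= 1.
  have c01 := cos_cube i r0 cx; have /andP[h1 h2] := newton_range n c01.
  by rewrite h2 andbT (le_trans _ h1)//; case/andP: c01.
by rewrite prodr_ge0 ?prodr_ile1//= => i _; case/andP: (h i).
Qed.

Lemma soft_cube_lb n (r q : R) x : 0 < r -> 1 < q -> cube r x -> soft_inf n q <= soft_cube n (q * r) x.
Proof.
move=> r0 q1 cx; have q0 : 0 < q by lra.
have pi0 := @pi_gt0 R.
have cqx : cube (q * r) x.
  apply/forallP => i; rewrite (le_trans (forallP cx i))// ler_peMl// ltW//.
rewrite /soft_inf /soft_cube -[X in _ ^+ X](card_ord d) -prodr_const.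
have ca : 0 <= cos (pi / (2 * q)) :> R.
  apply: cos_ge0_pihalf; rewrite (@le_trans _ _ 0) ?oppr_le0 ?divr_ge0 ?mulr_ge0 ?(ltW pi0) ?(ltW q0)//=.
  by rewrite ler_pdivrMr ?mulr_gt0// mulrA divfK// ler_peMr ?ltW.
have ca1 := cos_le1 (pi / (2 * q) : R).
apply: ler_prod => i _; apply/andP; split.
  by rewrite subr_ge0 exprn_ile1//; lra.
have c01 := cos_cube i (mulr_gt0 q0 r0) cqx.
rewrite lerBlDr -lerBlDl (le_trans (newton_cvg_rate n c01))//.
have /andP[c0 c1] := c01.
have cc : cos (pi / (2 * q)) <= cos (pi / (2 * (q * r)) * x i).
  rewrite -[leRHS]cos_norm normrM gtr0_norm ?divr_gt0 ?mulr_gt0//.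
  set z := _ * `|x i|.
  have zq : z <= pi / (2 * q).
    have -> : pi / (2 * q) = pi / (2 * (q * r)) * r by field; rewrite !gt_eqF.
    by rewrite ler_wpM2l ?(forallP cx i)// divr_ge0 ?mulr_ge0 ?(ltW pi0) ?(ltW q0) ?(ltW r0).
  have z0 : 0 <= z.
    by rewrite mulr_ge0// divr_ge0 ?mulr_ge0 ?(ltW pi0) ?(ltW q0) ?(ltW r0).
  have qpi : pi / (2 * q) <= pi :> R.
    by rewrite ler_pdivrMr ?mulr_gt0// ler_peMr ?(ltW pi0)//; lra.
  move: zq; rewrite le_eqVlt => /orP[/eqP->//|zq].
  rewrite ltW// ltr_cos// in_itv/= ?qpi ?(le_trans (ltW zq) qpi) ?z0 ?(le_trans z0 (ltW zq))//.
by rewrite lerXn2r ?nnegrE//; lra.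
Qed.

Lemma bmeas_soft_cube d0 (T : measurableType d0) n r (X : T -> 'I_d -> R) :
  (forall i, measurable_fun setT (fun w => X w i)) -> bmeas (fun w => soft_cube n r (X w)).
Proof.
move=> mX; apply: bmeas_prod => i _.
elim: n => [|n ih]; first exact: bmeas_cos.
rewrite /newton; under eq_fun do rewrite iterS.
have e : (fun w => newton (cos (pi / (2 * r) * X w i)) n *
     (3 - newton (cos (pi / (2 * r) * X w i)) n ^+ 2) / 2) =
   (fun w => (newton (cos (pi / (2 * r) * X w i)) n *
     (3 - newton (cos (pi / (2 * r) * X w i)) n * newton (cos (pi / (2 * r) * X w i)) n)) * 2^-1).
  by apply/funext => w; rewrite expr2.
rewrite /newton in e; rewrite e.
by repeat apply: bmeasM => //; rewrite -/(newton _ _); [apply: bmeasB; [exact: bmeas_cst|exact: bmeasM]|exact: bmeas_cst].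
Qed.

(** Expanding Newton's iterate reduces to [heat_array_eigen], so the limit depends on r and c only
    and is shared by all arrays. The scaling relation is that of the eigenvalues, [kap] being
    quadratic in the frequencies. *)
Lemma soft_cube_limit n : exists V : R -> R -> R,
  (forall r c : R, 0 < r -> 0 <= c -> V r c = r ^+ 2 * V 1 (r ^+ 2 * c)) /\
  forall d0 (T : measurableType d0) (P : probability T R) s Z h (c : R),
    0 <= c -> @heat_array R d0 T P d s Z h c -> forall r : R, 0 < r ->
    lim2 (fun N m => h N * \sum_(j < m)
      Ex P (fun w => soft_cube n r (s N j w) * (Z N j w * stay (s N) r j w))) (V r c).
Proof.
have [K [a ha]] := odd_cos_sum_newton R n.
pose th (r : R) (k : {ffun 'I_d -> 'I_K}) (i : 'I_d) : R := (2 * k i + 1)%:R * (pi / (2 * r)).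
have scE r x : soft_cube n r x =
    \sum_(k : {ffun 'I_d -> 'I_K}) (\prod_i a (k i)) * PhiR (th r k) x.
  rewrite /soft_cube; under eq_bigr do rewrite ha.
  rewrite bigA_distr_bigA/=; apply: eq_bigr => k _.
  rewrite /PhiR -big_split/=; apply: eq_bigr => i _.
  by rewrite /th mulrA.
have kapE r k : 0 < r -> kap (th r k) = (r ^+ 2)^-1 * kap (th 1 k).
  move=> r0; rewrite /kap mulrCA; congr (_ * _); rewrite mulr_sumr.
  by apply: eq_bigr => i _; rewrite /th; field; rewrite gt_eqF.
have kap0 k : 0 < kap (th 1 k).
  rewrite /kap mulr_gt0 ?invr_gt0 ?mulr_gt0 ?ltr0n//.
  rewrite (bigD1 (Ordinal d_gt0))//= ltr_wpDr//.
    by apply: sumr_ge0 => i _; exact: sqr_ge0.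
  rewrite exprn_gt0// /th mulr_gt0 ?ltr0n ?addn1// divr_gt0 ?pi_gt0//; lra.
exists (fun r c => \sum_(k : {ffun 'I_d -> 'I_K}) (\prod_i a (k i)) * (kap (th r k) + c)^-1).
split=> [r c r0 c0|d0 T P s Z h c c0 hA r r0].
  rewrite mulr_sumr; apply: eq_bigr => k _; rewrite kapE//; have := kap0 k => k0.
  have h1 : kap (th 1 k) + r ^+ 2 * c != 0.
    by rewrite gt_eqF// ltr_wpDr// mulr_ge0// sqr_ge0.
  have h2 : (r ^+ 2)^-1 * kap (th 1 k) + c = (kap (th 1 k) + r ^+ 2 * c) / r ^+ 2.
    by field; rewrite gt_eqF.
  rewrite h2; move: (kap _ + _) h1 => u u0; field.
  by rewrite u0 gt_eqF.
have := lim2_sum (index_enum _) (fun k : {ffun 'I_d -> 'I_K} =>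
  lim2Z (\prod_i a (k i)) (heat_array_eigen d_gt0 c0 hA (fun i => k i) r0)).
congr lim2; apply/funext => N; apply/funext => m.
under eq_bigr do rewrite mulrCA.
rewrite -mulr_sumr; congr (_ * _).
under eq_bigr do rewrite mulr_sumr.
rewrite exchange_big/=; apply: eq_bigr => j _.
under [in RHS]eq_fun do rewrite scE mulr_suml.
have bP k : bmeas (fun w => PhiR (th r k) (s N j w) * (Z N j w * stay (s N) r j w)).
  apply: bmeasM; first by apply: bmeas_PhiR => i; exact: (ha_ms hA).
  by apply: bmeasM; [exact: bZ hA _ _|exact: bchi hA _ _ _].
under [in RHS]eq_fun do under eq_bigr do rewrite -mulrA.
rewrite Ex_sum; last by move=> k _; exact: bmeasZ.
by apply: eq_bigr => k _; rewrite ExZ.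
Qed.

Definition kill_sum d0 (T : measurableType d0) (P : probability T R)
    (s : nat -> nat -> T -> 'I_d -> R) (Z : nat -> nat -> T -> R) (h : nat -> R) (r : R) N m :=
  h N * \sum_(j < m) Ex P (fun w => Z N j w * stay (s N) r j w).

Section sandwich.
Context d0 (T : measurableType d0) (P : probability T R).
Variables (s : nat -> nat -> T -> 'I_d -> R) (Z : nat -> nat -> T -> R) (h : nat -> R) (c : R).
Hypothesis hA : heat_array P s Z h c.

Let bZs r N j : bmeas (fun w => Z N j w * stay (s N) r j w).
Proof. by apply: bmeasM; [exact: bZ hA _ _|exact: bchi hA _ _ _]. Qed.

Let bS n r r' N j : bmeas (fun w => soft_cube n r (s N j w) * (Z N j w * stay (s N) r' j w)).
Proof. by apply: bmeasM => //; apply: bmeas_soft_cube => i; exact: (ha_ms hA). Qed.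

Let Zs0 r N j w : 0 <= Z N j w * stay (s N) r j w.
Proof.
by rewrite mulr_ge0//; [case/andP: (ha_Z01 hA N j w)|case/andP: (stay01 s r N j w)].
Qed.

Lemma soft_cube_le_kill n (r : R) : 0 < r -> \forall N \near \oo, forall m,
  h N * \sum_(j < m) Ex P (fun w => soft_cube n r (s N j w) * (Z N j w * stay (s N) r j w))
  <= kill_sum P s Z h r N m.
Proof.
move=> r0; near=> N => m; rewrite /kill_sum ler_wpM2l//.
  by rewrite ltW//; near: N; exact: (ha_h hA).
apply: ler_sum => j _; apply: Ex_le => // w.
rewrite [stay _ _ _ _]stay_cube; case: (boolP (cube r _)) => [cu|_]; last by rewrite !mulr0.
by rewrite mulr1 ler_piMl//; case/andP: (soft_cube01 n r0 cu).
Unshelve. all: by end_near. Qed.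

Lemma kill_le_soft_cube n (r q : R) : 0 < r -> 1 < q -> \forall N \near \oo, forall m,
  soft_inf n q * kill_sum P s Z h r N m <=
  h N * \sum_(j < m) Ex P (fun w => soft_cube n (q * r) (s N j w) *
    (Z N j w * stay (s N) (q * r) j w)).
Proof.
move=> r0 q1; have q0 : 0 < q by lra.
have cq x : cube r x -> cube (q * r) x.
  move=> /forallP h'; apply/forallP => i; rewrite (le_trans (h' i))// ler_peMl// ltW//.
near=> N => m; rewrite /kill_sum mulrCA ler_wpM2l//.
  by rewrite ltW//; near: N; exact: (ha_h hA).
rewrite mulr_sumr; apply: ler_sum => j _; rewrite -ExZ//; apply: Ex_le => //.
  exact: bmeasZ.
move=> w; rewrite [stay _ r _ _]stay_cube; case: (boolP (cube r (s N j w))) => [cu|_]; last first.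
  rewrite !mulr0 [stay _ _ _ _]stay_cube.
  case: (boolP (cube (q * r) _)) => [cu'|_]; last by rewrite !mulr0.
  rewrite mulr1 mulr_ge0//; by case/andP: (soft_cube01 n (mulr_gt0 q0 r0) cu').
rewrite mulr1.
have sc : 0 <= soft_cube n (q * r) (s N j w) <= 1.
  by apply: soft_cube01; [exact: mulr_gt0|exact: cq].
have si : soft_inf n q <= soft_cube n (q * r) (s N j w) by exact: soft_cube_lb.
rewrite (@le_trans _ _ (soft_cube n (q * r) (s N j w) * (Z N j w * stay (s N) r j w)))//.
  by rewrite ler_wpM2r.
rewrite ler_wpM2l//; first by case/andP: sc.
rewrite ler_wpM2l//; first by case/andP: (ha_Z01 hA N j w).
apply: ler_prod => l _; rewrite ler0n/= ler_nat.
by case: (boolP (cube r _)) => // /cq ->.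
Unshelve. all: by end_near. Qed.

End sandwich.

Lemma soft_inf_cvg (q : R) : 1 < q -> (fun n => soft_inf n q) @ \oo --> (1 : R).
Proof.
move=> q1; have q0 : 0 < q by lra.
have pi0 := @pi_gt0 R.
have ca : 0 < cos (pi / (2 * q)) :> R.
  apply: cos_gt0_pihalf; apply/andP; split.
    by rewrite (@lt_trans _ _ 0) ?oppr_lt0 ?divr_gt0 ?mulr_gt0.
  by rewrite ltr_pdivrMr ?mulr_gt0// mulrA divfK// ltr_pMr.
have ca1 := cos_le1 (pi / (2 * q) : R).
have -> : (1 : R) = (1 - 0) ^+ d by rewrite subr0 expr1n.
apply: (@cvg_comp _ _ _ (fun n => 1 - (1 - cos (pi / (2 * q)) / 2) ^+ n) (fun x : R => x ^+ d)).
  apply: cvgB; first exact: cvg_cst.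
  by apply: cvg_expr; rewrite ger0_norm; lra.
exact: exprn_continuous.
Qed.

Variable U : R -> R.
Hypothesis U_cont : forall c : R, 0 < c -> {for c, continuous U}.
(* One array per killing rate with a known limit: every other array inherits it. *)
Hypothesis U_ref : forall c : R, 0 < c -> exists d0 (T : measurableType d0) (P : probability T R) s Z h,
  @heat_array R d0 T P d s Z h c /\ lim2 (kill_sum P s Z h 1) (U c).

(** The kill sum lies between soft sums of half-widths r and q r. Their limits are common to all
    arrays, so the reference arrays bound them through U at the rates q^2 C and C / q^2, and the
    continuity of U brings the bounds together as q tends to 1. The order n is chosen after q, to
    make [soft_inf n q] close to 1. *)
Lemma kill_sum_limit d0 (T : measurableType d0) (P : probability T R) s Z h (c r : R) :
  0 < c -> 0 < r -> @heat_array R d0 T P d s Z h c ->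
  lim2 (kill_sum P s Z h r) (r ^+ 2 * U (r ^+ 2 * c)).
Proof.
move=> c0 r0 hA; set C := r ^+ 2 * c; have C0 : 0 < C by rewrite mulr_gt0// exprn_gt0.
have r2 : 0 < r ^+ 2 by rewrite exprn_gt0.
have [B B0 hB] := heat_array_bounded d_gt0 (ltW c0) hA r0.
(* Both halves of the sandwich, in the limit along the reference array. *)
have up n (q c' : R) (V : R -> R -> R) : 0 < c' -> 1 < q ->
  (forall r c : R, 0 < r -> 0 <= c -> V r c = r ^+ 2 * V 1 (r ^+ 2 * c)) ->
  (forall d0 (T : measurableType d0) (P : probability T R) s Z h (c : R),
    0 <= c -> @heat_array R d0 T P d s Z h c -> forall r : R, 0 < r ->
    lim2 (fun N m => h N * \sum_(j < m)
      Ex P (fun w => soft_cube n r (s N j w) * (Z N j w * stay (s N) r j w))) (V r c)) ->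
  V 1 c' <= U c' /\ soft_inf n q * U c' <= q ^+ 2 * V 1 (q ^+ 2 * c').
  move=> c'0 q1 VE Vl; have [d1 [T1 [P1 [s1 [Z1 [h1 [hA1 l1]]]]]]] := U_ref c'0.
  have q0 : 0 < q by lra.
  split.
    apply: (lim2_le (Vl _ _ _ _ _ _ _ (ltW c'0) hA1 1 ltr01) l1).
    exact: (soft_cube_le_kill hA1 n ltr01).
  have -> : q ^+ 2 * V 1 (q ^+ 2 * c') = V q c' by rewrite [RHS]VE// ltW.
  have k1 := kill_le_soft_cube hA1 n ltr01 q1; rewrite mulr1 in k1.
  exact: (lim2_le (lim2Z (soft_inf n q) l1) (Vl _ _ _ _ _ _ _ (ltW c'0) hA1 q q0) k1).
move=> e e0.
have [q [q1 qU1 qU2]] : exists q : R, [/\ 1 < q,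
    r ^+ 2 * (q ^+ 2 * U (q ^+ 2 * C)) <= r ^+ 2 * U C + e / 4 &
    r ^+ 2 * U C - e / 4 <= r ^+ 2 * ((q ^+ 2)^-1 * U (C / q ^+ 2))].
  have cv1 : (fun q : R => r ^+ 2 * (q ^+ 2 * U (q ^+ 2 * C))) @ (1 : R)^'+ --> r ^+ 2 * U C.
    apply: cvg_at_right_filter.
    rewrite -[U C]mul1r; apply: (@cvgM _ _ _ _ (fun=> r ^+ 2) _ (r ^+ 2)); first exact: cvg_cst.
    have sq : (fun q : R => q ^+ 2) @ (1 : R) --> (1 : R).
      by have := @exprn_continuous R 2 1; rewrite /continuous_at expr1n.
    apply: (@cvgM _ _ _ _ (fun q : R => q ^+ 2) _ 1) => //.
    apply: (@cvg_comp _ _ _ (fun q : R => q ^+ 2 * C) U _ (nbhs C)); last exact: U_cont.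
    have := @cvgM _ _ _ _ (fun q : R => q ^+ 2) (fun=> C) _ _ sq (cvg_cst C).
    by rewrite mul1r; exact.
  have cv2 : (fun q : R => r ^+ 2 * ((q ^+ 2)^-1 * U (C / q ^+ 2))) @ (1 : R)^'+ --> r ^+ 2 * U C.
    apply: cvg_at_right_filter.
    rewrite -[U C]mul1r; apply: (@cvgM _ _ _ _ (fun=> r ^+ 2) _ (r ^+ 2)); first exact: cvg_cst.
    have sq : (fun q : R => (q ^+ 2)^-1) @ (1 : R) --> (1 : R).
      have sq : (fun q : R => q ^+ 2) @ (1 : R) --> (1 : R).
        by have := @exprn_continuous R 2 1; rewrite /continuous_at expr1n.
      by have := cvgV (@oner_neq0 R) sq; rewrite invr1; exact.
    apply: (@cvgM _ _ _ _ (fun q : R => (q ^+ 2)^-1) _ 1) => //.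
    apply: (@cvg_comp _ _ _ (fun q : R => C / q ^+ 2) U _ (nbhs C)); last exact: U_cont.
    have := @cvgM _ _ _ _ (fun=> C) (fun q : R => (q ^+ 2)^-1) _ _ (cvg_cst C) sq.
    by rewrite mulr1; exact.
  have e4 : 0 < e / 4 by rewrite divr_gt0.
  apply: (@filter_ex _ (1 : R)^'+); near=> q; split.
  - by near: q; exact: nbhs_right_gt.
  - near: q; move/cvgrPdist_le: cv1 => /(_ _ e4); apply: filterS => q.
    by rewrite ler_norml => /andP[? ?]; lra.
  - near: q; move/cvgrPdist_le: cv2 => /(_ _ e4); apply: filterS => q.
    by rewrite ler_norml => /andP[? ?]; lra.
have q0 : 0 < q by lra.
have q2 : 0 < q ^+ 2 by rewrite exprn_gt0.
(* Bounds both quantities that the factor [1 - soft_inf n q] multiplies: the kill sum and its lower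
   limit. *)
pose M := B + `|r ^+ 2 * ((q ^+ 2)^-1 * U (C / q ^+ 2))| + 1.
have M0 : 0 < M by rewrite /M; have := normr_ge0 (r ^+ 2 * ((q ^+ 2)^-1 * U (C / q ^+ 2))); lra.
have [n In1 In2] : exists2 n, 1 - soft_inf n q <= e / (4 * M) & soft_inf n q <= 1.
  have e4 : 0 < e / (4 * M) by rewrite divr_gt0// mulr_gt0.
  have := soft_inf_cvg q1 => /cvgrPdist_le /(_ _ e4) /filter_ex[n].
  rewrite ler_norml => /andP[_ h1]; exists n => //.
  have ca : 0 <= cos (pi / (2 * q)) :> R.
    have pi0 := @pi_gt0 R.
    apply: cos_ge0_pihalf; rewrite (@le_trans _ _ 0) ?oppr_le0 ?divr_ge0 ?mulr_ge0 ?(ltW pi0) ?(ltW q0)//=.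
    by rewrite ler_pdivrMr ?mulr_gt0// mulrA divfK// ler_peMr ?ltW.
  have ca1 := cos_le1 (pi / (2 * q) : R).
  have h01 : 0 <= (1 - cos (pi / (2 * q)) / 2) ^+ n <= 1.
    by rewrite exprn_ge0 ?exprn_ile1//; lra.
  by rewrite /soft_inf exprn_ile1//; lra.
have [V [VE Vl]] := soft_cube_limit n.
have C2 : 0 < q ^+ 2 * C by rewrite mulr_gt0.
have Cq : 0 < C / q ^+ 2 by rewrite divr_gt0.
have [u1 _] := up n q (q ^+ 2 * C) V C2 q1 VE Vl.
have [_ u2] := up n q (C / q ^+ 2) V Cq q1 VE Vl.
have e4 : 0 < e / 4 by rewrite divr_gt0.
have L1 := Vl _ _ _ _ _ _ _ (ltW c0) hA r r0 _ e4.
have L2 := Vl _ _ _ _ _ _ _ (ltW c0) hA (q * r) (mulr_gt0 q0 r0) _ e4.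
near=> N.
have n1 : \forall m \near \oo, `|h N * \sum_(j < m) Ex P (fun w => soft_cube n r (s N j w) *
    (Z N j w * stay (s N) r j w)) - V r c| <= e / 4 by near: N; exact: L1.
have n2 : \forall m \near \oo, `|h N * \sum_(j < m) Ex P (fun w => soft_cube n (q * r) (s N j w) *
    (Z N j w * stay (s N) (q * r) j w)) - V (q * r) c| <= e / 4 by near: N; exact: L2.
have s1 : forall m, h N * \sum_(j < m) Ex P (fun w => soft_cube n r (s N j w) *
    (Z N j w * stay (s N) r j w)) <= kill_sum P s Z h r N m.
  by near: N; exact: (soft_cube_le_kill hA n r0).
have s2 : forall m, soft_inf n q * kill_sum P s Z h r N m <= h N * \sum_(j < m) Ex P (fun w =>
    soft_cube n (q * r) (s N j w) * (Z N j w * stay (s N) (q * r) j w)).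
  by near: N; exact: (kill_le_soft_cube hA n r0 q1).
have bd : forall m, kill_sum P s Z h r N m <= B by near: N; exact: hB.
near=> m.
have : `|h N * \sum_(j < m) Ex P (fun w => soft_cube n r (s N j w) *
    (Z N j w * stay (s N) r j w)) - V r c| <= e / 4 by near: m; exact: n1.
have : `|h N * \sum_(j < m) Ex P (fun w => soft_cube n (q * r) (s N j w) *
    (Z N j w * stay (s N) (q * r) j w)) - V (q * r) c| <= e / 4 by near: m; exact: n2.
have := s1 m; have := s2 m; have := bd m.
set K := kill_sum _ _ _ _ _ _ _; move=> KB.
move: (h N * _) (h N * _) => x y hx hy; rewrite !ler_norml => /andP[_ x2] /andP[y1 _].
have VrC : V r c = r ^+ 2 * V 1 C by rewrite VE ?(ltW c0).
have VqC : V (q * r) c = r ^+ 2 * (q ^+ 2 * V 1 (q ^+ 2 * C)).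
  by rewrite VE ?(ltW c0) ?mulr_gt0// exprMn -[q ^+ 2 * r ^+ 2 * c]mulrA -/C; ring.
have K0 : 0 <= K.
  rewrite /K mulr_ge0//; first by rewrite ltW//; near: N; exact: (ha_h hA).
  apply: sumr_ge0 => j _; apply: Ex_ge0 => w.
  by rewrite mulr_ge0//; [case/andP: (ha_Z01 hA N j w)|case/andP: (stay01 s r N j w)].
have I1 : (1 - soft_inf n q) * M <= e / 4.
  by rewrite -ler_pdivlMr// (le_trans In1)// invfM mulrA.
have I0 : 0 <= 1 - soft_inf n q by rewrite subr_ge0.
have KM : (1 - soft_inf n q) * K <= (1 - soft_inf n q) * M.
  by rewrite ler_wpM2l// /M; have := normr_ge0 (r ^+ 2 * ((q ^+ 2)^-1 * U (C / q ^+ 2))); lra.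
apply/andP; split; last first.
  have h1 : V (q * r) c <= r ^+ 2 * (q ^+ 2 * U (q ^+ 2 * C)).
    by rewrite VqC; do 2 (rewrite ler_pM2l//).
  by clear -hx x2 KM I1 h1 qU1 e0; lra.
have h2 : r ^+ 2 * ((q ^+ 2)^-1 * (soft_inf n q * U (C / q ^+ 2))) <= V r c.
  rewrite VrC ler_pM2l// ler_pdivrMl// (le_trans u2)//.
  by rewrite mulrCA mulfV ?mulr1// gt_eqF.
move: qU2; pose W := r ^+ 2 * ((q ^+ 2)^-1 * U (C / q ^+ 2)); rewrite -/W => qU2.
have e3 : r ^+ 2 * ((q ^+ 2)^-1 * (soft_inf n q * U (C / q ^+ 2))) = W - (1 - soft_inf n q) * W.
  by rewrite /W; ring.
have WM : (1 - soft_inf n q) * W <= (1 - soft_inf n q) * M.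
  by rewrite ler_wpM2l// /M -/W; have := ler_norm W; lra.
rewrite e3 in h2; clear -hy y1 qU2 h2 WM I1 e0; lra.
Unshelve. all: by end_near. Qed.

End heat_array_comparison.

(** * Laws with a density, Taylor bounds and Gaussian expectations *)

Section density.
Context d (T : measurableType d) (R : realType) (mu nu : {measure set T -> \bar R}) (p : T -> R).
Hypothesis mp : measurable_fun setT p.
Hypothesis p0 : forall x, 0 <= p x.
Hypothesis nuE : forall A, measurable A -> nu A = (\int[mu]_(x in A) (p x)%:E)%E.

Import HBNNSimple.
Local Open Scope ereal_scope.

Lemma density_integral (f : T -> R) : (forall x, 0 <= f x)%R -> measurable_fun setT f ->
  \int[nu]_x (f x)%:E = \int[mu]_x (f x * p x)%:E.
Proof.
move=> f0 mf; have mf' : measurable_fun setT (EFin \o f) by exact/measurable_EFinP.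
have mp' : measurable_fun setT (EFin \o p) by exact/measurable_EFinP.
pose h := nnsfun_approx measurableT mf'.
have hf x : (EFin \o h n) x @[n --> \oo] --> (f x)%:E.
  by apply: (@cvg_nnsfun_approx _ _ _ _ measurableT _ mf') => // y _; rewrite lee_fin.
have mh n : measurable_fun setT (EFin \o h n) by apply/measurable_EFinP; exact/measurable_funP.
have hnd x : {homo (fun n => h n x) : m n / (m <= n)%N >-> (m <= n)%R}.
  by move=> a b ab; exact/lefP/nd_nnsfun_approx.
have c1 : \int[nu]_x (EFin \o h n) x @[n --> \oo] --> \int[nu]_x (f x)%:E.
  have -> : \int[nu]_x (f x)%:E = \int[nu]_x limn (fun n => (EFin \o h n) x).
    by apply: eq_integral => x _; apply/esym/cvg_lim => //; exact: hf.
  apply: cvg_monotone_convergence => //.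
  - by move=> n x _; rewrite lee_fin.
  - by move=> x _ a b ab; rewrite lee_fin hnd.
have c2 : \int[mu]_x ((h n x)%:E * (p x)%:E) @[n --> \oo] --> \int[mu]_x (f x * p x)%:E.
  have -> : \int[mu]_x (f x * p x)%:E = \int[mu]_x limn (fun n => (h n x)%:E * (p x)%:E).
    apply: eq_integral => x _; apply/esym/cvg_lim => //; rewrite EFinM.
    by apply: cvgeZr => //; exact: hf.
  apply: cvg_monotone_convergence => //.
  - by move=> n; apply: emeasurable_funM => //; exact: mh.
  - by move=> n x _; rewrite mule_ge0 ?lee_fin.
  - by move=> x _ a b ab; rewrite lee_wpmul2r ?lee_fin ?hnd.
suff e n : \int[mu]_x ((h n x)%:E * (p x)%:E) = \int[nu]_x (EFin \o h n) x.
  rewrite (_ : (fun n => _) = (fun n => \int[nu]_x (EFin \o h n) x)) in c2.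
    by rewrite -(cvg_lim _ c1)// -(cvg_lim _ c2).
  by apply/funext => n; exact: e.
transitivity (\int[nu]_x (\sum_(y \in range (h n)) (y * \1_(h n @^-1` [set y]) x)%:E)); last first.
  by apply: eq_integral => t tE; rewrite /= fimfunE -fsumEFin.
have indich r : measurable_fun setT (fun x => (r * \1_(h n @^-1` [set r]) x)%:E).
  by apply: (measurable_comp measurableT) => //; exact: measurable_funM.
rewrite ge0_integral_fsum//; last by move=> m y Ey; exact: nnfun_muleindic_ge0.
transitivity (\int[mu]_x (\sum_(y \in range (h n)) (y * \1_(h n @^-1` [set y]) x)%:E * (p x)%:E)).
  apply: eq_integral => x xE.
  rewrite -ge0_mule_fsuml => [|y]; last exact: nnfun_muleindic_ge0.
  by rewrite fsumEFin // -(fimfunE _ x).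
rewrite ge0_integral_fsum//; last 2 first.
  - by move=> y; apply: emeasurable_funM.
  - move=> m y Ey; apply: mule_ge0; last by rewrite lee_fin.
    exact: nnfun_muleindic_ge0.
apply: eq_fsbigr => r rhn.
under [RHS]eq_integral do rewrite EFinM.
rewrite integralZl_indic_nnsfun => //.
under eq_integral do rewrite EFinM -muleA.
rewrite ge0_integralZl//.
- under eq_integral do rewrite muleC.
  rewrite (eq_integral ((EFin \o p) \_ (h n @^-1` [set r]))); last first.
    by move=> x xE; rewrite epatch_indic.
  by rewrite -integral_mkcondr setTI -nuE// integral_indic// setIT.
- by apply: emeasurable_funM => //; exact/measurable_EFinP.
- by move=> t Et; rewrite mule_ge0 ?lee_fin.
- by move: rhn; rewrite inE => -[t _ <-]; rewrite lee_fin.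
Qed.

End density.

Section expectation_law.
Context d (T : measurableType d) (R : realType) (P : probability T R).
Variables (X : T -> R) (nu : probability (measurableTypeR R) R) (p : R -> R).
Hypothesis mX : measurable_fun setT X.
Hypothesis mp : measurable_fun setT p.
Hypothesis p0 : forall x, 0 <= p x.
Hypothesis nuE : forall A : set R, measurable A ->
  nu A = (\int[lebesgue_measure]_(x in A) (p x)%:E)%E.
Hypothesis lawX : forall A : set R, measurable A -> P [set w | A (X w)] = nu A.

Lemma Ex_density (f : R -> R) : (forall x, 0 <= f x) -> bmeas f ->
  (Ex P (fun w => f (X w)))%:E = (\int[lebesgue_measure]_x (f x * p x)%:E)%E.
Proof.
move=> f0 [mf [C fC]]; rewrite -Ex_EFin; last first.
  by split; [exact: measurableT_comp|exists C => w].
rewrite -(@density_integral _ _ _ (@lebesgue_measure R) nu p mp p0 nuE f f0 mf).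
have mX' : @measurable_fun _ _ T (measurableTypeR R) setT X by exact: mX.
pose X' : {mfun T >-> measurableTypeR R} := @mfun_Sub _ _ T (measurableTypeR R) X (mem_set mX').
transitivity (\int[distribution P X']_x (f x)%:E)%E.
  by rewrite ge0_integral_distribution//; exact/measurable_EFinP.
by apply: eq_measure_integral => A mA _; first [exact: lawX|exact/esym/lawX].
Qed.

End expectation_law.

Section taylor.
Variable R : realType.

Lemma sin_mvt (z : R) : 0 < z -> exists2 c, 0 < c < z & sin z = z * cos c.
Proof.
move=> z0; have [c] := @MVT R (@sin R) (@cos R) 0 z z0
   (fun x _ => is_derive_sin x) (continuous_subspaceT (@continuous_sin R)).
by rewrite in_itv/= sin0 !subr0 => cz ->; exists c => //; rewrite mulrC.
Qed.

Lemma sin_sqr_le (z : R) : sin z ^+ 2 <= z ^+ 2.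
Proof.
wlog : z / 0 <= z => [hw|].
  have [/hw//|/ltW z0] := leP 0 z.
  by have := hw (- z); rewrite oppr_ge0 sinN !sqrrN; exact.
rewrite le_eqVlt => /orP[/eqP<-|/sin_mvt[c _ ->]]; first by rewrite sin0.
by rewrite exprMn ler_piMr ?sqr_ge0//; have := cos2Dsin2 c; have := sqr_ge0 (sin c); lra.
Qed.

Lemma cos_half_sin (y : R) : cos y = 1 - 2 * sin (y / 2) ^+ 2.
Proof.
have -> : cos y = cos ((y / 2) *+ 2) by congr cos; rewrite -mulr_natr; field.
by rewrite cos_mulr2n -mulr_natr; have := cos2Dsin2 (y / 2); lra.
Qed.

Lemma cos_taylor (y : R) : `|cos y - (1 - y ^+ 2 / 2)| <= y ^+ 4 / 8.
Proof.
wlog y0 : y / 0 < y => [hw|].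
  have [/hw//|y0|<-] := ltgtP 0 y; last by rewrite cos0 !expr0n/= !mul0r subr0 subrr normr0.
  have := hw (- y); rewrite oppr_gt0 cosN sqrrN (_ : (- y) ^+ 4 = y ^+ 4); last by ring.
  exact.
have lb (x : R) : 1 - x ^+ 2 / 2 <= cos x.
  rewrite cos_half_sin; have := sin_sqr_le (x / 2); rewrite expr_div_n; lra.
rewrite ger0_norm ?subr_ge0// cos_half_sin.
have y2 : 0 < y / 2 by lra.
have [c /andP[c0 cy] sE] := sin_mvt y2.
have cc : 1 - (y / 2) ^+ 2 / 2 <= cos c.
  by apply: le_trans (lb c); have : c ^+ 2 <= (y / 2) ^+ 2; [rewrite lerXn2r ?nnegrE//; lra|lra].
have main : (y / 2) ^+ 2 - (y / 2) ^+ 4 <= sin (y / 2) ^+ 2.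
  have [h|h] := leP (1 - (y / 2) ^+ 2 / 2) 0.
    rewrite (le_trans _ (sqr_ge0 _))//.
    rewrite (_ : (y / 2) ^+ 4 = (y / 2) ^+ 2 * (y / 2) ^+ 2); last by ring.
    have := sqr_ge0 (y / 2); nra.
  rewrite sE [leRHS]exprMn.
  have h2 : (1 - (y / 2) ^+ 2 / 2) ^+ 2 <= cos c ^+ 2 by rewrite lerXn2r ?nnegrE//; lra.
  rewrite (le_trans _ (ler_wpM2l (sqr_ge0 _) h2))//.
  rewrite (_ : (y / 2) ^+ 4 = (y / 2) ^+ 2 * (y / 2) ^+ 2); last by ring.
  move: (sqr_ge0 (y / 2)); move: ((y / 2) ^+ 2) => x x0.
  rewrite -subr_ge0 (_ : x * (1 - x / 2) ^+ 2 - (x - x * x) = x ^+ 3 / 4); last by field.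
  by rewrite divr_ge0 ?exprn_ge0.
by move: main; rewrite !expr_div_n; lra.
Qed.

Lemma expRN_bounds (x : R) : 0 <= x -> 1 - x <= expR (- x) <= 1 - x + x ^+ 2.
Proof.
move=> x0; rewrite expR_ge1Dx/= expRN.
have h := expR_ge1Dx x.
rewrite (@le_trans _ _ (1 + x)^-1)//; first by rewrite lef_pV2// ?posrE ?expR_gt0//; lra.
rewrite -div1r ler_pdivrMr; last lra.
rewrite (_ : _ * _ = 1 + x ^+ 3); last by ring.
by rewrite lerDl exprn_ge0.
Qed.

(** A fourth-order Taylor error in bounded form: the right side behaves as y^4 near 0, stays
    bounded, and has an explicit Gaussian expectation, which replaces a fourth moment. *)
Lemma cos_gauss (y : R) : `|cos y - expR (- (y ^+ 2 / 2))| <= 8 * (1 - expR (- y ^+ 2)) ^+ 2.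
Proof.
have y2 : 0 <= y ^+ 2 by exact: sqr_ge0.
have e1 : expR (- y ^+ 2) <= (1 + y ^+ 2)^-1.
  by rewrite expRN lef_pV2 ?posrE ?expR_gt0 ?expR_ge1Dx//; lra.
have e2 : y ^+ 2 / (1 + y ^+ 2) <= 1 - expR (- y ^+ 2).
  by rewrite (le_trans _ (lerB (lexx 1) e1))// le_eqVlt; apply/orP; left; apply/eqP; field; lra.
have [y1|y1] := leP (y ^+ 2) 1.
  have e3 : y ^+ 2 / 2 <= 1 - expR (- y ^+ 2).
    by rewrite (le_trans _ e2)// ler_wpM2l// lef_pV2 ?posrE//; lra.
  have e4 : y ^+ 4 / 4 <= (1 - expR (- y ^+ 2)) ^+ 2.
    rewrite (_ : y ^+ 4 / 4 = (y ^+ 2 / 2) ^+ 2); last by field.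
    by rewrite lerXn2r ?nnegrE//; lra.
  have y20 : 0 <= y ^+ 2 / 2 by lra.
  have := cos_taylor y; have := expRN_bounds y20.
  rewrite (_ : (y ^+ 2 / 2) ^+ 2 = y ^+ 4 / 4); last by field.
  by rewrite !ler_norml => /andP[? ?] /andP[? ?]; apply/andP; split; lra.
have e3 : 1 / 2 <= 1 - expR (- y ^+ 2).
  by rewrite (le_trans _ e2)// ler_pdivlMr; lra.
have e4 : (1 / 2) ^+ 2 <= (1 - expR (- y ^+ 2)) ^+ 2 by rewrite lerXn2r ?nnegrE//; lra.
have := cos_le1 y; have := cos_geN1 y; have := expR_ge0 (- (y ^+ 2 / 2)).
have : expR (- (y ^+ 2 / 2)) <= 1 by rewrite expR_le1; lra.
by rewrite ler_norml; move: e4; rewrite expr2 => *; apply/andP; split; lra.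
Qed.

Lemma inv_sqrt_bounds (s : R) : 0 <= s ->
  `|(Num.sqrt (1 + s))^-1 - (1 - s / 2)| <= s ^+ 2.
Proof.
move=> s0; set r := Num.sqrt (1 + s).
have r2 : r ^+ 2 = 1 + s by rewrite sqr_sqrtr//; lra.
have r0 : 0 <= r by exact: sqrtr_ge0.
have r1 : 1 <= r by rewrite -(@ler_pXn2r _ 2) ?nnegrE// r2 expr1n; lra.
have -> : s = r ^+ 2 - 1 by rewrite r2; ring.
have rn : r != 0 by rewrite gt_eqF//; lra.
have -> : r^-1 - (1 - (r ^+ 2 - 1) / 2) = (r - 1) ^+ 2 * ((r + 2) / (2 * r)) by field.
have h0 : 0 <= (r + 2) / (2 * r) by rewrite divr_ge0; lra.
rewrite ger0_norm; last by rewrite mulr_ge0// sqr_ge0.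
have -> : (r ^+ 2 - 1) ^+ 2 = (r - 1) ^+ 2 * (r + 1) ^+ 2 by ring.
rewrite ler_wpM2l ?sqr_ge0// (@le_trans _ _ 2)//; first by rewrite ler_pdivrMr; lra.
by rewrite expr2; nra.
Qed.

End taylor.

Section gaussian.
Context d (T : measurableType d) (R : realType) (P : probability T R).
Variables (X : T -> R) (sigma : R).
Hypothesis sigma_gt0 : 0 < sigma.
Hypothesis mX : measurable_fun setT X.
Hypothesis lawX : forall A : set R, measurable A -> P [set w | A (X w)] = normal_prob 0 sigma A.

Let mpdf : measurable_fun setT (@normal_pdf R 0 sigma). Proof. exact: measurable_normal_pdf. Qed.

Let law (f : R -> R) : (forall x, 0 <= f x) -> bmeas f ->
  (Ex P (fun w => f (X w)))%:E = (\int[lebesgue_measure]_x (f x * normal_pdf 0 sigma x)%:E)%E.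
Proof.
by move=> f0 bf; apply: (@Ex_density _ _ _ P X (normal_prob 0 sigma)) => // x; exact: normal_pdf_ge0.
Qed.

Let bexp (t : R) : 0 <= t -> bmeas (fun x : R => expR (- (t * x ^+ 2))).
Proof.
move=> t0; split; last first.
  by exists 1 => x; rewrite ger0_norm ?expR_ge0// expR_le1 oppr_le0 mulr_ge0 ?sqr_ge0.
apply: measurableT_comp => //; apply: measurableT_comp => //.
by apply: measurable_funM => //; exact: measurable_funX.
Qed.

Lemma bmeas_comp_rv (f : R -> R) : bmeas f -> bmeas (fun w => f (X w)).
Proof. by move=> [mf [C fC]]; split; [exact: measurableT_comp|exists C => w]. Qed.

(** The exponential times the density is 1/q times the centred Gaussian density of deviation sigma /
    q. *)
Lemma gaussian_exp_sqr (t : R) : 0 <= t ->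
  Ex P (fun w => expR (- (t * X w ^+ 2))) = (Num.sqrt (1 + 2 * t * sigma ^+ 2))^-1.
Proof.
move=> t0; apply: EFin_inj; rewrite (law (fun x => expR_ge0 _) (bexp t0)).
set q := Num.sqrt _; have s2 : 0 < sigma ^+ 2 by rewrite exprn_gt0.
have S0 : 0 <= 2 * t * sigma ^+ 2 by apply: mulr_ge0 (ltW s2); apply: mulr_ge0.
have q2 : q ^+ 2 = 1 + 2 * t * sigma ^+ 2.
  by rewrite sqr_sqrtr// addr_ge0.
have q0 : 0 < q by rewrite sqrtr_gt0 ltr_wpDr.
have s'0 : sigma / q != 0 by rewrite mulf_neq0 ?invr_neq0 ?gt_eqF.
transitivity (\int[lebesgue_measure]_x ((q^-1)%:E * (normal_pdf 0 (sigma / q) x)%:E))%E.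
  apply: eq_integral => x _; rewrite -EFinM (normal_pdfE _ (lt0r_neq0 sigma_gt0)) (normal_pdfE _ s'0).
  congr EFin.
  rewrite [LHS]mulrCA [RHS]mulrA; congr (_ * _).
    rewrite /normal_peak expr_div_n.
    have -> : sigma ^+ 2 / q ^+ 2 * pi *+ 2 = (sigma ^+ 2 * pi *+ 2) / q ^+ 2.
      by rewrite !mulr2n; ring.
    rewrite sqrtrM ?mulrn_wge0 ?mulr_ge0 ?pi_ge0 ?ltW// sqrtrV ?sqr_ge0// sqrtr_sqr gtr0_norm//.
    by rewrite invfM invrK mulrCA mulVf ?mulr1// gt_eqF.
  rewrite /normal_fun -expRD subr0; congr expR.
  rewrite expr_div_n q2 !mulr2n; field.
  by rewrite -q2 !gt_eqF ?exprn_gt0 ?addr_gt0.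
by rewrite integralZl//= ?integral_normal_pdf ?mule1//; exact: integrable_normal_pdf.
Qed.

Lemma gaussian_sin (th : R) : Ex P (fun w => sin (th * X w)) = 0.
Proof.
(* [Ex_density] takes nonnegative functions, so the symmetry is applied to 1 + sin and 1 - sin,
   which the reflection exchanges. *)
have bs (e : R) : bmeas (fun x : R => 1 + e * sin (th * x)).
  apply: bmeasD; first exact: bmeas_cst.
  apply: bmeasZ; split; last by exists 1 => x; exact: sin_max.
  apply: measurableT_comp; first exact: continuous_measurable_fun (@continuous_sin R).
  exact: measurable_funM.
have p0 (e x : R) : `|e| = 1 -> 0 <= 1 + e * sin (th * x).
  move=> e1; have : `|e * sin (th * x)| <= 1 by rewrite normrM e1 mul1r sin_max.
  by rewrite ler_norml => /andP[? _]; lra.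
have n1 : `|1 : R| = 1 by rewrite normr1.
have n2 : `|-1 : R| = 1 by rewrite normrN normr1.
have bX := bmeas_comp_rv (bs 1).
have bX' := bmeas_comp_rv (bs (-1)).
have bsX : bmeas (fun w => sin (th * X w)).
  have := bmeasB bX (bmeas_cst _ 1); rewrite (_ : (fun w => _ - _) = fun w => sin (th * X w))//.
  by apply/funext => w; ring.
suff : Ex P (fun w => 1 + 1 * sin (th * X w)) = Ex P (fun w => 1 + -1 * sin (th * X w)).
  rewrite !ExD ?ExZ ?Ex_cst//; try exact: bmeas_cst; try exact: bmeasZ.
  lra.
apply: EFin_inj; rewrite (law (fun x => p0 1 x n1) (bs 1)) (law (fun x => p0 (-1) x n2) (bs (-1))).
pose f x := ((1 + 1 * sin (th * x)) * normal_pdf 0 sigma x)%:E : \bar R.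
have mf : measurable_fun setT f.
  by apply/measurable_EFinP; apply: measurable_funM => //; exact: (bs 1).1.
transitivity (\int[lebesgue_measure]_(x in (-%R : R -> measurableTypeR R) @^-1` setT) (f \o (-%R : R -> measurableTypeR R)) x)%E; last first.
  rewrite preimage_setT; apply: eq_integral => x _; rewrite /f/=; congr (_%:E).
  have -> : th * - x = - (th * x) by ring.
  rewrite sinN; have -> : 1 + 1 * - sin (th * x) = 1 + -1 * sin (th * x) by ring.
  congr (_ * _).
  by rewrite !(normal_pdfE _ (lt0r_neq0 sigma_gt0)) /normal_fun !subr0 sqrrN.
have f0 x : (0 <= f x)%E by rewrite lee_fin mulr_ge0 ?normal_pdf_ge0// p0.
rewrite -ge0_integral_pushforward//=.
by apply: eq_measure_integral => A mA _; exact/esym/lebesgue_measureN.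
Qed.

(** After expanding the square the orders 0 and 1 in S = t sigma^2 cancel; 24 is 2 times 2^2 plus
    4^2, from [inv_sqrt_bounds] at 2S and 4S. *)
Lemma gaussian_fourth (t : R) : 0 <= t ->
  Ex P (fun w => (1 - expR (- (t * X w ^+ 2))) ^+ 2) <= 24 * t ^+ 2 * sigma ^+ 4.
Proof.
move=> t0; have b1 := bmeas_comp_rv (bexp t0).
have t20 : 0 <= 2 * t by rewrite mulr_ge0.
have b2 := bmeas_comp_rv (bexp t20).
have -> : (fun w => (1 - expR (- (t * X w ^+ 2))) ^+ 2) =
    (fun w => (1 - 2 * expR (- (t * X w ^+ 2))) + expR (- (2 * t * X w ^+ 2))).
  apply/funext => w; have -> : - (2 * t * X w ^+ 2) = - (t * X w ^+ 2) + - (t * X w ^+ 2) by ring.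
  by rewrite expRD; ring.
rewrite ExD//; last by apply: bmeasB; [exact: bmeas_cst|exact: bmeasZ].
rewrite ExB//; [|exact: bmeas_cst|exact: bmeasZ].
rewrite ExZ// Ex_cst !gaussian_exp_sqr//.
set S := t * sigma ^+ 2; have S0 : 0 <= S by rewrite mulr_ge0 ?sqr_ge0.
have -> : 2 * t * sigma ^+ 2 = 2 * S by rewrite /S; ring.
have -> : 2 * (2 * t) * sigma ^+ 2 = 4 * S by rewrite /S; ring.
have -> : 24 * t ^+ 2 * sigma ^+ 4 = 24 * S ^+ 2 by rewrite /S; ring.
have h2 : 0 <= 2 * S by lra.
have h4 : 0 <= 4 * S by lra.
have := inv_sqrt_bounds h2; have := inv_sqrt_bounds h4.
rewrite !ler_norml !exprMn => /andP[_ ?] /andP[? _]; lra.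
Qed.

(** The constant is 8 * 24 + 1: [cos_gauss] with [gaussian_fourth], then [inv_sqrt_bounds]. *)
Lemma gaussian_cos (th : R) :
  `|Ex P (fun w => cos (th * X w)) - (1 - th ^+ 2 * sigma ^+ 2 / 2)| <= 193 * th ^+ 4 * sigma ^+ 4.
Proof.
have bc : bmeas (fun w => cos (th * X w)) by exact: bmeas_cos.
have t2 : 0 <= th ^+ 2 by exact: sqr_ge0.
have t22 : 0 <= th ^+ 2 / 2 by lra.
have be := bmeas_comp_rv (bexp t22).
have b1 : bmeas (fun w => (1 - expR (- (th ^+ 2 * X w ^+ 2))) ^+ 2).
  under eq_fun do rewrite expr2; have b := bmeas_comp_rv (bexp t2).
  by apply: bmeasM; apply: bmeasB => //; exact: bmeas_cst.
have h1 : `|Ex P (fun w => cos (th * X w)) - Ex P (fun w => expR (- (th ^+ 2 / 2 * X w ^+ 2)))|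
    <= 8 * Ex P (fun w => (1 - expR (- (th ^+ 2 * X w ^+ 2))) ^+ 2).
  rewrite -ExB// -ExZ// (le_trans (Ex_norm_le _ _))//; first exact: bmeasB.
  apply: Ex_le; [exact/bmeas_norm/bmeasB|exact: bmeasZ|move=> w].
  have := cos_gauss (th * X w); rewrite exprMn.
  by rewrite (_ : th ^+ 2 * X w ^+ 2 / 2 = th ^+ 2 / 2 * X w ^+ 2)//; field.
have h2 := gaussian_fourth t2.
rewrite gaussian_exp_sqr// in h1.
have S0 : 0 <= th ^+ 2 * sigma ^+ 2 by rewrite mulr_ge0 ?sqr_ge0.
have := inv_sqrt_bounds S0.
move: h1; rewrite (_ : 2 * (th ^+ 2 / 2) * sigma ^+ 2 = th ^+ 2 * sigma ^+ 2); last by field.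
rewrite (_ : (th ^+ 2 * sigma ^+ 2) ^+ 2 = th ^+ 4 * sigma ^+ 4); last by ring.
rewrite (_ : 24 * (th ^+ 2) ^+ 2 * sigma ^+ 4 = 24 * (th ^+ 4 * sigma ^+ 4)) in h2; last by ring.
rewrite -mulrA; rewrite !ler_norml => /andP[? ?] /andP[? ?]; lra.
Qed.

Lemma gaussian_tail (q : R) : 0 < q -> Ex P (fun w => (q < `|X w|)%R%:R) <=
  24 * sigma ^+ 4 / (1 - expR (- q ^+ 2)) ^+ 2.
Proof.
move=> q0; have b := bmeas_comp_rv (bexp ler01).
have b1 : bmeas (fun w => (1 - expR (- (1 * X w ^+ 2))) ^+ 2).
  by under eq_fun do rewrite expr2; apply: bmeasM; apply: bmeasB => //; exact: bmeas_cst.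
have e0 : 0 < 1 - expR (- q ^+ 2) by rewrite subr_gt0 expR_lt1 oppr_lt0 exprn_gt0.
have b2 : bmeas (fun w => (q < `|X w|)%R%:R : R).
  have := bmeasB (bmeas_cst _ 1) (bmeas_norm_le q mX).
  rewrite (_ : (fun w => _ - _) = fun w => (q < `|X w|)%R%:R)//.
  by apply/funext => w; rewrite ltNge; case: (_ <= _); rewrite ?subrr ?subr0.
have := gaussian_fourth ler01; rewrite expr1n mulr1 => h.
rewrite ler_pdivlMr ?exprn_gt0// (le_trans _ h)// mulrC -ExZ//.
apply: Ex_le => //; first exact: bmeasZ.
move=> w; case: (ltP q `|X w|) => h'; rewrite ?mulr0 ?sqr_ge0// mulr1 mul1r.
rewrite lerXn2r ?nnegrE ?(ltW e0)//; last first.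
  apply: lerB => //; rewrite ler_expR lerN2 -[leRHS](real_normK (num_real (X w))).
  by rewrite lerXn2r ?nnegrE//; exact: ltW.
by rewrite subr_ge0 expR_le1 oppr_le0 sqr_ge0.
Qed.

End gaussian.

(** * Brownian motion *)

Section first_order.
Variable R : realType.

Definition mesh (N : nat) : R := N.+1%:R^-1.

Lemma mesh_gt0 N : 0 < mesh N. Proof. by rewrite invr_gt0. Qed.

Lemma mesh_le1 N : mesh N <= 1. Proof. by rewrite invf_le1 ?ler1n. Qed.

Lemma mesh_cvg0 : mesh @ \oo --> (0 : R). Proof. exact: cvg_harmonic. Qed.

Definition first_order (x : nat -> R) (a : R) := exists2 C : R, 0 <= C &
  forall N, `|x N - (1 - a * mesh N)| <= C * mesh N ^+ 2.

Lemma first_orderM x y a b : first_order x a -> first_order y b ->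
  first_order (fun N => x N * y N) (a + b).
Proof.
move=> [C C0 xa] [D D0 yb].
exists (C * (1 + `|b| + D) + (1 + `|a|) * D + `|a * b|) => [|N].
  by rewrite !addr_ge0 ?mulr_ge0 ?addr_ge0.
have h0 := mesh_gt0 N; have h1 := mesh_le1 N; have := xa N; have := yb N.
set h := mesh N in h0 h1 *; move=> hy hx.
have h2 : h ^+ 2 <= 1 by rewrite exprn_ile1// ltW.
have -> : x N * y N - (1 - (a + b) * h) =
  (x N - (1 - a * h)) * y N + (1 - a * h) * (y N - (1 - b * h)) + a * b * h ^+ 2 by ring.
have ny : `|y N| <= 1 + `|b| + D.
  have -> : y N = 1 - b * h + (y N - (1 - b * h)) by ring.
  rewrite (le_trans (ler_normD _ _))// lerD//.
    rewrite (le_trans (ler_normB _ _))// normr1 lerD2l// normrM ler_piMr//.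
    by rewrite gtr0_norm.
  by rewrite (le_trans hy)// ler_piMr.
have na : `|1 - a * h| <= 1 + `|a|.
  rewrite (le_trans (ler_normB _ _))// normr1 lerD2l// normrM ler_piMr//.
  by rewrite gtr0_norm.
rewrite (le_trans (ler_normD _ _))// [leRHS]mulrDl lerD//; last first.
  by rewrite normrM ler_wpM2l// ger0_norm// sqr_ge0.
rewrite (le_trans (ler_normD _ _))// [leRHS]mulrDl lerD// normrM.
  by rewrite [C * _ * _]mulrAC ler_pM.
by rewrite -mulrA ler_pM.
Qed.

Lemma first_order_prod (I : Type) (s : seq I) (x : I -> nat -> R) (a : I -> R) :
  (forall i, first_order (x i) (a i)) ->
  first_order (fun N => \prod_(i <- s) x i N) (\sum_(i <- s) a i).
Proof.
move=> h; elim: s => [|i s ih].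
  by exists 0 => // N; rewrite !big_nil mul0r subr0 subrr normr0 mul0r.
have [C C0 hC] := first_orderM (h i) ih.
by exists C => // N; rewrite !big_cons.
Qed.

Lemma first_order_exp (c : R) : 0 <= c -> first_order (fun N => expR (- (c * mesh N))) c.
Proof.
move=> c0; exists (c ^+ 2); first exact: sqr_ge0.
move=> N; have h0 : 0 <= c * mesh N by rewrite mulr_ge0// ltW// mesh_gt0.
have := expRN_bounds h0; rewrite exprMn => /andP[? ?].
by rewrite ger0_norm; lra.
Qed.

Lemma first_order_near x a e : first_order x a -> 0 < e ->
  \forall N \near \oo, `|x N - (1 - a * mesh N)| <= e * mesh N.
Proof.
move=> [C C0 hC] e0.
have C1 : 0 < e / (C + 1) by rewrite divr_gt0// ltr_wpDl.
have := mesh_cvg0 => /cvgrPdist_le /(_ _ C1); apply: filterS => N.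
rewrite sub0r normrN gtr0_norm ?mesh_gt0// => hN.
rewrite (le_trans (hC N))// expr2 mulrA ler_wpM2r ?(ltW (mesh_gt0 N))//.
rewrite (le_trans (ler_wpM2l C0 hN))// mulrCA ler_piMr ?(ltW e0)//.
by rewrite ler_pdivrMr ?mul1r ?lerDl// ltr_wpDl.
Qed.

End first_order.

Section brownian_array.
Context (R : realType) d0 (T : measurableType d0) (P : probability T R) (d : nat).
Hypothesis d_gt0 : (0 < d)%N.
Variable B : R -> T -> 'rV[R]_d.
Hypothesis hB : is_brownian_motion d%:R^-1 P B.

Let h := @mesh R.
Let tk N k : R := k%:R * h N.

Definition bm_path (N j : nat) (w : T) (i : 'I_d) : R := B (j%:R * mesh R N) w 0 i.

Let inc N (ki : nat * 'I_d) w := B (tk N ki.1.+1) w 0 ki.2 - B (tk N ki.1) w 0 ki.2.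
Let F N (ki : nat * 'I_d) : set (set T) := [set [set w | A (inc N ki w)] | A in measurable].

Let tk0 N : 0 <= tk N 0. Proof. by rewrite /tk mul0r. Qed.

Let tkS N k : tk N k < tk N k.+1.
Proof. by rewrite /tk ltr_pM2r ?mesh_gt0// ltr_nat. Qed.

Let tk_ge0 N k : 0 <= tk N k.
Proof. by rewrite mulr_ge0// ltW// mesh_gt0. Qed.

Let mB N j i : measurable_fun setT (fun w => bm_path N j w i).
Proof. by case: hB => h1 _ _ _ _; apply: h1; exact: tk_ge0. Qed.

Let minc N ki : measurable_fun setT (inc N ki).
Proof. by apply: measurable_funB; exact: mB. Qed.

Let Fm N ki : F N ki `<=` measurable.
Proof. by move=> _ [A mA <-]; rewrite -[X in measurable X]setTI; exact: minc. Qed.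

Let FI N ki : setI_closed (F N ki).
Proof.
by move=> _ _ [A mA <-] [C mC <-]; exists (A `&` C) => //; exact: measurableI.
Qed.

Let FT N ki : F N ki setT. Proof. by exists setT. Qed.

Let indF N : mutually_independent P (F N).
Proof. by case: hB => _ _ _ _; apply; [exact: tk0|exact: tkS]. Qed.

Let inc_past N (D : set (nat * 'I_d)) ki : D ki ->
  measurable_fun setT (inc N ki : past_type (F N) D -> R).
Proof. by move=> Dk _ A mA; rewrite setTI; apply: (measurable_past (@FT N) Dk); exists A. Qed.

Let path0 N w i : bm_path N 0 w i = 0.
Proof. by case: hB => _ B0 _ _ _; rewrite /bm_path mul0r B0 mxE. Qed.

Let path_inc N j w i : bm_path N j w i = \sum_(k < j) inc N (nat_of_ord k, i) w.
Proof.
elim: j => [|j ih]; first by rewrite path0 big_ord0.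
by rewrite big_ord_recr/= -ih /inc/= /tk addrC subrK.
Qed.

Let path_past N D j i : (forall k, (k < j)%N -> D (k, i)) ->
  measurable_fun setT ((fun w => bm_path N j w i) : past_type (F N) D -> R).
Proof.
move=> Dj; rewrite (_ : (fun w => _) = fun w => \sum_(k < j) inc N (nat_of_ord k, i) w).
  by apply: measurable_sum => k; apply: inc_past; exact: Dj.
by apply/funext => w; exact: path_inc.
Qed.

Let upto j : set (nat * 'I_d) := [set ki | (ki.1 < j)%N].

Let phi N (th : R) := Ex P (fun w => cos (th * inc N (0%N, Ordinal d_gt0) w)).

Let sig N : R := Num.sqrt (d%:R^-1 * mesh R N).

Let sig_gt0 N : 0 < sig N.
Proof. by rewrite sqrtr_gt0 mulr_gt0 ?invr_gt0 ?ltr0n ?mesh_gt0. Qed.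

Let sig2 N : sig N ^+ 2 = d%:R^-1 * mesh R N.
Proof. by rewrite sqr_sqrtr// mulr_ge0 ?invr_ge0// ltW// mesh_gt0. Qed.

Let law_inc N ki (A : set R) : measurable A ->
  P [set w | A (inc N ki w)] = normal_prob 0 (sig N) A.
Proof.
case: hB => _ _ _ nB _ mA; have := nB (tk N ki.1) (tk N ki.1.+1) ki.2 A.
rewrite tk_ge0 tkS => /(_ isT mA).
have -> : tk N ki.1.+1 - tk N ki.1 = mesh R N by rewrite /tk /h -natr1; ring.
exact.
Qed.

Let phiE N th j i : Ex P (fun w => cos (th * inc N (j, i) w)) = phi N th.
Proof.
have bc1 : bmeas (fun x : R => 1 + cos (th * x)).
  by apply: bmeasD; [exact: bmeas_cst|apply: bmeas_cos; exact: measurable_id].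
have p0 (x : R) : 0 <= 1 + cos (th * x) by have := cos_geN1 (th * x); lra.
have law ki := Ex_density (nu := normal_prob 0 (sig N)) (minc N ki)
  (measurable_normal_pdf 0 (sig N)) (normal_pdf_ge0 0 (sig N)) (fun A _ => erefl) (@law_inc N ki) p0 bc1.
have bc ki : bmeas (fun w => cos (th * inc N ki w)) by exact/bmeas_cos/minc.
suff : Ex P (fun w => 1 + cos (th * inc N (j, i) w)) =
    Ex P (fun w => 1 + cos (th * inc N (0%N, Ordinal d_gt0) w)).
  by rewrite !ExD// ?Ex_cst; [move/addrI|exact: bmeas_cst|exact: bmeas_cst].
by apply: EFin_inj; rewrite !law.
Qed.

(** In the addition formula the sine of the centred increment has mean 0. The variable [U] may
    contain increments of the other coordinates over the same step, which are independent of this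
    one. *)
Let one_coord N j (i : 'I_d) (th : R) (U : T -> R) :
  (forall D, (forall ki, (ki.1 < j)%N || (ki.1 == j) && (ki.2 != i) -> D ki) ->
    bmeas (U : past_type (F N) D -> R)) ->
  Ex P (fun w => U w * cos (th * bm_path N j.+1 w i)) =
  phi N th * Ex P (fun w => U w * cos (th * bm_path N j w i)).
Proof.
move=> bU; pose D1 := [set ki : nat * 'I_d | (ki.1 < j)%N || (ki.1 == j) && (ki.2 != i)].
pose D2 := [set (j, i)].
have D12 : D1 `&` D2 = set0.
  apply/seteqP; split => // -[k l] [/= /orP[kj|/andP[_ /= li]] [kE lE]].
    by rewrite kE ltnn in kj.
  by rewrite lE eqxx in li.
have stepE w : bm_path N j.+1 w i = bm_path N j w i + inc N (j, i) w.
  by rewrite !path_inc big_ord_recr.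
have mp : measurable_fun setT ((fun w => bm_path N j w i) : past_type (F N) D1 -> R).
  by apply: path_past => k kj; rewrite /D1/= kj.
have bc1 : bmeas ((fun w => cos (th * bm_path N j w i)) : past_type (F N) D1 -> R).
  exact: bmeas_cos.
have bs1 : bmeas ((fun w => sin (th * bm_path N j w i)) : past_type (F N) D1 -> R).
  split; last by exists 1 => w; exact: sin_max.
  apply: measurableT_comp; first exact: continuous_measurable_fun (@continuous_sin R).
  exact: measurable_funM.
have mi : measurable_fun setT (inc N (j, i) : past_type (F N) D2 -> R) by exact: inc_past.
have bc2 : bmeas ((fun w => cos (th * inc N (j, i) w)) : past_type (F N) D2 -> R).
  exact: bmeas_cos.
have bs2 : bmeas ((fun w => sin (th * inc N (j, i) w)) : past_type (F N) D2 -> R).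
  split; last by exists 1 => w; exact: sin_max.
  apply: measurableT_comp; first exact: continuous_measurable_fun (@continuous_sin R).
  exact: measurable_funM.
have bU1 := bU D1 (fun ki hk => hk).
have past D (V : past_type (F N) D -> R) : bmeas V -> bmeas (V : T -> R).
  by apply: bmeas_past; exact: Fm.
rewrite (_ : (fun w => U w * cos (th * bm_path N j.+1 w i)) = (fun w =>
    U w * cos (th * bm_path N j w i) * cos (th * inc N (j, i) w) -
    U w * sin (th * bm_path N j w i) * sin (th * inc N (j, i) w))); last first.
  by apply/funext => w; rewrite stepE mulrDr cosD mulrBr !mulrA.
have bUc : bmeas ((fun w => U w * cos (th * bm_path N j w i)) : past_type (F N) D1 -> R).
  exact: bmeasM.
have bUs : bmeas ((fun w => U w * sin (th * bm_path N j w i)) : past_type (F N) D1 -> R).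
  exact: bmeasM.
rewrite ExB; last 2 first.
- by apply: bmeasM; [exact: past _ _ bUc|exact: past _ _ bc2].
- by apply: bmeasM; [exact: past _ _ bUs|exact: past _ _ bs2].
rewrite (mutual_indep_Ex (@Fm N) (@FI N) (@FT N) (@indF N) D12 bUc bc2).
rewrite (mutual_indep_Ex (@Fm N) (@FI N) (@FT N) (@indF N) D12 bUs bs2).
rewrite (gaussian_sin (sig_gt0 N) (minc N _) (@law_inc N _)) mulr0 subr0 phiE.
by rewrite mulrC.
Qed.

Let one_step N j (th : 'I_d -> R) (W : T -> R) :
  (forall D, (forall ki, (ki.1 < j)%N -> D ki) -> bmeas (W : past_type (F N) D -> R)) ->
  Ex P (fun w => PhiR th (bm_path N j.+1 w) * W w) =
  (\prod_i phi N (th i)) * Ex P (fun w => PhiR th (bm_path N j w) * W w).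
Proof.
(* Coordinates are advanced one at a time: those in [S] are at time j + 1, the others still at time
   j. *)
move=> bW; pose g (S : seq 'I_d) w := \prod_i cos (th i * bm_path N (j + (i \in S)) w i).
have main (S : seq 'I_d) : uniq S -> Ex P (fun w => g S w * W w) =
    (\prod_(i <- S) phi N (th i)) * Ex P (fun w => g [::] w * W w).
  elim: S => [_|i S ih /= /andP[iS uS]]; first by rewrite big_nil mul1r.
  rewrite big_cons -mulrA -ih//.
  pose U w := W w * \prod_(l | l != i) cos (th l * bm_path N (j + (l \in S)) w l).
  have e1 : (fun w => g (i :: S) w * W w) = (fun w => U w * cos (th i * bm_path N j.+1 w i)).
    apply/funext => w; rewrite /g /U (bigD1 i)//= inE eqxx addn1 [RHS]mulrC [LHS]mulrAC -mulrA.
    by congr (_ * (_ * _)); apply: eq_bigr => l li; rewrite inE (negbTE li).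
  have e2 : (fun w => g S w * W w) = (fun w => U w * cos (th i * bm_path N j w i)).
    apply/funext => w; rewrite /g /U (bigD1 i)//= (negbTE iS) addn0 [RHS]mulrC [LHS]mulrAC.
    by rewrite -mulrA.
  rewrite e1 e2; apply: one_coord => D hD; apply: bmeasM.
    by apply: bW => ki kj; apply: hD; rewrite kj.
  apply: bmeas_prod => l li; apply: bmeas_cos; apply: path_past => k kj; apply: hD => /=.
  rewrite li andbT; case: (l \in S) kj; rewrite ?addn1 ?addn0 => kj; last by rewrite kj.
  by rewrite orbC -leq_eqVlt.
have := main (index_enum 'I_d) (index_enum_uniq _).
have -> : g (index_enum 'I_d) = (fun w => PhiR th (bm_path N j.+1 w)).
  by apply/funext => w; apply: eq_bigr => i _; rewrite mem_index_enum addn1.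
have -> : g [::] = (fun w => PhiR th (bm_path N j w)).
  by apply/funext => w; apply: eq_bigr => i _; rewrite addn0.
by [].
Qed.

Let phi_first th : first_order (phi^~ th) (th ^+ 2 / (2 * d%:R)).
Proof.
have d0' : d%:R != 0 :> R by rewrite pnatr_eq0 -lt0n.
exists (193 * th ^+ 4 / d%:R ^+ 2) => [|N].
  by rewrite divr_ge0 ?sqr_ge0// mulr_ge0// exprn_even_ge0.
have := gaussian_cos (sig_gt0 N) (minc N _) (@law_inc N (0%N, Ordinal d_gt0)) th.
rewrite (_ : sig N ^+ 4 = (sig N ^+ 2) ^+ 2); last by ring.
rewrite !sig2 -/(phi N th).
rewrite (_ : th ^+ 2 * (d%:R^-1 * mesh R N) / 2 = th ^+ 2 / (2 * d%:R) * mesh R N); last by field.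
by rewrite (_ : 193 * th ^+ 4 * _ = 193 * th ^+ 4 / d%:R ^+ 2 * mesh R N ^+ 2)//; field.
Qed.

Lemma brownian_heat_array (c : R) : 0 <= c ->
  heat_array P bm_path (fun N j _ => expR (- (c * (j%:R * mesh R N)))) (@mesh R) c.
Proof.
move=> c0; have bstay r N j D : (forall ki : nat * 'I_d, (ki.1 < j)%N -> D ki) ->
    bmeas (stay (bm_path N) r j : past_type (F N) D -> R).
  move=> hD; apply: bmeas_prod => l _; apply: bmeas_cube => i; apply: path_past => k kl.
  by apply: hD => /=; rewrite (leq_trans kl)// -ltnS.
have past N D (U : past_type (F N) D -> R) : bmeas U -> bmeas (U : T -> R).
  by apply: bmeas_past; exact: Fm.
split.
- by move=> N j i; exact: mB.
- by move=> N w i; exact: path0.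
- by move=> N j; exact: measurable_cst.
- move=> N j w; rewrite expR_ge0/= expR_le1 oppr_le0 mulr_ge0//; exact: tk_ge0.
- by move=> N w; rewrite mul0r mulr0 oppr0 expR0.
- by move=> N j w; rewrite ler_expR lerN2 ler_wpM2l// ltW// tkS.
- by near=> N; exact: mesh_gt0.
- move=> th r e r0 e0.
  have fo : first_order (fun N => expR (- (c * mesh R N)) * \prod_i phi N (th i)) (kap th + c).
    have -> : kap th + c = c + \sum_i th i ^+ 2 / (2 * d%:R).
      by rewrite addrC /kap mulr_sumr; congr (_ + _); apply: eq_bigr => i _; rewrite mulrC.
    apply: first_orderM; first exact: first_order_exp.
    by apply: first_order_prod => i; exact: phi_first.
  near=> N => j.
  have fN : `|expR (- (c * mesh R N)) * \prod_i phi N (th i) - (1 - (kap th + c) * mesh R N)|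
      <= e * mesh R N by near: N; exact: first_order_near.
  set z := expR (- (c * (j%:R * mesh R N))).
  have zS : expR (- (c * (j.+1%:R * mesh R N))) = expR (- (c * mesh R N)) * z.
    by rewrite -expRD -natr1; congr expR; ring.
  have bs := past N _ _ (bstay r N j (upto j) (fun ki hk => hk)).
  rewrite zS.
  have -> : (fun w => PhiR th (bm_path N j.+1 w) * (expR (- (c * mesh R N)) * z * stay (bm_path N) r j w)) =
      (fun w => expR (- (c * mesh R N)) * (PhiR th (bm_path N j.+1 w) * (z * stay (bm_path N) r j w))).
    by apply/funext => w; ring.
  have bP k : bmeas (fun w => PhiR th (bm_path N k w)) by apply: bmeas_PhiR => i; exact: mB.
  have bzs : bmeas (fun w => z * stay (bm_path N) r j w) by exact: bmeasZ.
  rewrite ExZ; last exact: bmeasM.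
  rewrite one_step; last by move=> D hD; apply: bmeasZ; exact: bstay.
  rewrite mulrA -mulrBl normrM ler_pM//.
  rewrite (le_trans (Ex_norm_le _ (bmeasM (bP j) bzs)))// Ex_le//.
    exact/bmeas_norm/bmeasM.
  move=> w; have z0 : 0 <= z * stay (bm_path N) r j w.
    by rewrite mulr_ge0 ?expR_ge0//; case/andP: (stay01 (bm_path) r N j w).
  by rewrite normrM (ger0_norm z0) ler_piMl ?PhiR_norm.
- move=> q r e q0 r0 e0.
  (* A union bound over the d coordinates with [gaussian_tail] at variance h / d: a large jump has
     probability at most K h^2, which is o(h). *)
  pose K : R := d%:R * (24 / d%:R ^+ 2 / (1 - expR (- q ^+ 2)) ^+ 2).
  have K0 : 0 <= K by apply: mulr_ge0 => //; apply: divr_ge0 (sqr_ge0 _); apply: divr_ge0 (sqr_ge0 _).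
  have fo : first_order (fun N => 1 + K * mesh R N ^+ 2) 0.
    by exists K => // N; rewrite mul0r subr0 addrC addKr ger0_norm// mulr_ge0// sqr_ge0.
  near=> N => j.
  have fN : `|1 + K * mesh R N ^+ 2 - (1 - 0 * mesh R N)| <= e * mesh R N.
    by near: N; exact: first_order_near.
  have bs := past N _ _ (bstay r N j (upto j) (fun ki hk => hk)).
  set z := expR _; pose W w := z * stay (bm_path N) r j w.
  have bW D : (forall ki : nat * 'I_d, (ki.1 < j)%N -> D ki) -> bmeas (W : past_type (F N) D -> R).
    by move=> hD; apply: bmeasZ; exact: bstay.
  have W0 w : 0 <= W w.
    by rewrite mulr_ge0 ?expR_ge0//; case/andP: (stay01 (bm_path) r N j w).
  have bW' : bmeas W := past N _ _ (bW (upto j) (fun ki hk => hk)).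
  have btail D ki : D ki -> bmeas ((fun w => (q < `|inc N ki w|)%R%:R) : past_type (F N) D -> R).
    move=> Dk; have := bmeasB (bmeas_cst _ 1) (bmeas_norm_le q (@inc_past N D ki Dk)).
    rewrite (_ : (fun w => _ - _) = fun w => (q < `|inc N ki w|)%R%:R)//.
    by apply/funext => w; rewrite ltNge; case: (_ <= _); rewrite ?subrr ?subr0.
  have bt ki : bmeas (fun w : T => (q < `|inc N ki w|)%R%:R : R).
    exact: (past N _ _ (btail [set ki] ki erefl)).
  apply: (@le_trans _ _ (Ex P (fun w => \sum_i (q < `|inc N (j, i) w|)%R%:R * W w))).
    apply: Ex_le; last 1 first.
    + move=> w; rewrite -mulr_suml ler_wpM2r ?W0//.
      case: (boolP (cube q (fun i => bm_path N j.+1 w i - bm_path N j w i))) => [_|]; first by rewrite sumr_ge0.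
      rewrite negb_forall => /existsP[i hi]; rewrite (bigD1 i)//=.
      by rewrite /inc/= /tk -/(bm_path N j.+1 w i) ltNge hi lerDl sumr_ge0.
    + apply: bmeasM => //.
      have := bmeasB (bmeas_cst _ 1) (bmeas_cube q (X := fun w i => inc N (j, i) w) (fun i => minc N (j, i))).
      rewrite (_ : (fun w => _ - _) = fun w => (~~ cube q (fun i => bm_path N j.+1 w i - bm_path N j w i))%:R)//.
      by apply/funext => w; rewrite -[cube q _]/(cube q _); case: (cube _ _); rewrite ?subrr ?subr0.
    + by apply: bmeas_sum => i _; apply: bmeasM.
  rewrite Ex_sum; last by move=> i _; exact: bmeasM.
  have D12 i : [set (j, i)] `&` upto j = set0.
    by apply/seteqP; split => // -[k l] [/= [-> _]]; rewrite /upto/= ltnn.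
  under eq_bigr => i _ do rewrite (mutual_indep_Ex (@Fm N) (@FI N) (@FT N) (@indF N) (D12 i)
    (btail _ _ erefl) (bW (upto j) (fun ki hk => hk))).
  rewrite -mulr_suml ler_wpM2r ?Ex_ge0//.
  rewrite (@le_trans _ _ (K * mesh R N ^+ 2))//; last first.
    by rewrite (le_trans (ler_norm _))// (le_trans _ fN)// mul0r subr0 addrC addKr.
  apply: (@le_trans _ _ (\sum_(i < d) (24 * sig N ^+ 4 / (1 - expR (- q ^+ 2)) ^+ 2))).
    by apply: ler_sum => i _; exact: (gaussian_tail (sig_gt0 N) (minc N (j, i)) (@law_inc N (j, i)) q0).
  rewrite sumr_const card_ord -mulr_natl (_ : sig N ^+ 4 = (sig N ^+ 2) ^+ 2); last by ring.
  rewrite sig2 /K exprMn exprVn le_eqVlt; apply/orP; left; apply/eqP.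
  by move: (_ ^+ 2)^-1 (_ ^+ 2)^-1 => u v; ring.
Unshelve. all: by end_near. Qed.

End brownian_array.

(** * Exit time of Brownian motion *)

Section stopping.
Variable R : realType.

(** Decrements of [z] are subtracted while [b] has held so far, which leaves the value of [z] at the
    first failure, or at m. A stopped value is thus a finite sum of products, whose expectation can
    be taken term by term. *)
Lemma stop_telescope (z : nat -> R) (b : nat -> bool) m : exists K, [/\ (K <= m)%N,
  forall j, (j < K)%N -> b j, (K < m)%N -> ~~ b K &
  z 0%N - \sum_(j < m) (z j - z j.+1) * \prod_(l < j.+1) (b l)%:R = z K].
Proof.
suff [K [h1 h2 h3 h4 _]] : exists K, [/\ (K <= m)%N, forall j, (j < K)%N -> b j,
    (K < m)%N -> ~~ b K,
    z 0%N - \sum_(j < m) (z j - z j.+1) * \prod_(l < j.+1) (b l)%:R = z K &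
    \prod_(l < m) (b l)%:R = (K == m)%:R :> R].
  by exists K.
elim: m => [|m [K [Km bK nbK zK pK]]].
  by exists 0%N; split => //; rewrite big_ord0 ?subr0.
move: Km; rewrite leq_eqVlt => /orP[/eqP KE|Km]; last first.
  exists K; split; [exact: leqW (ltnW Km)|exact: bK|by move=> _; exact: nbK| |].
  - by rewrite big_ord_recr/= big_ord_recr/= pK (ltn_eqF Km) mul0r mulr0 addr0.
  - by rewrite big_ord_recr/= pK (ltn_eqF Km) mul0r ltn_eqF// ltnW.
subst K; have [bm|bm] := boolP (b m).
  exists m.+1; split => //.
  - by move=> j; rewrite ltnS leq_eqVlt => /orP[/eqP->//|]; exact: bK.
  - by rewrite ltnn.
  - rewrite big_ord_recr/= big_ord_recr/= pK eqxx bm !mulr1.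
    by rewrite opprD addrA zK; ring.
  - by rewrite big_ord_recr/= pK !eqxx bm mulr1.
exists m; split => //.
- by rewrite big_ord_recr/= big_ord_recr/= pK (negbTE bm) !mulr0 addr0.
- by rewrite big_ord_recr/= (negbTE bm) mulr0 ltn_eqF.
Qed.

Lemma bounded_cvg_Ex d0 (T : measurableType d0) (P : probability T R) (X : nat -> T -> R)
    (Y : T -> R) (C : R) : (forall n, measurable_fun setT (X n)) ->
  (forall n w, `|X n w| <= C) -> (forall w, X n w @[n --> \oo] --> Y w) ->
  [/\ bmeas Y & Ex P (X n) @[n --> \oo] --> Ex P Y].
Proof.
move=> mX XC XY.
have bX n : bmeas (X n) by split => //; exists C.
have mY : measurable_fun setT Y by apply: measurable_fun_cvg mX _ => w _; exact: XY.
have bY : bmeas Y.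
  split => //; exists C => w; apply/ler_addgt0Pr => e e0.
  have [n hn] : exists n, `|Y w - X n w| <= e.
    by apply: (@filter_ex _ \oo); move/cvgrPdist_le: (XY w); exact.
  have -> : Y w = X n w + (Y w - X n w) by rewrite addrC subrK.
  by rewrite (le_trans (ler_normD _ _))// lerD.
split => //.
have mX' n : measurable_fun setT (fun w => (X n w)%:E) by apply/measurable_EFinP.
have mY' : measurable_fun setT (fun w => (Y w)%:E) by apply/measurable_EFinP.
have XY' w : (X n w)%:E @[n --> \oo] --> (Y w)%:E.
  by apply: cvg_EFin; [exact: nearW|exact: XY].
have [_ _] := dominated_convergence measurableT mX' mY' (aeW P (fun w _ => XY' w))
  (bmeas_integrable P (bmeas_cst T C)) (aeW P (fun w n _ => XC n w)).
rewrite Ex_EFin// => /fine_cvgP[_]; apply: cvg_trans; apply: near_eq_cvg.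
by apply: nearW => n.
Qed.

End stopping.

Section laplace.
Variable R : realType.

(** The value at +oo is the limit 0. The value at -oo is immaterial for the exit times, which are
    nonnegative. *)
Definition lapl (c : R) (x : \bar R) : R := if x is r%:E then expR (- (c * r)) else 0.

Lemma xexp_le1 (x : R) : x * expR (- x) <= 1.
Proof.
rewrite expRN ler_pdivrMr ?expR_gt0// mul1r (le_trans _ (expR_ge1Dx x))//; lra.
Qed.

Lemma lapl_lip (c c' : R) x : 0 < c -> c <= c' -> (0 <= x)%E ->
  `|lapl c x - lapl c' x| <= (c' - c) / c.
Proof.
move=> c0 cc; have h0 : 0 <= (c' - c) / c by rewrite divr_ge0 ?subr_ge0// ltW.
case: x => [r| |] //=; rewrite ?subrr ?normr0// lee_fin => r0.
rewrite ger0_norm; last by rewrite subr_ge0 ler_expR lerN2 ler_wpM2r.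
have -> : expR (- (c' * r)) = expR (- (c * r)) * expR (- ((c' - c) * r)).
  by rewrite -expRD; congr expR; ring.
have h1 : 0 <= (c' - c) * r by rewrite mulr_ge0 ?subr_ge0.
rewrite -[X in X - _]mulr1 -mulrBr.
have := expRN_bounds h1 => /andP[h2 _].
rewrite (@le_trans _ _ (expR (- (c * r)) * ((c' - c) * r)))//.
  by rewrite ler_wpM2l ?expR_ge0//; lra.
rewrite ler_pdivlMr//.
have -> : expR (- (c * r)) * ((c' - c) * r) * c = (c' - c) * (c * r * expR (- (c * r))) by ring.
by rewrite ler_piMr ?subr_ge0// xexp_le1.
Qed.

End laplace.

Section grid_exit.
Context (R : realType) (d : nat).

Lemma mesh_near (e : R) : 0 < e -> \forall N \near \oo, mesh R N < e.
Proof.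
move=> e0; have := @mesh_cvg0 R => /cvgrPdist_lt /(_ _ e0); apply: filterS => N.
by rewrite sub0r normrN gtr0_norm ?mesh_gt0.
Qed.

Lemma unit_cubeE (x : 'rV[R]_d) : unit_cube R d x <-> cube 1 (fun i => x 0 i).
Proof. by split => [h|/forallP//]; apply/forallP. Qed.

Section one_path.
Variable b : R -> 'rV[R]_d.
Hypothesis b_cont : forall i, {within `[0, +oo[, continuous (fun t : R => b t 0 i)}.
Let tau := exit_time (unit_cube R d) b.

Lemma exit_time_ge0 : (0 <= tau)%E.
Proof. by apply: le_ereal_inf_tmp => _ [t [t0 _] <-]; rewrite lee_fin. Qed.

Lemma exit_open (t : R) : 0 <= t -> ~ unit_cube R d (b t) ->
  exists2 e, 0 < e & forall s, t <= s -> s < t + e -> ~ unit_cube R d (b s).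
Proof.
move=> t0 ht; have [i hi] : exists i, 1 < `|b t 0 i|.
  apply: contrapT => h; apply: ht => i; rewrite leNgt; apply/negP => h'.
  by apply: h; exists i.
have /continuous_within_itvcyP[ci c0'] : {within `[0, +oo[, continuous (fun t : R => b t 0 i)}.
  exact: b_cont.
have : \forall s \near t^'+, 1 < `|b s 0 i|.
  have cv : (fun s => `|b s 0 i|) @ t^'+ --> `|b t 0 i|.
    apply: cvg_norm; move: t0; rewrite le_eqVlt => /orP[/eqP <-//|t0].
    by apply: cvg_at_right_filter; apply: ci; rewrite in_itv/= t0.
  by move/cvgr_gt: cv; exact.
move=> [e /= e0 he]; exists e => // s; rewrite le_eqVlt => /orP[/eqP <-//|ts] se hs.
have := he s; rewrite /= distrC ger0_norm ?subr_ge0 ?(ltW ts)// => /(_ _ ts).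
by rewrite ltrBlDl => /(_ se); rewrite ltNge hs.
Qed.

(** The cube is closed and the path continuous, so being outside at time t lasts for a while, and a
    fine enough grid sees it. The (N+1)^2 points at distance 1/(N+1) reach time N + 1, which tends
    to infinity and covers the paths that never leave. *)
Lemma grid_exit_cvg (c : R) (K : nat -> nat) : 0 < c ->
  (forall N, (K N <= N.+1 ^ 2)%N) ->
  (forall N j, (j < K N)%N -> unit_cube R d (b (j%:R * mesh R N))) ->
  (forall N, (K N < N.+1 ^ 2)%N -> ~ unit_cube R d (b ((K N)%:R * mesh R N))) ->
  expR (- (c * ((K N)%:R * mesh R N))) @[N --> \oo] --> lapl c tau.
Proof.
move=> c0 K1 K2 K3.
have mm N : (N.+1 ^ 2)%:R * mesh R N = N.+1%:R.
  by rewrite natrX expr2 mulfK.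
case tE : tau => [r| |]; last 2 first.
- have KE N : K N = (N.+1 ^ 2)%N.
    apply/eqP; rewrite eqn_leq K1 leqNgt; apply/negP => /K3 h.
    have : (tau <= ((K N)%:R * mesh R N)%:E)%E.
      by apply: ereal_inf_lbound; exists ((K N)%:R * mesh R N) => //; split => //;
        rewrite mulr_ge0// ltW// mesh_gt0.
    by rewrite tE leye_eq.
  rewrite /lapl; under eq_cvg do rewrite KE mm.
  apply: (@squeeze_cvgr _ _ _ _ (fun=> 0) (fun N => c^-1 * mesh R N)).
  + near=> N; rewrite expR_ge0/= expRN /mesh -invfM lef_pV2 ?posrE ?expR_gt0 ?mulr_gt0//.
    by rewrite (le_trans _ (expR_ge1Dx _))// mulrC; lra.
  + exact: cvg_cst.
  + by rewrite -[X in _ --> X](mulr0 c^-1); apply: cvgM; [exact: cvg_cst|exact: mesh_cvg0].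
- by have := exit_time_ge0; rewrite tE.
rewrite /lapl; have r0 : 0 <= r by rewrite -lee_fin -tE exit_time_ge0.
suff cv : (fun N => (K N)%:R * mesh R N) @ \oo --> r.
  apply: continuous_cvg; first exact: continuous_expR.
  by apply: cvgN; apply: cvgM => //; exact: cvg_cst.
apply/cvgrPdist_le => e e0.
have e2 : 0 < e / 2 by rewrite divr_gt0.
have [t [t0 ht] te] : exists2 t, 0 <= t /\ ~ unit_cube R d (b t) & t < r + e / 2.
  have : (tau < (r + e / 2)%:E)%E by rewrite tE lte_fin ltrDl.
  by move=> /ereal_inf_lt[_ [t ht <-]]; rewrite lte_fin; exists t.
have [q q0 hq] := exit_open t0 ht.
near=> N.
have N1 : mesh R N < q.
  by near: N; exact: mesh_near.
have N2 : mesh R N < e / 2 by near: N; exact: mesh_near.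
have N3 : r <= N.+1%:R.
  by near: N; exists (Num.trunc r) => //= k /= hk; rewrite ltW// (lt_le_trans (truncnS_gt r))// ler_nat ltnS.
have h0 := mesh_gt0 R N.
rewrite ler_norml; apply/andP; split.
  pose j := (Num.trunc (t / mesh R N)).+1.
  have j1 : t < j%:R * mesh R N by rewrite -ltr_pdivrMr// truncnS_gt.
  have j2 : j%:R * mesh R N <= t + mesh R N.
    rewrite /j -natr1 mulrDl mul1r lerD2r -ler_pdivlMr// truncn_le// divr_ge0// ltW//.
  have Kj : (K N <= j)%N.
    rewrite leqNgt; apply/negP => /K2; apply: hq; first exact: ltW.
    by rewrite (le_lt_trans j2)// ltrD2l.
  have : (K N)%:R * mesh R N <= j%:R * mesh R N by rewrite ler_pM2r// ler_nat.
  by lra.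
have := K1 N; rewrite leq_eqVlt => /orP[/eqP ->|/K3 h].
  by rewrite mm; lra.
have : (tau <= ((K N)%:R * mesh R N)%:E)%E.
  by apply: ereal_inf_lbound; exists ((K N)%:R * mesh R N) => //; split => //;
        rewrite mulr_ge0// ltW// mesh_gt0.
by rewrite tE lee_fin; lra.
Unshelve. all: by end_near. Qed.

End one_path.
End grid_exit.

Section brownian_exit.
Context (R : realType) d0 (T : measurableType d0) (P : probability T R) (d : nat).
Hypothesis d_gt0 : (0 < d)%N.
Variable B : R -> T -> 'rV[R]_d.
Hypothesis hB : is_brownian_motion d%:R^-1 P B.

Definition exit_bm (w : T) : \bar R := exit_time (unit_cube R d) (B^~ w).

Let bc w i : {within `[0, +oo[, continuous (fun t : R => B t w 0 i)}.
Proof. by case: hB. Qed.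

Lemma exit_bm_ge0 w : (0 <= exit_bm w)%E. Proof. exact: exit_time_ge0. Qed.

Definition psi (c : R) : R := Ex P (fun w => lapl c (exit_bm w)).

Let z c N j : R := expR (- (c * (j%:R * mesh R N))).
Let st N j w := stay (bm_path B N) 1 j w.
Let X c N (m : nat) w := 1 - \sum_(j < m) (z c N j - z c N j.+1) * st N j w.

Let bst N j : bmeas (st N j).
Proof. exact: bchi (brownian_heat_array d_gt0 hB (lexx 0)) _ _ _. Qed.

Let bX c N m : bmeas (X c N m).
Proof. by apply: bmeasB; [exact: bmeas_cst|apply: bmeas_sum => j _; exact: bmeasZ]. Qed.

Let X_stop c N m w : exists K, [/\ (K <= m)%N,
  forall j, (j < K)%N -> unit_cube R d (B (j%:R * mesh R N) w),
  (K < m)%N -> ~ unit_cube R d (B (K%:R * mesh R N) w) & X c N m w = z c N K].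
Proof.
have [K [h1 h2 h3 h4]] := stop_telescope (z c N) (fun j => cube 1 (bm_path B N j w)) m.
exists K; split => //.
- by move=> j /h2 hj; apply/unit_cubeE.
- by move=> /h3/negP hj /unit_cubeE.
- by rewrite -h4 /X /z mul0r mulr0 oppr0 expR0.
Qed.

Let X01 c N m w : 0 <= c -> 0 <= X c N m w <= 1.
Proof.
move=> c0; have [K [_ _ _ ->]] := X_stop c N m w.
by rewrite expR_ge0/= expR_le1 oppr_le0 !mulr_ge0// ltW// mesh_gt0.
Qed.

Let X_cvg c w : 0 < c -> X c N (N.+1 ^ 2) w @[N --> \oo] --> lapl c (exit_bm w).
Proof.
move=> c0; have /choice[K hK] := fun N => X_stop c N (N.+1 ^ 2) w.
rewrite (_ : (fun N => _) = fun N => expR (- (c * ((K N)%:R * mesh R N)))).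
  apply: (grid_exit_cvg (b := B^~ w)) => //.
  - by move=> N; case: (hK N).
  - by move=> N j; case: (hK N) => _ h _ _; exact: h.
  - by move=> N; case: (hK N).
by apply/funext => N; case: (hK N).
Qed.

Let psi_cvg c : 0 < c -> bmeas (fun w => lapl c (exit_bm w)) /\
  Ex P (X c N (N.+1 ^ 2)) @[N --> \oo] --> psi c.
Proof.
move=> c0; have [] := @bounded_cvg_Ex R _ T P (fun N => X c N (N.+1 ^ 2))
  (fun w => lapl c (exit_bm w)) 1 (fun N => (bX c N _).1).
- move=> N w; have /andP[x0 x1] := X01 N (N.+1 ^ 2) w (ltW c0).
  by rewrite ger0_norm.
- by move=> w; exact: X_cvg.
by [].
Qed.

Lemma bmeas_lapl_exit c : 0 < c -> bmeas (fun w => lapl c (exit_bm w)).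
Proof. by move=> /psi_cvg[]. Qed.

(** The infimum over uncountably many times is recovered from exp(-tau), a pointwise limit of grid
    approximations, by taking a logarithm. *)
Lemma measurable_exit_bm : measurable_fun setT exit_bm.
Proof.
pose f (y : R) : \bar R := if y <= 0 then +oo%E else (- ln y)%:E.
rewrite (_ : exit_bm = fun w => f (lapl 1 (exit_bm w))).
  apply: (@measurableT_comp _ _ _ _ _ _ f); last exact: (bmeas_lapl_exit ltr01).1.
  apply: measurable_fun_ifT => //.
    by apply: measurable_fun_ler.
  apply/measurable_EFinP; apply: measurableT_comp => //; exact: measurable_ln.
apply/funext => w; rewrite /f; have := exit_bm_ge0 w.
case: (exit_bm w) => [r| |] //=; last by rewrite lexx.
by move=> _; rewrite leNgt expR_gt0/= expRK mul1r opprK.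
Qed.

(** The expectation of the integral of exp(-ct) up to the exit time. *)
Definition kill_rate_sum (c : R) : R := (1 - psi c) / c.

Lemma psi_continuous c : 0 < c -> {for c, continuous psi}.
Proof.
move=> c0; apply/cvgrPdist_le => /= e e0.
have lip (x y : R) : 0 < x -> x <= y -> `|psi x - psi y| <= (y - x) / x.
  move=> x0 xy; have y0 := lt_le_trans x0 xy.
  rewrite /psi -ExB; [|exact: bmeas_lapl_exit..].
  have b : bmeas (fun w => lapl x (exit_bm w) - lapl y (exit_bm w)).
    by apply: bmeasB; exact: bmeas_lapl_exit.
  rewrite (le_trans (Ex_norm_le _ b))// -[leRHS](Ex_cst P).
  apply: Ex_le; [exact: bmeas_norm|exact: bmeas_cst|move=> w].
  by apply: lapl_lip => //; exact: exit_bm_ge0.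
have e1 : 0 < Num.min (c / 2) (e * c / 2) by rewrite lt_min !divr_gt0 ?mulr_gt0.
near=> x.
have : `|c - x| < Num.min (c / 2) (e * c / 2).
  by near: x; exact: (@cvgr_dist_lt _ _ _ _ _ id c).
rewrite lt_min => /andP[h1 h2].
have x0 : c / 2 < x by move: h1; rewrite ltr_norml => /andP[_ ?]; lra.
have [cx|xc] := leP c x.
  rewrite (le_trans (lip _ _ c0 cx))// ler_pdivrMr//.
  by move: h2; rewrite ltr_norml => /andP[? _]; nra.
have x0' : 0 < x by lra.
rewrite distrC (le_trans (lip _ _ x0' (ltW xc)))// ler_pdivrMr//.
by move: h2; rewrite ltr_norml => /andP[_ ?]; nra.
Unshelve. all: by end_near. Qed.

Lemma kill_rate_sum_continuous c : 0 < c -> {for c, continuous kill_rate_sum}.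
Proof.
move=> c0; apply: cvgM; last by apply: cvgV => //; rewrite gt_eqF.
by apply: cvgB; [exact: cvg_cst|exact: psi_continuous].
Qed.

(** With c = 0, [heat_array_bounded] bounds the mean time in the cube along one grid, whereas an
    event of never leaving of positive probability would make it grow linearly with the horizon. *)
Lemma exit_bm_finite : P [set w | exit_bm w = +oo%E] = 0%E.
Proof.
have mA : measurable [set w | exit_bm w = +oo%E].
  by rewrite -[X in measurable X]setTI; exact: (measurable_exit_bm measurableT (emeasurable_set1 +oo%E)).
have ha := brownian_heat_array d_gt0 hB (lexx 0).
have [C C0] := heat_array_bounded d_gt0 (lexx 0) ha (@ltr01 R).
move=> /filter_ex[N hN]; rewrite -Ex_indic//; congr EFin.
set p := Ex P _; have p0 : 0 <= p by apply: Ex_ge0 => w; rewrite indicE.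
apply/eqP; rewrite eq_le p0 andbT leNgt; apply/negP => pgt0.
have h0 := mesh_gt0 R N.
pose n := (Num.trunc (C / (mesh R N * p))).+1.
have := hN n; rewrite leNgt => /negP; apply.
have : C < n%:R * (mesh R N * p) by rewrite -ltr_pdivrMr ?mulr_gt0// truncnS_gt.
move=> /lt_le_trans; apply; rewrite mulrCA mulr_natl ler_pM2l//.
rewrite -[n in leLHS]card_ord -sumr_const; apply: ler_sum => j _.
apply: Ex_le; [exact: bmeas_indic| |move=> w].
  by apply: bmeasM; [exact: bmeas_cst|exact: bst].
rewrite indicE; case: (boolP (w \in _)) => [|_]; last first.
  by rewrite mulr_ge0 ?expR_ge0//; case/andP: (stay01 (bm_path B) 1 N j w).
rewrite inE/= => tE; rewrite mul0r oppr0 expR0 mul1r /stay big1// => l _.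
have -> // : cube 1 (bm_path B N l w).
apply/unit_cubeE; apply: contrapT => hl.
have : (exit_bm w <= (l%:R * mesh R N)%:E)%E.
  by apply: ereal_inf_lbound; exists (l%:R * mesh R N) => //; split => //; rewrite mulr_ge0// ltW.
by rewrite tE leye_eq.
Qed.

(** Killing factors form a geometric sequence, so the kill sum is h / (1 - exp(-ch)) times one minus
    the stopped discount. Past the horizon N + 1 the discount moves by at most exp(-c(N + 1)). *)
Lemma kill_sum_brownian c : 0 < c ->
  lim2 (kill_sum P (bm_path B) (fun N j _ => z c N j) (@mesh R) 1) (kill_rate_sum c).
Proof.
move=> c0 e e0.
have [_ pc] := psi_cvg c0.
have q0 N : 0 < 1 - expR (- (c * mesh R N)).
  by rewrite subr_gt0 expR_lt1 oppr_lt0 mulr_gt0// mesh_gt0.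
have zS N j : z c N j - z c N j.+1 = (1 - expR (- (c * mesh R N))) * z c N j.
  rewrite /z -natr1 mulrDl mul1r mulrDr opprD expRD; ring.
have kE N m : kill_sum P (bm_path B) (fun N j _ => z c N j) (@mesh R) 1 N m =
    mesh R N / (1 - expR (- (c * mesh R N))) * (1 - Ex P (X c N m)).
  rewrite /kill_sum /X ExB; [|exact: bmeas_cst|by apply: bmeas_sum => j _; exact: bmeasZ].
  rewrite Ex_cst opprB addrCA subrr addr0 -mulrA; congr (_ * _).
  rewrite Ex_sum; last by move=> j _; exact: bmeasZ.
  rewrite mulr_sumr; apply: eq_bigr => j _.
  have e1 : Ex P (fun w => z c N j * stay (bm_path B N) 1 j w) = z c N j * Ex P (st N j).
    by apply: ExZ; exact: bst.
  have e3 : Ex P (fun w => (z c N j - z c N j.+1) * st N j w) = (z c N j - z c N j.+1) * Ex P (st N j).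
    by apply: ExZ; exact: bst.
  by rewrite e1 e3 zS !mulrA mulVf ?mul1r// gt_eqF.
have qc : (fun N => mesh R N / (1 - expR (- (c * mesh R N)))) @ \oo --> c^-1.
  have : (fun N => ((1 - expR (- (c * mesh R N))) / mesh R N)^-1) @ \oo --> c^-1.
    apply: cvgV; first by rewrite gt_eqF.
    apply: (@squeeze_cvgr _ _ _ _ (fun N => c - c ^+ 2 * mesh R N) (fun=> c)).
    - near=> N; have h0 := mesh_gt0 R N.
      have ch : 0 <= c * mesh R N by rewrite mulr_ge0// ltW.
      have /andP[] := expRN_bounds ch; move: h0 (expR _); move: (mesh R N) => m m0 E E1 E2.
      rewrite ler_pdivlMr// ler_pdivrMr//; apply/andP; split; last by lra.
      by rewrite (_ : (c - c ^+ 2 * m) * m = c * m - (c * m) ^+ 2); [lra|ring].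
    - rewrite -[X in _ --> X]subr0; apply: cvgB; first exact: cvg_cst.
      rewrite -[X in _ --> X](mulr0 (c ^+ 2)); apply: cvgM; first exact: cvg_cst.
      exact: mesh_cvg0.
    - exact: cvg_cst.
  by under eq_cvg do rewrite invfM invrK mulrC.
have main : (fun N => mesh R N / (1 - expR (- (c * mesh R N))) * (1 - Ex P (X c N (N.+1 ^ 2))))
    @ \oo --> kill_rate_sum c.
  rewrite /kill_rate_sum mulrC; apply: cvgM => //.
  by apply: cvgB => //; exact: cvg_cst.
have tail : (fun N => mesh R N / (1 - expR (- (c * mesh R N))) * z c N (N.+1 ^ 2)) @ \oo --> (0 : R).
  rewrite -[X in _ --> X](mulr0 c^-1); apply: cvgM => //.
  apply: (@squeeze_cvgr _ _ _ _ (fun=> 0) (fun N => c^-1 * mesh R N)).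
  + near=> N; rewrite /z expR_ge0/= natrX expr2 mulfK// expRN /mesh -invfM lef_pV2 ?posrE ?expR_gt0 ?mulr_gt0//.
    by rewrite (le_trans _ (expR_ge1Dx _))// mulrC; lra.
  + exact: cvg_cst.
  + by rewrite -[X in _ --> X](mulr0 c^-1); apply: cvgM; [exact: cvg_cst|exact: mesh_cvg0].
have e2 : 0 < e / 2 by rewrite divr_gt0.
near=> N.
have h1 : `|kill_rate_sum c - mesh R N / (1 - expR (- (c * mesh R N))) * (1 - Ex P (X c N (N.+1 ^ 2)))| <= e / 2.
  by near: N; move/cvgrPdist_le: main; exact.
have h2 : `|0 - mesh R N / (1 - expR (- (c * mesh R N))) * z c N (N.+1 ^ 2)| <= e / 2.
  by near: N; move/cvgrPdist_le: tail; exact.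
exists (N.+1 ^ 2)%N => // m /= hm; rewrite kE.
set a := mesh R N / _ in h1 h2 *.
have a0 : 0 < a by rewrite divr_gt0// mesh_gt0.
rewrite sub0r normrN ger0_norm in h2; last first.
  by rewrite mulr_ge0 ?(ltW a0) ?expR_ge0.
have d0' w : 0 <= X c N (N.+1 ^ 2) w - X c N m w <= z c N (N.+1 ^ 2).
  rewrite /X opprB addrC addrA subrK -(subnKC hm) big_split_ord/= addrC addKr.
  have zni j : z c N j.+1 <= z c N j by rewrite -subr_ge0 zS mulr_ge0 ?expR_ge0// ltW.
  apply/andP; split.
    apply: sumr_ge0 => j _; rewrite mulr_ge0 ?subr_ge0//.
    by case/andP: (stay01 (bm_path B) 1 N (N.+1 ^ 2 + j) w).
  apply: (@le_trans _ _ (\sum_(j < m - N.+1 ^ 2) (z c N (N.+1 ^ 2 + j) - z c N (N.+1 ^ 2 + j).+1))).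
    apply: ler_sum => j _; rewrite ler_piMr ?subr_ge0//.
    by case/andP: (stay01 (bm_path B) 1 N (N.+1 ^ 2 + j) w).
  under eq_bigr do rewrite -addnS -opprB.
  rewrite sumrN -(big_mkord predT (fun j => z c N (N.+1 ^ 2 + j.+1) - z c N (N.+1 ^ 2 + j))).
  rewrite (telescope_sumr (fun j => z c N (N.+1 ^ 2 + j)))// addn0 opprB lerBlDr lerDl expR_ge0//.
have d1 : 0 <= Ex P (X c N (N.+1 ^ 2)) - Ex P (X c N m) <= z c N (N.+1 ^ 2).
  rewrite -ExB; [|exact: bX..]; apply/andP; split.
    by apply: Ex_ge0 => w; case/andP: (d0' w).
  rewrite -[leRHS](Ex_cst P); apply: Ex_le; [exact: bmeasB|exact: bmeas_cst|].
  by move=> w; case/andP: (d0' w).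
move: d1 => /andP[d1 d2]; move: (ler_wpM2l (ltW a0) d2) (ler_wpM2l (ltW a0) d1).
rewrite mulr0 => d3 d4; move: h1; rewrite !ler_norml => /andP[? ?].
by apply/andP; split; lra.
Unshelve. all: by end_near. Qed.

Lemma brownian_reference c : 0 < c -> exists d0 (T : measurableType d0) (P : probability T R) s Z h,
  @heat_array R d0 T P d s Z h c /\ lim2 (kill_sum P s Z h 1) (kill_rate_sum c).
Proof.
move=> c0; exists d0, T, P, (bm_path B), (fun N j _ => z c N j), (@mesh R); split.
  by have := brownian_heat_array d_gt0 hB (ltW c0); exact.
exact: kill_sum_brownian.
Qed.

End brownian_exit.

(** * Logarithmic scales *)

Section logarithmic_blocks.
Variable R : realType.

Lemma nneseries_delta (f : nat -> \bar R) n : (forall k, k != n -> f k = 0%E) -> (0 <= f n)%E ->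
  (\sum_(0 <= k <oo) f k = f n)%E.
Proof.
move=> fk fn; have f0 k : (0 <= f k)%E by have [->|/fk ->] := eqVneq k n.
rewrite (nneseries_split 0 n.+1)// add0n eseries0 ?adde0; last first.
  by move=> i ni _; rewrite fk// gt_eqF// ltEnat.
by rewrite big_mkord big_ord_recr/= big1 ?add0e// => i _; rewrite fk// lt_eqF// ltEnat/=.
Qed.

(** Rounded up by one, so that it is positive and exceeds log N for every N. *)
Definition logN (N : nat) : nat := (Num.trunc (ln N%:R : R)).+1.
Definition blk (N : nat) : nat := (logN N ^ 16)%N.

Lemma ln_near (A : R) : \forall N \near \oo, A <= ln N%:R.
Proof.
exists (Num.trunc (expR A)).+1 => // N /= hN.
have : expR A <= N%:R by rewrite (le_trans (ltW (truncnS_gt _)))// ler_nat.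
by move=> h; rewrite -[leLHS]expRK ler_ln ?posrE ?expR_gt0// (lt_le_trans _ h)// expR_gt0.
Qed.

Lemma logN_gt (N : nat) : ln N%:R < (logN N)%:R :> R.
Proof. exact: truncnS_gt. Qed.

Lemma logN_ge1 N : 1 <= (logN N)%:R :> R. Proof. by rewrite ler1n. Qed.

Lemma logN_near (K e : R) : 0 < e -> \forall N \near \oo, K <= e * (logN N)%:R.
Proof.
move=> e0; near=> N; rewrite -ler_pdivrMl// (@le_trans _ _ (ln N%:R))//; last exact: ltW (logN_gt N).
by near: N; exact: ln_near.
Unshelve. all: by end_near. Qed.

Lemma log_pow_near k (del e : R) : 0 < del -> 0 < e ->
  \forall N \near \oo, (logN N)%:R ^+ k * expR (- (del * ln N%:R)) <= e.
Proof.
move=> del0 e0; pose eta := Num.min 1 (del / k.+1%:R).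
have k0 : 0 < k.+1%:R :> R by rewrite ltr0n.
have eta0 : 0 < eta by rewrite lt_min ltr01 divr_gt0.
near=> N.
have l0 : 0 <= ln N%:R :> R by near: N; exact: ln_near.
have l1 : (e * eta ^+ k.+1)^-1 <= ln N%:R by near: N; exact: ln_near.
set l := ln N%:R in l0 l1 *.
have Ml : (logN N)%:R <= 1 + l by rewrite /logN -natr1 addrC lerD2l truncn_le.
have l2 : 0 < 1 + l by lra.
have ex : (eta * (1 + l)) ^+ k.+1 <= expR (del * l).
  have -> : del * l = k.+1%:R * (del / k.+1%:R * l) by field; rewrite gt_eqF.
  rewrite expRM_natl lerXn2r ?nnegrE ?expR_ge0 ?mulr_ge0 ?(ltW eta0) ?(ltW l2)//.
  rewrite (le_trans _ (expR_ge1Dx _))// mulrDr mulr1 lerD ?ge_min ?lexx//.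
  by rewrite ler_wpM2r// ge_min lexx orbT.
rewrite expRN ler_pdivrMr ?expR_gt0// (@le_trans _ _ ((1 + l) ^+ k))//.
  by rewrite lerXn2r ?nnegrE// ltW.
rewrite (le_trans _ (ler_wpM2l (ltW e0) ex))// exprMn exprS [(1 + l) ^+ k.+1]exprS.
rewrite -exprS mulrA mulrA ler_peMl ?exprn_ge0 ?(ltW l2)//.
have ee : 0 < e * eta ^+ k.+1 by rewrite mulr_gt0// exprn_gt0.
by rewrite -ler_pdivrMl// mulr1 (le_trans l1)//; lra.
Unshelve. all: by end_near. Qed.

Lemma expRN_ln (N : nat) k : (0 < N)%N -> expR (- (k%:R * ln N%:R)) = (N%:R ^+ k)^-1 :> R.
Proof.
move=> N0; rewrite expRN expRM_natl lnK// posrE ltr0n//.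
Qed.

Lemma blk_gt0 N : (0 < blk N)%N. Proof. by rewrite expn_gt0. Qed.

Lemma blk_small (q : R) : 0 < q -> \forall N \near \oo, (blk N)%:R <= q * N%:R.
Proof.
move=> q0; near=> N; have N0 : (0 < N)%N by near: N; exists 1%N.
have : (logN N)%:R ^+ 16 * expR (- (1 * ln N%:R)) <= q by near: N; exact: log_pow_near.
by rewrite (expRN_ln 1 N0) expr1 ler_pdivrMr ?ltr0n// /blk natrX.
Unshelve. all: by end_near. Qed.

(** Cut at M^8, where the weight is M^2: at most M^8 terms bounded by 1, and at most M^16 terms
    bounded by M^(-2). This rough count still leaves room for a factor log N below the block
    length. *)
Lemma sum_wt_log (M : nat) : (0 < M)%N ->
  \sum_(i < M ^ 16 | (0 < i)%N) (wt R i)^-1 <= 2 * M%:R ^+ 14.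
Proof.
move=> M0; have M1 : 1 <= M%:R :> R by rewrite ler1n.
have wtM : wt R (M ^ 8) = M%:R ^+ 2.
  apply/eqP; rewrite -(@eqrXn2 _ 4)// ?wt_ge0 ?exprn_ge0//.
  by rewrite wt4 natrX -exprM.
have w0 i : (0 < i)%N -> 0 < wt R i by move=> i0; rewrite (lt_le_trans ltr01)// wt_ge1.
apply: (@le_trans _ _ (\sum_(i < M ^ 16) ((i < M ^ 8)%N%:R + (M%:R ^+ 2)^-1))).
  rewrite [leLHS]big_mkcond; apply: ler_sum => i _; case: ifP => i0; last first.
    by rewrite addr_ge0// invr_ge0 exprn_ge0.
  case: ltnP => iM.
    by rewrite (@le_trans _ _ 1)// ?lerDl ?invr_ge0 ?exprn_ge0// invf_le1 ?w0// wt_ge1.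
  rewrite add0r lef_pV2 ?posrE ?w0 ?exprn_gt0 ?ltr0n//.
  by rewrite -wtM wt_le.
rewrite big_split/= sumr_const card_ord.
have -> : \sum_(i < M ^ 16) (i < M ^ 8)%N%:R = (M ^ 8)%:R :> R.
  rewrite -natr_sum; congr (_%:R); rewrite -(big_mkord predT (fun i => (i < M ^ 8)%N : nat)).
  have le8 : (M ^ 8 <= M ^ 16)%N by apply: leq_pexp2l.
  rewrite (big_cat_nat (leq0n _) le8)/=.
  have -> : (\sum_(M ^ 8 <= i < M ^ 16) (i < M ^ 8)%N)%N = 0%N.
    by rewrite big_nat big1// => i /andP[h _]; rewrite ltnNge h.
  rewrite addn0.
  rewrite big_nat (eq_bigr (fun=> 1%N)); last by move=> i /andP[_ ->].
  by rewrite -big_nat sum_nat_const_nat subn0 muln1.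
rewrite -[X in _ + X]mulr_natl !natrX -(_ : M%:R ^+ 14 + M%:R ^+ 14 = 2 * M%:R ^+ 14); last by ring.
rewrite lerD ?ler_weXn2l//.
by rewrite (_ : M%:R ^+ 16 / M%:R ^+ 2 = M%:R ^+ 14)//; field; rewrite gt_eqF ?ltr0n.
Qed.

End logarithmic_blocks.

(** * The walk in continuous time *)

Section discrete_measurability.
Context d1 d2 (T1 : measurableType d1) (T2 : measurableType d2) (C : countType).
Variable Z : T1 -> C.
Hypothesis mZ : forall z, measurable (Z @^-1` [set z]).

Lemma discrete_preimage (A : set C) : measurable (Z @^-1` A).
Proof.
rewrite (_ : Z @^-1` A = \bigcup_(z in A) Z @^-1` [set z]).
  rewrite bigcup_mkcond; apply: countable_bigcupT_measurable; first exact: countableP.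
  by move=> z; case: ifP.
by apply/seteqP; split => [w Aw|w [z Az /= zE]]; [exists (Z w)|rewrite /= zE].
Qed.

Lemma discrete_measurable (f : C -> T2) : measurable_fun setT (fun w => f (Z w)).
Proof. by move=> _ A _; rewrite setTI; exact: (discrete_preimage (f @^-1` A)). Qed.

Lemma discrete_pair_measurable (R : realType) (g : C -> T2 -> R) :
  (forall z, measurable_fun setT (g z)) ->
  measurable_fun setT (fun p : T1 * T2 => g (Z p.1) p.2).
Proof.
move=> mg _ A mA; rewrite setTI.
rewrite (_ : _ @^-1` A = \bigcup_(z in [set: C]) (Z @^-1` [set z] `*` (g z @^-1` A))).
  apply: countable_bigcupT_measurable; first exact: countableP.
  move=> z; apply: measurableX => //.
  by rewrite -[X in measurable X]setTI; exact: mg.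
apply/seteqP; split => [[w w'] /= Aw|[w w'] [z _ [/= -> //]]].
by exists (Z w).
Qed.

End discrete_measurability.

Section measurable_conditions.
Context d1 (T : measurableType d1) (R : realType).

Lemma bmeas_bool (b : T -> bool) : measurable_fun setT b -> bmeas (fun w => (b w)%:R : R).
Proof.
move=> mb; have mA : measurable (b @^-1` [set true]).
  by rewrite -[X in measurable X]setTI; exact: mb.
rewrite (_ : (fun w => _) = \1_(b @^-1` [set true])); first exact: bmeas_indic.
apply/funext => w; rewrite indicE; case bw : (b w); first by rewrite mem_set.
by rewrite memNset//= bw.
Qed.

Lemma bmeas_le (X Y : T -> R) : measurable_fun setT X -> measurable_fun setT Y ->
  bmeas (fun w => (X w <= Y w)%R%:R : R).
Proof. by move=> mX mY; apply: bmeas_bool; exact: measurable_fun_ler. Qed.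

Lemma bmeas_and (b b' : T -> bool) : bmeas (fun w => (b w)%:R : R) ->
  bmeas (fun w => (b' w)%:R : R) -> bmeas (fun w => (b w && b' w)%:R : R).
Proof. by move=> mb mb'; under eq_fun do rewrite -mulnb natrM; exact: bmeasM. Qed.

Lemma bmeas_not (b : T -> bool) : bmeas (fun w => (b w)%:R : R) ->
  bmeas (fun w => (~~ b w)%:R : R).
Proof.
move=> mb; rewrite (_ : (fun w => _) = fun w => 1 - (b w)%:R).
  by apply: bmeasB => //; exact: bmeas_cst.
by apply/funext => w; case: (b w); rewrite ?subrr ?subr0.
Qed.

Lemma bmeas_lt (X Y : T -> R) : measurable_fun setT X -> measurable_fun setT Y ->
  bmeas (fun w => (X w < Y w)%R%:R : R).
Proof. by move=> mX mY; under eq_fun do rewrite ltNge; apply: bmeas_not; exact: bmeas_le. Qed.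

End measurable_conditions.

Section steps_and_clocks.
Context (R : realType) d0 (T : measurableType d0) (P : probability T R) (d : nat).
Hypothesis d_gt0 : (0 < d)%N.
Local Notation V := 'rV[int]_d.
Variables (X : nat -> T -> V) (E : nat -> T -> R).
Hypothesis mX : forall n v, measurable (X n @^-1` [set v]).
Hypothesis mE : forall n, measurable_fun setT (E n).
Hypothesis lawX : forall n v, P (X n @^-1` [set v]) = (srw_step_pmf R v)%:E.
Hypothesis lawE : forall n (A : set R), measurable A -> P (E n @^-1` A) = exponential_prob 1 A.
Hypothesis indF : mutually_independent P (steps_and_clocks_events X E).
Hypothesis E_gt0 : forall n w, 0 < E n w.

Local Notation F := (steps_and_clocks_events X E).

Lemma events_measurable i : F i `<=` measurable.
Proof.
case: i => n _ [A mA <-]; first by apply: discrete_preimage => v; exact: mX.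
by rewrite -[X in measurable X]setTI; exact: mE.
Qed.

Lemma events_setI i : setI_closed (F i).
Proof.
by case: i => n _ _ [A mA <-] [A' mA' <-]; exists (A `&` A') => //; exact: measurableI.
Qed.

Lemma events_setT i : F i setT.
Proof. by case: i => n; exists setT. Qed.

Definition walk_freeze D1 D2 G (D12 : D1 `&` D2 = set0) bG :=
  @mutual_freeze _ T R P _ F events_measurable events_setI events_setT indF D1 D2 G D12 bG.

Lemma walk_past D (U : past_type F D -> R) : bmeas U -> bmeas (U : T -> R).
Proof. by apply: bmeas_past; exact: events_measurable. Qed.

Lemma step_past D n (v : V) : D (inl n) ->
  measurable ((X n : past_type F D -> V) @^-1` [set v]).
Proof. by move=> Dn; apply: (measurable_past events_setT Dn); exists [set v]. Qed.

Lemma steps_past D (r : seq nat) (s : seq V) : (forall n, n \in r -> D (inl n)) ->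
  measurable ((fun w : past_type F D => [seq X i w | i <- r]) @^-1` [set s]).
Proof.
elim: r s => [|i r ih] s rD.
  case: s => [|v s]; first by rewrite (_ : _ @^-1` _ = setT)//; apply/seteqP; split.
  by rewrite (_ : _ @^-1` _ = set0)//; apply/seteqP; split.
case: s => [|v s]; first by rewrite (_ : _ @^-1` _ = set0)//; apply/seteqP; split.
rewrite (_ : _ @^-1` _ = ((X i : past_type F D -> V) @^-1` [set v]) `&`
   ((fun w : past_type F D => [seq X i w | i <- r]) @^-1` [set s])).
  apply: measurableI; first by apply: step_past; apply: rD; rewrite mem_head.
  by apply: ih => n nr; apply: rD; rewrite in_cons nr orbT.
by apply/seteqP; split => w /= [-> ->].
Qed.

Lemma clock_past D n : D (inr n) -> measurable_fun setT (E n : past_type F D -> R).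
Proof.
by move=> Dn _ A mA; rewrite setTI; apply: (measurable_past events_setT Dn); exists A.
Qed.

Lemma stepv_pmf e : srw_step_pmf R (@stepv d e) = (2 * d)%:R^-1.
Proof.
rewrite /srw_step_pmf (bigD1 e.1)//= big1 ?addr0.
  by rewrite !mxE !eqxx mulr1 normrX normrN normr1 expr1n eqxx.
by move=> i ie; rewrite !mxE eqxx (negbTE ie) mulr0 normr0.
Qed.

(** Only the masses of single vectors are given. Those of the 2d unit steps add up to 1, so the
    variable is almost surely a finite combination of indicators. *)
Lemma step_law n (f : V -> R) (C : R) : (forall v, `|f v| <= C) ->
  Ex P (fun w => f (X n w)) = avg f.
Proof.
move=> fC; have mI v : measurable (X n @^-1` [set v]) := mX n v.
have bf : bmeas (fun w => f (X n w)).
  by split; [exact: (discrete_measurable (mX n))|exists C => w].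
pose q w := \sum_(e : 'I_d * bool) \1_(X n @^-1` [set stepv e]) w : R.
have bq : bmeas q by apply: bmeas_sum => e _; exact: bmeas_indic.
have pe e : Ex P \1_(X n @^-1` [set stepv e]) = (2 * d)%:R^-1.
  by apply: EFin_inj; rewrite Ex_indic// lawX stepv_pmf.
have d0' : (2 * d)%:R != 0 :> R by rewrite pnatr_eq0 muln_eq0 -lt0n d_gt0.
have q1 : Ex P q = 1.
  rewrite Ex_sum; last by move=> e _; exact: bmeas_indic.
  under eq_bigr do rewrite pe.
  by rewrite sumr_const card_prod card_ord card_bool -[LHS]mulr_natl [(d * 2)%N]mulnC mulfV.
have qE w : q w = 0 \/ exists e, X n w = stepv e /\ q w = 1.
  have [[e he]|h] := pselect (exists e, X n w = stepv e); last first.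
    by left; rewrite /q big1// => e _; rewrite indicE memNset//= => he; apply: h; exists e.
  right; exists e; split => //; rewrite /q (bigD1 e)//= indicE mem_set//= big1 ?addr0// => e' e'e.
  by rewrite indicE memNset//= he => /stepv_inj e1; rewrite e1 eqxx in e'e.
have C0 : 0 <= C by exact: le_trans (normr_ge0 _) (fC 0).
pose D w := f (X n w) - \sum_(e : 'I_d * bool) f (stepv e) * \1_(X n @^-1` [set stepv e]) w.
have bS : bmeas (fun w => \sum_(e : 'I_d * bool) f (stepv e) * \1_(X n @^-1` [set stepv e]) w).
  by apply: bmeas_sum => e _; apply: bmeasZ; exact: bmeas_indic.
have DE w : `|D w| <= C * (1 - q w).
  rewrite /D; case: (qE w) => [q0|[e [he qw]]].
    rewrite q0 subr0 mulr1 big1 ?subr0// => e _.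
    have /eqP := q0; rewrite /q psumr_eq0; last by move=> e' _; rewrite indicE.
    by move=> /allP /(_ e (mem_index_enum _)) /eqP ->; rewrite mulr0.
  rewrite qw subrr mulr0 (bigD1 e)//= indicE mem_set//= mulr1 he big1 ?addr0 ?subrr ?normr0//.
  move=> e' e'e; rewrite indicE memNset ?mulr0//= he => /stepv_inj e1.
  by rewrite e1 eqxx in e'e.
have : `|Ex P D| <= 0.
  rewrite (le_trans (Ex_norm_le _ (bmeasB bf bS)))//.
  apply: (@le_trans _ _ (Ex P (fun w => C * (1 - q w)))).
    apply: Ex_le => //; first by apply: bmeas_norm; exact: bmeasB.
    by apply: bmeasZ; apply: bmeasB => //; exact: bmeas_cst.
  rewrite ExZ; last by apply: bmeasB => //; exact: bmeas_cst.
  by rewrite ExB ?Ex_cst ?q1 ?subrr ?mulr0//; exact: bmeas_cst.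
rewrite normr_le0 /D ExB// subr_eq0 => /eqP ->.
rewrite Ex_sum; last by move=> e _; apply: bmeasZ; exact: bmeas_indic.
rewrite /avg mulr_sumr; apply: eq_bigr => e _.
by rewrite ExZ ?pe 1?mulrC//; exact: bmeas_indic.
Qed.

Lemma avgs_norm_le n (G : seq V -> R) (C : R) : (forall s, `|G s| <= C) -> `|avgs n G| <= C.
Proof.
move=> GC; rewrite ler_norml -[in - C](avgs_cst d_gt0 n (- C)) -[in X in _ && (_ <= X)](avgs_cst d_gt0 n C).
by apply/andP; split; apply: avgs_le => s; have := GC s; rewrite ler_norml => /andP[].
Qed.

Lemma steps_law (r : seq nat) (G : seq V -> R) (C : R) : uniq r -> (forall s, `|G s| <= C) ->
  Ex P (fun w => G [seq X i w | i <- r]) = avgs (size r) G.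
Proof.
elim: r G => [|i r ih] G /=; first by rewrite Ex_cst.
move=> /andP[ir ur] GC.
pose D1 : set (nat + nat) := [set inl i]; pose D2 : set (nat + nat) := [set k | exists2 j, j \in r & k = inl j].
have D12 : D1 `&` D2 = set0.
  by apply/seteqP; split => // k [/= -> [j jr [ij]]]; rewrite -ij (negbTE ir) in jr.
pose H (p : past_type F D1 * past_type F D2) := G (X i p.1 :: [seq X j p.2 | j <- r]).
have bH : bmeas H.
  split; last by exists C => p; exact: GC.
  apply: (@discrete_pair_measurable _ _ (past_type F D1) (past_type F D2) _ (X i) _ R
    (fun v (w : past_type F D2) => G (v :: [seq X j w | j <- r]))).
    by move=> v; apply: step_past.
  move=> v; apply: (@discrete_measurable _ _ (past_type F D2) _ _
    (fun w : past_type F D2 => [seq X j w | j <- r]) _ (fun s => G (v :: s))).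
  by move=> s; apply: steps_past => n nr; exists n.
have [_ /= ->] := walk_freeze D12 bH.
have -> : (fun w => Ex P (fun w' => G (X i w :: [seq X j w' | j <- r]))) =
    (fun w => avgs (size r) (fun s => G (X i w :: s))).
  by apply/funext => w; rewrite (ih (fun s => G (X i w :: s))).
exact: (step_law (f := fun v => avgs (size r) (fun s => G (v :: s))) i
  (fun v => avgs_norm_le (size r) (fun s => GC (v :: s)))).
Qed.

(** The two exponentials multiply to exp(-u), which leaves a power of u - t to integrate. *)
Lemma integral_pois (u : R) k : 0 <= u ->
  (\int[lebesgue_measure]_(t in `[0%R, u]) (pois (u - t) k * expR (- t))%:E)%E = (pois u k.+1)%:E.
Proof.
rewrite le_eqVlt => /orP[/eqP<-|u0].
  by rewrite set_itv1 integral_set1 /pois expr0n/= mul0r mulr0.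
pose c : R := - (expR (- u) / k.+1`!%:R).
pose G : R -> R := c \*: ((cst u - id) ^+ k.+1 : R -> R).
have kf : k`!%:R != 0 :> R by rewrite pnatr_eq0 -lt0n fact_gt0.
have GE (t : R) : G t = c * (u - t) ^+ k.+1 by rewrite /G/= exprfctE.
have dG (t : R) : is_derive t 1 G (pois (u - t) k * expR (- t)).
  have h := is_deriveZ c (is_deriveX k.+1 (is_deriveB (is_derive_cst u t 1) (is_derive_id t 1))).
  apply: is_derive_eq h _; rewrite !fctE /GRing.scale/= sub0r mulrN1 mulrN mulNr opprK /c.
  rewrite factS natrM /pois opprB expRD !expRN.
  have k1 : k.+1%:R != 0 :> R by rewrite pnatr_eq0.
  move: kf k1; move: (k.+1%:R : R) (k`!%:R : R) => K1 K2 K20 K10.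
  by field; rewrite K10 K20 !gt_eqF ?expR_gt0.
have cG : continuous G.
  by move=> t; apply: differentiable_continuous; apply/derivable1_diffP; exact: ex_derive.
have cf : continuous (fun t : R => pois (u - t) k * expR (- t)).
  move=> t; rewrite /pois.
  have cs : (fun x : R => u - x) @ t --> u - t by apply: cvgB; [exact: cvg_cst|exact: cvg_id].
  apply: cvgM; last by apply: continuous_cvg; [exact: continuous_expR|apply: cvgN; exact: cvg_id].
  apply: cvgM.
    by apply: continuous_cvg; [exact: continuous_expR|apply: cvgN].
  by apply: cvgM; [exact: continuous_cvg (@exprn_continuous R k _) cs|exact: cvg_cst].
rewrite (@continuous_FTC2 _ _ G)//.
- rewrite !GE subrr expr0n/= mulr0 subr0 -EFinB sub0r; congr EFin.
  by rewrite /c mulNr opprK /pois; ring.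
- exact: continuous_subspaceT.
- split; last 2 first.
  + by apply: cvg_at_right_filter; exact: cG.
  + by apply: cvg_at_left_filter; exact: cG.
  + by move=> t _; exact: ex_derive.
- by move=> t _; rewrite derive1E; exact: derive_val.
Qed.

Let clock_law n (f : R -> R) : (forall x, 0 <= f x) -> bmeas f ->
  (Ex P (fun w => f (E n w)))%:E = (\int[lebesgue_measure]_x (f x * exponential_pdf 1 x)%:E)%E.
Proof.
move=> f0 bf; apply: (@Ex_density _ _ _ P (E n) (exponential_prob 1)) => //.
  exact: measurable_exponential_pdf.
  by move=> x; apply: exponential_pdf_ge0.
by move=> A mA; exact: lawE.
Qed.

Lemma bmeas_pois (k : nat) (u : R) : 0 <= u ->
  bmeas (fun t : R => (0 <= t <= u)%R%:R * pois (u - t) k).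
Proof.
move=> u0; split.
  apply: measurable_funM.
    have [m _] : bmeas (fun t : R => ((0 <= t) && (t <= u))%R%:R : R).
      by apply: bmeas_and; apply: bmeas_le.
    exact: m.
  have ms : measurable_fun setT (fun t : R => u - t) by exact: measurable_funB.
  apply: measurable_funM; first by apply: measurableT_comp => //; apply: measurableT_comp.
  by apply: measurable_funM => //; exact: measurable_funX.
exists (u ^+ k / k`!%:R) => t; case: (boolP (0 <= t <= u)) => [/andP[t0 tu]|_]; last first.
  by rewrite mul0r normr0 divr_ge0 ?exprn_ge0.
have ut : 0 <= u - t by rewrite subr_ge0.
rewrite mul1r ger0_norm ?pois_ge0// /pois.
rewrite (@le_trans _ _ ((u - t) ^+ k / k`!%:R))//.
  by rewrite ler_piMl ?divr_ge0 ?exprn_ge0// expR_le1 oppr_le0.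
by rewrite ler_wpM2r ?invr_ge0// lerXn2r ?nnegrE//; lra.
Qed.

Definition clocks (r : seq nat) (w : T) : R := \sum_(i <- r) E i w.

Lemma clocks_ge0 r w : 0 <= clocks r w.
Proof. by rewrite sumr_ge0// => i _; exact: ltW. Qed.

Lemma clocks_past D r : (forall n, n \in r -> D (inr n)) ->
  measurable_fun setT (clocks r : past_type F D -> R).
Proof.
elim: r => [|i r ih] rD; rewrite /clocks.
  by under eq_fun do rewrite big_nil; exact: measurable_cst.
under eq_fun do rewrite big_cons; apply: measurable_funD.
  by apply: clock_past; apply: rD; rewrite mem_head.
by apply: ih => n nr; apply: rD; rewrite in_cons nr orbT.
Qed.

Definition crossing (u : R) (r : seq nat) (m : nat) (w : T) : bool :=
  (clocks r w <= u) && (u < clocks r w + E m w).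

Lemma crossing_past D u r m : (forall n, n \in m :: r -> D (inr n)) ->
  bmeas ((fun w => (crossing u r m w)%:R) : past_type F D -> R).
Proof.
move=> rD; have mr : measurable_fun setT (clocks r : past_type F D -> R).
  by apply: clocks_past => n nr; apply: rD; rewrite in_cons nr orbT.
apply: bmeas_and; first by apply: bmeas_le.
apply: bmeas_lt => //; apply: measurable_funD => //.
by apply: clock_past; apply: rD; rewrite mem_head.
Qed.

(** The number of unit exponential clocks that fit in u is Poisson; one clock at a time is frozen,
    and [integral_pois] integrates over it. *)
Lemma crossing_law u r m : 0 <= u -> uniq (m :: r) ->
  Ex P (fun w => (crossing u r m w)%:R) = pois u (size r).
Proof.
elim: r u => [|i r ih] u u0.
  move=> _; apply: EFin_inj.
  have -> : (fun w => (crossing u [::] m w)%:R) = (fun w => (u < E m w)%R%:R : R).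
    by apply/funext => w; rewrite /crossing /clocks big_nil u0 add0r.
  have mA : measurable (E m @^-1` `[0, u]).
    by rewrite -[X in measurable X]setTI; exact: mE.
  have -> : (fun w => (u < E m w)%R%:R) = (fun w => 1 - \1_(E m @^-1` `[0, u]) w : R).
    apply/funext => w; rewrite indicE ltNge; case: (boolP (E m w <= u)) => Eu.
      by rewrite mem_set ?subrr//= in_itv/= (ltW (E_gt0 m w)).
    by rewrite memNset ?subr0//= in_itv/= (negbTE Eu) andbF.
  rewrite ExB; [|exact: bmeas_cst|exact: bmeas_indic].
  rewrite Ex_cst EFinB Ex_indic// lawE//= /pois expr0 fact0 divr1 mulr1.
  move: u0; rewrite le_eqVlt => /orP[/eqP<-|u0].
    by rewrite set_itv1 /exponential_prob integral_set1 sube0 oppr0 expR0.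
  rewrite exponential_prob_itv0c// mulN1r.
  have -> : (1 - (expR (- u))%:E)%E = (1 - expR (- u))%:E by [].
  by rewrite -EFinB; congr EFin; ring.
rewrite /= in_cons negb_or -!andbA => /and4P[mi mr ir ur].
pose D1 : set (nat + nat) := [set inr i].
pose D2 : set (nat + nat) := [set k | exists2 j, j \in m :: r & k = inr j].
have D12 : D1 `&` D2 = set0.
  apply/seteqP; split => // k [/= -> [j jr [ij]]]; move: jr; rewrite -ij in_cons (negbTE ir) orbF.
  by rewrite eq_sym (negbTE mi).
pose G (p : past_type F D1 * past_type F D2) : R :=
  ((E i p.1 + clocks r p.2 <= u) && (u < E i p.1 + clocks r p.2 + E m p.2))%:R.
have bG : bmeas G.
  have m1 : measurable_fun setT (fun p : past_type F D1 * past_type F D2 => E i p.1).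
    by apply: measurableT_comp => //; exact: clock_past.
  have m2 : measurable_fun setT (fun p : past_type F D1 * past_type F D2 => clocks r p.2).
    apply: measurableT_comp => //; apply: clocks_past => n nr; exists n => //.
    by rewrite in_cons nr orbT.
  have m3 : measurable_fun setT (fun p : past_type F D1 * past_type F D2 => E m p.2).
    by apply: measurableT_comp => //; apply: clock_past; exists m => //; rewrite mem_head.
  apply: bmeas_and; first by apply: bmeas_le => //; exact: measurable_funD.
  by apply: bmeas_lt => //; apply: measurable_funD => //; exact: measurable_funD.
have [_ eG] := walk_freeze D12 bG.
transitivity (Ex P (fun w => G (w, w))).
  by congr (Ex P _); apply/funext => w; rewrite /crossing /clocks big_cons.
rewrite eG.
have -> : (fun w => Ex P (fun w' => G (w, w'))) =
    (fun w => (0 <= E i w <= u)%R%:R * pois (u - E i w) (size r)).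
  apply/funext => w; rewrite (ltW (E_gt0 i w))/=.
  case: (leP (E i w) u) => Eu; last first.
    rewrite mul0r -[RHS](Ex_cst P); congr (Ex P _); apply/funext => w'.
    rewrite /G/= leNgt (lt_le_trans Eu)// lerDl; exact: clocks_ge0.
  rewrite mul1r -ih ?subr_ge0//; last by rewrite /= mr.
  congr (Ex P _); apply/funext => w'; rewrite /G /crossing/=.
  by rewrite lerBrDl ltrBlDl addrA.
apply: EFin_inj; rewrite (@clock_law i (fun t => (0 <= t <= u)%R%:R * pois (u - t) (size r))).
- rewrite -integral_pois// [RHS]integral_mkcond; apply: eq_integral => x _.
  rewrite patchE; case: (boolP (0 <= x <= u)) => xu.
    rewrite mem_set ?mul1r; last by rewrite /= in_itv.
    by case/andP: xu => x0 _; rewrite exponential_pdfE// mul1r mulN1r.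
  by rewrite memNset/= ?mul0r// in_itv/=; exact/negP.
- move=> x; case: (boolP (0 <= x <= u)) => [/andP[_ xu]|_]; last by rewrite mul0r.
  by rewrite mul1r pois_ge0// subr_ge0.
- exact: bmeas_pois.
Qed.

Lemma clocks_tail u r : 0 <= u -> uniq r ->
  Ex P (fun w => (u < clocks r w)%R%:R) = \sum_(i < size r) pois u i.
Proof.
move=> u0; elim: r => [_|m r ih].
  rewrite big_ord0 -[RHS](Ex_cst P); congr (Ex P _); apply/funext => w.
  by rewrite /clocks big_nil ltNge u0.
move=> umr; have /andP[mr ur] := umr; rewrite /= big_ord_recr/= -ih// -(@crossing_law u r m u0 umr).
pose D : set (nat + nat) := [set: nat + nat].
have b1 : bmeas (fun w => (u < clocks r w)%R%:R : R).
  by apply: (@walk_past D); apply: bmeas_lt => //; exact: clocks_past.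
have b2 : bmeas (fun w => (crossing u r m w)%:R : R).
  by apply: (@walk_past D); exact: crossing_past.
rewrite -ExD//; congr (Ex P _); apply/funext => w.
rewrite /crossing /clocks big_cons addrC; have := E_gt0 m w.
case: (leP (\sum_(i <- r) E i w) u) => h e0; first by rewrite add0r.
by rewrite addr0 (lt_trans h)// ltrDl.
Qed.

(* the indices of the visits to 0 after time 0 of the path started at [x] with increments
   [s], the increments being numbered n - 1, n - 2, ... *)
Fixpoint vidx (x : V) (n : nat) (s : seq V) : seq nat :=
  if s is e :: s' then (if x + e == 0 then [:: n.-1] else [::]) ++ vidx (x + e) n.-1 s'
  else [::].

Lemma size_vidx x n s : size (vidx x n s) = visits x s.
Proof. by elim: s x n => [//|e s ih] x n /=; rewrite size_cat ih; case: ifP. Qed.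

Lemma vidx_cat x n s1 s2 :
  vidx x n (s1 ++ s2) = vidx x n s1 ++ vidx (x + \sum_(e <- s1) e) (n - size s1) s2.
Proof.
elim: s1 x n => [|e s1 ih] x n /=; first by rewrite big_nil addr0 subn0.
rewrite ih big_cons addrA -catA; congr (_ ++ (_ ++ vidx _ _ _)); clear; lia.
Qed.

Lemma vidx_range x n s i : (size s <= n)%N -> i \in vidx x n s -> (n - size s <= i < n)%N.
Proof.
elim: s x n => [//|e s ih] x [//|n] /=; rewrite ltnS => sn.
rewrite mem_cat => /orP[|/(ih _ _ sn) /andP[h1 h2]].
  by case: ifP => // _; rewrite inE => /eqP ->; rewrite ltnSn andbT subSS leq_subr.
by rewrite subSS h1/= ltnS ltnW.
Qed.

Lemma vidx_uniq x n s : (size s <= n)%N -> uniq (vidx x n s).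
Proof.
elim: s x n => [//|e s ih] x [//|n] /=; rewrite ltnS => sn.
case: ifP => _ /=; last exact: ih.
rewrite ih// andbT; apply/negP => /(vidx_range sn) /andP[_]; by rewrite ltnn.
Qed.

Lemma vidx_notin x n s : (size s <= n)%N -> uniq (n :: vidx x n s).
Proof.
move=> sn; rewrite /= vidx_uniq// andbT; apply/negP => /(vidx_range sn) /andP[_].
by rewrite ltnn.
Qed.

Lemma vidx_disjoint x y n s i : x != y -> (size s <= n)%N ->
  i \in vidx x n s -> i \in vidx y n s -> False.
Proof.
move=> xy; elim: s x y n xy => [//|e s ih] x y [//|n] xy /=; rewrite ltnS => sn.
rewrite !mem_cat => /orP[ix|ix] /orP[iy|iy].
- move: ix iy; case: eqP => // xe _; case: eqP => // ye _.
  by move/eqP: xy; apply; apply: (addIr e); rewrite xe ye.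
- move: ix; case: ifP => // _; rewrite inE => /eqP iE.
  by have := vidx_range sn iy; rewrite iE ltnn andbF.
- move: iy; case: ifP => // _; rewrite inE => /eqP iE.
  by have := vidx_range sn ix; rewrite iE ltnn andbF.
- by apply: (ih (x + e) (y + e) n) ix iy => //; rewrite (inj_eq (addIr e)).
Qed.

Definition pos (k : nat) (w : T) : V := \sum_(i < k) X i w.

(* The latest increment comes first. *)
Definition incs (n0 n : nat) (w : T) : seq V := [seq X i w | i <- rev (index_iota n0 n)].

Lemma posS k w : pos k.+1 w = pos k w + X k w.
Proof. by rewrite /pos big_ord_recr. Qed.

Lemma size_incs n0 n w : size (incs n0 n w) = (n - n0)%N.
Proof. by rewrite size_map size_rev size_iota. Qed.

Lemma incs_cat n0 m n w : (n0 <= m)%N -> (m <= n)%N -> incs n0 n w = incs m n w ++ incs n0 m w.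
Proof.
move=> nm mn; rewrite /incs -map_cat -rev_cat; congr (map _ (rev _)).
have -> : index_iota n0 n = iota n0 ((m - n0) + (n - m)) by congr iota; clear -nm mn; lia.
by rewrite iotaD subnKC.
Qed.

Lemma incsS n0 n w : (n0 <= n)%N -> incs n0 n.+1 w = X n w :: incs n0 n w.
Proof. by move=> n0n; rewrite (incs_cat w n0n (leqnSn n)) /incs /index_iota subSnn. Qed.

Lemma sum_incs n0 n w : (n0 <= n)%N -> \sum_(e <- incs n0 n w) e = pos n w - pos n0 w.
Proof.
elim: n => [|n ih]; first by rewrite leqn0 => /eqP ->; rewrite /incs big_nil subrr.
rewrite leq_eqVlt => /orP[/eqP <-|]; first by rewrite /incs /index_iota subnn big_nil subrr.
by rewrite ltnS => nn; rewrite incsS// big_cons ih// posS; rewrite addrA [X n w + _]addrC.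
Qed.

Lemma clocks_vidx x n0 n w : (n0 <= n)%N -> clocks (vidx x n (incs n0 n w)) w =
  \sum_(n0 <= i < n | x + (pos n w - pos i w) == 0) E i w.
Proof.
elim: n x => [|n ih] x; first by rewrite leqn0 => /eqP ->; rewrite big_geq// /clocks big_nil.
rewrite leq_eqVlt => /orP[/eqP <-|].
  by rewrite big_geq// /incs /index_iota subnn /clocks big_nil.
rewrite ltnS => nn; rewrite incsS//= big_mkcond big_nat_recr//= -big_mkcond/=.
rewrite /clocks big_cat/=; have := ih (x + X n w) nn; rewrite /clocks => ->.
rewrite addrC; congr (_ + _).
  by apply: eq_bigl => i; rewrite posS -!addrA [X n w + _]addrCA.
rewrite posS addrAC subrr add0r; case: ifP => _; first by rewrite big_seq1.
by rewrite big_nil.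
Qed.

(* The holding time after jump n makes the time spent at the current position since jump
   n0 pass the level u. *)
Definition cross (u : R) (n0 n : nat) (w : T) : bool := crossing u (vidx 0 n (incs n0 n w)) n w.

Let Dstep : set (nat + nat) := [set k | exists i, k = inl i].
Let Dclock : set (nat + nat) := [set k | exists i, k = inr i].

(** Steps and clocks are independent: with the steps frozen, the lists of visits are deterministic,
    and what remains is a walk average of clock probabilities. *)
Lemma steps_clocks_law (r : seq nat) (G : seq V -> T -> R) (C : R) : uniq r ->
  (forall s, bmeas (G s : past_type F Dclock -> R)) -> (forall s w, `|G s w| <= C) ->
  Ex P (fun w => G [seq X i w | i <- r] w) = avgs (size r) (fun s => Ex P (G s)).
Proof.
move=> ur mG GC.
have D12 : Dstep `&` Dclock = set0 by apply/seteqP; split => // k [[i ->] [j]].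
pose H (p : past_type F Dstep * past_type F Dclock) := G [seq X i p.1 | i <- r] p.2.
have bH : bmeas H.
  split; last by exists C => p; exact: GC.
  apply: (@discrete_pair_measurable _ _ (past_type F Dstep) (past_type F Dclock) _
    (fun w => [seq X i w | i <- r]) _ R (fun s (w : past_type F Dclock) => G s w)).
    by move=> s; apply: steps_past => n _; exists n.
  by move=> s; exact: (mG s).1.
have [_ /= ->] := walk_freeze D12 bH.
apply: (steps_law (G := fun s => Ex P (G s)) (C := C)) => // s.
have bG : bmeas (G s : T -> R) by exact: (walk_past (mG s)).
rewrite (le_trans (Ex_norm_le _ bG))// -[leRHS](Ex_cst P).
by apply: Ex_le => //; [exact: bmeas_norm|exact: bmeas_cst].
Qed.

Lemma bcrossing u r m : bmeas ((fun w => (crossing u r m w)%:R) : past_type F Dclock -> R).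
Proof. by apply: crossing_past => n _; exists n. Qed.

Lemma natb_norm (b : bool) : `|b%:R : R| <= 1.
Proof. by case: b; rewrite ?normr1 ?normr0. Qed.

Lemma cross_past u n0 n D : (forall i, (n0 <= i < n)%N -> D (inl i)) ->
  (forall i, (n0 <= i <= n)%N -> D (inr i)) -> (n0 <= n)%N ->
  bmeas ((fun w => (cross u n0 n w)%:R) : past_type F D -> R).
Proof.
move=> Dl Dr nn; pose r := rev (index_iota n0 n).
(* The size factor silences the lists of other lengths, whose visit indices could leave the range
   [n0, n] allowed by [D]. *)
pose g s (w : past_type F D) : R := (crossing u (vidx 0 n s) n w)%:R * (size s == n - n0)%N%:R.
have mg : measurable_fun setT (fun p : past_type F D * past_type F D => g [seq X i p.1 | i <- r] p.2).
  apply: (@discrete_pair_measurable _ _ (past_type F D) (past_type F D) _ (fun w => [seq X i w | i <- r]) _ R g).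
    by move=> s; apply: steps_past => k; rewrite mem_rev mem_index_iota => hk; exact: Dl.
  move=> s; rewrite /g; case: eqP => [sz|_]; last first.
    by under eq_fun do rewrite mulr0; exact: measurable_cst.
  under eq_fun do rewrite mulr1.
  suff [m _] : bmeas (fun x : past_type F D => (crossing u (vidx 0 n s) n x)%:R : R) by exact: m.
  apply: crossing_past => k; rewrite in_cons => /orP[/eqP ->|kv].
    by apply: Dr; rewrite nn leqnn.
  have sn : (size s <= n)%N by rewrite sz leq_subr.
  have := vidx_range sn kv; rewrite sz subKn// => /andP[k1 k2].
  by apply: Dr; rewrite k1 ltnW.
split; last by exists 1 => w; exact: natb_norm.
have md : measurable_fun setT (fun w : past_type F D => (w, w)).
  by apply/measurable_fun_pairP; split; exact: measurable_id.
have := measurableT_comp mg md; congr measurable_fun; apply/funext => w /=.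
by rewrite /g size_map size_rev size_iota eqxx mulr1.
Qed.

Lemma bcross u n0 n : (n0 <= n)%N -> bmeas (fun w => (cross u n0 n w)%:R : R).
Proof. by move=> nn; apply: (@walk_past setT); exact: cross_past. Qed.

Lemma cross_law u n0 n : 0 <= u -> (n0 <= n)%N ->
  Ex P (fun w => (cross u n0 n w)%:R) = avgs (n - n0) (fun s : seq V => pois u (visits 0 s)).
Proof.
move=> u0 nn; rewrite (steps_clocks_law (r := rev (index_iota n0 n))
  (G := fun s w => (crossing u (vidx 0 n s) n w)%:R) (C := 1)).
- rewrite size_rev size_iota; apply: avgs_size => s sz.
  by rewrite crossing_law ?size_vidx// vidx_notin// sz leq_subr.
- by rewrite rev_uniq iota_uniq.
- by move=> s; exact: bcrossing.
- by move=> s w; exact: natb_norm.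
Qed.

(** The truncated list of visits is a prefix of the full one: with equal counts they coincide and so
    do the crossings; otherwise one of the two must occur. *)
Lemma cross_discrepancy u n0 n : 0 <= u -> (n0 <= n)%N ->
  Ex P (fun w => (cross u n0 n w != cross u 0 n w)%:R) <=
  avgs n (fun s : seq V => (visits 0 (take (n - n0) s) != visits 0 s)%:R *
    (pois u (visits 0 (take (n - n0) s)) + pois u (visits 0 s))).
Proof.
move=> u0 nn.
pose G s w : R := (crossing u (vidx 0 n (take (n - n0) s)) n w != crossing u (vidx 0 n s) n w)%:R.
have bG s : bmeas (G s : past_type F Dclock -> R).
  rewrite (_ : (G s : _ -> R) = fun w => (crossing u (vidx 0 n (take (n - n0) s)) n w)%:R +
    (crossing u (vidx 0 n s) n w)%:R - 2 * ((crossing u (vidx 0 n (take (n - n0) s)) n w)%:R *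
    (crossing u (vidx 0 n s) n w)%:R)); last first.
    by apply/funext => w; rewrite /G; case: (crossing _ _ _ _); case: (crossing _ _ _ _) => /=; ring.
  have b1 := bcrossing u (vidx 0 n (take (n - n0) s)) n; have b2 := bcrossing u (vidx 0 n s) n.
  by apply: bmeasB; [exact: bmeasD|apply: bmeasZ; exact: bmeasM].
have -> : (fun w => (cross u n0 n w != cross u 0 n w)%:R) = (fun w => G (incs 0 n w) w).
  apply/funext => w; rewrite /G /cross (incs_cat w (leq0n n0) nn).
  by rewrite -(size_incs n0 n w) take_size_cat.
rewrite (steps_clocks_law (r := rev (index_iota 0 n)) (G := G) (C := 1)); last 3 first.
- by rewrite rev_uniq iota_uniq.
- exact: bG.
- by move=> s w; exact: natb_norm.
rewrite size_rev size_iota subn0; apply: avgs_size_le => s sz.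
case: eqP => [vE|_].
  rewrite mul0r -[leRHS](Ex_cst P); apply: Ex_le; [exact: walk_past (bG s)|exact: bmeas_cst|].
  move=> w; rewrite /G; have -> : vidx 0 n (take (n - n0) s) = vidx 0 n s.
    have := vidx_cat 0 n (take (n - n0) s) (drop (n - n0) s); rewrite cat_take_drop => e1.
    have : size (vidx 0 n (take (n - n0) s)) = size (vidx 0 n s) by rewrite !size_vidx.
    rewrite e1 size_cat => /eqP; rewrite -[X in X == _]addn0 eqn_add2l eq_sym size_eq0 => /eqP ->.
    by rewrite cats0.
  by rewrite eqxx.
have b1 := walk_past (bcrossing u (vidx 0 n (take (n - n0) s)) n).
have b2 := walk_past (bcrossing u (vidx 0 n s) n).
rewrite mul1r -!(size_vidx 0 n) -!(@crossing_law u _ n u0); last 2 first.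
- by apply: vidx_notin; rewrite sz.
- by apply: vidx_notin; rewrite size_take sz; case: ifP => // _; exact: leq_subr.
rewrite -ExD//; apply: Ex_le; [exact: walk_past (bG s)|exact: bmeasD|move=> w].
by rewrite /G; case: (crossing _ _ _ _); case: (crossing _ _ _ _); rewrite /= ?addr0 ?add0r// -natrD.
Qed.

Definition is_step (v : V) : bool := [exists e, v == @stepv d e].

Lemma avgs_step_le n (G H : seq V -> R) :
  (forall s, size s = n -> all is_step s -> G s <= H s) -> avgs n G <= avgs n H.
Proof.
elim: n G H => [|n ih] G H GH /=; first exact: GH.
rewrite /avg ler_wpM2l ?invr_ge0//; apply: ler_sum => e _; apply: ih => s sz st.
by apply: GH; rewrite /= ?sz ?st ?andbT//; apply/existsP; exists e.
Qed.

Lemma step_coord (s : seq V) i : all is_step s -> (`|(\sum_(e <- s) e) 0 i| <= (size s)%:Z)%R.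
Proof.
elim: s => [|e s ih] /=; first by rewrite big_nil mxE normr0.
move=> /andP[/existsP[q /eqP eq] st]; rewrite big_cons mxE (le_trans (ler_normD _ _))//.
have -> : (size s).+1%:Z = 1 + (size s)%:Z by rewrite -add1n PoszD.
rewrite lerD ?ih// eq !mxE eqxx/=.
by rewrite normrM normrX normrN normr1 expr1n mul1r; case: (_ == _).
Qed.

Lemma pair_tail (r r' : seq nat) (u b : R) : 0 <= u -> 1 <= b -> uniq r -> uniq r' ->
  (forall i, i \in r -> i \in r' -> False) ->
  Ex P (fun w => (u < clocks r w)%R%:R * (u < clocks r' w)%R%:R) <=
  b ^+ (size r + size r') * expR (- (2 * (u * (1 - b^-1)))).
Proof.
move=> u0 b1 ur ur' rr'.
pose D (q : seq nat) : set (nat + nat) := [set k | exists2 i, i \in q & k = inr i].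
have D12 : D r `&` D r' = set0.
  by apply/seteqP; split => // k [[i ir ->] [j jr' [ij]]]; apply: (rr' i) => //; rewrite ij.
have bt q : bmeas ((fun w => (u < clocks q w)%R%:R) : past_type F (D q) -> R).
  by apply: bmeas_lt => //; apply: clocks_past => n nq; exists n.
rewrite (mutual_indep_Ex events_measurable events_setI events_setT indF D12 (bt r) (bt r')).
have cdf (q : seq nat) : uniq q -> 0 <= Ex P (fun w => (u < clocks q w)%R%:R) <=
    b ^+ size q * expR (- (u * (1 - b^-1))).
  by move=> uq; rewrite Ex_ge0//= clocks_tail// pois_cdf_le.
have /andP[p0 p1] := cdf r ur; have /andP[q0 q1] := cdf r' ur'.
rewrite (le_trans (ler_pM p0 q0 p1 q1))// le_eqVlt; apply/orP; left; apply/eqP.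
have -> : - (2 * (u * (1 - b^-1))) = - (u * (1 - b^-1)) + - (u * (1 - b^-1)) by ring.
by rewrite expRD exprD; ring.
Qed.

(** Read backwards from jump n, crossings at two distinct positions force the clocks of two disjoint
    lists of visits to exceed u each. Given the steps these events are independent, and Chernoff's
    bound leaves an exponential moment of the visits to two points. *)
Lemma cross_pair : (3 <= d)%N -> exists2 C : R, 0 < C & forall u n0 m n, 0 <= u ->
  (n0 <= m)%N -> (m < n)%N ->
  Ex P (fun w => (cross u n0 m w)%:R * (cross u n0 n w)%:R) <=
  (2 * (n - n0)).+1%:R ^+ d * (C * expR (- (2 * (u * (1 - (two_base R d)^-1))))).
Proof.
move=> d_ge3; have [C C0 hC] := two_points_moment R d_ge3.
set b := two_base R d; have b1 : 1 < b := two_base_gt1 R d_ge3.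
have b0 : 0 < b by lra.
exists (b * C); first exact: mulr_gt0.
move=> u n0 m n u0 nm mn; set k := (n - n0)%N; set e := expR _.
pose G s w : R := (crossing u (vidx 0 m (drop (n - m) s)) m w)%:R * (crossing u (vidx 0 n s) n w)%:R.
have bG s : bmeas (G s : past_type F Dclock -> R) by apply: bmeasM; exact: bcrossing.
have -> : (fun w => (cross u n0 m w)%:R * (cross u n0 n w)%:R) = (fun w => G (incs n0 n w) w).
  apply/funext => w; rewrite /G /cross; congr (_%:R * _); congr (crossing _ (vidx _ _ _) _ _).
  by rewrite (incs_cat w nm (ltnW mn)) -(size_incs m n w) drop_size_cat.
rewrite (steps_clocks_law (r := rev (index_iota n0 n)) (G := G) (C := 1)); last 3 first.
- by rewrite rev_uniq iota_uniq.
- exact: bG.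
- by move=> s w; rewrite /G -natrM mulnb; exact: natb_norm.
rewrite size_rev size_iota -/k.
(* [two_points_moment] concerns a deterministic point, so all (2k + 1)^d possible displacements
   between the two positions are summed over. *)
pose z (f : {ffun 'I_d -> 'I_(2 * k).+1}) : V := \row_i ((f i : nat)%:Z - k%:Z).
apply: (@le_trans _ _ (avgs k (fun s : seq V => \sum_f
    (z f != 0)%:R * ((b * e) * b ^+ (visits 0 s + visits (z f) s))))); last first.
  rewrite avgs_sum.
  apply: (@le_trans _ _ (\sum_(f : {ffun 'I_d -> 'I_(2 * k).+1}) (b * C * e))).
    have be : 0 <= b * e by rewrite mulr_ge0 ?expR_ge0// ltW.
    apply: ler_sum => f _; rewrite !avgsZ.
    case: eqP => [_|/eqP zf] /=; first by rewrite mul0r !mulr_ge0 ?(ltW b0) ?(ltW C0) ?expR_ge0.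
    rewrite mul1r [leRHS]mulrAC ler_wpM2l//; have := hC k (- z f); rewrite oppr_eq0 opprK; exact.
  by rewrite sumr_const card_ffun !card_ord -[leLHS]mulr_natl natrX.
apply: avgs_step_le => s sz st.
have kn : (size s <= n)%N by rewrite sz leq_subr.
have e1 x : vidx x n s = vidx x n (take (n - m) s) ++
    vidx (x + \sum_(v <- take (n - m) s) v) m (drop (n - m) s).
  rewrite -[in LHS](cat_take_drop (n - m) s) vidx_cat size_take sz; congr (_ ++ vidx _ _ _).
  case: ltnP => h; first by rewrite subKn// ltnW.
  have -> : k = (n - m)%N by apply/eqP; rewrite eqn_leq h /k leq_sub2l.
  by rewrite subKn// ltnW.
have bGs := walk_past (bG s).
set y := \sum_(v <- take (n - m) s) v in e1.
(* The displacement [y] leads from the position after jump m to the one after jump n; visits listed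
   from -y are those to the former, and m is one of them. *)
have last x : x + y = 0 -> m \in vidx x n (take (n - m) s).
  have : size (take (n - m) s) = (n - m)%N.
    by rewrite size_takel// sz /k leq_sub2l.
  rewrite /y; case/lastP: (take (n - m) s) => [/= /esym/eqP|t v].
    by rewrite subn_eq0 leqNgt mn.
  rewrite size_rcons => szt; rewrite big_rcons/= addrCA => xy.
  rewrite -cats1 vidx_cat mem_cat/=.
  have -> : x + \sum_(e <- t) e + v = 0 by rewrite -[RHS]xy addrCA addrA.
  rewrite eqxx inE.
  apply/orP; right; apply/eqP; rewrite -subnS szt subKn// ltnW//.
have big x w : x + y = 0 -> crossing u (vidx 0 m (drop (n - m) s)) m w -> u < clocks (vidx x n s) w.
  move=> xy /andP[_ uc]; rewrite e1 xy /clocks big_cat/= -/(clocks _ w) addrC.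
  rewrite (lt_le_trans uc)// lerD2l /clocks (perm_big _ (perm_to_rem (last x xy))) big_cons lerDl.
  by rewrite sumr_ge0// => i _; exact: ltW.
(* At the same position, the crossing at m has already used up the level for n. *)
have [y0|y0] := eqVneq y 0.
  apply: (@le_trans _ _ 0).
    rewrite -[leRHS](Ex_cst P); apply: Ex_le; [exact: bGs|exact: bmeas_cst|move=> w].
    rewrite /G; case: (boolP (crossing u (vidx 0 m _) m w)) => [cm|_]; last by rewrite mul0r.
    have := big 0 w; rewrite y0 addr0 => /(_ erefl cm) uc.
    have -> : crossing u (vidx 0 n s) n w = false by rewrite /crossing leNgt uc.
    by rewrite mulr0.
  by apply: sumr_ge0 => f _; rewrite !mulr_ge0 ?expR_ge0 ?exprn_ge0 ?(ltW b0).
have [f zf] : exists f, z f = - y.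
  have yi i : (`|(- y) 0 i| <= k%:Z)%R.
    rewrite mxE normrN (le_trans (step_coord i _))//.
      by apply/allP => v /mem_take; exact: (allP st).
    by rewrite lez_nat size_take sz; case: ifP => // _; rewrite /k leq_sub2l.
  have fi i : (`|((- y) 0 i + k%:Z)%R| < (2 * k).+1)%N.
    by have := yi i; move: ((- y) 0 i) => q; clear; lia.
  exists [ffun i => Ordinal (fi i)]; apply/rowP => i; rewrite !mxE ffunE/=.
  have := yi i; rewrite mxE; move: (y 0 i) => q; clear; lia.
have zf0 : z f != 0 by rewrite zf oppr_eq0.
rewrite (bigD1 f)//= zf0 mul1r ler_wpDr//.
  by apply: sumr_ge0 => f' _; rewrite !mulr_ge0 ?expR_ge0 ?exprn_ge0 ?(ltW b0).
have ur := vidx_notin 0 kn; have ur' := vidx_uniq (- y) kn.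
have dis i : i \in n :: vidx 0 n s -> i \in vidx (- y) n s -> False.
  rewrite in_cons => /orP[/eqP -> /(vidx_range kn)|i0 iy]; first by rewrite ltnn andbF.
  by apply: (vidx_disjoint _ kn i0 iy); rewrite eq_sym oppr_eq0.
have bt q : bmeas (fun w => (u < clocks q w)%R%:R : R).
  by apply: (@walk_past setT); apply: bmeas_lt => //; exact: clocks_past.
apply: (@le_trans _ _ (Ex P (fun w => (u < clocks (n :: vidx 0 n s) w)%R%:R *
    (u < clocks (vidx (- y) n s) w)%R%:R))).
  apply: Ex_le; [exact: bGs|by apply: bmeasM|move=> w].
  rewrite /G; case: (boolP (crossing u (vidx 0 m _) m w)) => [cm|_]; last by rewrite mul0r mulr_ge0.
  rewrite (big (- y) w (addNr y) cm) mul1r mulr1; case: (boolP (crossing _ _ n w)) => // /andP[_].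
  by rewrite /clocks big_cons addrC => ->.
rewrite (le_trans (pair_tail u0 (ltW b1) ur ur' dis))//= !size_vidx zf.
by rewrite addSn exprS [leLHS]mulrAC.
Qed.

Lemma avgs_Phi (th : 'I_d -> R) k (v : V) :
  avgs k (fun s => Phi th (v + \sum_(e <- s) e)) = (d%:R^-1 * \sum_i cos (th i)) ^+ k * Phi th v.
Proof.
elim: k v => [|k ih] v /=; first by rewrite big_nil addr0 expr0 mul1r.
under eq_avg => e do under eq_avgs => s do rewrite big_cons addrA.
under eq_avg do rewrite ih.
by rewrite avgZ avg_Phi// mulrA -exprSr.
Qed.

Lemma Phi_norm (th : 'I_d -> R) (v : V) : `|Phi th v| <= 1.
Proof. by rewrite /Phi normr_prod; apply: prodr_ile1 => i _; rewrite normr_ge0 cos_max. Qed.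

Lemma incs_law (G : seq V -> R) (C : R) n0 n : (forall s, `|G s| <= C) ->
  Ex P (fun w => G (incs n0 n w)) = avgs (n - n0) G.
Proof.
move=> GC; rewrite (steps_law (r := rev (index_iota n0 n)) (G := G) (C := C))//.
  by rewrite size_rev size_iota.
by rewrite rev_uniq iota_uniq.
Qed.

Lemma incs_measurable n0 n (f : seq V -> R) : measurable_fun setT (fun w : T => f (incs n0 n w)).
Proof.
apply: (@discrete_measurable _ _ T _ _ (incs n0 n) _ f) => s.
apply: (past_measurable events_measurable (D := setT)).
exact: (@steps_past setT _ s (fun _ _ => Logic.I)).
Qed.

(** The law makes the increments unit vectors only almost surely; this null event is what the
    pathwise bounds on displacements leave out. *)
Lemma incs_steps n0 n : Ex P (fun w => (~~ all is_step (incs n0 n w))%:R) = 0.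
Proof.
apply/eqP; rewrite eq_le Ex_ge0 ?andbT//.
rewrite (@incs_law (fun s => (~~ all is_step s)%:R) 1); last by move=> s; exact: natb_norm.
by rewrite -[leRHS](avgs_cst d_gt0 (n - n0) 0); apply: avgs_step_le => s _ ->.
Qed.

Lemma prod_lipschitz (I : Type) (s : seq I) (x y : I -> R) :
  (forall i, `|x i| <= 1) -> (forall i, `|y i| <= 1) ->
  `|\prod_(i <- s) x i - \prod_(i <- s) y i| <= \sum_(i <- s) `|x i - y i|.
Proof.
move=> hx hy; elim: s => [|i s ih]; first by rewrite !big_nil subrr normr0.
rewrite !big_cons.
have -> : x i * \prod_(j <- s) x j - y i * \prod_(j <- s) y j =
  (x i - y i) * \prod_(j <- s) x j + y i * (\prod_(j <- s) x j - \prod_(j <- s) y j) by ring.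
rewrite (le_trans (ler_normD _ _))// lerD// normrM.
  by rewrite ler_piMr// normr_prod prodr_ile1// => j _; rewrite normr_ge0 hx.
by rewrite (le_trans _ ih)// ler_piMl.
Qed.

Lemma pow_one_minus (y : R) (L : nat) : 0 <= y <= 1 ->
  `|(1 - y) ^+ L - (1 - L%:R * y)| <= (L%:R * y) ^+ 2.
Proof.
move=> /andP[y0 y1].
have lb : 1 - L%:R * y <= (1 - y) ^+ L.
  elim: L => [|L ih]; first by rewrite mul0r subr0 expr0.
  rewrite exprS; have h : 0 <= 1 - y by lra.
  rewrite (le_trans _ (ler_wpM2l h ih))// -natr1.
  rewrite -subr_ge0 (_ : (1 - y) * (1 - L%:R * y) - (1 - (L%:R + 1) * y) = L%:R * y ^+ 2); last by ring.
  by rewrite mulr_ge0// sqr_ge0.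
rewrite ger0_norm ?subr_ge0// lerBlDl.
have Ly : 0 <= L%:R * y by rewrite mulr_ge0.
have /andP[_ ub] := expRN_bounds Ly.
rewrite (le_trans _ ub)// -mulrN expRM_natl lerXn2r ?nnegrE ?expR_ge0//; first by lra.
exact: expR_ge1Dx.
Qed.

(** * The blocks of the walk as a killed array *)

Section walk_array.
Variables (u : nat -> R) (L : nat -> nat) (lam : nat -> R) (c : R).
Hypothesis lam_ge0 : forall N, 0 <= lam N.
Hypothesis L_gt0 : forall N, (0 < L N)%N.
Hypothesis c_ge0 : 0 <= c.

Definition walk_mesh (N : nat) : R := (L N)%:R / N%:R ^+ 2.

Definition block_count N j w : R := \sum_(i < L N) (cross (u N) (j * L N) (j * L N + i) w)%:R.

Definition walk_path N j w (i : 'I_d) : R := ((pos (j * L N) w) 0 i)%:~R / N%:R.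

Definition walk_kill N j w : R := expR (- (lam N * \sum_(l < j) block_count N l w)).

Let rate N j : R := Ex P (fun w => 1 - expR (- (lam N * block_count N j w))).

Hypothesis L_small : forall q : R, 0 < q -> \forall N \near \oo, (L N)%:R <= q * N%:R.
Hypothesis rate_asymp : forall e : R, 0 < e -> \forall N \near \oo, forall j,
  `|rate N j - c * walk_mesh N| <= e * walk_mesh N.

Let before n : set (nat + nat) := [set k | match k with inl i => (i < n)%N | inr i => (i < n)%N end].
Let during n m : set (nat + nat) := [set k | match k with inl i => (n <= i < m)%N | inr i => (n <= i < m)%N end].

Let before_during n m : before n `&` during n m = set0.
Proof.
by apply/seteqP; split => // -[i|i] /= [h1 /andP[h2 _]]; move: (leq_ltn_trans h2 h1); rewrite ltnn.
Qed.

Lemma incs_past D n0 n (f : seq V -> R) : (forall i, (n0 <= i < n)%N -> D (inl i)) ->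
  measurable_fun setT ((fun w => f (incs n0 n w)) : past_type F D -> R).
Proof.
move=> hD; apply: (@discrete_measurable _ _ (past_type F D) _ _ (incs n0 n) _ f).
by move=> s; apply: steps_past => k; rewrite mem_rev mem_index_iota; exact: hD.
Qed.

Lemma pos_incs k w : pos k w = \sum_(e <- incs 0 k w) e.
Proof. by rewrite sum_incs// /pos big_ord0 subr0. Qed.

Let path_past N j i D : (forall k, (k < j * L N)%N -> D (inl k)) ->
  measurable_fun setT ((fun w => walk_path N j w i) : past_type F D -> R).
Proof.
move=> hD; rewrite /walk_path; under eq_fun do rewrite pos_incs.
by apply: (@incs_past D 0 (j * L N) (fun s => ((\sum_(e <- s) e) 0 i)%:~R / N%:R)) => k /andP[_ /hD].
Qed.

Let count_past N j D : (forall i, (j * L N <= i < j.+1 * L N)%N -> D (inl i)) ->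
  (forall i, (j * L N <= i < j.+1 * L N)%N -> D (inr i)) ->
  bmeas (block_count N j : past_type F D -> R).
Proof.
move=> Dl Dr; apply: bmeas_sum => i _; apply: cross_past; last exact: leq_addr.
- move=> k /andP[k1 k2]; apply: Dl; rewrite k1 (ltn_trans k2)// mulSn [(L N + _)%N]addnC ltn_add2l.
  exact: ltn_ord.
- move=> k /andP[k1 k2]; apply: Dr; rewrite k1 (leq_ltn_trans k2)// mulSn [(L N + _)%N]addnC ltn_add2l.
  exact: ltn_ord.
Qed.

Lemma block_count_ge0 N j w : 0 <= block_count N j w.
Proof. exact: sumr_ge0. Qed.

Let bexp_count N j D : (forall i, (j * L N <= i < j.+1 * L N)%N -> D (inl i)) ->
  (forall i, (j * L N <= i < j.+1 * L N)%N -> D (inr i)) ->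
  bmeas ((fun w => expR (- (lam N * block_count N j w))) : past_type F D -> R).
Proof.
move=> Dl Dr; have [mc _] := count_past Dl Dr; split.
  by apply: measurableT_comp => //; apply: measurableT_comp => //; exact: measurable_funM.
by exists 1 => w; rewrite ger0_norm ?expR_ge0// expR_le1 oppr_le0 mulr_ge0// block_count_ge0.
Qed.

Let kill_past N j D : (forall k, before (j * L N) k -> D k) ->
  bmeas (walk_kill N j : past_type F D -> R).
Proof.
move=> hD; have bs : bmeas ((fun w => \sum_(l < j) block_count N l w) : past_type F D -> R).
  apply: bmeas_sum => l _; apply: count_past => k /andP[_ kl]; apply: hD => /=;
  by rewrite (leq_trans kl)// leq_mul2r ltn_ord orbT.
split.
  by apply: measurableT_comp => //; apply: measurableT_comp => //; apply: measurable_funM => //; exact: bs.1.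
exists 1 => w; rewrite ger0_norm ?expR_ge0// expR_le1 oppr_le0 mulr_ge0// sumr_ge0// => l _.
exact: block_count_ge0.
Qed.

Let W r N j w : R := walk_kill N j w * stay (walk_path N) r j w.

Let W_past r N j D : (forall k, before (j * L N) k -> D k) -> bmeas (W r N j : past_type F D -> R).
Proof.
move=> hD; apply: bmeasM; first exact: kill_past.
apply: bmeas_prod => l _; apply: bmeas_cube => i; apply: path_past => k kl; apply: hD => /=.
by rewrite (leq_trans kl)// leq_mul2r -ltnS ltn_ord orbT.
Qed.

Let kill01 N j w : 0 <= walk_kill N j w <= 1.
Proof.
rewrite expR_ge0/= expR_le1 oppr_le0 mulr_ge0// sumr_ge0// => l _; exact: block_count_ge0.
Qed.

Let W01 r N j w : 0 <= W r N j w <= 1.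
Proof.
have /andP[a0 a1] := kill01 N j w; have /andP[b0 b1] := stay01 (walk_path) r N j w.
by rewrite mulr_ge0//= mulr_ile1.
Qed.

Let bW r N j : bmeas (W r N j).
Proof. by apply: (@walk_past setT); exact: W_past. Qed.

Let mpath N j i : measurable_fun setT (fun w => walk_path N j w i).
Proof.
rewrite /walk_path; under eq_fun do rewrite pos_incs.
exact: (incs_measurable 0 (j * L N) (fun s => ((\sum_(e <- s) e) 0 i)%:~R / N%:R)).
Qed.

Let posB N j w : pos (j.+1 * L N) w = pos (j * L N) w + \sum_(e <- incs (j * L N) (j.+1 * L N) w) e.
Proof. by rewrite sum_incs ?leq_mul2r ?leqnSn ?orbT// addrC subrK. Qed.

Let PhiE (th : 'I_d -> R) N (v : V) :
  PhiR th (fun i => (v 0 i)%:~R / N%:R) = Phi (fun i => th i / N%:R) v.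
Proof. by apply: eq_bigr => i _; congr cos; rewrite mulrA mulrAC. Qed.

(** The eigenvalue is 1 - kap / N^2 up to O(N^(-4)); its power L N is linearised with an error
    quadratic in the mesh, and the mesh tends to 0. *)
Let char_asymp (th : 'I_d -> R) e : 0 < e -> \forall N \near \oo,
  `|(d%:R^-1 * \sum_i cos (th i / N%:R)) ^+ L N - (1 - kap th * walk_mesh N)| <= e * walk_mesh N.
Proof.
move=> e0; pose K : R := d%:R^-1 * \sum_i th i ^+ 4.
have th4 i : 0 <= th i ^+ 4 by rewrite exprn_even_ge0.
have K0 : 0 <= K by rewrite mulr_ge0 ?invr_ge0// sumr_ge0.
have k0 := kap_ge0 th.
pose q := Num.min 1 (e / (K + (kap th + K) ^+ 2 + 1)).
have den : 0 < K + (kap th + K) ^+ 2 + 1 by rewrite ltr_wpDl// addr_ge0// sqr_ge0.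
have q0 : 0 < q by rewrite lt_min ltr01 divr_gt0.
have q20 : 0 < q / (kap th + K + 1) by rewrite divr_gt0// ltr_wpDl// addr_ge0.
near=> N.
have N1 : (1 <= N)%N by near: N; exists 1%N.
have N1' : 1 <= N%:R :> R by rewrite ler1n.
have N0 : 0 < N%:R :> R by lra.
have LN : (L N)%:R <= q * N%:R by near: N; exact: L_small.
have NK : q^-1 * (kap th + K) <= N%:R.
  near: N; exists (Num.trunc (q^-1 * (kap th + K))).+1 => // k /= hk.
  by rewrite (le_trans (ltW (truncnS_gt _)))// ler_nat.
set y := 1 - d%:R^-1 * \sum_i cos (th i / N%:R).
have d0' : d%:R != 0 :> R by rewrite pnatr_eq0 -lt0n.
have sumd (a : R) : d%:R^-1 * \sum_(i < d) a = a.
  by rewrite sumr_const card_ord -[a *+ d]mulr_natl mulKf.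
have yE : `|y - kap th / N%:R ^+ 2| <= K / N%:R ^+ 4.
  have -> : y - kap th / N%:R ^+ 2 =
      - (d%:R^-1 * \sum_i (cos (th i / N%:R) - (1 - (th i / N%:R) ^+ 2 / 2))).
    rewrite big_split/= sumrN big_split/= sumrN mulrDr mulrN mulrDr mulrN sumd /y.
    have -> : kap th / N%:R ^+ 2 = d%:R^-1 * \sum_i (th i / N%:R) ^+ 2 / 2.
      rewrite /kap invfM -mulrA [2^-1 * _]mulrC -!mulrA; congr (_ * _).
      rewrite mulr_suml mulr_sumr; apply: eq_bigr => i _.
      by rewrite expr_div_n mulrC.
    by ring.
  rewrite normrN normrM ger0_norm ?invr_ge0// /K -mulrA ler_wpM2l ?invr_ge0//.
  rewrite (le_trans (ler_norm_sum _ _ _))// mulr_suml; apply: ler_sum => i _.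
  have h4 : 0 <= th i ^+ 4 / N%:R ^+ 4 by rewrite divr_ge0// exprn_ge0// ltW.
  by rewrite (le_trans (cos_taylor _))// expr_div_n; lra.
have y0 : 0 <= y.
  rewrite subr_ge0 -[leRHS]sumd ler_wpM2l ?invr_ge0//; apply: ler_sum => i _; exact: cos_le1.
have N2 : N%:R <= N%:R ^+ 2 :> R by rewrite expr2 ler_peMl// ltW.
have i2 : (N%:R ^+ 2)^-1 <= N%:R^-1 :> R by rewrite lef_pV2 ?posrE ?exprn_gt0.
have i1 : N%:R^-1 <= 1 :> R by rewrite invf_le1.
have i20 : 0 <= (N%:R ^+ 2)^-1 :> R by rewrite invr_ge0 sqr_ge0.
have i4 : K / N%:R ^+ 4 <= K / N%:R ^+ 2.
  by rewrite ler_wpM2l// lef_pV2 ?posrE ?exprn_gt0// ler_weXn2l.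
have yub : y <= (kap th + K) / N%:R ^+ 2.
  by rewrite mulrDl; move: yE; rewrite ler_norml => /andP[_ ?]; lra.
have q1 : q <= 1 by rewrite ge_min lexx.
have Nq : (kap th + K) / N%:R <= q.
  by rewrite ler_pdivrMr// -ler_pdivrMl// mulrC.
have y1 : y <= 1.
  by rewrite (le_trans yub)// (le_trans _ q1)// (le_trans _ Nq)// ler_wpM2l// addr_ge0.
have -> : d%:R^-1 * \sum_i cos (th i / N%:R) = 1 - y by rewrite /y; ring.
have y01 : 0 <= y <= 1 by rewrite y0.
have p1 := pow_one_minus (L N) y01.
set h := walk_mesh N; have h0 : 0 <= h by rewrite divr_ge0// sqr_ge0.
have -> : (1 - y) ^+ L N - (1 - kap th * h) =
  ((1 - y) ^+ L N - (1 - (L N)%:R * y)) - (L N)%:R * (y - kap th / N%:R ^+ 2).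
  by rewrite /h /walk_mesh; field; rewrite gt_eqF.
rewrite (le_trans (ler_normB _ _))//.
have hq : h <= q.
  rewrite /h /walk_mesh ler_pdivrMr ?exprn_gt0// (le_trans LN)// ler_wpM2l ?(ltW q0)//.
have t1 : (L N)%:R * y <= (kap th + K) * h.
  by rewrite /h /walk_mesh mulrCA ler_wpM2l.
have t2 : ((L N)%:R * y) ^+ 2 <= (kap th + K) ^+ 2 * q * h.
  rewrite (@le_trans _ _ (((kap th + K) * h) ^+ 2))//.
    by rewrite lerXn2r ?nnegrE//; apply: mulr_ge0 => //; apply: addr_ge0.
  by rewrite exprMn -mulrA ler_wpM2l ?sqr_ge0// expr2 ler_wpM2r.
have t3 : `|(L N)%:R * (y - kap th / N%:R ^+ 2)| <= K * q * h.
  rewrite normrM ger0_norm//.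
  rewrite (@le_trans _ _ ((L N)%:R * (K / N%:R ^+ 4)))//; first by rewrite ler_wpM2l.
  rewrite (_ : (L N)%:R * (K / N%:R ^+ 4) = K * (N%:R ^+ 2)^-1 * h); last first.
    by rewrite /h /walk_mesh; field; rewrite gt_eqF.
  rewrite ler_wpM2r// ler_wpM2l//.
  have : (L N)%:R / N%:R ^+ 2 <= q := hq.
  by apply: le_trans; rewrite ler_peMl// ler1n.
have qe : q * (K + (kap th + K) ^+ 2 + 1) <= e.
  by rewrite -ler_pdivlMr// ge_min lexx orbT.
rewrite (@le_trans _ _ (q * (K + (kap th + K) ^+ 2 + 1) * h))//; last by rewrite ler_wpM2r.
have : 0 <= q * h by rewrite mulr_ge0// ltW.
rewrite (le_trans (lerD p1 t3))// (le_trans (lerD t2 (lexx _)))//.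
by rewrite -subr_ge0 (_ : _ - _ = q * h) ?mulr_ge0 ?(ltW q0)//; ring.
Unshelve. all: by end_near. Qed.

(** Displacement and crossings of a block are dependent, but the displacement is o(N), so [Phi]
    hardly changes over the block, and the change matters only where killing occurs, which has
    probability of the order of the mesh. The mixed term is thus negligible without any correlation
    estimate. *)
Let one_block (th : 'I_d -> R) e : 0 < e -> \forall N \near \oo, forall j (v : V),
  `|Ex P (fun w => Phi (fun i => th i / N%:R) (v + \sum_(e <- incs (j * L N) (j.+1 * L N) w) e) *
      expR (- (lam N * block_count N j w))) -
    (1 - (kap th + c) * walk_mesh N) * Phi (fun i => th i / N%:R) v| <= e * walk_mesh N.
Proof.
move=> e0; have e3 : 0 < e / 3 by rewrite divr_gt0.
pose K : R := \sum_i `|th i|; have K0 : 0 <= K by rewrite sumr_ge0.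
pose q : R := e / 3 / ((K + 1) * (c + 1)).
have q0 : 0 < q by rewrite divr_gt0// mulr_gt0// ltr_wpDl.
near=> N => j v.
have ch : `|(d%:R^-1 * \sum_i cos (th i / N%:R)) ^+ L N - (1 - kap th * walk_mesh N)| <=
   (e / 3) * walk_mesh N by near: N; exact: char_asymp.
have ra3 : forall j, `|rate N j - c * walk_mesh N| <= (e / 3) * walk_mesh N.
  by near: N; exact: rate_asymp.
have ra1 : forall j, `|rate N j - c * walk_mesh N| <= 1 * walk_mesh N.
  by near: N; exact: rate_asymp.
have LN : (L N)%:R <= q * N%:R by near: N; exact: L_small.
have N0 : 0 < N%:R :> R by rewrite ltr0n; near: N; exists 1%N.
set h := walk_mesh N in ch ra1 ra3 *; have h0 : 0 <= h by rewrite divr_ge0// sqr_ge0.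
set t := fun i => th i / N%:R.
pose n0 := (j * L N)%N; pose n := (j.+1 * L N)%N.
have nL : (n - n0)%N = L N by rewrite /n /n0 mulSn addnK.
pose A w := Phi t (v + \sum_(e <- incs n0 n w) e).
pose B w := 1 - expR (- (lam N * block_count N j w)).
have bA : bmeas A.
  split; last by exists 1 => w; exact: Phi_norm.
  exact: (incs_measurable n0 n (fun s => Phi t (v + \sum_(e <- s) e))).
have bB : bmeas B.
  apply: bmeasB; first exact: bmeas_cst.
  by apply: (@walk_past setT); exact: bexp_count.
have B01 w : 0 <= B w <= 1.
  rewrite subr_ge0 expR_le1 oppr_le0 mulr_ge0 ?block_count_ge0//=.
  by rewrite lerBlDr lerDl expR_ge0.
pose G w : R := (~~ all is_step (incs n0 n w))%:R.
have bG : bmeas G.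
  split; last by exists 1 => w; exact: natb_norm.
  exact: (incs_measurable n0 n (fun s => (~~ all is_step s)%:R)).
have EA : Ex P A = (d%:R^-1 * \sum_i cos (t i)) ^+ L N * Phi t v.
  by rewrite /A (@incs_law (fun s => Phi t (v + \sum_(e <- s) e)) 1) ?nL ?avgs_Phi// => s; exact: Phi_norm.
have EB : Ex P B = rate N j by [].
have rem w : `|(A w - Phi t v) * B w| <= q * K * B w + 2 * G w.
  have /andP[b0 b1] := B01 w.
  rewrite normrM (ger0_norm b0) /G; case: (boolP (all is_step _)) => st /=; last first.
    have A2 : `|A w - Phi t v| <= 1 + 1 by rewrite (le_trans (ler_normB _ _))// lerD// Phi_norm.
    have qKB : 0 <= q * K * B w by apply: mulr_ge0 => //; apply: mulr_ge0 => //; exact: ltW.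
    have := ler_pM (normr_ge0 _) b0 A2 b1; lra.
  rewrite mulr0 addr0 ler_wpM2r//.
  rewrite (le_trans (prod_lipschitz _ _ _))//; try by move=> i; exact: cos_max.
  rewrite /K mulr_sumr; apply: ler_sum => i _.
  rewrite (le_trans (cos_lipschitz _ _))// -mulrBr normrM /t normrM -mulrA [leRHS]mulrC.
  rewrite ler_wpM2l// normfV (gtr0_norm N0) ler_pdivrMl// mxE rmorphD/= addrAC subrr add0r.
  rewrite [leRHS]mulrC (le_trans _ LN)//.
  have := step_coord i st; rewrite size_incs nL => h1.
  by rewrite -intr_norm pmulrn ler_int; exact: h1.
have -> : (fun w => Phi t (v + \sum_(e <- incs n0 n w) e) * expR (- (lam N * block_count N j w))) =
    (fun w => (A w - Phi t v * B w) - (A w - Phi t v) * B w).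
  by apply/funext => w; rewrite /A /B; ring.
have bR : bmeas (fun w => (A w - Phi t v) * B w).
  by apply: bmeasM => //; apply: bmeasB => //; exact: bmeas_cst.
rewrite ExB//; last by apply: bmeasB => //; exact: bmeasZ.
rewrite ExB//; last exact: bmeasZ.
rewrite ExZ// EA EB.
set rho := (_ * _) ^+ _ in ch *.
have -> : rho * Phi t v - Phi t v * rate N j - Ex P (fun w => (A w - Phi t v) * B w) -
    (1 - (kap th + c) * h) * Phi t v =
  (rho - (1 - kap th * h)) * Phi t v - (rate N j - c * h) * Phi t v -
    Ex P (fun w => (A w - Phi t v) * B w) by ring.
have PB (x : R) : `|x| <= e / 3 * h -> `|x * Phi t v| <= e / 3 * h.
  by move=> hx; rewrite normrM (le_trans _ hx)// ler_piMr// Phi_norm.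
rewrite (le_trans (ler_normB _ _))//.
have -> : e * h = (e / 3 * h + e / 3 * h) + e / 3 * h by field.
rewrite lerD//; first by rewrite (le_trans (ler_normB _ _))// lerD// PB.
rewrite (le_trans (Ex_norm_le _ bR))//.
apply: (@le_trans _ _ (Ex P (fun w => q * K * B w + 2 * G w))).
  apply: Ex_le => //; first exact: bmeas_norm.
  by apply: bmeasD; exact: bmeasZ.
rewrite ExD ?ExZ//; try exact: bmeasZ.
rewrite incs_steps mulr0 addr0 EB.
have rb : rate N j <= (c + 1) * h by have := ra1 j; rewrite ler_norml => /andP[_ ?]; lra.
rewrite (@le_trans _ _ (q * (K + 1) * ((c + 1) * h)))//.
  apply: ler_pM => //; first by rewrite mulr_ge0// ltW.
    by rewrite -EB; apply: Ex_ge0 => w; case/andP: (B01 w).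
  by rewrite ler_pM2l// lerDl.
rewrite (_ : q * (K + 1) * ((c + 1) * h) = e / 3 * h)//.
rewrite /q; field; rewrite !gt_eqF ?ltr_wpDl//.
Unshelve. all: by end_near. Qed.

Lemma walk_heat_array : heat_array P walk_path walk_kill walk_mesh c.
Proof.
split.
- by move=> N j i; exact: mpath.
- by move=> N w i; rewrite /walk_path mul0n /pos big_ord0 mxE mul0r.
- by move=> N j; have [] := walk_past (@kill_past N j setT (fun _ _ => Logic.I)).
- by move=> N j w; exact: kill01.
- by move=> N w; rewrite /walk_kill big_ord0 mulr0 oppr0 expR0.
- move=> N j w; rewrite ler_expR lerN2 ler_wpM2l// big_ord_recr/= lerDl; exact: block_count_ge0.
- near=> N; rewrite divr_gt0 ?ltr0n// exprn_gt0// ltr0n; near: N; by exists 1%N.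
- move=> th r e r0 e0; near=> N => j.
  have ob : forall j (v : V), `|Ex P (fun w => Phi (fun i => th i / N%:R)
      (v + \sum_(e <- incs (j * L N) (j.+1 * L N) w) e) * expR (- (lam N * block_count N j w))) -
    (1 - (kap th + c) * walk_mesh N) * Phi (fun i => th i / N%:R) v| <= e * walk_mesh N.
    by near: N; exact: one_block.
  set t := fun i => th i / N%:R in ob.
  pose n0 := (j * L N)%N; pose n := (j.+1 * L N)%N.
  pose g w' v := Phi t (v + \sum_(e <- incs n0 n w') e) * expR (- (lam N * block_count N j w')).
  (* The past enters only through the position at the start of the block and the factor [W];
     freezing it reduces to [one_block] at a fixed starting point. *)
  pose G (p : past_type F (before n0) * past_type F (during n0 n)) :=
    g p.2 (pos n0 p.1) * W r N j p.1.
  have bWp := @W_past r N j (before n0) (fun _ h => h).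
  have bg v D : (forall k, during n0 n k -> D k) -> bmeas ((fun w => g w v) : past_type F D -> R).
    move=> hD; apply: bmeasM.
      split; last by exists 1 => w; exact: Phi_norm.
      by apply: (@incs_past D n0 n (fun s => Phi t (v + \sum_(e <- s) e))) => k hk; exact: hD.
    by apply: bexp_count => k hk; exact: hD.
  have g1 v w : `|g w v| <= 1.
    rewrite normrM mulr_ile1 ?Phi_norm// ger0_norm ?expR_ge0// expR_le1 oppr_le0 mulr_ge0//.
    exact: block_count_ge0.
  have bG : bmeas G.
    split; last first.
      exists 1 => p; rewrite normrM mulr_ile1 ?g1//.
      by have /andP[w0 w1] := W01 r N j p.1; rewrite ger0_norm.
    apply: measurable_funM; last exact: (measurableT_comp bWp.1 measurable_fst).
    rewrite /=; under eq_fun do rewrite pos_incs.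
    apply: (@discrete_pair_measurable _ _ (past_type F (before n0)) (past_type F (during n0 n)) _
      (incs 0 n0) _ R (fun s (w : past_type F (during n0 n)) => g w (\sum_(e <- s) e))).
      by move=> s; apply: steps_past => k; rewrite mem_rev mem_index_iota => /andP[].
    by move=> s; exact: (bg _ _ (fun _ h => h)).1.
  have [bI eG] := walk_freeze (before_during n0 n) bG.
  have -> : (fun w => PhiR th (walk_path N j.+1 w) * (walk_kill N j.+1 w * stay (walk_path N) r j w)) =
      (fun w => G (w, w)).
    apply/funext => w; rewrite /G /g /W/= PhiE posB /walk_kill big_ord_recr/= mulrDr opprD expRD.
    by rewrite /n0 /n; ring.
  rewrite eG.
  have inE w : Ex P (fun w' => G (w, w')) = Ex P (fun w' => g w' (pos n0 w)) * W r N j w.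
    rewrite mulrC -ExZ; last exact: walk_past (bg (pos n0 w) setT (fun _ _ => Logic.I)).
    by congr (Ex P _); apply/funext => w'; rewrite /G mulrC.
  have bPhi : bmeas (fun w => Phi t (pos n0 w) * W r N j w).
    apply: bmeasM => //; split; last by exists 1 => w; exact: Phi_norm.
    under eq_fun do rewrite pos_incs.
    exact: (incs_measurable 0 n0 (fun s => Phi t (\sum_(e <- s) e))).
  have -> : (fun w => PhiR th (walk_path N j w) * (walk_kill N j w * stay (walk_path N) r j w)) =
      (fun w => Phi t (pos n0 w) * W r N j w) by apply/funext => w; rewrite PhiE.
  have bI' : bmeas (fun w : T => Ex P (fun w' : T => G (w, w'))) by apply: (@walk_past (before n0)); exact: bI.
  rewrite -[(1 - _) * Ex P _]ExZ// -ExB//; last exact: bmeasZ.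
  rewrite (le_trans (Ex_norm_le _ _))//; first by apply: bmeasB => //; exact: bmeasZ.
  rewrite -ExZ//; last exact: bW.
  apply: Ex_le; [by apply/bmeas_norm/bmeasB => //; exact: bmeasZ|apply: bmeasZ; exact: bW|move=> w].
  rewrite inE mulrA -mulrBl normrM; have /andP[w0 _] := W01 r N j w.
  by rewrite (ger0_norm w0) ler_wpM2r//; exact: ob.
- move=> q r e q0 r0 e0; near=> N => j.
  have LN : (L N)%:R <= q * N%:R by near: N; exact: L_small.
  have N0 : 0 < N%:R :> R by rewrite ltr0n; near: N; exists 1%N.
  apply: (@le_trans _ _ 0); last first.
    rewrite mulr_ge0//; first by rewrite mulr_ge0 ?(ltW e0)// divr_ge0// sqr_ge0.
    by apply: Ex_ge0 => w; case/andP: (W01 r N j w).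
  rewrite -(incs_steps (j * L N) (j.+1 * L N)); apply: Ex_le.
  + apply: bmeasM; last exact: bW.
    by apply: bmeas_not; apply: bmeas_cube => i; apply: measurable_funB; exact: mpath.
  + split; last by exists 1 => w; exact: natb_norm.
    exact: (incs_measurable _ _ (fun s => (~~ all is_step s)%:R)).
  move=> w; case: (boolP (all is_step _)) => st /=; last first.
    by have /andP[w0 w1] := W01 r N j w; case: (cube _ _); rewrite ?mul0r ?mul1r.
  have -> : cube q (fun i => walk_path N j.+1 w i - walk_path N j w i) = true.
    apply/forallP => i; rewrite /walk_path posB -mulrBl mxE rmorphD/= addrAC subrr add0r.
    rewrite normrM normfV (gtr0_norm N0) ler_pdivrMr// (le_trans _ LN)//.
    have := step_coord i st; rewrite size_incs mulSn addnK => h1.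
    by rewrite -intr_norm pmulrn ler_int; exact: h1.
  by rewrite mul0r.
Unshelve. all: by end_near. Qed.

(** The survival probability at the first block start outside the cube, or after n blocks, in the
    form of [stop_telescope]. *)
Definition stopped r N n w : R :=
  1 - \sum_(j < n) (walk_kill N j w - walk_kill N j.+1 w) * stay (walk_path N) r j w.

Let bstay r N j : bmeas (stay (walk_path N) r j).
Proof. exact: bchi walk_heat_array _ _ _. Qed.

Let bkill N j : bmeas (walk_kill N j).
Proof. exact: bZ walk_heat_array _ _. Qed.

Lemma bmeas_stopped r N n : bmeas (stopped r N n).
Proof.
apply: bmeasB; first exact: bmeas_cst.
by apply: bmeas_sum => j _; apply: bmeasM => //; exact: bmeasB.
Qed.

Lemma stopped_index r N n w : exists K, [/\ (K <= n)%N, forall j, (j < K)%N -> cube r (walk_path N j w),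
  (K < n)%N -> ~~ cube r (walk_path N K w) & stopped r N n w = walk_kill N K w].
Proof.
have [K [h1 h2 h3 h4]] := stop_telescope (walk_kill N ^~ w) (fun j => cube r (walk_path N j w)) n.
exists K; split => //; rewrite -h4 /stopped.
by rewrite [walk_kill N 0 w]/walk_kill big_ord0 mulr0 oppr0 expR0.
Qed.

Lemma stay_le r N n j w : (n <= j)%N -> stay (walk_path N) r j w <= stay (walk_path N) r n w.
Proof.
move=> /subnKC <-; elim: (j - n)%N => [|k ih]; first by rewrite addn0.
by rewrite addnS (le_trans _ ih)//; exact: (stay_niS walk_path).
Qed.

(** The decrements after block n count only if the walk has stayed in the cube up to then, and they
    add up to at most 1. *)
Lemma stopped_far r N n m w : (n < m)%N ->
  stopped r N m w <= stopped r N n.+1 w <= stopped r N m w + stay (walk_path N) r n w.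
Proof.
move=> nm; have kni j : 0 <= walk_kill N j w - walk_kill N j.+1 w.
  rewrite subr_ge0 ler_expR lerN2 ler_wpM2l// [leRHS]big_ord_recr/= lerDl; exact: block_count_ge0.
have s0 j : 0 <= stay (walk_path N) r j w by case/andP: (stay01 walk_path r N j w).
pose D j := (walk_kill N j w - walk_kill N j.+1 w) * stay (walk_path N) r j w.
have B0 : 0 <= \sum_(j < m - n.+1) D (n.+1 + j)%N by apply: sumr_ge0 => j _; rewrite mulr_ge0.
suff B1 : \sum_(j < m - n.+1) D (n.+1 + j)%N <= stay (walk_path N) r n w.
  have -> : stopped r N m w = stopped r N n.+1 w - \sum_(j < m - n.+1) D (n.+1 + j)%N.
    by rewrite /stopped -[in LHS](subnKC nm) big_split_ord/= opprD addrA.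
  by apply/andP; split; lra.
apply: (@le_trans _ _ (\sum_(j < m - n.+1) (walk_kill N (n.+1 + j) w - walk_kill N (n.+1 + j).+1 w) *
    stay (walk_path N) r n w)).
  by apply: ler_sum => j _; rewrite ler_wpM2l//; apply: stay_le; rewrite addSnnS leq_addr.
rewrite -mulr_suml ler_piMl//; under eq_bigr do rewrite -addnS -opprB.
rewrite sumrN -(big_mkord predT (fun j => walk_kill N (n.+1 + j.+1) w - walk_kill N (n.+1 + j) w)).
rewrite (telescope_sumr (fun j => walk_kill N (n.+1 + j) w))// opprB addn0.
have /andP[_ k1] := kill01 N n.+1 w; have /andP[k0 _] := kill01 N (n.+1 + (m - n.+1)) w.
by move: k0 k1; lra.
Qed.

(** Survival through block j factors into the survival before it and an independent factor of that
    block, while [stay] looks only at block starts up to j. *)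
Lemma stopped_Ex r N n : Ex P (stopped r N n) =
  1 - \sum_(j < n) Ex P (fun w => walk_kill N j w * stay (walk_path N) r j w) * rate N j.
Proof.
rewrite /stopped ExB; last 2 first.
- exact: bmeas_cst.
- by apply: bmeas_sum => j _; apply: bmeasM => //; exact: bmeasB.
rewrite Ex_cst Ex_sum; last by move=> j _; apply: bmeasM => //; exact: bmeasB.
congr (_ - _); apply: eq_bigr => j _.
have bWp := @W_past r N j (before (j * L N)) (fun _ h => h).
have bEp : bmeas ((fun w => 1 - expR (- (lam N * block_count N j w))) :
    past_type F (during (j * L N) (j.+1 * L N)) -> R).
  by apply: bmeasB; [exact: bmeas_cst|exact: bexp_count].
rewrite -(mutual_indep_Ex events_measurable events_setI events_setT indF (before_during _ _) bWp bEp).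
congr (Ex P _); apply/funext => w; rewrite /W /walk_kill big_ord_recr/= mulrDr opprD expRD; ring.
Qed.

Lemma stopped_limit (U : R -> R) r : 0 < c -> 0 < r ->
  lim2 (kill_sum P walk_path walk_kill walk_mesh r) (r ^+ 2 * U (r ^+ 2 * c)) ->
  lim2 (fun N n => Ex P (stopped r N n)) (1 - c * (r ^+ 2 * U (r ^+ 2 * c))).
Proof.
move=> c0 r0 lk e e0.
have [C C0 hC] := heat_array_bounded d_gt0 c_ge0 walk_heat_array r0.
have e1 : 0 < e / 2 / C by rewrite !divr_gt0.
have e2 : 0 < e / 2 / c by rewrite !divr_gt0.
have l2 := lk _ e2.
near=> N.
have lN : \forall n \near \oo, `|kill_sum P walk_path walk_kill walk_mesh r N n -
    r ^+ 2 * U (r ^+ 2 * c)| <= e / 2 / c by near: N; exact: l2.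
have ra : forall j, `|rate N j - c * walk_mesh N| <= e / 2 / C * walk_mesh N.
  by near: N; exact: rate_asymp.
have hN : forall n, walk_mesh N * \sum_(j < n) Ex P (fun w => walk_kill N j w * stay (walk_path N) r j w) <= C.
  by near: N; exact: hC.
near=> n.
have : `|kill_sum P walk_path walk_kill walk_mesh r N n - r ^+ 2 * U (r ^+ 2 * c)| <= e / 2 / c.
  by near: n; exact: lN.
pose b j := Ex P (fun w => walk_kill N j w * stay (walk_path N) r j w).
rewrite /kill_sum -/(b _) stopped_Ex => h1.
rewrite [\sum_(j < n) _](eq_bigr (fun j : 'I_n => b j * rate N j))//.
have b0 j : 0 <= b j by apply: Ex_ge0 => w; case/andP: (W01 r N j w).
have -> : 1 - \sum_(j < n) b j * rate N j - (1 - c * (r ^+ 2 * U (r ^+ 2 * c))) =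
    - (c * (walk_mesh N * \sum_(j < n) b j - r ^+ 2 * U (r ^+ 2 * c))) -
    \sum_(j < n) b j * (rate N j - c * walk_mesh N).
  under [X in _ = _ - X]eq_bigr do rewrite mulrBr.
  by rewrite sumrB -mulr_suml; ring.
rewrite (le_trans (ler_normB _ _))// (_ : e = e / 2 + e / 2); last by field.
apply: lerD.
  rewrite normrN normrM (gtr0_norm c0) -ler_pdivlMl// [leRHS]mulrC; exact: h1.
rewrite (le_trans (ler_norm_sum _ _ _))//.
apply: (@le_trans _ _ (\sum_(j < n) b j * (e / 2 / C * walk_mesh N))).
  by apply: ler_sum => j _; rewrite normrM (ger0_norm (b0 j)) ler_wpM2l.
have -> : \sum_(j < n) b j * (e / 2 / C * walk_mesh N) = e / 2 / C * (walk_mesh N * \sum_(j < n) b j).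
  by rewrite -mulr_suml; ring.
by rewrite (le_trans (ler_wpM2l (ltW e1) (hN n)))// divfK// gt_eqF.
Unshelve. all: by end_near. Qed.

End walk_array.

(** The walk without killing is also an array, with c = 0; as [stay] decreases in time, the bound on
    the sum becomes one on its last term. *)
Lemma stay_bound (L : nat -> nat) r : (forall N, (0 < L N)%N) ->
  (forall q : R, 0 < q -> \forall N \near \oo, (L N)%:R <= q * N%:R) -> 0 < r ->
  exists2 C : R, 0 < C & \forall N \near \oo, forall n,
    n.+1%:R * walk_mesh L N * Ex P (stay (walk_path L N) r n) <= C.
Proof.
move=> L0 Ls r0.
have ra (e : R) : 0 < e -> \forall N \near \oo, forall j,
  `|Ex P (fun w => 1 - expR (- (0 * block_count (fun=> 0) L N j w))) - 0 * walk_mesh L N| <= e * walk_mesh L N.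
  move=> e0; near=> N => j; under eq_fun do rewrite mul0r oppr0 expR0 subrr.
  by rewrite Ex_cst mul0r subrr normr0 mulr_ge0 ?(ltW e0)// divr_ge0// sqr_ge0.
have hA := @walk_heat_array (fun=> 0) L (fun=> 0) 0 (fun=> lexx 0) L0 (lexx 0) Ls ra.
have [C C0 hC] := heat_array_bounded d_gt0 (lexx 0) hA r0; exists C => //.
near=> N => n; have hN : forall n, walk_mesh L N * \sum_(j < n) Ex P (fun w =>
    walk_kill (fun=> 0) L (fun=> 0) N j w * stay (walk_path L N) r j w) <= C by near: N; exact: hC.
rewrite (le_trans _ (hN n.+1))// mulrAC mulrC ler_wpM2l//; first by rewrite divr_ge0// sqr_ge0.
rewrite mulr_natl -[n.+1 in leLHS](card_ord n.+1) -sumr_const; apply: ler_sum => j _.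
apply: Ex_le; [exact: bchi hA _ _ _|by apply: bmeasM; [exact: bZ hA _ _|exact: bchi hA _ _ _]|move=> w].
rewrite /walk_kill mul0r oppr0 expR0 mul1r.
by apply: stay_le; rewrite -ltnS.
Unshelve. all: by end_near. Qed.

Lemma bmeas_neqb (b c : T -> bool) : bmeas (fun w => (b w)%:R : R) -> bmeas (fun w => (c w)%:R : R) ->
  bmeas (fun w => (b w != c w)%:R : R).
Proof.
move=> bb bc; rewrite (_ : (fun w => (b w != c w)%:R) =
    (fun w => (b w)%:R + (c w)%:R - 2 * ((b w)%:R * (c w)%:R))).
  by apply: bmeasB; [exact: bmeasD|apply: bmeasZ; exact: bmeasM].
by apply/funext => w; case: (b w); case: (c w); rewrite /=; ring.
Qed.

(** * Crossings in a block *)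

Section crossing_counts.
Hypothesis d_ge3 : (3 <= d)%N.
Variable a : R.
Hypothesis a_ge0 : 0 <= a.

Let g := green R d.
Let M N : R := (logN R N)%:R.
Let L := blk R.

Definition level (N : nat) : R := 2 * g * a * ln N%:R.
(* The probability of a crossing is asymptotically [thinning N] / g. *)
Definition thinning (N : nat) : R := expR (- (2 * a * ln N%:R)).

Let g_gt0 : 0 < g. Proof. exact: lt_le_trans ltr01 (green_ge1 R d_ge3). Qed.
Let ga_ge0 : 0 <= 2 * g * a. Proof. by rewrite !mulr_ge0// ltW. Qed.
Let M_ge1 N : 1 <= M N. Proof. exact: logN_ge1. Qed.

Lemma ln_nat_ge0 (N : nat) : 0 <= ln N%:R :> R.
Proof. by case: N => [|N]; [rewrite ln0|rewrite ln_ge0// ler1n]. Qed.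

Lemma level_ge0 N : 0 <= level N.
Proof. by rewrite mulr_ge0// ln_nat_ge0. Qed.

Lemma level_thinning N : expR (- (level N * (1 - retp R d))) = thinning N.
Proof.
rewrite /retp -/g subKr /level /thinning; congr (expR (- _)).
by field; rewrite gt_eqF.
Qed.

Let retpE : 1 - retp R d = g^-1. Proof. by rewrite /retp -/g subKr. Qed.

Let level_le N : 1 + level N <= (1 + 2 * g * a) * M N.
Proof.
rewrite mulrDl mul1r lerD ?M_ge1// ler_wpM2l//; exact/ltW/logN_gt.
Qed.

Let budget N (A B D : R) : 0 <= A -> 0 <= B -> 0 <= D ->
  A + B * (1 + level N) + D * (1 + level N) * (2 * M N ^+ 14) <=
  (A + B + 2 * D) * (1 + 2 * g * a) * M N ^+ 15.
Proof.
move=> A0 B0 D0; have := level_le N; set x := 1 + level N => hx.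
have K1 : 1 <= 1 + 2 * g * a by rewrite lerDl.
set K := 1 + 2 * g * a in hx K1 *.
have M14 : 1 <= M N ^+ 14 by rewrite exprn_ege1.
have K0 : 0 <= K by lra.
have h1 : x * M N ^+ 14 <= K * M N ^+ 15.
  by rewrite [M N ^+ 15]exprS mulrA ler_wpM2r// (le_trans ler01 M14).
have x1 : 1 <= x by rewrite lerDl level_ge0.
have h2 : x <= K * M N ^+ 15 by rewrite (le_trans _ h1)// ler_peMr//; lra.
have h3 : 1 <= K * M N ^+ 15 by lra.
set z := K * M N ^+ 15 in h1 h2 h3; set y := x * M N ^+ 14 in h1.
have -> : A + B * x + D * x * (2 * M N ^+ 14) = A * 1 + B * x + 2 * D * y by rewrite /y; ring.
have -> : (A + B + 2 * D) * K * M N ^+ 15 = A * z + B * z + 2 * D * z by rewrite /z; ring.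
rewrite lerD ?lerD ?ler_wpM2l//; by rewrite mulr_ge0.
Qed.

(** The index 0 is set apart because [wt R 0] is 0. *)
Let sum_error (x : nat -> R) N (A B : R) : 0 <= B -> `|x 0%N| <= A ->
  (forall i, (0 < i)%N -> `|x i| <= B / wt R i) ->
  `|\sum_(i < L N) x i| <= A + B * (2 * M N ^+ 14).
Proof.
move=> B0 x0 xi; rewrite (le_trans (ler_norm_sum _ _ _))//.
rewrite (bigID (fun i : 'I_(L N) => (0 < i)%N))/= addrC lerD//.
  rewrite (bigD1 (Ordinal (blk_gt0 R N)))//= big1 ?addr0// => i /andP[i0 /negP[]].
  by apply/eqP/val_inj/eqP; rewrite /= -leqn0 leqNgt.
apply: (@le_trans _ _ (\sum_(i < L N | (0 < i)%N) B / wt R i)); first by apply: ler_sum => i; exact: xi.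
rewrite -mulr_sumr ler_wpM2l//; exact: sum_wt_log.
Qed.

Lemma mean_count : exists2 C : R, 0 < C & forall N j,
  `|Ex P (block_count level L N j) - (L N)%:R * (g^-1 * thinning N)| <=
  thinning N * (C * M N ^+ 15).
Proof.
have [C C0 hC] := crossing_asymp R d_ge3.
exists ((1 + 0 + 2 * C) * (1 + 2 * g * a)).
  by rewrite mulr_gt0 ?ltr_pwDl//; lra.
move=> N j; have q0 : 0 < thinning N by exact: expR_gt0.
rewrite /block_count Ex_sum; last by move=> i _; exact: bcross (leq_addr _ _).
have u0 := level_ge0 N.
under eq_bigr do rewrite (cross_law u0 (leq_addr _ _)) addKn.
have -> : (L N)%:R * (g^-1 * thinning N) = \sum_(i < L N) (g^-1 * thinning N).
  by rewrite sumr_const card_ord -[RHS]mulr_natl.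
rewrite -sumrB.
have Cu : 0 <= C * (1 + level N) by rewrite mulr_ge0 ?addr_ge0// ltW.
apply: (@le_trans _ _ (thinning N * 1 + C * (1 + level N) * thinning N * (2 * M N ^+ 14))).
  apply: (@sum_error (fun i => avgs i (fun s : seq V => pois (level N) (visits 0 s)) - g^-1 * thinning N)).
  - by rewrite mulr_ge0// ltW.
  - rewrite /= /pois expr0 fact0 divr1 mulr1.
    have h1 : expR (- level N) <= thinning N.
      rewrite -level_thinning ler_expR lerN2 ler_piMr// lerBlDr lerDl; exact: retp_ge0.
    have h2 : g^-1 * thinning N <= thinning N.
      by rewrite ler_piMl ?(ltW q0)// invf_le1// green_ge1.
    have h3 := expR_ge0 (- level N).
    have h4 : 0 <= g^-1 * thinning N by rewrite mulr_ge0 ?invr_ge0 ?(ltW g_gt0)// ltW.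
    by rewrite mulr1 ler_norml; apply/andP; split; lra.
  - move=> i i0; have := hC _ i u0 i0; rewrite level_thinning retpE; exact.
rewrite (_ : _ + _ = thinning N * (1 + 0 * (1 + level N) + C * (1 + level N) * (2 * M N ^+ 14))); last by ring.
by rewrite ler_wpM2l ?(ltW q0)//; apply: budget => //; exact: ltW.
Qed.

Lemma discrepancy_count : exists2 C : R, 0 < C & forall N j,
  \sum_(i < L N) Ex P (fun w => (cross (level N) (j * L N) (j * L N + i) w !=
     cross (level N) 0 (j * L N + i) w)%:R) <= thinning N * (C * M N ^+ 15).
Proof.
have [C C0 hC] := crossing_asymp R d_ge3.
have [D D0 hD] := crossing_discrepancy R d_ge3.
exists ((2 + C + 2 * D) * (1 + 2 * g * a)).
  by rewrite mulr_gt0 ?ltr_pwDl//; lra.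
move=> N j; have q0 : 0 < thinning N by exact: expR_gt0.
have u0 := level_ge0 N; have u1 : 0 < 1 + level N by lra.
have Cu : 0 <= C * (1 + level N) by rewrite mulr_ge0// ltW.
have Du : 0 <= D * (1 + level N) by rewrite mulr_ge0// ltW.
pose x i := Ex P (fun w => (cross (level N) (j * L N) (j * L N + i) w !=
     cross (level N) 0 (j * L N + i) w)%:R).
have x0 i : 0 <= x i by apply: Ex_ge0.
apply: (@le_trans _ _ (thinning N * (2 + C * (1 + level N)) + D * (1 + level N) * thinning N * (2 * M N ^+ 14))).
  rewrite (le_trans (ler_norm _))//; apply: (@sum_error x); first by rewrite mulr_ge0// ltW.
    rewrite ger0_norm// /x addn0.
    (* The first block has no past to forget. In the others the initial jump has lost its whole
       past, and the two crossing probabilities are simply added. *)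
    have [j0|j0] := posnP (j * L N)%N.
      rewrite j0; under eq_fun do rewrite eqxx; rewrite Ex_cst mulr_ge0 ?(ltW q0)//; lra.
    apply: (@le_trans _ _ (Ex P (fun w => (cross (level N) (j * L N) (j * L N) w)%:R +
        (cross (level N) 0 (j * L N) w)%:R))).
      apply: Ex_le; last by move=> w; case: (cross _ _ _ w); case: (cross _ 0 _ w) => /=; lra.
        by apply: bmeas_neqb; exact: bcross.
      by apply: bmeasD; exact: bcross.
    rewrite ExD ?cross_law ?subnn ?subn0//=; try exact: bcross.
    have := hC _ _ u0 j0; rewrite level_thinning retpE => hx.
    have h1 : pois (level N) 0 <= thinning N.
      rewrite /pois expr0 fact0 divr1 mulr1 -level_thinning ler_expR lerN2 ler_piMr//.
      rewrite lerBlDr lerDl; exact: retp_ge0.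
    have h2 : g^-1 * thinning N <= thinning N.
      by rewrite ler_piMl ?(ltW q0)// invf_le1// green_ge1.
    have h3 : C * (1 + level N) * thinning N / wt R (j * L N) <= C * (1 + level N) * thinning N.
      have hw : 1 <= wt R (j * L N) by exact: wt_ge1.
      apply: ler_piMr; first by rewrite mulr_ge0// ltW.
      by rewrite invf_le1// (lt_le_trans ltr01).
    by move: hx; rewrite ler_norml => /andP[_ hx]; lra.
  move=> i i0; rewrite ger0_norm// (le_trans (cross_discrepancy u0 (leq_addr _ _)))// addKn.
  have := hD _ i (j * L N)%N u0 i0; rewrite level_thinning addnC; exact.
rewrite (_ : _ + _ = thinning N * (2 + C * (1 + level N) + D * (1 + level N) * (2 * M N ^+ 14))); last by ring.
by rewrite ler_wpM2l ?(ltW q0)//; apply: budget => //; exact: ltW.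
Qed.

Variable lm : R.
Hypothesis lm_gt0 : 0 < lm.

(** The Laplace parameter lm divided by the normalisation N^(2(1-a)); against the thinning N^(-2a)
    it leaves the rate lm / N^2, whatever a. *)
Definition block_lam (N : nat) : R := lm * expR (- (2 * (1 - a) * ln N%:R)).

Lemma block_lam_gt0 N : 0 < block_lam N.
Proof. by rewrite mulr_gt0// expR_gt0. Qed.

Lemma block_lam_thinning N : (0 < N)%N -> block_lam N * thinning N = lm / N%:R ^+ 2.
Proof.
move=> N0; rewrite -mulrA -expRD -(expRN_ln R 2 N0); congr (_ * expR _); ring.
Qed.

Let mesh_gt0 N : (0 < N)%N -> 0 < walk_mesh L N.
Proof. by move=> N0; rewrite divr_gt0 ?exprn_gt0 ?ltr0n// blk_gt0. Qed.

Let LE N : (L N)%:R = M N ^+ 16. Proof. by rewrite /L /blk natrX. Qed.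

Let bcount N j : bmeas (block_count level L N j).
Proof. by apply: bmeas_sum => i _; exact: bcross (leq_addr _ _). Qed.

Let count_le N j w : 0 <= block_count level L N j w <= (L N)%:R.
Proof.
rewrite block_count_ge0/= -[leRHS]mulr1 mulr_natl -[L N in leRHS]card_ord -sumr_const.
by apply: ler_sum => i _; case: (cross _ _ _ _).
Qed.

Let mean_mesh : exists2 C : R, 0 < C & forall N j, (0 < N)%N ->
  `|block_lam N * Ex P (block_count level L N j) - lm / g * walk_mesh L N| <= C / M N * walk_mesh L N.
Proof.
have [C C0 hC] := mean_count; exists (lm * C); first exact: mulr_gt0.
move=> N j N0; have M0 : 0 < M N := lt_le_trans ltr01 (M_ge1 N).
have -> : lm / g * walk_mesh L N = block_lam N * ((L N)%:R * (g^-1 * thinning N)).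
  have r1 (x y z t : R) : x * (y * (z * t)) = (x * t) * (y * z) by ring.
  have r2 (x y z t : R) : x * y * (z * t) = x * t * (z * y) by ring.
  by rewrite r1 block_lam_thinning// -r2.
rewrite -mulrBr normrM gtr0_norm ?block_lam_gt0//.
rewrite (le_trans (ler_wpM2l (ltW (block_lam_gt0 N)) (hC N j)))// [leLHS]mulrA block_lam_thinning//.
rewrite /walk_mesh LE [M N ^+ 16]exprSr le_eqVlt; apply/orP; left; apply/eqP.
by field; rewrite !gt_eqF ?exprn_gt0 ?ltr0n.
Qed.

(** Below a = 1 even a crossing at every jump of the block would kill with vanishing probability, so
    1 - exp(-x) may be replaced by x and the mean count decides. *)
Lemma rate_subcritical : a < 1 -> forall e : R, 0 < e -> \forall N \near \oo, forall j,
  `|Ex P (fun w => 1 - expR (- (block_lam N * block_count level L N j w))) - lm / g * walk_mesh L N| <=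
  e * walk_mesh L N.
Proof.
move=> a1 e e0; have [C C0 hC] := mean_mesh.
have e2 : 0 < e / 2 by rewrite divr_gt0.
have c0 : 0 < lm / g by rewrite divr_gt0.
have del0 : 0 < 2 * (1 - a) by rewrite mulr_gt0// subr_gt0.
pose eta := e / 2 / (lm / g + e / 2); have eta0 : 0 < eta by rewrite divr_gt0// addr_gt0.
have el0 : 0 < eta / lm by rewrite divr_gt0.
near=> N => j.
have N0 : (0 < N)%N by near: N; exists 1%N.
have hM : C <= e / 2 * M N by near: N; exact: logN_near.
have hl : M N ^+ 16 * expR (- (2 * (1 - a) * ln N%:R)) <= eta / lm.
  by near: N; exact: log_pow_near.
have M0 : 0 < M N := lt_le_trans ltr01 (M_ge1 N).
have l0 := block_lam_gt0 N; have h0 := mesh_gt0 N0.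
have lL : block_lam N * (L N)%:R <= eta.
  by rewrite LE /block_lam -mulrA mulrC -ler_pdivlMr// mulrC.
have := hC N j N0; set m := Ex P (block_count level L N j) => hm.
have hm2 : `|block_lam N * m - lm / g * walk_mesh L N| <= e / 2 * walk_mesh L N.
  by rewrite (le_trans hm)// ler_wpM2r ?(ltW h0)// ler_pdivrMr.
have b1 : bmeas (fun w => block_lam N * block_count level L N j w) by exact: bmeasZ.
have bE : bmeas (fun w => 1 - expR (- (block_lam N * block_count level L N j w))).
  split.
    apply: measurable_funB => //; apply: measurableT_comp => //; apply: measurableT_comp => //.
    exact: b1.1.
  exists 1 => w; have /andP[x0 _] := count_le N j w.
  have y0 : expR (- (block_lam N * block_count level L N j w)) <= 1.
    by rewrite expR_le1 oppr_le0 mulr_ge0// ltW.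
  have := expR_ge0 (- (block_lam N * block_count level L N j w)).
  by rewrite ler_norml => ?; apply/andP; split; lra.
have lo : (1 - eta) * (block_lam N * m) <= Ex P (fun w => 1 - expR (- (block_lam N * block_count level L N j w))).
  rewrite -!ExZ//; apply: Ex_le => //; first exact: bmeasZ.
  move=> w; have /andP[x0 xL] := count_le N j w.
  have X0 : 0 <= block_lam N * block_count level L N j w by rewrite mulr_ge0// ltW.
  have X1 : block_lam N * block_count level L N j w <= eta.
    by rewrite (le_trans _ lL)// ler_wpM2l// ltW.
  have /andP[_ h] := expRN_bounds X0; have := ler_wpM2r X0 X1; rewrite -expr2; lra.
have up : Ex P (fun w => 1 - expR (- (block_lam N * block_count level L N j w))) <= block_lam N * m.
  rewrite -ExZ//; apply: Ex_le => // w; have /andP[x0 xL] := count_le N j w.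
  have X0 : 0 <= block_lam N * block_count level L N j w by rewrite mulr_ge0// ltW.
  by have /andP[h _] := expRN_bounds X0; lra.
have etaE : eta * (lm / g + e / 2) = e / 2 by rewrite /eta divfK// gt_eqF// addr_gt0.
have h3 : eta * (block_lam N * m) <= e / 2 * walk_mesh L N.
  rewrite -etaE -mulrA ler_wpM2l ?(ltW eta0)//.
  by move: hm2; rewrite ler_norml => /andP[_ ?]; lra.
by move: hm2; rewrite !ler_norml => /andP[h5 h6]; apply/andP; split; lra.
Unshelve. all: by end_near. Qed.

(** The deficit vanishes for k at most 1, and k (k - 1) counts the ordered pairs of crossings, whose
    mean [cross_pair] controls. *)
Lemma pow_deficit (y : R) k : 0 <= y <= 1 -> 0 <= (1 - y) * k%:R - (1 - y ^+ k) <= k%:R * (k%:R - 1).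
Proof.
move=> /andP[y0 y1]; elim: k => [|k /andP[ih1 ih2]]; first by rewrite expr0 !(mulr0, mul0r) subrr subr0 lexx.
have p0 : 0 <= y ^+ k by rewrite exprn_ge0.
have p1 : y ^+ k <= 1 by rewrite exprn_ile1.
have -> : (1 - y) * k.+1%:R - (1 - y ^+ k.+1) = (1 - y) * k%:R - (1 - y ^+ k) + (1 - y) * (1 - y ^+ k).
  by rewrite exprS -natr1; ring.
have q0 : 0 <= (1 - y) * (1 - y ^+ k) by rewrite mulr_ge0 ?subr_ge0.
have q1 : (1 - y) * (1 - y ^+ k) <= 1 by rewrite mulr_ile1 ?subr_ge0// lerBlDr lerDl.
rewrite addr_ge0//=; case: k ih1 ih2 p0 p1 q0 q1 => [|k] ih1 ih2 p0 p1 q0 q1.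
  by rewrite expr0 !(subrr, mulr0, mul0r, addr0).
rewrite -[k.+2%:R]natr1; set x : R := k.+1%:R in ih1 ih2 *.
have x1 : 1 <= x by rewrite ler1n.
by rewrite (le_trans (lerD ih2 q1))//; nra.
Qed.

Let double_pow (l : nat) : (0 < l)%N -> (2 * l).+1%:R ^+ d <= 3 ^+ d * l%:R ^+ d :> R.
Proof.
move=> l0; rewrite -exprMn lerXn2r ?nnegrE ?mulr_ge0//.
by rewrite -natrM ler_nat; lia.
Qed.

(** The parameter does not tend to 0 here, so the killing probability given k crossings is compared
    with (1 - exp(-lm)) k, at the price of the pairs. *)
Lemma rate_critical : a = 1 -> forall e : R, 0 < e -> \forall N \near \oo, forall j,
  `|Ex P (fun w => 1 - expR (- (block_lam N * block_count level L N j w))) -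
    (1 - expR (- lm)) / g * walk_mesh L N| <= e * walk_mesh L N.
Proof.
move=> a1 e e0; have [C C0 hC] := mean_mesh; have [D D0 hD] := cross_pair d_ge3.
have e2 : 0 < e / 2 by rewrite divr_gt0.
pose b := two_base R d; pose del := 4 * g * (1 - b^-1) - 2.
have del0 : 0 < del by rewrite subr_gt0; exact: two_base_exponent.
have D3 : 0 < 3 ^+ d * D by rewrite mulr_gt0// exprn_gt0.
have eD : 0 < e / 2 / (3 ^+ d * D) by rewrite divr_gt0.
set y := expR (- lm); have y01 : 0 <= y <= 1 by rewrite expR_ge0 expR_le1 oppr_le0 ltW.
near=> N => j.
have N0 : (0 < N)%N by near: N; exists 1%N.
have hM : C / lm <= e / 2 * M N by near: N; exact: logN_near.
(* The pairs cost (L N)^2, the displacements (L N)^d and the mesh gives back one factor L N, against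
   the surplus N^(-del) of the two-point exponent over 2. *)
have hl : M N ^+ (16 * d.+1) * expR (- (del * ln N%:R)) <= e / 2 / (3 ^+ d * D).
  by near: N; exact: log_pow_near.
have M0 : 0 < M N := lt_le_trans ltr01 (M_ge1 N).
have h0 := mesh_gt0 N0; have L1 : 1 <= (L N)%:R :> R by rewrite ler1n blk_gt0.
have lamE : block_lam N = lm by rewrite /block_lam a1 subrr mulr0 mul0r oppr0 expR0 mulr1.
rewrite lamE; have := hC N j N0; rewrite lamE; set m := Ex P (block_count level L N j) => hm.
have hm2 : `|(1 - y) * m - (1 - y) / g * walk_mesh L N| <= e / 2 * walk_mesh L N.
  have -> : (1 - y) * m - (1 - y) / g * walk_mesh L N = (1 - y) / lm * (lm * m - lm / g * walk_mesh L N).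
    by field; rewrite !gt_eqF.
  have /andP[y0 y1] := y01.
  rewrite normrM ger0_norm ?divr_ge0 ?(ltW lm_gt0) ?subr_ge0//.
  apply: (@le_trans _ _ (lm^-1 * (C / M N * walk_mesh L N))).
    rewrite ler_pM ?normr_ge0 ?divr_ge0 ?(ltW lm_gt0) ?subr_ge0//.
    by rewrite ler_piMl ?invr_ge0 ?(ltW lm_gt0)// lerBlDr lerDl.
  rewrite (_ : lm^-1 * _ = C / lm / M N * walk_mesh L N); last by ring.
  by rewrite ler_wpM2r ?(ltW h0)// ler_pdivrMr.
pose cr (i : 'I_(L N)) w : R := (cross (level N) (j * L N) (j * L N + i) w)%:R.
have bcr i : bmeas (cr i) by exact: bcross (leq_addr _ _).
pose D2 := (2 * L N).+1%:R ^+ d * (D * expR (- (2 * (level N * (1 - b^-1))))).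
have pairle (i i' : 'I_(L N)) : (i < i')%N -> Ex P (fun w => cr i w * cr i' w) <= D2.
  move=> ii; have := hD (level N) (j * L N)%N (j * L N + i)%N (j * L N + i')%N (level_ge0 N) (leq_addr _ _).
  rewrite ltn_add2l ii => /(_ isT) h; apply: (le_trans h).
  rewrite addKn ler_wpM2r ?mulr_ge0 ?(ltW D0) ?expR_ge0// lerXn2r ?nnegrE// ler_nat ltnS leq_mul2l/=.
  exact: ltnW.
have D20 : 0 <= D2 by rewrite mulr_ge0 ?exprn_ge0// mulr_ge0 ?expR_ge0// ltW.
pose S w : R := \sum_(i < L N) \sum_(i' < L N | i' != i) cr i w * cr i' w.
have bS : bmeas S.
  by apply: bmeas_sum => i _; apply: bmeas_sum => i' _; exact: bmeasM.
have ES : Ex P S <= (L N)%:R ^+ 2 * D2.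
  rewrite /S Ex_sum; last by move=> i _; apply: bmeas_sum => i' _; exact: bmeasM.
  apply: (@le_trans _ _ (\sum_(i < L N) \sum_(i' < L N) D2)).
    apply: ler_sum => i _; rewrite Ex_sum; last by move=> i' _; exact: bmeasM.
    rewrite big_mkcond; apply: ler_sum => i' _; case: ifP => // /negPf ii.
    have [h|h|h] := ltngtP i i'; first exact: pairle.
      under eq_fun do rewrite mulrC; exact: pairle.
    by move: ii; rewrite (val_inj h) eqxx.
  by rewrite !sumr_const !card_ord -!mulrnA -[leLHS]mulr_natl natrM expr2.
have SE w : block_count level L N j w * (block_count level L N j w - 1) = S w.
  rewrite mulrBr mulr1 /block_count mulr_suml -sumrB; apply: eq_bigr => i _.
  rewrite mulr_sumr (bigD1 i)//= -/(cr i w) addrC -addrA.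
  have -> : cr i w * cr i w = cr i w by rewrite /cr -natrM mulnb andbb.
  by rewrite subrr addr0.
have key w : `|(1 - y) * block_count level L N j w - (1 - expR (- (lm * block_count level L N j w)))| <= S w.
  rewrite -SE /block_count -natr_sum; set k := (\sum_i _)%N.
  have -> : - (lm * k%:R) = k%:R * - lm by rewrite mulrN [lm * _]mulrC.
  rewrite expRM_natl -/y.
  by have /andP[p0 p1] := pow_deficit k y01; rewrite ger0_norm.
have bE : bmeas (fun w => 1 - expR (- (lm * block_count level L N j w))).
  split.
    apply: measurable_funB => //; apply: measurableT_comp => //; apply: measurableT_comp => //.
    by apply: measurable_funM => //; exact: (bcount N j).1.
  exists 1 => w; have /andP[x0 _] := count_le N j w.
  have z0 : expR (- (lm * block_count level L N j w)) <= 1.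
    by rewrite expR_le1 oppr_le0 mulr_ge0// ltW.
  have := expR_ge0 (- (lm * block_count level L N j w)).
  by rewrite ler_norml => ?; apply/andP; split; lra.
have h3 : `|(1 - y) * m - Ex P (fun w => 1 - expR (- (lm * block_count level L N j w)))| <= (L N)%:R ^+ 2 * D2.
  rewrite -ExZ// -ExB//; last exact: bmeasZ.
  rewrite (le_trans (Ex_norm_le _ _))//; first by apply: bmeasB => //; exact: bmeasZ.
  rewrite (le_trans _ ES)//; apply: Ex_le => //.
  by apply/bmeas_norm/bmeasB => //; exact: bmeasZ.
have h4 : (L N)%:R ^+ 2 * D2 <= e / 2 * walk_mesh L N.
  have -> : e / 2 * walk_mesh L N = (e / 2 / (3 ^+ d * D)) * ((3 ^+ d * D) * walk_mesh L N).
    by rewrite mulrA divfK// gt_eqF.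
  have eE : expR (- (2 * (level N * (1 - b^-1)))) = (N%:R ^+ 2)^-1 * expR (- (del * ln N%:R)).
    rewrite -(expRN_ln R 2 N0) -expRD /level a1 /del; congr expR; ring.
  have Ld : (2 * L N).+1%:R ^+ d <= 3 ^+ d * (L N)%:R ^+ d :> R by apply: double_pow; exact: blk_gt0.
  have := ler_wpM2r (_ : 0 <= (3 ^+ d * D) * walk_mesh L N) hl.
  move=> /(_ (mulr_ge0 (ltW D3) (ltW h0))); apply: le_trans.
  have hm0 : 0 <= (L N)%:R ^+ 2 * (D * expR (- (2 * (level N * (1 - b^-1))))).
    by rewrite mulr_ge0 ?sqr_ge0// mulr_ge0 ?expR_ge0// ltW.
  have r3 (p q l D' n ex : R) : p * q * (l ^+ 2 * (D' * (n * ex))) = l * q * ex * (p * D' * (l * n)) by ring.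
  by rewrite /D2 mulrCA (le_trans (ler_wpM2r hm0 Ld))// eE mulnS exprD exprM -LE r3.
move: hm2 h3; rewrite !ler_norml => /andP[h5 h6] /andP[h7 h8].
by apply/andP; split; lra.
Unshelve. all: by end_near. Qed.

End crossing_counts.

(** The limits in n are turned into one finite horizon of bounded rescaled time, so that the errors
    summed over its blocks still vanish. The half-width r < 1 leaves a margin for the moves inside a
    block, where the walk is not watched. *)
Lemma stopped_sandwich (u : nat -> R) (L : nat -> nat) (lam : nat -> R) (c : R) (psi : R -> R) (e : R) :
  (forall N, 0 <= lam N) -> (forall N, (0 < L N)%N) ->
  (forall q : R, 0 < q -> \forall N \near \oo, (L N)%:R <= q * N%:R) ->
  0 < c -> {for c, continuous psi} ->
  (forall r, 0 < r -> lim2 (fun N n => Ex P (stopped u L lam r N n)) (psi (r ^+ 2 * c))) ->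
  (forall r N n, bmeas (stopped u L lam r N n)) ->
  0 < e -> exists r A : R, [/\ 0 < r < 1, 0 < A & \forall N \near \oo, exists n,
    [/\ n.+1%:R * walk_mesh L N <= A, psi c - e <= Ex P (stopped u L lam 1 N n.+1),
        Ex P (stopped u L lam r N n.+1) <= psi c + e &
        Ex P (stay (walk_path L N) 1 n) <= e]].
Proof.
move=> lam0 L0 Ls c0 psic slim bst e0; have e2 : 0 < e / 3 by rewrite divr_gt0.
have bstay (r : R) N n : bmeas (stay (walk_path L N) r n).
  have ra (e' : R) : 0 < e' -> \forall N \near \oo, forall j,
      `|Ex P (fun w => 1 - expR (- (0 * block_count (fun=> 0) L N j w))) - 0 * walk_mesh L N| <= e' * walk_mesh L N.
    move=> e'0; near=> N' => j; under eq_fun do rewrite mul0r oppr0 expR0 subrr.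
    by rewrite Ex_cst mul0r subrr normr0 mulr_ge0 ?(ltW e'0)// divr_ge0// sqr_ge0.
  have hA := @walk_heat_array (fun=> 0) L (fun=> 0) 0 (fun=> lexx 0) L0 (lexx 0) Ls ra.
  exact: (bchi hA).
have [r /andP[r0 r1] hr] : exists2 r : R, 0 < r < 1 & psi (r ^+ 2 * c) <= psi c + e / 3.
  have /cvgrPdist_le /(_ _ e2) [del /= del0 hdel] : psi x @[x --> c] --> psi c by exact: psic.
  pose t := Num.min (1 / 2) (del / (4 * c)).
  have t0 : 0 < t by rewrite lt_min !divr_gt0// mulr_gt0.
  have t1 : t <= 1 / 2 by rewrite ge_min lexx.
  have t2 : t * (4 * c) <= del.
    by rewrite -ler_pdivlMr ?mulr_gt0// ge_min lexx orbT.
  exists (1 - t); first by apply/andP; split; lra.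
  have dc : `|c - (1 - t) ^+ 2 * c| < del.
    rewrite (_ : c - (1 - t) ^+ 2 * c = t * (2 - t) * c); last by ring.
    have tt : 0 <= 2 - t by lra.
    rewrite ger0_norm; last by rewrite !mulr_ge0// ltW.
    have tc : 0 < t * c by exact: mulr_gt0.
    have : t * (2 - t) * c <= 2 * (t * c) by rewrite mulrAC mulrC ler_wpM2r ?(ltW tc)//; lra.
    lra.
  by have := hdel _ dc; rewrite /= ler_norml => /andP[]; lra.
have [C1 C10 hC1] := stay_bound L0 Ls ltr01; have [C2 C20 hC2] := stay_bound L0 Ls r0.
(* By [stay_bound], at rescaled time A the walk is still in either cube with probability at most e /
   3. *)
pose A := (C1 + C2) / (e / 3).
have A0 : 0 < A by rewrite divr_gt0// addr_gt0.
exists r, (A + 1); split; [by rewrite r0 r1|by rewrite addr_gt0|].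
have l1 := slim _ ltr01 _ e2; have lr := slim _ r0 _ e2.
near=> N.
have N1 : 1 <= N%:R :> R by rewrite ler1n; near: N; exists 1%N.
have LN : (L N)%:R <= 1 * N%:R :> R by near: N; exact: Ls.
have h1 : \forall n \near \oo, `|Ex P (stopped u L lam 1 N n) - psi (1 ^+ 2 * c)| <= e / 3.
  by near: N; exact: l1.
have h2 : \forall n \near \oo, `|Ex P (stopped u L lam r N n) - psi (r ^+ 2 * c)| <= e / 3.
  by near: N; exact: lr.
have s1 : forall n, n.+1%:R * walk_mesh L N * Ex P (stay (walk_path L N) 1 n) <= C1.
  by near: N; exact: hC1.
have s2 : forall n, n.+1%:R * walk_mesh L N * Ex P (stay (walk_path L N) r n) <= C2.
  by near: N; exact: hC2.
have m0 : 0 < walk_mesh L N by rewrite divr_gt0 ?exprn_gt0 ?ltr0n// -(ltr_nat R) (lt_le_trans ltr01).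
have m1 : walk_mesh L N <= 1.
  rewrite /walk_mesh ler_pdivrMr ?exprn_gt0; try lra.
  by rewrite mul1r (le_trans LN)// mul1r expr2 ler_peMl//; lra.
set h := walk_mesh L N in m0 m1 s1 s2 *.
pose n := Num.trunc (A / h).
have nA : n%:R <= A / h by rewrite truncn_le// divr_ge0// ltW.
have nA' : A / h < n.+1%:R by exact: truncnS_gt.
have nh : A <= n.+1%:R * h by rewrite -ler_pdivrMr// ltW.
have nh' : n.+1%:R * h <= A + 1.
  have : n%:R * h <= A by rewrite -ler_pdivlMr.
  by rewrite -[n.+1%:R]natr1 mulrDl mul1r; lra.
have sE (x C : R) : 0 <= x -> 0 < C -> C <= C1 + C2 -> n.+1%:R * h * x <= C -> x <= e / 3.
  move=> x0 Cp CC hx; have : A * x <= C by rewrite (le_trans _ hx)// ler_wpM2r.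
  rewrite /A => hx'; have AC : (C1 + C2) * x <= (C1 + C2) * (e / 3).
    have := ler_wpM2r (ltW e2) (le_trans hx' CC).
    by rewrite mulrAC divfK ?gt_eqF.
  by move: AC; rewrite ler_pM2l// addr_gt0.
have st0 (q : R) : 0 <= Ex P (stay (walk_path L N) q n).
  by apply: Ex_ge0 => w; case/andP: (stay01 (walk_path L) q N n w).
exists n; split => //.
- near \oo => m.
  have nm : (n < m)%N by near: m; exists n.+1.
  have : `|Ex P (stopped u L lam 1 N m) - psi (1 ^+ 2 * c)| <= e / 3 by near: m; exact: h1.
  rewrite expr1n mul1r ler_norml => /andP[h3 _].
  have : Ex P (stopped u L lam 1 N m) <= Ex P (stopped u L lam 1 N n.+1).
    by apply: Ex_le => // w; have /andP[] := @stopped_far u L lam lam0 1 N _ _ w nm.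
  lra.
- near \oo => m.
  have nm : (n < m)%N by near: m; exists n.+1.
  have : `|Ex P (stopped u L lam r N m) - psi (r ^+ 2 * c)| <= e / 3 by near: m; exact: h2.
  rewrite ler_norml => /andP[_ h3].
  have : Ex P (stopped u L lam r N n.+1) <= Ex P (stopped u L lam r N m) + Ex P (stay (walk_path L N) r n).
    rewrite -ExD//; apply: Ex_le => //; first exact: bmeasD.
    by move=> w; have /andP[] := @stopped_far u L lam lam0 r N _ _ w nm.
  have := sE _ _ (st0 r) C20 _ (s2 n); rewrite lerDr (ltW C10) => /(_ isT).
  lra.
- by have := sE _ _ (st0 1) C10 _ (s1 n); rewrite lerDl (ltW C20) => /(_ isT); lra.
Unshelve. all: by end_near. Qed.

(** * Local times, thick points and crossings *)

Section paths.
Variable Y : R -> T -> V.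
Hypothesis clock_infty : forall w, \sum_(i < n) E i w @[n --> \oo] --> +oo.
Hypothesis Y_path : forall n w (t : R),
  \sum_(i < n) E i w <= t < \sum_(i < n.+1) E i w -> Y t w = \sum_(i < n) X i w.

Definition jump_time n w : R := \sum_(i < n) E i w.

Let jump_timeS n w : jump_time n.+1 w = jump_time n w + E n w.
Proof. exact: big_ord_recr. Qed.

Let jump_time_le m n w : (m <= n)%N -> jump_time m w <= jump_time n w.
Proof.
move=> /subnKC <-; elim: (n - m)%N => [|k ih]; first by rewrite addn0.
by rewrite addnS (le_trans ih)// jump_timeS lerDl ltW.
Qed.

Let jump_index t w : 0 <= t -> exists n, jump_time n w <= t < jump_time n.+1 w.
Proof.
move=> t0; have ex : exists n, t < jump_time n w.
  have /cvgryPgt /(_ t) [m _ hm] := clock_infty w; exists m; exact: (hm m (leqnn m)).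
case: (ex_minnP ex) => -[|n] tn mn; first by move: tn; rewrite /jump_time big_ord0 ltNge t0.
exists n; rewrite tn andbT leNgt; apply/negP => /mn; rewrite ltnn//.
Qed.

Let jump_time_unique k n s w : jump_time n w <= s < jump_time n.+1 w ->
  (jump_time k w <= s < jump_time k.+1 w) = (k == n).
Proof.
move=> /andP[s1 s2]; have [kn|kn|->] := ltngtP k n; last by rewrite s1 s2.
  by rewrite [s < _]ltNge (le_trans (jump_time_le w kn) s1) andbF.
by rewrite leNgt (lt_le_trans s2 (jump_time_le w kn)).
Qed.

(** The clocks add up to infinity, so the holding intervals partition the half-line. The hypothesis
    says that the horizon cuts no interval spent at x: each counts wholly or not at all, exit times
    being jump times. *)
Lemma local_time_series (c : nat -> bool) x (t : \bar R) w :
  (forall n s, jump_time n w <= s < jump_time n.+1 w -> ((s%:E <= t)%E && (pos n w == x)) = c n) ->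
  local_time (Y^~ w) x t = (\sum_(0 <= k <oo) ((c k)%:R * E k w)%:E)%E.
Proof.
move=> hc; rewrite /local_time integral_mkcond.
pose I k : set R := `[jump_time k w, jump_time k.+1 w[%classic.
have fE : (fun s : R => (\1_[set s | Y s w = x] s : R)%:E) \_ [set s : R | (0 <= s)%R /\ (s%:E <= t)%E] =
    (fun s : R => \sum_(0 <= k <oo) ((c k)%:R * \1_(I k) s : R)%:E)%E.
  apply/funext => s; rewrite patchE; have [s0|s0] := ltP s 0.
    rewrite ifF; last by apply/negbTE; rewrite notin_setE/= => -[]; rewrite leNgt s0.
    rewrite eseries0// => k _ _.
    have kns : ~ I k s.
      rewrite /I /= in_itv/= => /andP[ks _].
      by move: s0; rewrite ltNge (le_trans _ ks)// sumr_ge0// => i _; exact: ltW.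
    by rewrite indicE memNset// mulr0.
  have [n ns] := jump_index w s0.
  have Ik k : \1_(I k) s = (k == n)%:R :> R.
    by rewrite indicE -(jump_time_unique k ns) /I mem_setE in_itv.
  rewrite (@nneseries_delta R _ n); last 2 first.
  - by move=> k kn; rewrite Ik (negbTE kn) mulr0.
  - by rewrite lee_fin mulr_ge0// Ik.
  rewrite Ik eqxx mulr1 -(hc _ _ ns); have Ys : Y s w = pos n w by exact: Y_path ns.
  case: ifP => [|/negbT].
    rewrite inE/= => -[_ ->] /=; rewrite indicE; congr ((nat_of_bool _)%:R%:E).
    by apply/idP/idP; rewrite inE/= Ys => /eqP.
  by rewrite notin_setE/= => h; case: leP => // st; case: h.
rewrite fE integral_nneseries//; last first.
  move=> k; apply/measurable_EFinP; apply: measurable_funM => //.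
  by apply: measurable_indic; exact: measurable_itv.
apply: eq_eseriesr => k _; case: (c k); last first.
  by under eq_integral do rewrite mul0r; rewrite integral0 mul0r.
under eq_integral do rewrite mul1r.
rewrite integral_indic; [|exact: measurableT|exact: measurable_itv].
have muI : lebesgue_measure (I k) = (E k w)%:E.
  rewrite /I lebesgue_measure_itv/= lte_fin jump_timeS ltrDl E_gt0.
  by rewrite -EFinD addrAC subrr add0r.
by rewrite setIT mul1r; exact: muI.
Qed.

Let before_exit (D : set V) k w : bool := [forall j : 'I_k.+1, pos j w \in D].

Lemma exit_time_ge n (D : set V) w : (forall j, (j <= n)%N -> D (pos j w)) ->
  ((jump_time n.+1 w)%:E <= exit_time D (Y^~ w))%E.
Proof.
move=> hD; apply: le_ereal_inf_tmp => _ [t [t0 Dt] <-].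
have [m mt] := jump_index w t0; have Ym : Y t w = pos m w by exact: Y_path mt.
rewrite lee_fin; case: (leqP m n) => mn; first by case: Dt; rewrite Ym; exact: hD.
by case/andP: mt => mt _; rewrite (le_trans _ mt)// jump_time_le.
Qed.

Lemma exit_time_le j (D : set V) w : ~ D (pos j w) ->
  (exit_time D (Y^~ w) <= (jump_time j w)%:E)%E.
Proof.
move=> Dj; apply: ereal_inf_lbound; exists (jump_time j w) => //; split.
  by rewrite sumr_ge0// => i _; exact: ltW.
rewrite (@Y_path j)//; rewrite lexx/= -/(jump_time j w) -/(jump_time j.+1 w) jump_timeS ltrDl//.
Qed.

Lemma local_time_exit (D : set V) x w : D x ->
  local_time (Y^~ w) x (exit_time D (Y^~ w)) =
  (\sum_(0 <= k <oo) ((before_exit D k w && (pos k w == x))%:R * E k w)%:E)%E.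
Proof.
move=> Dx; apply: local_time_series => n s /andP[ns sn].
have [/eqP nx|] := boolP (pos n w == x); last by rewrite !andbF.
rewrite !andbT; apply/idP/forallP => [sx j|hj].
  rewrite inE; apply: contrapT => nD.
  have jn : (j < n)%N.
    rewrite ltn_neqAle -ltnS ltn_ord andbT; apply/eqP => jn; apply: nD; rewrite jn nx//.
  have := le_trans sx (exit_time_le nD); rewrite lee_fin leNgt => /negP; apply.
  by rewrite (lt_le_trans _ ns)// (lt_le_trans _ (jump_time_le w jn))// jump_timeS ltrDl.
rewrite (le_trans _ (@exit_time_ge n D w _))// ?lee_fin ?ltW// => j jn.
by have := hj (Ordinal (jn : (j < n.+1)%N)); rewrite inE.
Qed.

Lemma local_time_total x w :
  local_time (Y^~ w) x +oo%E = (\sum_(0 <= k <oo) ((pos k w == x)%:R * E k w)%:E)%E.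
Proof. by apply: local_time_series => n s _; rewrite leey. Qed.

Lemma crossE u k w : cross u 0 k w =
  (\sum_(0 <= i < k | pos i w == pos k w) E i w <= u) &&
  (u < \sum_(0 <= i < k | pos i w == pos k w) E i w + E k w).
Proof.
rewrite /cross /crossing clocks_vidx//.
by under eq_bigl do rewrite add0r subr_eq0 eq_sym.
Qed.

Let thick (D : set V) u w := [set x | D x /\ (u%:E < local_time (Y^~ w) x (exit_time D (Y^~ w)))%E].

Let crossings u K w := [seq pos k w | k <- iota 0 K & cross u 0 k w].

Let series_ge (D : set V) x w m : D x ->
  ((\sum_(0 <= k < m) (before_exit D k w && (pos k w == x))%:R * E k w)%:E <=
   local_time (Y^~ w) x (exit_time D (Y^~ w)))%E.
Proof.
move=> Dx; rewrite local_time_exit// -sumEFin; apply: nneseries_lim_ge => k _ _.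
by rewrite lee_fin mulr_ge0// ltW.
Qed.

(** A later visit to the same position starts from an accumulated time already above u. *)
Lemma cross_uniq u k k' w : cross u 0 k w -> cross u 0 k' w -> pos k w = pos k' w -> k = k'.
Proof.
wlog kk : k k' / (k <= k')%N.
  by move=> h; have [|/ltnW] := leqP k k'; [exact: h|move=> ? ? ? ?; apply/esym/h].
move=> ck ck' kE; apply/eqP; move: kk; rewrite leq_eqVlt => /orP[//|kk].
move: ck ck'; rewrite !crossE => /andP[_ h1] /andP[h2 _]; exfalso.
suff h3 : \sum_(0 <= i < k | pos i w == pos k w) E i w + E k w <=
    \sum_(0 <= i < k' | pos i w == pos k' w) E i w.
  by move: (lt_le_trans h1 (le_trans h3 h2)); rewrite ltxx.
rewrite -kE (big_cat_nat (leq0n k.+1) kk)/= [X in _ <= X + _]big_mkcond/= big_nat_recr//=.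
by rewrite -big_mkcond/= eqxx lerDl sumr_ge0// => i _; exact: ltW.
Qed.

Let uniq_crossings u K w : uniq (crossings u K w).
Proof.
rewrite map_inj_in_uniq ?filter_uniq ?iota_uniq// => k k'.
by rewrite !mem_filter => /andP[ck _] /andP[ck' _] kE; apply: (cross_uniq ck ck'); exact: kE.
Qed.

Let finite_thick (D : set V) u w : finite_set D -> finite_set (thick D u w).
Proof. by apply: sub_finite_set => x []. Qed.

Lemma card_thick_ge (D : set V) u K w : finite_set D -> (forall j, (j < K)%N -> D (pos j w)) ->
  (count (fun k => cross u 0 k w) (iota 0 K) <= #|` fset_set (thick D u w)|)%N.
Proof.
move=> fD hD; rewrite -size_filter -(size_map (pos ^~ w)); apply: uniq_leq_size.
  exact: uniq_crossings.
move=> x /mapP[k]; rewrite mem_filter mem_iota add0n => /andP[ck kK] ->.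
rewrite in_fset_set; last exact: finite_thick.
rewrite inE; split; first exact: hD.
apply: lt_le_trans (series_ge w k.+1 (hD _ kK)); rewrite lte_fin.
move: ck; rewrite crossE => /andP[_ /lt_le_trans]; apply.
have be i : (i <= k)%N -> before_exit D i w.
  move=> ik; apply/forallP => j; rewrite inE; apply: hD.
  by rewrite (leq_ltn_trans _ kK)// (leq_trans _ ik)// -ltnS.
rewrite big_nat_recr//= be// eqxx mul1r lerD2r big_mkcond/= le_eqVlt; apply/orP; left; apply/eqP.
rewrite big_nat [RHS]big_nat; apply: eq_bigr => i /andP[_ ik]; rewrite be ?(ltnW ik)//.
by case: ifP; rewrite ?mul1r ?mul0r.
Qed.

(** A thick point has a first jump at which its accumulated time before the exit passes u; that jump
    is a crossing and comes before K, where the walk is already outside. *)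
Lemma card_thick_le (D : set V) u K w : 0 <= u -> finite_set D -> ~ D (pos K w) ->
  (#|` fset_set (thick D u w)| <= count (fun k => cross u 0 k w) (iota 0 K))%N.
Proof.
move=> u0 fD nD; rewrite -size_filter -(size_map (pos ^~ w)); apply: uniq_leq_size.
  exact: fset_uniq.
move=> x; rewrite in_fset_set; last exact: finite_thick.
rewrite inE => -[Dx]; rewrite local_time_exit//.
pose c k := before_exit D k w && (pos k w == x).
have cK k : (K <= k)%N -> c k = false.
  move=> Kk; apply/negbTE/negP => /andP[/forallP /(_ (Ordinal (Kk : (K < k.+1)%N)))].
  by rewrite inE.
have f0 k : (0 <= ((c k)%:R * E k w)%:E)%E by rewrite lee_fin mulr_ge0// ltW.
have serE : (\sum_(0 <= k <oo) ((c k)%:R * E k w)%:E = (\sum_(0 <= k < K) (c k)%:R * E k w)%:E)%E.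
  rewrite (nneseries_split 0 K) => [|k _]; last exact: f0.
  by rewrite add0n eseries0 ?adde0 ?sumEFin// => i Ki _; rewrite cK// mul0r.
rewrite -[X in (_ < X)%E]/(\sum_(0 <= k <oo) ((c k)%:R * E k w)%:E)%E serE lte_fin => uK.
pose S m := \sum_(0 <= k < m) (c k)%:R * E k w.
have ex : exists m, u < S m by exists K.
case: (ex_minnP ex) => -[|k] uk mk; first by move: uk; rewrite /S big_geq// ltNge u0.
have kK : (k < K)%N by exact: mk.
have Sk : S k <= u by rewrite leNgt; apply/negP => /mk; rewrite ltnn.
have ck : c k.
  apply: contraLR uk => nck; rewrite -leNgt /S big_nat_recr//= (negbTE nck) mul0r addr0//.
have /andP[bk /eqP kx] := ck; apply/mapP; exists k => //; rewrite mem_filter mem_iota kK andbT.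
have SE : \sum_(0 <= i < k | pos i w == pos k w) E i w = S k.
  rewrite /S big_mkcond/= big_nat [RHS]big_nat; apply: eq_bigr => i /andP[_ ik].
  rewrite /c kx; have -> : before_exit D i w.
    apply/forallP => j; move/forallP: bk => /(_ (widen_ord (ltnW ik : (i < k.+1)%N) j)).
    exact.
  by case: ifP; rewrite ?mul1r ?mul0r.
rewrite crossE SE Sk/= (lt_le_trans uk)// /S big_nat_recr//= ck mul1r//.
Qed.

Let bpos k x : bmeas (fun w => (pos k w == x)%:R : R).
Proof.
split; last by exists 1 => w; exact: natb_norm.
under eq_fun do rewrite pos_incs.
exact: (incs_measurable 0 k (fun s => (\sum_(e <- s) e == x)%:R)).
Qed.

Let bbefore (D : set V) k : bmeas (fun w => (before_exit D k w)%:R : R).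
Proof.
rewrite (_ : (fun w => _) = fun w => \prod_(j < k.+1) (pos j w \in D)%:R).
  apply: bmeas_prod => j _; split; last by exists 1 => w; exact: natb_norm.
  under eq_fun do rewrite pos_incs.
  exact: (incs_measurable 0 j (fun s => (\sum_(e <- s) e \in D)%:R)).
apply/funext => w; rewrite /before_exit; case: forallP => [h|h].
  by rewrite big1// => j _; rewrite h.
have [j nj] : exists j : 'I_k.+1, pos j w \notin D.
  by apply: contrapT => n; apply: h => j; apply: contrapT => /negP nj; apply: n; exists j.
by rewrite (bigD1 j)//= (negbTE nj) mul0r.
Qed.

Lemma measurable_local_time (D : set V) x : D x ->
  measurable_fun setT (fun w => local_time (Y^~ w) x (exit_time D (Y^~ w))).
Proof.
move=> Dx; under eq_fun do rewrite local_time_exit//.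
apply: ge0_emeasurable_sum => [k w _ _|k _]; first by rewrite lee_fin mulr_ge0// ltW.
apply/measurable_EFinP; apply: measurable_funM => //.
under eq_fun do rewrite -mulnb natrM.
by have [] := bmeasM (bbefore D k) (bpos k x).
Qed.

(** Indexing the box by a finite type writes the cardinality as a finite sum of indicators, hence as
    a measurable function. *)
Let zb (N : nat) (f : {ffun 'I_d -> 'I_(2 * N).+1}) : V := \row_i ((f i : nat)%:Z - N%:Z).

Let zb_inj N : injective (@zb N).
Proof.
move=> f f' ff; apply/ffunP => i; apply/val_inj => /=.
by have := congr1 (fun v : V => v 0 i) ff; rewrite !mxE => /addIr [].
Qed.

Let box_zb N x : box d N x -> exists f, @zb N f = x.
Proof.
move=> xN; have xi i : (`|(x 0 i + N%:Z)%R| < (2 * N).+1)%N.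
  by have := xN i; move: (x 0 i) => q; clear; lia.
exists [ffun i => Ordinal (xi i)]; apply/rowP => i; rewrite !mxE ffunE/=.
by have := xN i; move: (x 0 i) => q; clear; lia.
Qed.

Lemma finite_box N : finite_set (box d N).
Proof.
apply: (@sub_finite_set _ _ (@zb N @` setT)); last by apply: finite_image; exact: finite_finset.
by move=> x /box_zb[f <-]; exists f.
Qed.

Lemma card_thick_sum u N w : (#|` fset_set (thick (box d N) u w)|)%:R =
  \sum_(f : {ffun 'I_d -> 'I_(2 * N).+1} | zb f \in box d N)
    (u%:E < local_time (Y^~ w) (zb f) (exit_time (box d N) (Y^~ w)))%E%:R :> R.
Proof.
rewrite -natr_sum; congr (_%:R).
transitivity (size [seq f <- index_enum {ffun 'I_d -> 'I_(2 * N).+1} | (zb f \in box d N) &&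
    (u%:E < local_time (Y^~ w) (zb f) (exit_time (box d N) (Y^~ w)))%E]); last first.
  by rewrite -sum1_size big_filter big_mkcondr/=; apply: eq_bigr => f _; case: ifP.
rewrite -(size_map (@zb N)); apply/perm_size/uniq_perm; first exact: fset_uniq.
  rewrite map_inj_uniq ?filter_uniq ?index_enum_uniq//; exact: zb_inj.
move=> x; rewrite in_fset_set; last exact/finite_thick/finite_box.
apply/idP/mapP => [|[f]].
  rewrite inE => -[xN ux]; have [f fx] := box_zb xN; exists f => //.
  by rewrite mem_filter mem_index_enum andbT fx ux andbT inE.
by rewrite mem_filter => /andP[/andP[fN uf] _] ->; rewrite inE; split => //; rewrite inE in fN.
Qed.

Lemma measurable_card_thick u N :
  measurable_fun setT (fun w => (#|` fset_set (thick (box d N) u w)|)%:R : R).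
Proof.
under eq_fun do rewrite card_thick_sum big_mkcond/=.
apply: measurable_sum => f.
have [|_] := boolP (zb f \in box d N); last exact: measurable_cst.
rewrite inE => fN; suff [] : bmeas (fun w => (u%:E < local_time (Y^~ w) (zb f) (exit_time (box d N) (Y^~ w)))%E%:R : R) by [].
by apply: bmeas_bool; apply: measurable_fun_lte => //; exact: measurable_local_time.
Qed.

(* By the layer-cake formula, as the clocks are not bounded. *)
Lemma return_clock_mean k : (\int[P]_w ((pos k w == 0)%:R * E k w)%:E = (Pn R k (0 : V))%:E)%E.
Proof.
have mf : measurable_fun setT (fun w => (pos k w == 0)%:R * E k w : R).
  by apply: measurable_funM => //; exact: (bpos k 0).1.
pose Z : {RV P >-> R} := mfun_Sub (mem_set mf).
have Zge0 w : 0 <= Z w by rewrite /= mulr_ge0// ltW.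
have PnE : Ex P (fun w => (pos k w == 0)%:R) = Pn R k (0 : V).
  under eq_fun do rewrite pos_incs.
  rewrite (@incs_law (fun s => (\sum_(e <- s) e == 0)%:R) 1) ?subn0 ?Pn_avgs.
    by apply: eq_avgs => s; rewrite add0r.
  by move=> s; exact: natb_norm.
have D12 : Dstep `&` Dclock = set0 by apply/seteqP; split => // i [[j ->] [j']].
have ccdfE r : 0 <= r -> ccdf Z r = (Pn R k (0 : V) * expR (- r))%:E.
  move=> r0; pose A := [set w | pos k w = 0 /\ r < E k w].
  have AE w : \1_A w = (pos k w == 0)%:R * (r < E k w)%R%:R :> R.
    rewrite indicE -natrM mulnb; congr (_%:R : R); congr nat_of_bool.
    by apply/idP/andP; rewrite inE/= => -[/eqP h1 h2].
  have bp : bmeas ((fun w => (pos k w == 0)%:R) : past_type F Dstep -> R).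
    split; last by exists 1 => w; exact: natb_norm.
    under eq_fun do rewrite pos_incs.
    by apply: (@incs_past Dstep 0 k (fun s => (\sum_(e <- s) e == 0)%:R)) => i _; exists i.
  have be : bmeas ((fun w => (r < E k w)%R%:R) : past_type F Dclock -> R).
    rewrite (_ : (fun w => _) = fun w => (r < clocks [:: k] w)%R%:R); last first.
      by apply/funext => w; rewrite /clocks big_seq1.
    by apply: bmeas_lt => //; apply: clocks_past => n _; exists n.
  have mA : measurable A.
    rewrite (_ : A = (fun w => (pos k w == 0)%:R * (r < E k w)%R%:R) @^-1` [set 1 : R]).
      rewrite -[X in measurable X]setTI.
      exact: ((bmeasM (walk_past bp) (walk_past be)).1 _ _ (measurable_set1 1)).
    apply/seteqP; split => w /=; rewrite -AE indicE.
      by move=> ?; rewrite mem_set.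
    by case: (boolP (w \in A)) => [|_ /eqP]; [rewrite inE|rewrite eq_sym oner_eq0].
  have -> : ccdf Z r = P A.
    rewrite /ccdf /distribution /pushforward; congr (P _); apply/seteqP; split => w /=.
      rewrite in_itv/= andbT; case: eqP => p0; rewrite ?mul1r// mul0r ltNge r0//.
    by move=> [-> h]; rewrite eqxx mul1r in_itv/= andbT.
  rewrite -(Ex_indic P mA) (_ : Ex P \1_A = Ex P (fun w => (pos k w == 0)%:R * (r < E k w)%R%:R)); last first.
    by congr (Ex P _); apply/funext => w; exact: AE.
  rewrite (mutual_indep_Ex events_measurable events_setI events_setT indF D12 bp be) PnE.
  rewrite (_ : Ex P (fun w => (r < E k w)%R%:R) = expR (- r))//.
  have := @clocks_tail r [:: k] r0 erefl; rewrite /= big_ord_recl big_ord0 addr0.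
  rewrite /pois expr0 fact0 divr1 mulr1 => <-.
  by congr (Ex P _); apply/funext => w; rewrite /clocks big_seq1.
have := ge0_expectation_ccdf Zge0; rewrite unlock => ->.
have p0 := Pn_ge0 R k (0 : V).
transitivity (\int[lebesgue_measure]_r ((Pn R k (0 : V))%:E * (exponential_pdf 1 r)%:E)%E)%E.
  rewrite integral_mkcond; apply: eq_integral => r _; rewrite patchE /exponential_pdf patchE.
  case: ifP => [|_]; last by rewrite mule0.
  by rewrite inE/= in_itv/= andbT => r0; rewrite ccdfE// mul1r mulN1r.
rewrite ge0_integralZl_EFin//; last 2 first.
- by move=> r _; rewrite lee_fin exponential_pdf_ge0.
- by apply/measurable_EFinP; exact: measurable_exponential_pdf.
by rewrite integral_exponential_pdf// mule1.
Qed.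

(** Each visit lasts one unit on average, independently of the steps. *)
Lemma green0E : (3 <= d)%N -> green0 P Y = green R d.
Proof.
move=> d_ge3; rewrite /green0; under eq_integral do rewrite local_time_total.
rewrite integral_nneseries//; last 2 first.
- move=> k; apply/measurable_EFinP; apply: measurable_funM => //; exact: (bpos k 0).1.
- by move=> k w _; rewrite lee_fin mulr_ge0// ltW.
under eq_eseriesr do rewrite return_clock_mean.
under eq_fun do rewrite sumEFin.
rewrite (_ : limn _ = (green R d)%:E)//; apply/cvg_lim => //.
apply: cvg_EFin; first by near=> n.
rewrite (_ : _ \o _ = fun m => Gn R m (0 : V)); first exact: Gn_cvg.
by apply/funext => n /=; rewrite big_mkord.
Unshelve. all: by end_near. Qed.

Lemma expRN_lipschitz (x y : R) : 0 <= x -> 0 <= y -> `|expR (- x) - expR (- y)| <= `|x - y|.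
Proof.
wlog xy : x y / x <= y.
  move=> h x0 y0; have [|/ltW] := leP x y; first by move=> ?; exact: h.
  by move=> ?; rewrite distrC [leRHS]distrC; exact: h.
move=> x0 y0; rewrite [leRHS]distrC !ger0_norm ?subr_ge0 ?ler_expR ?lerN2//.
have -> : expR (- x) - expR (- y) = expR (- x) * (1 - expR (- (y - x))).
  by rewrite mulrBr mulr1 -expRD; congr (_ - expR _); ring.
have e1 : expR (- x) <= 1 by rewrite expR_le1 oppr_le0.
have yx : 0 <= y - x by rewrite subr_ge0.
have /andP[e2 _] := expRN_bounds yx.
have e3 : 0 <= 1 - expR (- (y - x)) by rewrite subr_ge0 expR_le1 oppr_le0.
by rewrite (le_trans (ler_wpM2r e3 e1))// mul1r; lra.
Qed.

Lemma count_blocks u (l K : nat) w : (count (fun k => cross u 0 k w) (iota 0 (K * l)))%:R =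
  \sum_(j < K) \sum_(i < l) (cross u 0 (j * l + i) w)%:R :> R.
Proof.
elim: K => [|K ih]; first by rewrite big_ord0.
rewrite mulSnr iotaD count_cat natrD ih big_ord_recr/=; congr (_ + _).
rewrite -sum1_count big_mkcond/= natr_sum -[X in iota X]addn0 iotaDl big_map.
rewrite -(big_mkord predT (fun i => (cross u 0 (K * l + i) w)%:R : R)) /index_iota subn0.
by apply: eq_bigr => i _; case: (cross _ _ _ _).
Qed.

(** * Laplace transform of the number of thick points *)

Section card_laplace.
Hypothesis d_ge3 : (3 <= d)%N.
Variables a lm : R.
Hypothesis a_ge0 : 0 <= a.
Hypothesis lm_gt0 : 0 < lm.

Let u := level a.
Let L := blk R.
Let lam := block_lam a lm.
Let card N w : nat := #|` fset_set (thick (box d N) (u N) w)|.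

Let lam_ge0 N : 0 <= lam N. Proof. exact/ltW/block_lam_gt0. Qed.

Definition discrepancy N n w : R := \sum_(j < n.+1) \sum_(i < L N)
  (cross (u N) (j * L N) (j * L N + i) w != cross (u N) 0 (j * L N + i) w)%:R.

Let discrepancy_ge0 N n w : 0 <= discrepancy N n w.
Proof. by apply: sumr_ge0 => j _; apply: sumr_ge0. Qed.

(** The exponential is Lipschitz on the half-line, so forgetting the past at each block start costs
    at most the number of crossings that this changes. *)
Let kill_count N n K w : (K <= n.+1)%N ->
  `|walk_kill u L lam N K w - expR (- (lam N * (count (fun k => cross (u N) 0 k w) (iota 0 (K * L N)))%:R))| <=
  lam N * discrepancy N n w.
Proof.
move=> Kn; rewrite (le_trans (expRN_lipschitz _ _))//.
- by rewrite mulr_ge0// sumr_ge0// => l _; exact: block_count_ge0.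
- by rewrite mulr_ge0.
rewrite -mulrBr normrM ger0_norm// ler_wpM2l// count_blocks /block_count -sumrB.
rewrite (le_trans (ler_norm_sum _ _ _))//.
apply: (@le_trans _ _ (\sum_(j < K) \sum_(i < L N)
  (cross (u N) (j * L N) (j * L N + i) w != cross (u N) 0 (j * L N + i) w)%:R)).
  apply: ler_sum => j _; rewrite -sumrB (le_trans (ler_norm_sum _ _ _))//.
  apply: ler_sum => i _; case: (cross _ (j * L N)%N _ _); case: (cross _ 0 _ _) => /=;
    rewrite ?subrr ?subr0 ?sub0r ?normrN ?normr0 ?normr1//.
rewrite /discrepancy.
pose f j : R := \sum_(i < L N)
  (cross (u N) (j * L N) (j * L N + i) w != cross (u N) 0 (j * L N + i) w)%:R.
rewrite -(big_mkord predT f) -(big_mkord predT f) (big_cat_nat (leq0n K) Kn)/= lerDl.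
by apply: sumr_ge0 => j _; apply: sumr_ge0.
Qed.

Let cube_box r N j w : (0 < N)%N -> cube r (walk_path L N j w) <->
  forall i, (`|(pos (j * L N) w) 0 i|%:~R <= r * N%:R :> R).
Proof.
move=> N0; split=> [/forallP h i|h].
  by have := h i; rewrite /walk_path normrM normfV normr_nat ler_pdivrMr ?ltr0n// intr_norm.
apply/forallP => i; rewrite /walk_path normrM normfV normr_nat ler_pdivrMr ?ltr0n//.
by rewrite -intr_norm; exact: h.
Qed.

(** While the block starts lie in the cube of ratio r, moves of at most L N keep the walk in the box
    all along, so every crossing of these blocks gives a thick point. Increments that are not unit
    steps are paid for by the last term. *)
Lemma laplace_card_upper r N n w : (0 < N)%N -> (L N)%:R <= (1 - r) * N%:R ->
  expR (- (lam N * (card N w)%:R)) <= stopped u L lam r N n.+1 w + lam N * discrepancy N n w +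
    (~~ all is_step (incs 0 (n.+1 * L N) w))%:R.
Proof.
move=> N0 LN; have [K [Kn hK _ ->]] := stopped_index u L lam r N n.+1 w.
have e1 : expR (- (lam N * (card N w)%:R)) <= 1 by rewrite expR_le1 oppr_le0 mulr_ge0.
have e0 : 0 <= walk_kill u L lam N K w by exact: expR_ge0.
have d0' : 0 <= lam N * discrepancy N n w by rewrite mulr_ge0.
case: (boolP (all is_step _)) => st /=; last by rewrite (le_trans e1)// lerDr addr_ge0.
rewrite addr0; have := kill_count N w Kn; rewrite ler_norml => /andP[h1 _].
suff cK : (count (fun k => cross (u N) 0 k w) (iota 0 (K * L N)) <= card N w)%N.
  have : expR (- (lam N * (card N w)%:R)) <=
      expR (- (lam N * (count (fun k => cross (u N) 0 k w) (iota 0 (K * L N)))%:R)).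
    by rewrite ler_expR lerN2 ler_wpM2l// ler_nat.
  by move=> h2; rewrite (le_trans h2)//; move: h1; rewrite lerNl opprB lerBlDl.
apply: card_thick_ge; first exact: finite_box.
move=> k kK i; have L0 : (0 < L N)%N := blk_gt0 R N.
pose j := (k %/ L N)%N; have jK : (j < K)%N by rewrite ltn_divLR.
have jk : (j * L N <= k)%N by exact: leq_trunc_div.
have kj : (k - j * L N <= L N)%N.
  by rewrite leq_subLR [k in leqLHS](divn_eq k (L N)) leq_add2l ltnW// ltn_mod.
have := cube_box r j w N0; move=> [/(_ (hK j jK)) /(_ i) hc _].
have sk : all is_step (incs (j * L N) k w).
  apply/allP => v /mapP[l]; rewrite mem_rev mem_index_iota => /andP[_ lk] ->.
  apply: (allP st); apply/mapP; exists l => //; rewrite mem_rev mem_index_iota/=.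
  by rewrite (ltn_trans lk)// (leq_trans kK)// leq_mul2r Kn orbT.
have := step_coord i sk; rewrite sum_incs// size_incs !mxE => hs.
have hs' : (`|(pos k w) 0 i - (pos (j * L N) w) 0 i|%:~R <= (L N)%:R :> R)%R.
  by rewrite pmulrn ler_int (le_trans hs)// lez_nat.
have tri : (`|(pos k w) 0 i| <= `|(pos k w) 0 i - (pos (j * L N) w) 0 i| + `|(pos (j * L N) w) 0 i|)%R.
  by rewrite -{1}[(pos k w) 0 i](subrK ((pos (j * L N) w) 0 i)) ler_normD.
rewrite -(ler_int R); move: tri; rewrite -(ler_int R) rmorphD/= => tri.
rewrite -[leRHS]/((N%:Z)%:~R) -pmulrn (le_trans tri)// (le_trans (lerD hs' hc))// (le_trans (lerD LN (lexx _)))//.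
by rewrite -mulrDl subrK mul1r.
Qed.

(** A block start outside the box comes after the exit, so the crossings before it include all those
    of the thick points. If none occurs within the horizon, the subtracted [stay] is 1 and the left
    side is not positive. *)
Lemma laplace_card_lower N n w : (0 < N)%N ->
  stopped u L lam 1 N n.+1 w - lam N * discrepancy N n w - stay (walk_path L N) 1 n w <=
  expR (- (lam N * (card N w)%:R)).
Proof.
move=> N0; have [K [Kn hK nK ->]] := stopped_index u L lam 1 N n.+1 w.
have d0' : 0 <= lam N * discrepancy N n w by rewrite mulr_ge0.
have /andP[s0 _] := stay01 (walk_path L) 1 N n w.
have := kill_count N w Kn; rewrite ler_norml => /andP[_ h1].
move: Kn; rewrite leq_eqVlt => /orP[/eqP KE|/nK out].
  have -> : stay (walk_path L N) 1 n w = 1.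
    by rewrite /stay big1// => j _; rewrite hK// KE ltn_ord.
  have k1 : walk_kill u L lam N K w <= 1.
    by rewrite expR_le1 oppr_le0 mulr_ge0// sumr_ge0// => l _; exact: block_count_ge0.
  have := expR_ge0 (- (lam N * (card N w)%:R)); lra.
have cK : (card N w <= count (fun k => cross (u N) 0 k w) (iota 0 (K * L N)))%N.
  apply: card_thick_le; [exact: level_ge0|exact: finite_box|].
  move=> bx; move/negP: out; apply; apply/(cube_box 1 K w N0) => i.
  by rewrite mul1r pmulrn ler_int; exact: bx.
have : expR (- (lam N * (count (fun k => cross (u N) 0 k w) (iota 0 (K * L N)))%:R)) <=
    expR (- (lam N * (card N w)%:R)).
  by rewrite ler_expR lerN2 ler_wpM2l// ler_nat.
lra.
Qed.

Lemma laplace_card (c : R) (psi : R -> R) (e : R) : 0 < c -> {for c, continuous psi} ->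
  (forall r, 0 < r -> lim2 (fun N n => Ex P (stopped u L lam r N n)) (psi (r ^+ 2 * c))) ->
  (forall r N n, bmeas (stopped u L lam r N n)) -> (forall r N n, bmeas (stay (walk_path L N) r n)) ->
  0 < e -> \forall N \near \oo, `|Ex P (fun w => expR (- (lam N * (card N w)%:R))) - psi c| <= e.
Proof.
move=> c0 psic slim bst bsy e0; have e3 : 0 < e / 3 by rewrite divr_gt0.
have [r [A [/andP[r0 r1] A0 hN]]] := @stopped_sandwich u L lam c psi (e / 3) lam_ge0 (blk_gt0 R)
  (@blk_small R) c0 psic slim bst e3.
have [C C0 hC] := discrepancy_count d_ge3 a_ge0.
have q0 : 0 < 1 - r by rewrite subr_gt0.
near=> N.
have N0 : (0 < N)%N by near: N; exists 1%N.
have LN : (L N)%:R <= (1 - r) * N%:R by near: N; exact: blk_small.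
have hM : A * lm * C <= e / 3 * (logN R N)%:R by near: N; exact: logN_near.
have [n [nA lo up sy]] : exists n,
    [/\ n.+1%:R * walk_mesh L N <= A, psi c - e / 3 <= Ex P (stopped u L lam 1 N n.+1),
        Ex P (stopped u L lam r N n.+1) <= psi c + e / 3 &
        Ex P (stay (walk_path L N) 1 n) <= e / 3] by near: N; exact: hN.
have bE : bmeas (fun w => expR (- (lam N * (card N w)%:R))).
  split.
    apply: measurableT_comp => //; apply: measurableT_comp => //; apply: measurable_funM => //.
    exact: measurable_card_thick.
  by exists 1 => w; rewrite ger0_norm ?expR_ge0// expR_le1 oppr_le0 mulr_ge0.
have bij j i : bmeas (fun w => (cross (u N) (j * L N) (j * L N + i) w != cross (u N) 0 (j * L N + i) w)%:R : R).
  by apply: bmeas_neqb; apply: bcross; rewrite ?leq_addr.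
have bd : bmeas (discrepancy N n) by apply: bmeas_sum => j _; apply: bmeas_sum => i _.
have bld : bmeas (fun w => lam N * discrepancy N n w) by exact: bmeasZ.
have bsp : bmeas (fun w => (~~ all is_step (incs 0 (n.+1 * L N) w))%:R : R).
  split; last by exists 1 => w; exact: natb_norm.
  exact: (incs_measurable 0 (n.+1 * L N) (fun s => (~~ all is_step s)%:R)).
(* The n + 1 blocks make up a rescaled time of at most A, and the discrepancy per unit of it is at
   most lm C / log N. *)
have Ed : Ex P (fun w => lam N * discrepancy N n w) <= e / 3.
  rewrite ExZ// /discrepancy Ex_sum; last by move=> j _; apply: bmeas_sum.
  apply: (@le_trans _ _ (lam N * \sum_(j < n.+1) (thinning a N * (C * (logN R N)%:R ^+ 15)))).
    by rewrite ler_wpM2l//; apply: ler_sum => j _; rewrite Ex_sum//; exact: hC.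
  rewrite sumr_const card_ord -[X in lam N * X]mulr_natl.
  have M0 : 0 < (logN R N)%:R :> R := lt_le_trans ltr01 (logN_ge1 R N).
  have r4 (l k t z : R) : l * (k * (t * z)) = k * (l * t) * z by ring.
  rewrite r4 block_lam_thinning//.
  have meshE : walk_mesh L N = (logN R N)%:R ^+ 15 * (logN R N)%:R / N%:R ^+ 2.
    by rewrite /walk_mesh /L /blk natrX -exprSr.
  have r5 (k l n2 C' m15 m : R) : m != 0 ->
      k * (l * n2) * (C' * m15) = (k * (m15 * m * n2)) * (l * C' / m).
    by move=> m0; field.
  rewrite (r5 _ _ _ _ _ (logN R N)%:R) ?gt_eqF// -meshE.
  have lC : 0 <= lm * C / (logN R N)%:R by rewrite divr_ge0 ?mulr_ge0// ltW.
  by rewrite (le_trans (ler_wpM2r lC nA))// !mulrA ler_pdivrMr.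
have E0 := incs_steps 0 (n.+1 * L N).
have upper : Ex P (fun w => expR (- (lam N * (card N w)%:R))) <=
    Ex P (stopped u L lam r N n.+1) + Ex P (fun w => lam N * discrepancy N n w) + 0.
  rewrite -E0 -ExD// -ExD//; last exact: bmeasD.
  apply: Ex_le => //; first by apply: bmeasD => //; exact: bmeasD.
  by move=> w; exact: laplace_card_upper.
have lower : Ex P (stopped u L lam 1 N n.+1) - Ex P (fun w => lam N * discrepancy N n w) -
    Ex P (stay (walk_path L N) 1 n) <= Ex P (fun w => expR (- (lam N * (card N w)%:R))).
  rewrite -ExB// -ExB//; last exact: bmeasB.
  apply: Ex_le => //; first by apply: bmeasB => //; exact: bmeasB.
  by move=> w; exact: laplace_card_lower.
rewrite ler_norml; apply/andP; split; lra.
Unshelve. all: by end_near. Qed.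

End card_laplace.

Lemma thick_count_laplace (psi : R -> R) (a lm : R) :
  (forall c, 0 < c -> {for c, continuous psi}) ->
  (forall c, 0 < c -> {for c, continuous (fun c => (1 - psi c) / c)}) ->
  (forall c, 0 < c -> exists d1 (T1 : measurableType d1) (P1 : probability T1 R) s Z h,
    @heat_array R d1 T1 P1 d s Z h c /\ lim2 (kill_sum P1 s Z h 1) ((1 - psi c) / c)) ->
  (3 <= d)%N -> 0 <= a <= 1 -> 0 < lm ->
  Ex P (fun w => expR (- (lm * ((card_thick_points (green0 P Y) a N (Y^~ w))%:R /
    (N%:R `^ (2 * (1 - a))))))) @[N --> \oo] -->
  psi ((if a == 1 then 1 - expR (- lm) else lm) / green R d).
Proof.
move=> psic Uc Uref d_ge3 /andP[a0 a1] lm0; set c := _ / green R d.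
have g0 : 0 < green R d := lt_le_trans ltr01 (green_ge1 R d_ge3).
have c0 : 0 < c.
  by rewrite divr_gt0//; case: eqP => // _; rewrite subr_gt0 expR_lt1 oppr_lt0.
have lam0 N : 0 <= block_lam a lm N by exact/ltW/block_lam_gt0.
have ra (e : R) : 0 < e -> \forall N \near \oo, forall j,
    `|Ex P (fun w => 1 - expR (- (block_lam a lm N * block_count (level a) (blk R) N j w))) -
      c * walk_mesh (blk R) N| <= e * walk_mesh (blk R) N.
  move=> e0; rewrite /c; have [aE|aE] := eqVneq a 1.
    exact: (rate_critical d_ge3 a0 lm0 aE e0).
  by apply: (rate_subcritical d_ge3 a0 lm0 _ e0); rewrite lt_neqAle aE.
have hA := @walk_heat_array (level a) (blk R) (block_lam a lm) c lam0 (blk_gt0 R) (ltW c0) (@blk_small R) ra.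
have slim r : 0 < r ->
    lim2 (fun N n => Ex P (stopped (level a) (blk R) (block_lam a lm) r N n)) (psi (r ^+ 2 * c)).
  move=> r0; have := @stopped_limit (level a) (blk R) (block_lam a lm) c lam0 (blk_gt0 R) (ltW c0)
    (@blk_small R) ra (fun c => (1 - psi c) / c) r c0 r0 (kill_sum_limit d_gt0 Uc Uref c0 r0 hA).
  rewrite (_ : 1 - c * _ = psi (r ^+ 2 * c))//.
  by field; rewrite !gt_eqF.
have bst r N n : bmeas (stopped (level a) (blk R) (block_lam a lm) r N n).
  exact: (@bmeas_stopped (level a) (blk R) (block_lam a lm) c lam0 (blk_gt0 R) (ltW c0) (@blk_small R) ra).
have bsy r N n : bmeas (stay (walk_path (blk R) N) r n) by exact: (bchi hA).
apply/cvgrPdist_le => e e0; near=> N.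
have N0 : (0 < N)%N by near: N; exists 1%N.
have eqE : (fun w => expR (- (lm * ((card_thick_points (green0 P Y) a N (Y^~ w))%:R /
    (N%:R `^ (2 * (1 - a))))))) =
    (fun w => expR (- (block_lam a lm N * (#|` fset_set (thick (box d N) (level a N) w)|)%:R))).
  apply/funext => w; rewrite green0E// /block_lam /powR pnatr_eq0 (gtn_eqF N0); congr (expR (- _)).
  by rewrite expRN -mulrA [_^-1 * _]mulrC.
rewrite eqE distrC; near: N; exact: (laplace_card d_ge3 a0 lm0 c0 (psic c c0) slim bst bsy e0).
Unshelve. all: by end_near. Qed.

End paths.
End steps_and_clocks.

(** * Laplace transforms *)

Section bernstein.
Variable R : realType.

(** The mean of [g] at a binomial variable of parameters m and y, by conditioning on one trial. The
    recursion spares the binomial coefficients. *)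
Fixpoint bern (g : nat -> R) (m : nat) (y : R) : R :=
  if m is m'.+1 then y * bern (fun k => g k.+1) m' y + (1 - y) * bern g m' y else g 0%N.

Lemma bern_le (g g' : nat -> R) m y : 0 <= y <= 1 -> (forall k, (k <= m)%N -> g k <= g' k) ->
  bern g m y <= bern g' m y.
Proof.
move=> /andP[y0 y1]; elim: m g g' => [|m ih] g g' gg /=; first exact: gg.
apply: lerD; apply: ler_wpM2l; rewrite ?subr_ge0//; apply: ih => k km; apply: gg => //.
exact: leqW.
Qed.

Lemma bern_affine (a b : R) g m y : bern (fun k => a + b * g k) m y = a + b * bern g m y.
Proof. by elim: m g => [//|m ih] g /=; rewrite !ih; ring. Qed.

Lemma bern_square (a : R) m y :
  bern (fun k => (k%:R - a) ^+ 2) m y = m%:R * (y * (1 - y)) + (m%:R * y - a) ^+ 2.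
Proof.
elim: m a => [|m ih] a /=; first by ring.
rewrite ih (_ : (fun k : nat => (k.+1%:R - a) ^+ 2) = (fun k : nat => (k%:R - (a - 1)) ^+ 2)); last first.
  by apply/funext => k; rewrite -natr1; congr (_ ^+ 2); ring.
by rewrite ih -natr1; ring.
Qed.

Lemma bern_norm_le (g b : nat -> R) (c : R) m y : 0 <= y <= 1 ->
  (forall k, (k <= m)%N -> `|g k - c| <= b k) -> `|bern g m y - c| <= bern b m y.
Proof.
move=> y01 gb; rewrite ler_norml; apply/andP; split.
  have : bern (fun k => c + (-1) * b k) m y <= bern g m y.
    by apply: bern_le => // k /gb; rewrite ler_norml => /andP[]; lra.
  by rewrite bern_affine; lra.
have : bern g m y <= bern (fun k => c + 1 * b k) m y.
  by apply: bern_le => // k /gb; rewrite ler_norml => /andP[]; lra.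
by rewrite bern_affine; lra.
Qed.

(* Heine's theorem, in the shape in which Chebyshev's inequality consumes it. *)
Lemma quadratic_modulus (h : R -> R) (C e : R) : continuous h -> (forall x, `|h x| <= C) -> 0 < e ->
  exists2 K : R, 0 < K & forall x y, 0 <= x <= 1 -> 0 <= y <= 1 ->
    `|h x - h y| <= e + K * (x - y) ^+ 2.
Proof.
move=> hc hC e0; apply: contrapT => nK.
have ex (n : nat) : exists p : R * R, [/\ 0 <= p.1 <= 1, 0 <= p.2 <= 1 &
    e + n.+1%:R * (p.1 - p.2) ^+ 2 < `|h p.1 - h p.2|].
  apply: contrapT => np; apply: nK; exists n.+1%:R => // x y x01 y01.
  by rewrite leNgt; apply/negP => lt; apply: np; exists (x, y).
have [p hp] := choice ex.
have bp : bounded_fun (fun n => (p n).1).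
  exists 1; split => // M M1 n _; have [/andP[p0 p1] _ _] := hp n.
  by rewrite /= ger0_norm// (le_trans p1)// ltW.
have [f finc /cvg_ex[x /= fx]] := bolzano_weierstrass bp.
have fn n : (n <= f n)%N.
  elim: n => [//|n ih]; rewrite (leq_ltn_trans ih)//.
  by rewrite ltnNge; have := finc n.+1 n; rewrite !leEnat ltnn => ->.
have /cvgrPdist_lt /(_ (e / 2)) := hc x.
rewrite divr_gt0// => /(_ isT) [del /= del0 hdel].
have C0 : 0 <= C := le_trans (normr_ge0 (h 0)) (hC 0).
have sq n : (n.+1%:R * ((p n).1 - (p n).2) ^+ 2) <= 2 * C.
  have [_ _ h1] := hp n; have := ler_normB (h (p n).1) (h (p n).2).
  have := hC (p n).1; have := hC (p n).2; lra.
near \oo => n.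
have h1 : `|x - (p (f n)).1| < del / 2.
  by near: n; move/cvgrPdist_lt : fx; apply; rewrite divr_gt0.
have h2 : `|(p (f n)).1 - (p (f n)).2| < del / 2.
  rewrite -(ltr_pXn2r (n := 2)) ?nnegrE ?divr_ge0 ?(ltW del0)// real_normK ?num_real//.
  have n0 : 0 < (f n).+1%:R :> R by rewrite ltr0n.
  have d2 : 0 < (del / 2) ^+ 2 by rewrite exprn_gt0// divr_gt0.
  have big : 2 * C < (f n).+1%:R * (del / 2) ^+ 2.
    rewrite -ltr_pdivrMr//; apply: lt_le_trans (truncnS_gt _) _; rewrite ler_nat ltnS.
    apply: leq_trans (fn n); near: n; exact: nbhs_infty_ge.
  by rewrite -(ltr_pM2l n0) (le_lt_trans (sq (f n))).
have b1 : `|h x - h (p (f n)).1| < e / 2 by apply: hdel; rewrite /= (lt_trans h1)//; lra.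
have b2 : `|h x - h (p (f n)).2| < e / 2.
  apply: hdel; rewrite /=; have := ler_normD (x - (p (f n)).1) ((p (f n)).1 - (p (f n)).2).
  by rewrite addrA subrK; lra.
have [_ _ h3] := hp (f n).
have : 0 <= (f n).+1%:R * ((p (f n)).1 - (p (f n)).2) ^+ 2 by rewrite mulr_ge0// sqr_ge0.
have := ler_distD (h x) (h (p (f n)).1) (h (p (f n)).2).
rewrite (distrC (h (p (f n)).1) (h x)); lra.
Unshelve. all: by end_near. Qed.

Lemma bern_approx (h : R -> R) (C e : R) : continuous h -> (forall x, `|h x| <= C) -> 0 < e ->
  exists m, forall y, 0 <= y <= 1 -> `|bern (fun k => h (k%:R / m.+1%:R)) m.+1 y - h y| <= e.
Proof.
move=> hc hC e0; have e2 : 0 < e / 2 by rewrite divr_gt0.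
have [K K0 hK] := quadratic_modulus hc hC e2.
exists (Num.trunc (K / (e / 2))) => y y01; set m := Num.trunc _.
have m0 : 0 < m.+1%:R :> R by rewrite ltr0n.
have mK : K <= e / 2 * m.+1%:R by rewrite -ler_pdivrMl// mulrC ltW// truncnS_gt.
rewrite (@le_trans _ _ (bern (fun k => e / 2 + K / m.+1%:R ^+ 2 * (k%:R - m.+1%:R * y) ^+ 2) m.+1 y))//.
  apply: bern_norm_le => // k km.
  have k01 : 0 <= (k%:R / m.+1%:R : R) <= 1.
    by rewrite divr_ge0//= ler_pdivrMr// mul1r ler_nat.
  rewrite (le_trans (hK _ _ k01 y01))// lerD2l le_eqVlt; apply/orP; left; apply/eqP.
  by field; rewrite gt_eqF.
rewrite bern_affine bern_square subrr expr0n/= addr0.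
have /andP[y0 y1] := y01; have yy : y * (1 - y) <= 1 by rewrite mulr_ile1 ?subr_ge0// lerBlDr lerDl.
have ee : e = e / 2 + e / 2 by field.
rewrite [leRHS]ee lerD2l.
have -> : K / m.+1%:R ^+ 2 * (m.+1%:R * (y * (1 - y))) = K / m.+1%:R * (y * (1 - y)).
  by field; rewrite gt_eqF.
have Km : 0 <= K / m.+1%:R by rewrite divr_ge0// ltW.
by rewrite (le_trans (ler_wpM2l Km yy))// mulr1 ler_pdivrMr.
Qed.

End bernstein.

Section laplace_convergence.
Context (R : realType) dT (T : measurableType dT) (P : probability T R)
  dS (S : measurableType dS) (Q : probability S R).
Variables (X : nat -> T -> R) (M : S -> R).
Hypothesis mX : forall n, measurable_fun setT (X n).
Hypothesis mM : measurable_fun setT M.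
Hypothesis X_ge0 : forall n w, 0 <= X n w.
Hypothesis M_ge0 : forall w, 0 <= M w.
Hypothesis lap : forall k : nat, (0 < k)%N ->
  Ex P (fun w => expR (- (k%:R * X n w))) @[n --> \oo] --> Ex Q (fun w => expR (- (k%:R * M w))).

Let expR_meas dU (U : measurableType dU) (Z : U -> R) : measurable_fun setT Z ->
  measurable_fun setT (fun w => expR (- Z w)).
Proof. by move=> mZ; apply: measurableT_comp => //; exact: measurableT_comp. Qed.

Let exp01 (x : R) : 0 <= x -> 0 <= expR (- x) <= 1.
Proof. by move=> x0; rewrite expR_ge0 expR_le1 oppr_le0. Qed.

Let bexp dU (U : measurableType dU) (Z : U -> R) : measurable_fun setT Z -> (forall w, 0 <= Z w) ->
  bmeas (fun w => expR (- Z w)).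
Proof.
move=> mZ Z0; split; first exact: expR_meas.
by exists 1 => w; have /andP[? ?] := exp01 (Z0 w); rewrite ger0_norm.
Qed.

Let bbern dU (U : measurableType dU) (Z : U -> R) m (g : nat -> R) : measurable_fun setT Z ->
  (forall w, 0 <= Z w) -> bmeas (fun w => bern g m (expR (- Z w))).
Proof.
move=> mZ Z0; elim: m g => [|m ih] g; first exact: bmeas_cst.
apply: bmeasD; apply: bmeasM => //; first exact: bexp.
by apply: bmeasB; [exact: bmeas_cst|exact: bexp].
Qed.

Let bpow dU (U : measurableType dU) (Z : U -> R) j : measurable_fun setT Z ->
  (forall w, 0 <= Z w) -> bmeas (fun w => expR (- Z w) ^+ j).
Proof.
move=> mZ Z0; elim: j => [|j ih]; first exact: bmeas_cst.
by under eq_fun do rewrite exprS; apply: bmeasM => //; exact: bexp.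
Qed.

(** The extra power of exp(-X) absorbs the factor y of the recursion, so that the induction stays
    within one family. *)
Let bern_cvg m (g : nat -> R) j :
  Ex P (fun w => expR (- X n w) ^+ j * bern g m (expR (- X n w))) @[n --> \oo] -->
  Ex Q (fun w => expR (- M w) ^+ j * bern g m (expR (- M w))).
Proof.
elim: m g j => [|m ih] g j /=.
  have e dU (U : measurableType dU) (PU : probability U R) (Z : U -> R) : measurable_fun setT Z ->
      (forall w, 0 <= Z w) -> Ex PU (fun w => expR (- Z w) ^+ j * g 0%N) =
      g 0%N * Ex PU (fun w => expR (- (j%:R * Z w))).
    move=> mZ Z0; rewrite -ExZ; last by under eq_fun do rewrite -mulrN expRM_natl; exact: bpow.
    by congr (Ex PU _); apply/funext => w; rewrite -mulrN expRM_natl mulrC.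
  rewrite e//; under eq_fun do rewrite e//.
  apply: cvgMr; case: j {e} => [|j]; last exact: lap.
  have e0 dU (U : measurableType dU) (PU : probability U R) (Z : U -> R) :
      Ex PU (fun w => expR (- (0%:R * Z w))) = 1.
    by rewrite -[RHS](Ex_cst PU); congr (Ex PU _); apply/funext => w; rewrite mul0r oppr0 expR0.
  by rewrite e0; under eq_fun do rewrite e0; exact: cvg_cst.
have e dU (U : measurableType dU) (PU : probability U R) (Z : U -> R) : measurable_fun setT Z ->
    (forall w, 0 <= Z w) ->
    Ex PU (fun w => expR (- Z w) ^+ j * (expR (- Z w) * bern (fun k => g k.+1) m (expR (- Z w)) +
      (1 - expR (- Z w)) * bern g m (expR (- Z w)))) =
    Ex PU (fun w => expR (- Z w) ^+ j.+1 * bern (fun k => g k.+1) m (expR (- Z w))) +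
    Ex PU (fun w => expR (- Z w) ^+ j * bern g m (expR (- Z w))) -
    Ex PU (fun w => expR (- Z w) ^+ j.+1 * bern g m (expR (- Z w))).
  move=> mZ Z0; have b i f : bmeas (fun w => expR (- Z w) ^+ i * bern f m (expR (- Z w))).
    by apply: bmeasM; [exact: bpow|exact: bbern].
  rewrite -ExD// -ExB//; last exact: bmeasD.
  by congr (Ex PU _); apply/funext => w; rewrite exprS; ring.
rewrite e//; under eq_fun do rewrite e//.
by apply: cvgB; [apply: cvgD; exact: ih|exact: ih].
Qed.

Let exp_fun_cvg (h : R -> R) (C : R) : continuous h -> (forall x, `|h x| <= C) ->
  Ex P (fun w => h (expR (- X n w))) @[n --> \oo] --> Ex Q (fun w => h (expR (- M w))).
Proof.
move=> hc hC; apply/cvgrPdist_le => e e0; have e3 : 0 < e / 3 by rewrite divr_gt0.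
have [m hm] := bern_approx hc hC e3; set b := bern _ _ in hm.
have := @bern_cvg m.+1 (fun k => h (k%:R / m.+1%:R)) 0; rewrite -/b.
move=> /cvgrPdist_le /(_ _ e3).
have ap dU (U : measurableType dU) (PU : probability U R) (Z : U -> R) : measurable_fun setT Z ->
    (forall w, 0 <= Z w) -> `|Ex PU (fun w => h (expR (- Z w))) -
    Ex PU (fun w => expR (- Z w) ^+ 0 * b (expR (- Z w)))| <= e / 3.
  move=> mZ Z0; have bb : bmeas (fun w => expR (- Z w) ^+ 0 * b (expR (- Z w))).
    by apply: bmeasM; [exact: bpow|exact: bbern].
  have bh : bmeas (fun w => h (expR (- Z w))).
    split; last by exists C.
    apply: measurableT_comp; last exact: expR_meas.
    exact: continuous_measurable_fun.
  rewrite -ExB// (le_trans (Ex_norm_le _ _))//; first exact: bmeasB.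
  rewrite -[leRHS](Ex_cst PU); apply: Ex_le; [exact/bmeas_norm/bmeasB|exact: bmeas_cst|move=> w].
  by rewrite expr0 mul1r distrC hm// exp01.
apply: filterS => n hn.
have h1 := ap _ _ Q M mM M_ge0; have h2 := ap _ _ P (X n) (mX n) (X_ge0 n).
move: hn h1 h2; rewrite !ler_norml => /andP[? ?] /andP[? ?] /andP[? ?].
by apply/andP; split; lra.
Qed.

(** The projection to [0, 1], written with absolute values to make continuity immediate.
    [clamp (K - x)] is a cut-off: 1 up to K - 1 and 0 from K on. *)
Let clamp (t : R) : R := (1 + `|t| - `|t - 1|) / 2.

Let clampE t : clamp t = if t <= 0 then 0 else if t <= 1 then t else 1.
Proof.
rewrite /clamp; case: leP => t0.
  by rewrite (ler0_norm t0) ler0_norm; [field|lra].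
case: leP => t1; rewrite (gtr0_norm t0).
  by rewrite ler0_norm; [field|lra].
by rewrite gtr0_norm; [field|lra].
Qed.

Let clamp01 t : 0 <= clamp t <= 1.
Proof.
by rewrite clampE; case: (leP t 0) => h0; last case: (leP t 1) => h1; apply/andP; split; lra.
Qed.

Let clamp_cont : continuous clamp.
Proof.
move=> t; apply: cvgMl; apply: cvgB; last first.
  by apply: cvg_norm; apply: cvgB; [exact: cvg_id|exact: cvg_cst].
by apply: cvgD; [exact: cvg_cst|apply: cvg_norm; exact: cvg_id].
Qed.

Let cut_cvg (f : R -> R) (C K : R) : continuous f -> (forall x, `|f x| <= C) ->
  Ex P (fun w => f (X n w) * clamp (K - X n w)) @[n --> \oo] -->
  Ex Q (fun w => f (M w) * clamp (K - M w)).
Proof.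
(* In the variable y = exp(-x) the cut-off vanishes for 0 < y <= exp(-K), so the extension by 0 is
   continuous on the whole line. *)
move=> fc fC; pose h y := if 0 < y then f (- ln y) * clamp (K + ln y) else 0.
have hE (x : R) : f x * clamp (K - x) = h (expR (- x)).
  by rewrite /h expR_gt0 expRK opprK.
under eq_fun do under [X in Ex _ X]eq_fun do rewrite hE.
have -> : Ex Q (fun w => f (M w) * clamp (K - M w)) = Ex Q (fun w => h (expR (- M w))).
  by congr (Ex Q _); apply/funext => w; exact: hE.
have C0 : 0 <= C := le_trans (normr_ge0 (f 0)) (fC 0).
apply: (@exp_fun_cvg h C) => [y|x]; last first.
  rewrite /h; case: ifP => _; last by rewrite normr0.
  have /andP[c0 c1] := clamp01 (K + ln x).
  by rewrite normrM (ger0_norm c0) (le_trans (ler_wpM2l (normr_ge0 _) c1))// mulr1.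
have [y0|y0] := ltP 0 y.
  have near_h : \forall z \near y, f (- ln z) * clamp (K + ln z) = h z.
    near=> z; rewrite /h ifT//; near: z; exact: lt_nbhsr.
  apply: (cvg_trans (near_eq_cvg near_h)); rewrite /h y0.
  have lnc : ln z @[z --> y] --> ln y by exact: continuous_ln.
  apply: cvgM; first by apply: (@cvg_comp _ _ _ (fun z => - ln z) f); [by apply: cvgN; exact: lnc|exact: fc].
  apply: (@cvg_comp _ _ _ (fun z => K + ln z) clamp); last exact: clamp_cont.
  by apply: cvgD => //; exact: cvg_cst.
have near_h : \forall z \near y, 0 = h z.
  have yK : y < expR (- K) by rewrite (le_lt_trans y0)// expR_gt0.
  near=> z; have zK : z < expR (- K) by near: z; exact: lt_nbhsl.
  rewrite /h; case: ifP => // z0; rewrite clampE ifT ?mulr0//.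
  have : ln z <= - K by rewrite -[leRHS]expRK ler_ln ?posrE ?expR_gt0// ltW.
  lra.
apply: (cvg_trans (near_eq_cvg near_h)); rewrite /h ltNge y0/=; exact: cvg_cst.
Unshelve. all: by end_near. Qed.

(** Tightness comes from [cut_cvg] itself: with the constant function 1 it shows that the mass lost
    by the cut-off is asymptotically that of the limit. *)
Lemma laplace_cvg_in_distribution : cvg_in_distribution P X Q M.
Proof.
split => // f fc [C fC].
have mf : measurable_fun setT f by exact: continuous_measurable_fun.
have C0 : 0 <= C := le_trans (normr_ge0 (f 0)) (fC 0).
have bf dU (U : measurableType dU) (Z : U -> R) : measurable_fun setT Z -> bmeas (f \o Z).
  by move=> mZ; split; [exact: measurableT_comp|exists C => w; exact: fC].
have bc dU (U : measurableType dU) (Z : U -> R) K : measurable_fun setT Z ->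
    bmeas (fun w => clamp (K - Z w)).
  move=> mZ; split; last by exists 1 => w; have /andP[? ?] := clamp01 (K - Z w); rewrite ger0_norm.
  apply: measurableT_comp; first exact: continuous_measurable_fun.
  exact: measurable_funB.
rewrite unlock; under eq_fun do rewrite (Ex_EFin P (bf _ _ _ (mX _))).
rewrite (Ex_EFin Q (bf _ _ _ mM)); apply: cvg_EFin; first by near=> n.
rewrite (_ : _ \o _ = fun n => Ex P (f \o X n))//.
apply/cvgrPdist_le => e e0; pose e' := e / (3 + 3 * C).
have den : 0 < 3 + 3 * C by lra.
have e'0 : 0 < e' by rewrite divr_gt0.
have [K hK] : exists K, 1 - Ex Q (fun w => clamp (K - M w)) <= e'.
  have ptw w : clamp (n%:R - M w) @[n --> \oo] --> (1 : R).
    apply: cvg_near_cst; near=> n; rewrite clampE.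
    have : M w + 1 < n%:R.
      near: n; exists (Num.trunc (M w + 1)).+1 => // k /= hk.
      by rewrite (lt_le_trans (truncnS_gt _))// ler_nat.
    by move=> h; case: leP => ?; [lra|case: leP => ?; lra].
  have cl1 n w : `|clamp (n%:R - M w)| <= 1.
    by have /andP[? ?] := clamp01 (n%:R - M w); rewrite ger0_norm.
  have [_] := @bounded_cvg_Ex R dS S Q (fun n w => clamp (n%:R - M w)) (fun=> 1) 1
    (fun n => (bc _ _ M n%:R mM).1) cl1 ptw.
  rewrite Ex_cst => /cvgrPdist_le /(_ _ e'0) [n _ hn]; exists n%:R.
  by rewrite (le_trans (ler_norm _))// hn/=.
have bfc dU (U : measurableType dU) (Z : U -> R) : measurable_fun setT Z ->
    bmeas (fun w => f (Z w) * clamp (K - Z w)) by move=> mZ; apply: bmeasM; [exact: bf|exact: bc].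
have diff dU (U : measurableType dU) (PU : probability U R) (Z : U -> R) : measurable_fun setT Z ->
    `|Ex PU (f \o Z) - Ex PU (fun w => f (Z w) * clamp (K - Z w))| <=
    C * (1 - Ex PU (fun w => clamp (K - Z w))).
  move=> mZ; rewrite -ExB; [|exact: bf|exact: bfc].
  rewrite (le_trans (Ex_norm_le _ _))//; first by apply: bmeasB; [exact: bf|exact: bfc].
  rewrite -[X in _ * (X - _)](Ex_cst PU 1) -ExB; [|exact: bmeas_cst|exact: bc].
  rewrite -ExZ; last by apply: bmeasB; [exact: bmeas_cst|exact: bc].
  apply: Ex_le; [|by apply: bmeasZ; apply: bmeasB; [exact: bmeas_cst|exact: bc]|move=> w].
    by apply/bmeas_norm/bmeasB; [exact: bf|exact: bfc].
  have /andP[c0 c1] := clamp01 (K - Z w).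
  rewrite /= -{1}[f (Z w)]mulr1 -mulrBr normrM (ger0_norm (_ : 0 <= 1 - _)) ?subr_ge0//.
  by rewrite ler_wpM2r// subr_ge0.
have l1 := @cut_cvg f C K fc fC.
have l2 : Ex P (fun w => clamp (K - X n w)) @[n --> \oo] --> Ex Q (fun w => clamp (K - M w)).
  have E1 dU (U : measurableType dU) (PU : probability U R) (Z : U -> R) :
      Ex PU (fun w => 1 * clamp (K - Z w)) = Ex PU (fun w => clamp (K - Z w)).
    by congr (Ex PU _); apply/funext => w; rewrite mul1r.
  have one1 (x : R) : `|1 : R| <= 1 by rewrite normr1.
  have c1 : continuous (fun _ : R => 1 : R) by move=> x; exact: cvg_cst.
  have := @cut_cvg (fun=> 1) 1 K c1 one1.
  by rewrite E1; under eq_fun do rewrite E1.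
move/cvgrPdist_le : l1 => /(_ _ e'0) l1; move/cvgrPdist_le : l2 => /(_ _ e'0) l2.
near=> n.
have h1 : `|Ex Q (fun w => f (M w) * clamp (K - M w)) - Ex P (fun w => f (X n w) * clamp (K - X n w))| <= e'.
  by near: n; exact: l1.
have h2 : `|Ex Q (fun w => clamp (K - M w)) - Ex P (fun w => clamp (K - X n w))| <= e'.
  by near: n; exact: l2.
have h3 := diff _ _ Q M mM; have h4 := diff _ _ P (X n) (mX n).
have h5 : C * (1 - Ex Q (fun w => clamp (K - M w))) <= C * e' by rewrite ler_wpM2l.
have h6 : C * (1 - Ex P (fun w => clamp (K - X n w))) <= C * (2 * e').
  by rewrite ler_wpM2l//; move: h2; rewrite ler_norml => /andP[]; lra.
have eE : e = (3 + 3 * C) * e' by rewrite /e' mulrC divfK// gt_eqF.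
have Ce : 0 <= C * e' by rewrite mulr_ge0// ltW.
have {}h3 := le_trans h3 h5; have {}h4 := le_trans h4 h6.
rewrite eE; move: h1 h3 h4; rewrite !ler_norml => /andP[a1 a2] /andP[a3 a4] /andP[a5 a6].
by apply/andP; split; lra.
Unshelve. all: by end_near. Qed.

End laplace_convergence.

(** * The limit law *)

Section null_sets.
Context (R : realType) dT (T : measurableType dT) (P : probability T R).

Lemma Ex_eq_ae (A : set T) (X Y : T -> R) : measurable A -> P A = 0%E -> bmeas X -> bmeas Y ->
  (forall w, ~ A w -> X w = Y w) -> Ex P X = Ex P Y.
Proof.
move=> mA PA bX bY XY; apply/eqP; rewrite -subr_eq0 -normr_le0 -ExB//.
have [_ [C hC]] := bX; have [_ [D hD]] := bY.
rewrite (le_trans (Ex_norm_le _ _))//; first exact: bmeasB.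
apply: (@le_trans _ _ (Ex P (fun w => (C + D) * \1_A w))); last first.
  rewrite ExZ; last exact: bmeas_indic.
  have : (Ex P \1_A)%:E = 0%:E :> \bar R by rewrite Ex_indic.
  by move=> [->]; rewrite mulr0.
apply: Ex_le; [exact/bmeas_norm/bmeasB|exact/bmeasZ/bmeas_indic|move=> w].
rewrite indicE; have [|] := boolP (w \in A); rewrite (inE, notin_setE) => Aw /=.
  by rewrite mulr1 (le_trans (ler_normB _ _))// lerD.
by rewrite XY// subrr normr0 mulr0.
Qed.

Lemma probability_eq_ae (N A B : set T) : measurable N -> P N = 0%E -> measurable A -> measurable B ->
  (forall w, ~ N w -> A w <-> B w) -> P A = P B.
Proof.
move=> mN PN mA mB AB; rewrite -(Ex_indic P mA) -(Ex_indic P mB); congr (_%:E).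
apply: (Ex_eq_ae mN PN) => [||w /AB h]; try exact: bmeas_indic.
by rewrite !indicE; congr (_%:R); congr nat_of_bool; apply/idP/idP; rewrite !inE; apply h.
Qed.

End null_sets.

Section mixed_poisson.
Context (R : realType) dS (S : measurableType dS) (P : probability S R) (t : S -> R).
Hypothesis mt : measurable_fun setT t.
Hypothesis t_ge0 : forall w, 0 <= t w.

Lemma exp_nneseries (x : R) : 0 <= x ->
  (\sum_(0 <= k <oo) (x ^+ k / k`!%:R)%:E = (expR x)%:E)%E.
Proof.
move=> x0; apply/cvg_lim => //; under eq_fun do rewrite sumEFin.
apply: cvg_EFin; first by near=> n.
exact: is_cvg_series_exp_coeff.
Unshelve. all: by end_near. Qed.

Lemma pois_nneseries (u s : R) : 0 <= u -> 0 <= s ->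
  (\sum_(0 <= k <oo) (pois u k * s ^+ k)%:E = (expR (- (u * (1 - s))))%:E)%E.
Proof.
move=> u0 s0; have us : 0 <= u * s by rewrite mulr_ge0.
transitivity ((expR (- u))%:E * \sum_(0 <= k <oo) ((u * s) ^+ k / k`!%:R)%:E)%E.
  rewrite -nneseriesZl; last by move=> k _; rewrite lee_fin divr_ge0// exprn_ge0.
  by apply: eq_eseriesr => k _; rewrite -EFinM /pois exprMn; congr (_%:E); ring.
by rewrite exp_nneseries// -EFinM -expRD; congr (expR _)%:E; ring.
Qed.

Lemma pois_le1 (u : R) k : 0 <= u -> pois u k <= 1.
Proof.
move=> u0; have := @exp_partial_le R u k.+1 u0; rewrite big_ord_recr/= => h.
rewrite /pois expRN ler_pdivrMl ?expR_gt0// mulr1 (le_trans _ h)// lerDr.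
by apply: sumr_ge0 => i _; rewrite divr_ge0// exprn_ge0.
Qed.

Lemma bmeas_pois_mix k : bmeas (fun w => pois (t w) k).
Proof.
split; last by exists 1 => w; rewrite ger0_norm ?pois_ge0// pois_le1.
apply: measurable_funM; first by apply: measurableT_comp => //; exact: measurableT_comp.
by apply: measurable_funM => //; exact: measurable_funX.
Qed.

Definition mixed_weight (k : nat) : R := Ex P (fun w => pois (t w) k).

Lemma mixed_weight_ge0 k : 0 <= mixed_weight k.
Proof. by apply: Ex_ge0 => w; exact: pois_ge0. Qed.

(* [mt] is recorded so that the probability instance below can be inferred. *)
Definition mixed_poisson : set nat -> \bar R :=
  let _ := mt in mseries (fun k => mscale (NngNum (mixed_weight_ge0 k)) (\d_k : {measure set nat -> \bar R})) 0.

HB.instance Definition _ := Measure.on mixed_poisson.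

Lemma integral_mixed_poisson (f : nat -> R) : (forall k, 0 <= f k) ->
  (\int[mixed_poisson]_k (f k)%:E = \sum_(0 <= k <oo) (mixed_weight k * f k)%:E)%E.
Proof.
move=> f0; rewrite /mixed_poisson ge0_integral_measure_series//; last by move=> k _; rewrite lee_fin.
apply: eq_eseriesr => k _; rewrite ge0_integral_mscale//; last by move=> j _; rewrite lee_fin.
by rewrite integral_dirac// diracT mul1e.
Qed.

(** Identifies the limit at a = 1, with s = exp(-k) for the Laplace transform at k. At s = 1 it
    gives the total mass. *)
Lemma mixed_poisson_pgf (s : R) : 0 <= s <= 1 ->
  (\int[mixed_poisson]_k (s ^+ k)%:E = (Ex P (fun w => expR (- (t w * (1 - s)))))%:E)%E.
Proof.
move=> /andP[s0 s1]; rewrite integral_mixed_poisson; last by move=> k; exact: exprn_ge0.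
have bE : bmeas (fun w => expR (- (t w * (1 - s)))).
  split; first by apply: measurableT_comp => //; apply: measurableT_comp => //; exact: measurable_funM.
  by exists 1 => w; rewrite ger0_norm ?expR_ge0// expR_le1 oppr_le0 mulr_ge0// subr_ge0.
rewrite -(Ex_EFin P bE); under [RHS]eq_integral do rewrite -pois_nneseries//.
rewrite integral_nneseries//; last 2 first.
- by move=> k; apply/measurable_EFinP; apply: measurable_funM => //; exact: (bmeas_pois_mix k).1.
- by move=> k w _; rewrite lee_fin mulr_ge0 ?pois_ge0// exprn_ge0.
apply: eq_eseriesr => k _; have bk := bmeas_pois_mix k.
under [RHS]eq_integral do rewrite mulrC.
by rewrite (Ex_EFin P (bmeasZ _ bk)) ExZ// mulrC.
Qed.

Let mixed_setT : mixed_poisson setT = 1%E.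
Proof.
have := @mixed_poisson_pgf 1; rewrite ler01 lexx => /(_ isT).
under eq_integral do rewrite expr1n.
rewrite integral_cst// mul1e => ->.
rewrite (_ : (fun w => _) = fun=> 1) ?Ex_cst//.
by apply/funext => w; rewrite subrr mulr0 oppr0 expR0.
Qed.

HB.instance Definition _ := Measure_isProbability.Build _ _ R mixed_poisson mixed_setT.

Lemma mixed_poisson_atom k : mixed_poisson [set k] = (mixed_weight k)%:E.
Proof.
transitivity (mixed_poisson ([set k] `&` setT)); first by rewrite setIT.
rewrite -(integral_indic mixed_poisson measurableT)//.
rewrite (integral_mixed_poisson (f := \1_[set k])); last by move=> j; rewrite indicE.
rewrite (@nneseries_delta R _ k).
- by rewrite indicE mem_set// mulr1.
- by move=> j jk; rewrite indicE memNset ?mulr0//= => /eqP; rewrite (negbTE jk).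
- by rewrite lee_fin mulr_ge0 ?mixed_weight_ge0// indicE.
Qed.

End mixed_poisson.

Section product_marginals.
Context (R : realType) d1 d2 (T1 : measurableType d1) (T2 : measurableType d2)
  (P1 : probability T1 R) (P2 : probability T2 R).

Lemma integral_fst (f : T1 -> R) : measurable_fun setT f -> (forall w, 0 <= f w) ->
  (\int[(P1 \x P2)%E]_z (f z.1)%:E = \int[P1]_w (f w)%:E)%E.
Proof.
move=> mf f0; rewrite (fubini_tonelli1 (fun z => (f z.1)%:E)).
- apply: eq_integral => w _; rewrite /fubini_F/= integral_cst//.
  by rewrite [X in (_ * X)%E]probability_setT mule1.
- by apply/measurable_EFinP; apply: measurableT_comp => //; exact: measurable_fst.
- by move=> z; rewrite lee_fin.
Qed.

Lemma integral_snd (f : T2 -> R) : measurable_fun setT f -> (forall w, 0 <= f w) ->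
  (\int[(P1 \x P2)%E]_z (f z.2)%:E = \int[P2]_w (f w)%:E)%E.
Proof.
move=> mf f0; rewrite (fubini_tonelli2 (fun z => (f z.2)%:E)).
- apply: eq_integral => w _; rewrite /fubini_G/= integral_cst//.
  by rewrite [X in (_ * X)%E]probability_setT mule1.
- by apply/measurable_EFinP; apply: measurableT_comp => //; exact: measurable_snd.
- by move=> z; rewrite lee_fin.
Qed.

Lemma probability_fst (A : set T1) : measurable A -> (P1 \x P2)%E (fst @^-1` A) = P1 A.
Proof.
move=> mA; rewrite (_ : fst @^-1` A = A `*` setT); last first.
  by apply/seteqP; split => z /=; [move=> ?|case].
by rewrite product_measure1E// [X in (_ * X)%E]probability_setT mule1.
Qed.

Lemma probability_snd (A : set T2) : measurable A -> (P1 \x P2)%E (snd @^-1` A) = P2 A.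
Proof.
move=> mA; rewrite (_ : snd @^-1` A = setT `*` A); last first.
  by apply/seteqP; split => z /=; [move=> ?|case].
by rewrite product_measure1E// [X in (X * _)%E]probability_setT mul1e.
Qed.

End product_marginals.

Theorem theorem1p2p2 (R : realType) (d : nat) (d_ge3 : (3 <= d)%N)
    (dispY : measure_display) (OmegaY : measurableType dispY)
    (P : probability OmegaY R) (Y : R -> OmegaY -> 'rV[int]_d)
    (Y_ctsrw : is_ctsrw P Y)
    (dispB : measure_display) (OmegaB : measurableType dispB)
    (PB : probability OmegaB R) (B : R -> OmegaB -> 'rV[R]_d)
    (* the scaling limit of N^-1 Y_(N^2 t), which has covariance (t / d) Id *)
    (B_brownian : is_brownian_motion d%:R^-1 PB B) :
  let g := green0 P Y in
  let tau_g w := (exit_time (unit_cube R d) (B^~ w) * (g^-1)%:E)%E in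
  exists (dispM : measure_display) (OmegaM : measurableType dispM)
    (Q : probability OmegaM R) (M : R -> {RV Q >-> R}),
  [/\ forall a : R, 0 <= a <= 1 ->
        cvg_in_distribution P
          (fun N w => (card_thick_points g a N (Y^~ w))%:R
                      / (N%:R `^ (2 * (1 - a))))
          Q (M a),
      forall a b : R, 0 <= a < 1 -> 0 <= b < 1 ->
        eq_in_distribution Q (M a) Q (M b),
      forall a : R, 0 <= a < 1 ->
        eq_in_distribution Q (fun w => (M a w)%:E) PB tau_g &
      forall k : nat,
        Q (M 1 @^-1` [set k%:R]) =
        ((k`!%:R^-1)%:E * \int[PB]_w (expeR (- tau_g w) * tau_g w ^+ k))%E].
Proof.
move=> g tau_g.
have d_gt0 : (0 < d)%N := leq_trans (isT : (0 < 3)%N) d_ge3.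
have [X [E [[mX mE lawX lawE indF] E_gt0 cinf Yp]]] := Y_ctsrw.
have gE : g = green R d := green0E d_gt0 mX mE lawX lawE indF E_gt0 cinf Yp d_ge3.
have g0 : 0 < g by rewrite gE (lt_le_trans ltr01 (green_ge1 R d_ge3)).
have gV0 : 0 < g^-1 by rewrite invr_gt0.
pose tau := exit_bm B.
have tau0 w : (0 <= tau w)%E := exit_bm_ge0 B w.
have mtau : measurable_fun setT tau := measurable_exit_bm d_gt0 B_brownian.
pose N := [set w | tau w = +oo%E].
have PN : PB N = 0%E := exit_bm_finite d_gt0 B_brownian.
have mN : measurable N.
  by rewrite -[N]setTI; exact: (mtau measurableT [set +oo%E] (emeasurable_set1 +oo%E)).
(* The default value of [fine] occurs on the null set [N] only. *)
pose t w : R := fine (tau w) / g.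
have tau_gE w : tau_g w = (tau w * (g^-1)%:E)%E by [].
have tg w : ~ N w -> tau_g w = (t w)%:E.
  move=> nN; rewrite tau_gE -[tau w]fineK ?EFinM// ge0_fin_numE// ltey.
  exact/eqP.
have t0 w : 0 <= t w by apply: divr_ge0; [exact: fine_ge0|exact: ltW].
have mt : measurable_fun setT t.
  by apply: measurable_funM => //; apply: measurableT_comp mtau; exact: fine_measurable.
have mtg : measurable_fun setT tau_g.
  rewrite (_ : tau_g = fun w => ((g^-1)%:E * tau w)%E); first exact: measurable_funeM.
  by apply/funext => w; rewrite muleC.
pose m : probability nat R := mixed_poisson PB mt t0.
(* Only the individual laws of the M a are constrained, so two coordinates suffice: tau / g for all
   a < 1, and a mixed Poisson integer for a = 1. *)
pose Q : probability (OmegaB * nat)%type R := (PB \x m)%E.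
have m1 : measurable_fun setT (fun z : OmegaB * nat => t z.1).
  exact: (measurableT_comp mt measurable_fst).
have m2 : measurable_fun setT (fun z : OmegaB * nat => z.2%:R : R).
  by apply: (measurableT_comp (f := fun k : nat => k%:R : R)) => //; exact: measurable_snd.
pose M1 : {RV Q >-> R} := mfun_Sub (mem_set m1).
pose M2 : {RV Q >-> R} := mfun_Sub (mem_set m2).
have bexp dU (U : measurableType dU) (Z : U -> R) (c : R) : measurable_fun setT Z ->
    (forall w, 0 <= Z w) -> 0 <= c -> bmeas (fun w => expR (- (c * Z w))).
  move=> mZ Z0 c0; split; last first.
    by exists 1 => w; rewrite ger0_norm ?expR_ge0// expR_le1 oppr_le0 mulr_ge0.
  by apply: measurableT_comp => //; apply: measurableT_comp => //; exact: measurable_funM.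
have psiE (c : R) : 0 < c -> psi PB B (c / g) = Ex PB (fun w => expR (- (c * t w))).
  move=> c0; apply: (Ex_eq_ae mN PN).
  - by apply: (bmeas_lapl_exit d_gt0 B_brownian); rewrite divr_gt0.
  - exact: bexp (ltW c0).
  move=> w nN; have tw : tau w = (fine (tau w))%:E.
    by rewrite fineK// ge0_fin_numE// ltey; exact/eqP.
  rewrite -/(tau w) tw /= /t; congr (expR (- _)); field; rewrite gt_eqF//.
exists _, (OmegaB * nat)%type, Q, (fun a => if a == 1 then M2 else M1); split.
- move=> a a01; apply: laplace_cvg_in_distribution.
  + move=> n; apply: measurable_funM => //; rewrite gE.
    exact: (measurable_card_thick mX mE E_gt0 cinf Yp (2 * green R d * a * ln n%:R) n).
  + by case: ifP => _; exact: measurable_funP.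
  + by move=> n w; rewrite divr_ge0// powR_ge0.
  + by move=> z; case: ifP => _ /=.
  move=> k k0; have k0' : 0 < k%:R :> R by rewrite ltr0n.
  have := thick_count_laplace d_gt0 mX mE lawX lawE indF E_gt0 cinf Yp
    (fun c c0 => psi_continuous d_gt0 B_brownian c0)
    (fun c c0 => kill_rate_sum_continuous d_gt0 B_brownian c0)
    (fun c c0 => brownian_reference d_gt0 B_brownian c0) d_ge3 a01 k0'.
  rewrite -gE; suff -> : psi PB B ((if a == 1 then 1 - expR (- k%:R) else k%:R) / g) =
      Ex Q (fun w => expR (- (k%:R * (if a == 1 then M2 else M1) w))) by [].
  have k00 : 0 <= k%:R :> R by exact: ltW.
  case: ifP => _; last first.
    rewrite psiE//; apply: EFin_inj; rewrite -(Ex_EFin PB (bexp _ _ t _ mt t0 k00)).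
    rewrite -(Ex_EFin Q (bexp _ _ M1 _ m1 (fun z => t0 z.1) k00)).
    rewrite -(integral_fst PB m (f := fun w => expR (- (k%:R * t w))))//.
    exact: (bexp _ _ t _ mt t0 k00).1.
  (* At a = 1 the killing rate (1 - exp(-k)) / g is the one that the generating function at s =
     exp(-k) produces. *)
  have s01 : 0 <= (expR (- k%:R) : R) <= 1 by rewrite expR_ge0 expR_le1 oppr_le0.
  have s1 : 0 < 1 - (expR (- k%:R) : R) by rewrite subr_gt0 expR_lt1 oppr_lt0.
  rewrite psiE//; apply: EFin_inj.
  rewrite -(Ex_EFin Q (bexp _ _ M2 _ m2 (fun z => ler0n R z.2) k00)).
  transitivity (\int[Q]_z (expR (- k%:R) ^+ z.2)%:E)%E; last first.
    by apply: eq_integral => z _ /=; rewrite -expRM_natl mulrN mulrC.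
  rewrite (integral_snd PB m (f := fun j => expR (- k%:R) ^+ j))//.
  apply: etrans (esym (mixed_poisson_pgf PB mt t0 s01)); congr (Ex PB _)%:E; apply/funext => w.
  by rewrite mulrC.
- by move=> a b /andP[_ a1] /andP[_ b1]; rewrite (lt_eqF a1) (lt_eqF b1).
- move=> a /andP[_ a1]; rewrite (lt_eqF a1); split => //.
    by apply/measurable_EFinP; exact: m1.
  move=> A mA; have mA1 : measurable [set w | A (t w)%:E].
    rewrite -[X in measurable X]setTI.
    by have /measurable_EFinP := mt; apply.
  rewrite -[LHS]/((PB \x m)%E (fst @^-1` [set w | A (t w)%:E])) probability_fst//.
  apply: (probability_eq_ae mN PN) => //.
    by rewrite -[X in measurable X]setTI; exact: mtg.
  by move=> w /tg /= ->.
- move=> k; rewrite eqxx.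
  have -> : Q (M2 @^-1` [set k%:R]) = (mixed_weight PB t k)%:E.
    rewrite -(mixed_poisson_atom PB mt t0) -(probability_snd PB m)//; congr (Q _).
    apply/seteqP; split => z /=; last by move=> ->.
    by move=> /eqP; rewrite eqr_nat => /eqP.
  (* Where tau is infinite the integrand is 0 times a power, hence 0 in the extended reals, whence
     the indicator. *)
  pose h w : R := k`!%:R * pois (t w) k * \1_(~` N) w.
  have bp := bmeas_pois_mix mt t0 k.
  have bh : bmeas h.
    by apply: bmeasM; [exact: bmeasZ|apply: bmeas_indic; exact: measurableC].
  have f0 : k`!%:R != 0 :> R by rewrite pnatr_eq0 -lt0n fact_gt0.
  have -> : (\int[PB]_w (expeR (- tau_g w) * tau_g w ^+ k) = \int[PB]_w (h w)%:E)%E.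
    apply: eq_integral => w _; rewrite /h indicE; have [wN|wN] := pselect (N w).
      by rewrite memNset ?mulr0; [rewrite tau_gE wN gt0_mulye ?lte_fin//= mul0e|move=> /(_ wN)].
    rewrite mem_set// mulr1 tg//= -EFin_expe -EFinM; congr (_%:E); rewrite /pois.
    by field.
  rewrite (Ex_EFin PB bh) -EFinM; congr (_%:E).
  rewrite (Ex_eq_ae mN PN bh (bmeasZ k`!%:R bp)).
    by rewrite ExZ// mulKf.
  by move=> w wN; rewrite /h indicE mem_set// mulr1.
Qed.
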